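(* Let $\Gamma$ be a finite connected graph that contains $T_0$ or $S_0$. Then for every braid index $n\ge 5$, the graph braid group $B_n\Gamma$ is not a right-angled Artin group.
   Context: A graph is a finite connected 1-dimensional CW complex (loops and multiple edges allowed). A graph $\Gamma$ contains a graph $\Gamma'$ if some subdivision of $\Gamma'$ is a subgraph of some subdivision of $\Gamma$. The unordered configuration space is $UC_n\Gamma=\{\{x_1,\dots,x_n\}\subset\Gamma : x_i\ne x_j \text{ for } i\ne j\}$ and $B_n\Gamma=\pi_1(UC_n\Gamma)$. $T_0$ is the tree with ten vertices consisting of a central vertex $v$ adjacent to three vertices $u_1,u_2,u_3$, each $u_i$ being adjacent to two further vertices of valency one. $S_0$ is the graph consisting of a cycle together with two distinct vertices $x,y$ on the cycle, each of which has one additional pendant edge attached. A right-angled Artin group is a group admitting a finite presentation in which every relator is a commutator of two generators. *)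

(* Defs.v *)
From HB Require Import structures.
From mathcomp Require Import all_boot all_order all_algebra.
From mathcomp Require Import all_classical all_reals all_analysis.
From mathcomp Require Import Rstruct Rstruct_topology.
Set Implicit Arguments. Unset Strict Implicit. Unset Printing Implicit Defensive.
Import Order.TTheory GRing.Theory Num.Theory.
Local Open Scope classical_set_scope.
Local Open Scope ring_scope.

Notation RR := Rdefinitions.R.

(** * Graphs = finite 1-dim CW complexes (loops and multi-edges allowed).
    Vertices and (unoriented) edges are finite types; each edge has two
    (possibly equal) endpoints. *)
Record graph := Graph { gV : finType; gE : finType;
                        gsrc : gE -> gV; gtgt : gE -> gV }.

Definition gadj (G : graph) : rel (gV G) := fun u v =>
  [exists e : gE G, ((gsrc e == u) && (gtgt e == v)) || ((gsrc e == v) && (gtgt e == u))].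

Definition gconnected (G : graph) : Prop :=
  (0 < #|gV G|)%N /\ forall u v : gV G, connect (@gadj G) u v.

(** Subdivision: edge e is replaced by a path of (k e).+1 edges through
    k e new interior vertices. *)
Definition sd_node (G : graph) (k : gE G -> nat) (e : gE G) (j : nat)
  : (gV G + {e0 : gE G & 'I_(k e0)})%type :=
  match j with
  | 0 => inl (gsrc e)
  | j'.+1 => match (insub j' : option 'I_(k e)) with
             | Some i => inr (existT (fun e0 => 'I_(k e0)) e i)
             | None => inl (gtgt e)
             end
  end.

Definition subdiv (G : graph) (k : gE G -> nat) : graph :=
  @Graph (gV G + {e0 : gE G & 'I_(k e0)})%type {e0 : gE G & 'I_(k e0).+1}
    (fun a => sd_node k (tag a) (tagged a))
    (fun a => sd_node k (tag a) (tagged a).+1).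

Definition subgraph (H G : graph) : Prop :=
  exists (fV : gV H -> gV G) (fE : gE H -> gE G),
    injective fV /\ injective fE /\
    forall e, (fV (gsrc e) = gsrc (fE e) /\ fV (gtgt e) = gtgt (fE e)) \/
              (fV (gsrc e) = gtgt (fE e) /\ fV (gtgt e) = gsrc (fE e)).

Definition contains (G H : graph) : Prop :=
  exists (kG : gE G -> nat) (kH : gE H -> nat), subgraph (@subdiv H kH) (@subdiv G kG).

(** T_0 : vertex 0 = v, 1,2,3 = u_1,u_2,u_3, leaves 4..9; edges 0,1,2 : v--u_i,
    edges 3..8 : u_((e-3)/2+1) -- (e+1). *)
Definition T0 : graph :=
  @Graph 'I_10 'I_9
    (fun e : 'I_9 => if (e < 3)%N then inord 0 else inord (((e - 3) %/ 2).+1))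
    (fun e : 'I_9 => inord e.+1).

(** S_0 : cycle x=0, y=1, z=2 (edges 0:0-1, 1:1-2, 2:2-0), pendant edges
    3: x--3 and 4: y--4. *)
Definition S0 : graph :=
  @Graph 'I_5 'I_5
    (fun e : 'I_5 => inord (nth 0%N [:: 0; 1; 2; 0; 1]%N e))
    (fun e : 'I_5 => inord (nth 0%N [:: 1; 2; 0; 3; 4]%N e)).

(** * Topological realization |G|: points are vertices or (e,t), 0<t<1. *)
Definition gpt (G : graph) := (gV G + (gE G * RR))%type.

Definition gvalid (G : graph) (p : gpt G) : Prop :=
  match p with inl _ => True | inr (_, t) => 0 < t < 1 end.

Definition gchar (G : graph) (e : gE G) (t : RR) : gpt G :=
  if t <= 0 then inl (gsrc e) else if 1 <= t then inl (gtgt e) else inr (e, t).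

Definition rel_open01 (A : set RR) : Prop :=
  exists O : set RR, open O /\ forall t : RR, 0 <= t <= 1 -> (A t <-> O t).

Definition rel_open_sq (A : set (RR * RR)) : Prop :=
  exists O : set (RR * RR), open O /\
    forall s t : RR, 0 <= s <= 1 -> 0 <= t <= 1 -> (A (s, t) <-> O (s, t)).

Definition gopen (G : graph) (U : set (gpt G)) : Prop :=
  forall e : gE G, rel_open01 (gchar e @^-1` U).

Definition oconf (G : graph) (n : nat) (x : 'I_n -> gpt G) : Prop :=
  (forall i, gvalid (x i)) /\ injective x.

Definition oopen (G : graph) (n : nat) (W : set ('I_n -> gpt G)) : Prop :=
  forall x, oconf x -> W x ->
    exists U : 'I_n -> set (gpt G),
      (forall i, gopen (U i) /\ U i (x i)) /\
      forall y, oconf y -> (forall i, U i (y i)) -> W y.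

Definition uconf (G : graph) (n : nat) (S : set (gpt G)) : Prop :=
  exists x : 'I_n -> gpt G, oconf x /\ S = range x.

Definition uopen (G : graph) (n : nat) (U : set (set (gpt G))) : Prop :=
  oopen (fun x : 'I_n -> gpt G => U (range x)).

Definition ucont01 (G : graph) (n : nat) (f : RR -> set (gpt G)) : Prop :=
  (forall t : RR, 0 <= t <= 1 -> uconf n (f t)) /\
  forall U, uopen n U -> rel_open01 (f @^-1` U).

Definition ucont_sq (G : graph) (n : nat) (H : RR * RR -> set (gpt G)) : Prop :=
  (forall s t : RR, 0 <= s <= 1 -> 0 <= t <= 1 -> uconf n (H (s, t))) /\
  forall U, uopen n U -> rel_open_sq (H @^-1` U).

Definition uloop (G : graph) (n : nat) (b : set (gpt G)) (f : RR -> set (gpt G)) : Prop :=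
  ucont01 n f /\ f 0 = b /\ f 1 = b.

Definition uhomotopic (G : graph) (n : nat) (b : set (gpt G))
    (f g : RR -> set (gpt G)) : Prop :=
  exists H : RR * RR -> set (gpt G), ucont_sq n H /\
    (forall t : RR, 0 <= t <= 1 -> H (0, t) = f t /\ H (1, t) = g t) /\
    (forall s : RR, 0 <= s <= 1 -> H (s, 0) = b /\ H (s, 1) = b).

Definition pconcat (T : Type) (f g : RR -> T) : RR -> T :=
  fun t => if t <= 2^-1 then f (2 * t) else g (2 * t - 1).

(** * Right-angled Artin groups: words over generators (x, true) = x,
    (x, false) = x^-1, modulo free cancellation and the commutation
    relators [x, y] for the (finitely many) pairs with Rl x y. *)
Inductive raag_eq (X : finType) (Rl : rel X) : seq (X * bool) -> seq (X * bool) -> Prop :=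
| raag_refl w : raag_eq Rl w w
| raag_sym w1 w2 : raag_eq Rl w1 w2 -> raag_eq Rl w2 w1
| raag_trans w1 w2 w3 : raag_eq Rl w1 w2 -> raag_eq Rl w2 w3 -> raag_eq Rl w1 w3
| raag_cancel u v x b : raag_eq Rl (u ++ (x, b) :: (x, ~~ b) :: v) (u ++ v)
| raag_comm u v x y b c : Rl x y ->
    raag_eq Rl (u ++ (x, b) :: (y, c) :: v) (u ++ (y, c) :: (x, b) :: v).

(** pi_1(UC_n G, b) is isomorphic to some right-angled Artin group:
    phi induces a bijective homomorphism from homotopy classes of loops
    (with concatenation) onto the RAAG. *)
Definition pi1_is_raag (G : graph) (n : nat) (b : set (gpt G)) : Prop :=
  exists (X : finType) (Rl : rel X) (phi : (RR -> set (gpt G)) -> seq (X * bool)),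
    (forall f g, uloop n b f -> uloop n b g ->
        (uhomotopic n b f g <-> raag_eq Rl (phi f) (phi g))) /\
    (forall w, exists f, uloop n b f /\ raag_eq Rl (phi f) w) /\
    (forall f g, uloop n b f -> uloop n b g ->
        raag_eq Rl (phi (pconcat f g)) (phi f ++ phi g)).

(* Main.v *)
(** Subdivide the graph finely and let [M S u w] be the class of the move of one token of the
    vertex configuration [S] along the edge [u w], closed up by fixed paths to the base point.
    Moves at disjoint places commute. Homomorphisms on the braid group are holonomies of
    locally constant cocycles: the permutation of the strands, and for an edge [a r] at which a
    part [D] of the graph hangs by [a], maps to the integral Heisenberg group that count the
    passages through the edge with weights depending on the number of tokens in [D].

    Suppose that the braid group is a right-angled Artin group. If a generator x has a nonzero
    exponent sum in g, then g translates an axis in the tree of the HNN extension with stable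
    letter x. Elements of exponent sum 0 commuting with g fix this axis, hence an edge of it, so
    up to one conjugation they all lie in the subgroup of the link of x; this goes through for
    chains of commuting elements. Exchange two tokens at each of two vertices of valency three:
    the resulting [sa] and [sb] commute and induce disjoint transpositions, and each of their
    centralizers still exchanges any two of the remaining strands. This forces that no x has an
    odd exponent sum in one of [sa], [sb] and a nonzero one in the other.
    - For T_0, a commutator of two braids at the third vertex of valency three commutes with
      conjugates of [sa] and of [sb], so that its square fixes too many strands.
    - If two vertices are joined by three disjoint arcs, then the exponent sums of [sb] are
      opposite to those of [sa], a contradiction.
    - For S_0 we may thus assume that no path off the cycle joins two of its points. Let t be the
      braid in which one token goes round the cycle, and lam the number of its passages through a
      gate. With the Heisenberg relations, the gates at the two attaching points yield conjugates
      x' and y' of generators such that x' and t^-1 x' t commute with [sb]. Then t is the product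
      of an element of the centralizer of x' by one of the centralizer of y', on both of which lam
      vanishes, whereas lam t is nonzero. *)
From HB Require Import structures.
Require Import Defs.
From mathcomp Require Import all_boot all_order all_algebra all_fingroup.
From mathcomp Require Import all_classical all_reals all_analysis.
From mathcomp Require Import Rstruct Rstruct_topology.
From mathcomp Require Import zify ring lra.
Set Implicit Arguments. Unset Strict Implicit. Unset Printing Implicit Defensive.

(** * Right-angled Artin groups acting on trees *)

(** No presentation of the braid group is computed. Of the classes of moves one uses only that
    opposite moves are inverse and that disjoint moves commute; all else is read off from
    homomorphisms to permutation groups, the integers and the Heisenberg group. The obstacle is that
    [sa] may involve many generators in an unknown way. A nonzero exponent sum is the only handle on
    it, and the trapping of centralizers in link groups concerns elements of exponent sum 0. Hence
    commutators occur throughout: that of two overlapping transpositions is a 3-cycle, that of a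
    rotation and a reflection of a polygon is the square of the rotation, which has no fixed point
    and for an odd polygon keeps none when squared. A fifth strand makes the 3-cycles off one
    exchanged pair overlap with those off the other; this is one source of the bound 5. Conjugating
    elements are moved into link groups by the retractions that kill the other generators. Integer
    invariants alone do not notice that two elements commute. Two coordinates [e], [f] of a
    homomorphism to the Heisenberg group do: [e g * f h = f g * e h] for commuting [g], [h]. *)

Section RaagGroup.
Local Open Scope group_scope.
Variables (X : finType) (Rl : rel X).
Implicit Types (u v w : seq (X * bool)) (x y : X) (W : pred X).

Lemma raag_cat u u' v v' :
  raag_eq Rl u u' -> raag_eq Rl v v' -> raag_eq Rl (u ++ v) (u' ++ v').
Proof.
move=> hu hv; apply: (@raag_trans _ _ _ (u' ++ v)).
  elim: hu => {u u'} [w|w1 w2 _ h|w1 w2 w3 _ h1 _ h2|u1 u2 x b|u1 u2 x y b c hxy].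
  - exact: raag_refl.
  - exact: raag_sym.
  - exact: raag_trans h1 h2.
  - by rewrite -!catA /=; exact: raag_cancel.
  - by rewrite -!catA /=; exact: raag_comm.
elim: hv => {v v'} [w|w1 w2 _ h|w1 w2 w3 _ h1 _ h2|u1 u2 x b|u1 u2 x y b c hxy].
- exact: raag_refl.
- exact: raag_sym.
- exact: raag_trans h1 h2.
- by rewrite !catA; exact: raag_cancel.
- by rewrite !catA; exact: raag_comm.
Qed.

Definition rflip (a : X * bool) := (a.1, ~~ a.2).
Definition rinv w := rev (map rflip w).

Lemma raag_invl w : raag_eq Rl (rinv w ++ w) [::].
Proof.
elim: w => [|[x b] w IH]; first exact: raag_refl.
rewrite /rinv /= rev_cons cat_rcons; apply: raag_trans IH.
by rewrite /rflip /= -[in (x, b)](negbK b); exact: raag_cancel.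
Qed.

Lemma rinvK : involutive rinv.
Proof.
move=> w; rewrite /rinv map_rev revK -map_comp -[RHS]map_id.
by apply: eq_map => -[x b]; rewrite /rflip /= negbK.
Qed.

Lemma raag_invr w : raag_eq Rl (w ++ rinv w) [::].
Proof. by rewrite -{1}(rinvK w); exact: raag_invl. Qed.

(** [choose] picks the same word for all members of a class, so that the quotient becomes a type
    with Leibniz equality on which a [groupType] can be declared. *)
Definition rcanon w := choose [pred v | `[< raag_eq Rl w v >]] w.

Lemma rcanon_eq w : raag_eq Rl w (rcanon w).
Proof.
by apply/asboolP; apply: (@chooseP _ [pred v | `[< raag_eq Rl w v >]] w);
   apply/asboolP; exact: raag_refl.
Qed.

Lemma rcanonP w w' : raag_eq Rl w w' -> rcanon w = rcanon w'.
Proof.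
move=> h; rewrite /rcanon.
have e : [pred v | `[< raag_eq Rl w v >]] =1 [pred v | `[< raag_eq Rl w' v >]].
  move=> v /=; apply/asboolP/asboolP => h'; last exact: raag_trans h h'.
  by apply: raag_trans h'; exact: raag_sym.
rewrite (eq_choose e); apply: choose_id.
- by apply/asboolP; exact: raag_sym.
- by apply/asboolP; exact: raag_refl.
Qed.

Record raag := Raag { rval : seq (X * bool); _ : rcanon rval == rval }.
HB.instance Definition _ := [isSub for rval].
HB.instance Definition _ := [Choice of raag by <:].

Lemma rmk_subproof w : rcanon (rcanon w) == rcanon w.
Proof. by apply/eqP/esym/rcanonP/rcanon_eq. Qed.
Definition rmk w : raag := Raag (rmk_subproof w).

Lemma rmkP w w' : rmk w = rmk w' <-> raag_eq Rl w w'.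
Proof.
split=> [/(congr1 rval) /= e|/rcanonP e]; last exact: val_inj.
apply: raag_trans (rcanon_eq w) _; rewrite e; exact: raag_sym (rcanon_eq w').
Qed.

Lemma rvalK : cancel rval rmk.
Proof. by case=> w cw; apply: val_inj => /=; apply/eqP. Qed.

Definition rmul (g h : raag) := rmk (rval g ++ rval h).
Definition rinvg (g : raag) := rmk (rinv (rval g)).

Lemma rmkM w w' : rmul (rmk w) (rmk w') = rmk (w ++ w').
Proof.
apply/rmkP; apply: raag_cat; apply: raag_sym; exact: rcanon_eq.
Qed.

Lemma rmulA : associative rmul.
Proof.
by move=> g h k; rewrite -(rvalK g) -(rvalK h) -(rvalK k) !rmkM catA.
Qed.
Lemma rmul1 : left_id (rmk [::]) rmul.
Proof. by move=> g; rewrite -(rvalK g) rmkM. Qed.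
Lemma rmulr1 : right_id (rmk [::]) rmul.
Proof. by move=> g; rewrite -(rvalK g) rmkM cats0. Qed.
Lemma rmulV : left_inverse (rmk [::]) rinvg rmul.
Proof. by move=> g; rewrite -{2}(rvalK g) rmkM; apply/rmkP/raag_invl. Qed.
Lemma rmulrV : right_inverse (rmk [::]) rinvg rmul.
Proof. by move=> g; rewrite -{1}(rvalK g) rmkM; apply/rmkP/raag_invr. Qed.

HB.instance Definition _ := isGroup.Build raag rmulA rmul1 rmulr1 rmulV rmulrV.

Lemma rmk_cat w w' : rmk (w ++ w') = rmk w * rmk w'.
Proof. by rewrite -rmkM. Qed.
Lemma rmk_nil : rmk [::] = 1. Proof. by []. Qed.
Lemma rmk_rinv w : rmk (rinv w) = (rmk w)^-1.
Proof.
apply: (mulgI (rmk w)); rewrite mulgV -rmk_cat; apply/rmkP; exact: raag_invr.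
Qed.

Definition rgen x : raag := rmk [:: (x, true)].
Definition rlet (a : X * bool) : raag := rmk [:: a].

Lemma rletV x b : rlet (x, ~~ b) = (rlet (x, b))^-1.
Proof. by rewrite /rlet -rmk_rinv. Qed.

Lemma rlet_gen x b : rlet (x, b) = if b then rgen x else (rgen x)^-1.
Proof. by case: b => //; rewrite -(rletV x true). Qed.

Lemma rmk_cons a w : rmk (a :: w) = rlet a * rmk w.
Proof. by rewrite -cat1s rmk_cat. Qed.

Section Lift.
Variables (H : groupType) (f : X -> H).
Hypothesis fC : forall x y, Rl x y -> commute (f x) (f y).
Definition rlf (a : X * bool) := if a.2 then f a.1 else (f a.1)^-1.
Definition rlfw w := foldr (fun a h => rlf a * h) 1 w.

Lemma rlfw_cat u v : rlfw (u ++ v) = rlfw u * rlfw v.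
Proof. by elim: u => [|a u IH] /=; rewrite ?mul1g // IH mulgA. Qed.

Lemma rlfw_eq u v : raag_eq Rl u v -> rlfw u = rlfw v.
Proof.
elim=> {u v} // [w1 w2 w3 _ -> _ -> //|u v x b|u v x y b c hxy].
  rewrite !rlfw_cat /=; congr (_ * _); rewrite mulgA /rlf /=.
  by case: b => /=; rewrite (mulgV, mulVg) mul1g.
rewrite !rlfw_cat /=; congr (_ * _); rewrite !mulgA; congr (_ * _).
have cxy := fC hxy.
rewrite /rlf /=; case: b; case: c => //.
- by apply: commuteV.
- by apply/commute_sym/commuteV/commute_sym.
- by apply/commuteV/commute_sym/commuteV/commute_sym.
Qed.

Definition rlift (g : raag) : H := rlfw (rval g).
Lemma rlift_mk w : rlift (rmk w) = rlfw w.
Proof. by apply: rlfw_eq; apply: raag_sym; exact: rcanon_eq. Qed.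
Lemma rliftM g h : rlift (g * h) = rlift g * rlift h.
Proof. by rewrite -(rvalK g) -(rvalK h) -rmk_cat !rlift_mk rlfw_cat. Qed.
Lemma rlift_gen x : rlift (rgen x) = f x.
Proof. by rewrite rlift_mk /= mulg1. Qed.
End Lift.

(** The link of [x] in the defining graph. [Rl] is an arbitrary relation, hence the symmetrization
    and the explicit removal of [x]. *)
Definition rlk x : pred X := fun y => (y != x) && (Rl x y || Rl y x).

Lemma rgen_comm x y : Rl x y || Rl y x -> commute (rgen x) (rgen y).
Proof.
have h a b : Rl a b -> commute (rgen a) (rgen b).
  move=> hab; rewrite /commute -!rmk_cat /=; apply/rmkP.
  exact: (raag_comm [::] [::] true true hab).
by case/orP=> [/h//|/h /commute_sym].
Qed.

Definition inA W (g : raag) := exists2 w, all (fun a => W a.1) w & g = rmk w.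

Lemma inA1 W : inA W 1. Proof. by exists [::]. Qed.
Lemma inAM W g h : inA W g -> inA W h -> inA W (g * h).
Proof.
by case=> u hu -> [v hv ->]; exists (u ++ v); rewrite ?all_cat ?hu ?rmk_cat.
Qed.
Lemma inAV W g : inA W g -> inA W g^-1.
Proof.
case=> u hu ->; exists (rinv u); rewrite ?rmk_rinv //.
by rewrite /rinv all_rev all_map; apply: sub_all hu.
Qed.
Lemma inA_gen W x : W x -> inA W (rgen x).
Proof. by move=> h; exists [:: (x, true)]; rewrite //= h. Qed.
Lemma inA_sub W W' g : (forall x, W x -> W' x) -> inA W g -> inA W' g.
Proof. by move=> s [w hw ->]; exists w => //; apply: sub_all hw => a; apply: s. Qed.
Lemma inA_let W x b : W x -> inA W (rlet (x, b)).
Proof. by move=> h; exists [:: (x, b)]; rewrite //= h. Qed.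
Lemma inA_all g : inA predT g.
Proof. by exists (rval g); rewrite ?rvalK // all_predT. Qed.

Lemma inA_ind W (P : raag -> Prop) : P 1 ->
  (forall x b g, W x -> P g -> P (rlet (x, b) * g)) -> forall g, inA W g -> P g.
Proof.
move=> P1 PM g [w + ->]; elim: w => [|[x b] w IH] //= /andP[hx /IH hw].
by rewrite rmk_cons; apply: PM.
Qed.

Lemma commute_inA W (h g : raag) :
  (forall x, W x -> commute h (rgen x)) -> inA W g -> commute h g.
Proof.
move=> hW; elim/inA_ind => [|x b {}g hx hg]; first exact: commute1.
apply: commuteM => //; rewrite rlet_gen; case: b; [|apply: commuteV]; exact: hW.
Qed.

Lemma inA_lk_comm x g : inA (rlk x) g -> commute (rgen x) g.
Proof. by apply: commute_inA => y /andP[_ h]; exact: rgen_comm. Qed.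

(** Killing the generators outside [W] respects every commutator, so the special subgroup of [W] is
    a retract. A conjugation between two of its elements can then be replaced by one inside it, and
    other special subgroups are mapped to intersections ([rret_in]). *)
Definition rret W : raag -> raag := rlift (fun x => if W x then rgen x else 1).

Lemma rret_subproof W x y : Rl x y ->
  commute (if W x then rgen x else 1) (if W y then rgen y else 1).
Proof.
move=> h; case: ifP => _; case: ifP => _;
  try exact: commute1; try exact/commute_sym/commute1.
by apply: rgen_comm; rewrite h.
Qed.

Lemma rretM W g h : rret W (g * h) = rret W g * rret W h.
Proof. exact: rliftM (rret_subproof W) _ _. Qed.

Lemma rret1 W : rret W 1 = 1.
Proof. by apply: (mulgI (rret W 1)); rewrite -rretM !mulg1. Qed.

Lemma rretV W g : rret W g^-1 = (rret W g)^-1.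
Proof. by apply: (mulgI (rret W g)); rewrite -rretM !mulgV rret1. Qed.

Lemma rret_gen W x : rret W (rgen x) = if W x then rgen x else 1.
Proof. exact: rlift_gen (rret_subproof W) _. Qed.

Lemma rret_id W g : inA W g -> rret W g = g.
Proof.
elim/inA_ind => [|x b h hx hh]; first exact: rret1.
rewrite rretM hh; congr (_ * _); rewrite rlet_gen.
by case: b; rewrite ?rretV rret_gen hx.
Qed.

Lemma rret_in W W' g : inA W' g -> inA (predI W W') (rret W g).
Proof.
elim/inA_ind => [|x b h hx hh]; first by rewrite rret1; exact: inA1.
rewrite rretM; apply: inAM => //; rewrite rlet_gen.
have : inA (predI W W') (rret W (rgen x)).
  by rewrite rret_gen; case: ifP => hW; [apply: inA_gen; rewrite /= hW|exact: inA1].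
by case: b => //; rewrite rretV; exact: inAV.
Qed.

End RaagGroup.

(** * Exponent sums and homomorphisms to the integers *)

Section ExponentSum.
Local Open Scope ring_scope.
Import GRing.Theory.
Variables (X : finType) (Rl : rel X).

Definition rexpw (x : X) (w : seq (X * bool)) : int :=
  \sum_(a <- w) (if a.1 == x then (if a.2 then 1 else -1) else 0).

Lemma rexpw_eq x u v : raag_eq Rl u v -> rexpw x u = rexpw x v.
Proof.
elim=> {u v} // [w1 w2 w3 _ -> _ -> //|u v y b|u v y z b c hxy].
  rewrite /rexpw !big_cat !big_cons /=; case: eqP => _; rewrite ?add0r //.
  by rewrite [X in _ + X]addrA; case: b; rewrite /= ?subrr ?addNr add0r.
by rewrite /rexpw !big_cat !big_cons /=; congr (_ + _); rewrite addrCA.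
Qed.

Definition rexp x (g : raag Rl) : int := rexpw x (rval g).

Lemma rexp_mk x w : rexp x (rmk Rl w) = rexpw x w.
Proof. by apply: rexpw_eq; apply: raag_sym; exact: rcanon_eq. Qed.

Lemma rexpM x (g h : raag Rl) : rexp x (g * h)%g = rexp x g + rexp x h.
Proof.
by rewrite -(rvalK g) -(rvalK h) -rmk_cat !rexp_mk /rexpw big_cat.
Qed.

Lemma rexp_gen x y : rexp x (rgen Rl y) = (y == x)%:R.
Proof. by rewrite rexp_mk /rexpw big_seq1 /=; case: eqP. Qed.

End ExponentSum.

Section IntHom.
Local Open Scope ring_scope.
Import GRing.Theory.
Variables (G : groupType) (e : G -> int).
Hypothesis eM : forall g h, e (g * h)%g = e g + e h.
Lemma ihom1 : e 1%g = 0.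
Proof. by apply: (addrI (e 1%g)); rewrite -eM mulg1 addr0. Qed.
Lemma ihomV g : e g^-1%g = - e g.
Proof. by apply: (addrI (e g)); rewrite -eM mulgV ihom1 subrr. Qed.
Lemma ihomX g n : e (g ^+ n)%g = e g *+ n.
Proof. by elim: n => [|n IH]; rewrite ?ihom1 // expgS eM IH mulrS. Qed.
Lemma ihomJ g u : e (u^-1 * g * u)%g = e g.
Proof. by rewrite !eM ihomV addrAC addNr add0r. Qed.
End IntHom.

Section IntHomRaag.
Local Open Scope ring_scope.
Import GRing.Theory.
Variables (X : finType) (Rl : rel X) (e : raag Rl -> int).
Hypothesis eM : forall g h, e (g * h)%g = e g + e h.
(** A homomorphism to the integers factors through the abelianization, which is free on the
    generators. *)
Lemma ihom_raag g : e g = \sum_x rexp x g * e (rgen Rl x).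
Proof.
elim/(@inA_ind X Rl predT): (inA_all g) => [|x b {}g _ IH].
  rewrite (ihom1 eM) big1 // => x _.
  by rewrite (ihom1 (fun g h => rexpM x g h)) mul0r.
rewrite eM IH; under [RHS]eq_bigr => y _ do rewrite rexpM mulrDl.
rewrite big_split /=; congr (_ + _); rewrite (bigD1 x) //= big1 => [|y yx].
  rewrite rlet_gen addr0; case: b; rewrite ?(ihomV (fun g h => rexpM x g h)) ?(ihomV eM);
  by rewrite rexp_gen eqxx ?mul1r ?mulN1r.
rewrite rlet_gen; case: b; rewrite ?(ihomV (fun g h => rexpM y g h)) rexp_gen;
by rewrite eq_sym (negbTE yx) ?oppr0 mul0r.
Qed.
End IntHomRaag.

(** * The Bass-Serre tree of a generator *)

Section Tree.
Local Open Scope group_scope.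
Variables (X : finType) (Rl : rel X) (x : X).
Notation G := (raag Rl).
Notation L := (@inA X Rl (rlk Rl x)).
Implicit Types (g h k : G) (w u : seq (X * bool)) (l : seq (G * bool)).

(** A representative of the coset of [c] modulo [L], normalized to 1 on [L] so that [p.1 == 1]
    detects the trivial coset. Cosets are taken in the whole group instead of the subgroup without
    [x]; this only enlarges the tree. *)
Definition cr (c : G) : G :=
  if `[< L c >] then 1 else choose [pred d : G | `[< L (c^-1 * d) >]] c.

Lemma crL c : L (c^-1 * cr c).
Proof.
rewrite /cr; case: asboolP => [Lc|_]; first by rewrite mulg1; exact: inAV.
have /(@chooseP _ [pred d : G | `[< L (c^-1 * d) >]]) /asboolP //
  : [pred d : G | `[< L (c^-1 * d) >]] c.
by apply/asboolP; rewrite mulVg; exact: inA1.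
Qed.

Lemma cr_eq c d : L (c^-1 * d) -> cr c = cr d.
Proof.
move=> h; have h' : L (d^-1 * c) by rewrite -[c]invgK -invgM; exact: inAV.
rewrite /cr; have -> : `[< L d >] = `[< L c >].
  apply/asboolP/asboolP => Lc.
    by rewrite -(mulVKg d c); apply: inAM.
  by rewrite -(mulVKg c d); apply: inAM.
case: asboolP => // nLc.
have e : [pred e : G | `[< L (c^-1 * e) >]] =1 [pred e : G | `[< L (d^-1 * e) >]].
  move=> a /=; apply/asboolP/asboolP => ha.
    by have := inAM h' ha; rewrite -mulgA mulVKg.
  by have := inAM h ha; rewrite -mulgA mulVKg.
rewrite (eq_choose e); apply: choose_id; apply/asboolP; first by [].
by rewrite mulVg; exact: inA1.
Qed.

Lemma cr1 : cr 1 = 1. Proof. by rewrite /cr; case: asboolP => // -[]; exact: inA1. Qed.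
Lemma crK c : cr (cr c) = cr c. Proof. by apply/esym/cr_eq/crL. Qed.
Lemma cr_1P c : cr c = 1 <-> L c.
Proof.
split=> [e|Lc]; first by have := inAV (crL c); rewrite e mulg1 invgK.
by rewrite -cr1; apply: cr_eq; rewrite mulg1; exact: inAV.
Qed.
Lemma cr_1M h c : L h -> cr (h * c) = 1 <-> cr c = 1.
Proof.
move=> Lh; rewrite !cr_1P; split=> Lc; last exact: inAM.
by rewrite -(mulKg h c); apply: inAM => //; exact: inAV.
Qed.

(** A list is a normal form [c1 x^s1 c2 x^s2 ...] of a coset, thus a vertex of the tree. An element
    [h] of the vertex group replaces [c1] by the representative of [h * c1]; the remainder lies in
    [L], passes through the stable letter and acts on the tail. *)
Fixpoint actH (h : G) l := match l with
  | [::] => [::]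
  | p :: l' => (cr (h * p.1), p.2) :: actH ((cr (h * p.1))^-1 * h * p.1) l'
  end.
Definition actT (s : bool) l := match l with
  | p :: l' => if (p.1 == 1) && (p.2 != s) then l' else (1 : G, s) :: l
  | [::] => [:: (1 : G, s)]
  end.
Definition lact (a : X * bool) l :=
  if a.1 == x then actT a.2 l else actH (rlet Rl a) l.
Definition act w l := foldr lact l w.
Definition tstep : rel (G * bool) := fun p q => ~~ ((q.1 == 1) && (q.2 != p.2)).
Definition tok l := all (fun p : G * bool => cr p.1 == p.1) l && sorted tstep l.

Lemma Lrest h c : L ((cr (h * c))^-1 * h * c).
Proof. by have := inAV (crL (h * c)); rewrite invgM invgK mulgA. Qed.

Lemma actH_ok h l : tok l -> tok (actH h l).
Proof.
case/andP; elim: l h => [|p l IH] h //= /andP[/eqP cp al] sl.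
have /andP[a s] := IH ((cr (h * p.1))^-1 * h * p.1) al (path_sorted sl).
rewrite /tok /= crK eqxx a /=; case: l {IH} al sl a s => [|q l] //= /andP[/eqP cq _].
case/andP=> st _ _ ->; rewrite andbT; move: st; rewrite /tstep /=; apply: contra.
by case/andP=> /eqP/(cr_1M _ (Lrest _ _)); rewrite cq => -> ->; rewrite eqxx.
Qed.

Lemma actHM h k l : actH h (actH k l) = actH (h * k) l.
Proof.
elim: l h k => [|p l IH] h k //=.
have e : cr (h * cr (k * p.1)) = cr (h * k * p.1).
  apply: cr_eq; rewrite invgM -!mulgA mulKg.
  by rewrite !mulgA; exact: Lrest.
by rewrite e IH; congr (_ :: actH _ _); rewrite !mulgA mulgK.
Qed.

Lemma actH1 l : tok l -> actH 1 l = l.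
Proof.
case/andP=> + _; elim: l => [|[c s] l IH] //= /andP[/eqP cp al].
by rewrite mul1g cp mulg1 mulVg IH.
Qed.

Lemma actT_ok s l : tok l -> tok (actT s l).
Proof.
case: l => [|[c t] l]; first by rewrite /tok /= cr1 eqxx.
rewrite /actT /= => okl; case: ifP => h.
  by case/andP: okl => /= /andP[_ a] /path_sorted s'; rewrite /tok a s'.
case/andP: okl => a s'; rewrite /tok /= cr1 eqxx /=.
by move: a s' => /= -> ->; rewrite /tstep /= h.
Qed.

Lemma actTK s l : tok l -> actT (~~ s) (actT s l) = l.
Proof.
case: l => [|[c t] l] okl; first by rewrite /= eqxx; case: s.
rewrite [actT s _]/=; case: ifP => [/andP[/eqP c1 ts]|_] /=; last first.
  by rewrite eqxx; case: s.
have -> : ~~ s = t by case: s t ts {okl} => [] [].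
move: okl; rewrite c1; case: l => [|q l] // /andP[_ /= /andP[st _]].
by rewrite /= ifN.
Qed.

(** The relation that defines the HNN extension: the stable letter commutes with [L]. It makes the
    action of words respect the commutation of [x] with its link. *)
Lemma actHT h s l : L h -> tok l -> actH h (actT s l) = actT s (actH h l).
Proof.
move=> Lh; case: l => [|[c t] l] okl.
  by rewrite /= mulg1 (cr_1P _).2.
have cc : (cr (h * c) == 1) = (c == 1).
  case/andP: okl => /= /andP[/eqP ec _] _.
  by apply/eqP/eqP => [/(cr_1M _ Lh)|->]; rewrite ?ec // (cr_1M _ Lh) cr1.
rewrite /= cc; case: ifP => [/andP[/eqP -> _]|_] /=.
  by rewrite !mulg1 (cr_1P _).2 // invg1 mul1g.
by rewrite !mulg1 (cr_1P _).2 // invg1 mul1g.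
Qed.

Lemma lact_ok a l : tok l -> tok (lact a l).
Proof. by move=> okl; rewrite /lact; case: ifP => _; [exact: actT_ok|exact: actH_ok]. Qed.
Lemma act_ok w l : tok l -> tok (act w l).
Proof. by elim: w => //= a w IH okl; apply/lact_ok/IH. Qed.
Lemma act_cat u w l : act (u ++ w) l = act u (act w l).
Proof. exact: foldr_cat. Qed.

Lemma lactK y b l : tok l -> lact (y, b) (lact (y, ~~ b) l) = l.
Proof.
move=> okl; rewrite /lact /=; have [yx|yx] := boolP (y == x).
  by rewrite -{1}(negbK b) actTK.
by rewrite actHM rletV mulgV actH1.
Qed.

Lemma act_eq u w l : raag_eq Rl u w -> tok l -> act u l = act w l.
Proof.
move=> h; elim: h l => {u w} [//|w1 w2 _ h l okl|w1 w2 w3 _ h1 _ h2 l okl|u v y b l okl|].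
- by rewrite h.
- by rewrite h1 ?h2.
- by rewrite !act_cat /= lactK // act_ok.
move=> u v y z b c hR l okl; rewrite !act_cat /=; congr act.
have {okl} := act_ok v okl; move: (act v l) => {}l okl.
case: (eqVneq y z) => [<-|yz].
  have := lactK y false okl; have := lactK y true okl.
  by case: b; case: c => //= -> ->.
have inL a d : a != x -> Rl x a || Rl a x -> L (rlet Rl (a, d)).
  by move=> ax ha; apply: inA_let; rewrite /rlk ax.
rewrite /lact /=; case: (eqVneq y x) => [yx|yx]; case: (eqVneq z x) => [zx|zx].
- by rewrite yx zx eqxx in yz.
- by rewrite actHT //; apply: inL; rewrite // -yx hR.
- by rewrite actHT //; apply: inL; rewrite // -zx hR orbT.
rewrite !actHM; congr actH; rewrite -!rmk_cat /=; apply/rmkP.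
exact: (raag_comm [::] [::] _ _ hR).
Qed.

Definition gact g l := act (rval g) l.
Lemma gact_mk w l : tok l -> gact (rmk Rl w) l = act w l.
Proof. by apply: act_eq; apply: raag_sym; exact: rcanon_eq. Qed.
Lemma gact_ok g l : tok l -> tok (gact g l). Proof. exact: act_ok. Qed.
Lemma gactM g h l : tok l -> gact (g * h) l = gact g (gact h l).
Proof. by move=> okl; rewrite -{1}(rvalK g) -{1}(rvalK h) -rmk_cat gact_mk // act_cat. Qed.
Lemma gact1 l : tok l -> gact 1 l = l.
Proof. by move=> okl; rewrite -(rmk_nil Rl) gact_mk. Qed.
Lemma gact_inj g l l' : tok l -> tok l' -> gact g l = gact g l' -> l = l'.
Proof.
by move=> ol ol' /(congr1 (gact g^-1)); rewrite -!gactM // mulVg !gact1.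
Qed.

(** A height on the tree, which every element raises by its exponent sum in [x] ([ht_gact]). A
    nonzero exponent sum therefore forces an unbounded orbit. *)
Definition ht l : int := (\sum_(p <- l) (if p.2 then 1 else -1))%R.

Lemma ht_actH h l : ht (actH h l) = ht l.
Proof.
by elim: l h => [|p l IH] h //=; rewrite /ht !big_cons /= -!/(ht _) IH.
Qed.

Lemma ht_act w l : (ht (act w l) = ht l + rexpw x w)%R.
Proof.
elim: w => [|[y b] w IH]; first by rewrite /rexpw big_nil GRing.addr0.
rewrite /rexpw big_cons -/(rexpw x w) /= /lact /=; case: eqP => _; last first.
  by rewrite ht_actH IH GRing.add0r.
rewrite GRing.addrCA -IH.
case: (act w l) => [|[c t] m]; first by rewrite /ht /= big_seq1 big_nil; case: b.
rewrite /actT /=; case: ifP => [/andP[_ bt]|_]; rewrite /ht !big_cons //=.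
by case: b t bt => [] []; rewrite //=; lia.
Qed.

Lemma ht_gact g l : (ht (gact g l) = ht l + rexp x g)%R.
Proof. exact: ht_act. Qed.

Lemma ht_size l : (`|ht l|%N <= size l)%N.
Proof.
elim: l => [|p l IH]; rewrite /ht ?big_nil // big_cons -/(ht l) /=.
by move: IH; case: p.2; lia.
Qed.

(** The edges of the tree: seen from the root [[::]], a neighbour is the parent or a child. *)
Definition adjl l l' := exists z, l' = rcons l z \/ l = rcons l' z.

Lemma actH_rcons h l z : exists z', actH h (rcons l z) = rcons (actH h l) z'.
Proof.
elim: l h => [|p l IH] h /=; first by eexists.
by have [z' ->] := IH ((cr (h * p.1))^-1 * h * p.1); exists z'.
Qed.

Lemma adj_act w l l' : adjl l l' -> adjl (act w l) (act w l').
Proof.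
elim: w => //= a w IH /IH {IH}; move: (act w l) (act w l') => {}l {}l'.
suff main m z : adjl (lact a m) (lact a (rcons m z)).
  case=> z [->|->]; first exact: main.
  by have [z' [h|h]] := main l' z; exists z'; [right|left].
rewrite /lact; case: ifP => _.
  case: m => [|p m] /=.
    by case: ifP => _; [exists (1, a.2); right|exists z; left].
  by case: ifP => _; exists z; left.
by have [z' ->] := actH_rcons (rlet Rl a) m z; exists z'; left.
Qed.

(** What is needed of two vertices at distance at most [B]: their geodesics from the root agree up
    to the last [B] steps. *)
Definition near B l l' := [/\ (size l <= size l' + B)%N, (size l' <= size l + B)%N &
  forall i, (i + B <= size l)%N -> take i l = take i l'].

Lemma near_refl l : near 0 l l.
Proof. by split; rewrite // addn0. Qed.
Lemma near_adj l l' : adjl l l' -> near 1 l l'.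
Proof.
case=> z [->|->]; split; rewrite ?size_rcons; try lia.
- by move=> i hi; rewrite -cats1 takel_cat //; lia.
- by move=> i hi; rewrite -cats1 takel_cat //; lia.
Qed.
Lemma near_trans B B' l1 l2 l3 : near B l1 l2 -> near B' l2 l3 -> near (B + B') l1 l3.
Proof.
case=> a1 a2 a3 [b1 b2 b3]; split; try lia.
by move=> i hi; rewrite a3 ?b3 //; lia.
Qed.

Lemma adjl_sym l l' : adjl l l' -> adjl l' l.
Proof. by case=> z [->|->]; exists z; [right|left]. Qed.

Lemma near_nil w l : near (size l) (act w [::]) (act w l) /\ near (size l) (act w l) (act w [::]).
Proof.
elim/last_ind: l => [|l z [IH1 IH2]]; first by split; exact: near_refl.
have a : adjl (act w l) (act w (rcons l z)) by apply: adj_act; exists z; left.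
rewrite size_rcons; split.
  by rewrite -addn1; apply: near_trans IH1 (near_adj a).
by rewrite -add1n; apply: near_trans IH2; apply/near_adj/adjl_sym.
Qed.

Lemma near_word u w : near (size w) (act u [::]) (act (u ++ w) [::]).
Proof.
elim/last_ind: w => [|w a IH]; first by rewrite cats0; exact: near_refl.
rewrite size_rcons -addn1; apply: near_trans IH _.
rewrite -cats1 catA !(act_cat _ [:: a]) /= /lact.
case: ifP => _ /=; last by split; rewrite ?leq_addr.
by apply/near_adj/adj_act; exists (1, a.2); left.
Qed.

(** Beyond depth [size w] the action of [w] commutes with truncation up to a shift, that is, it maps
    the remote part of a geodesic from the root to a part of such a geodesic. The number [d] is the
    shift plus [size w], which keeps it a natural number. *)
Lemma act_take w l : (size w <= size l)%N -> exists d,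
  (size (act w l) + size w = size l + d)%N /\
  forall i, (size w <= i <= size l)%N -> act w (take i l) = take (i + d - size w) (act w l).
Proof.
elim: w => [|a w IH] hs /=; first by exists 0; split=> // i hi; congr take; lia.
have [d [hd ht]] := IH (ltnW hs).
have ht1 i : (size w < i <= size l)%N -> lact a (act w (take i l))
   = lact a (take (i + d - size w) (act w l)) by move=> hi; rewrite ht //; lia.
rewrite /lact; case: ifP => ax.
  case E: (act w l) hd ht1 => [|p m] hd ht1; first by move: hd hs => /=; lia.
  have tE i : (size w < i)%N -> take (i + d - size w) (p :: m)
      = p :: take (i + d - size w).-1 m.
    by move=> hi; rewrite -[in LHS](@prednK (i + d - size w)) //; lia.
  case h : ((p.1 == 1) && (p.2 != a.2)).
    exists d; rewrite /= h; split; first by move: hd => /=; lia.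
    move=> i hi; have := ht1 i; rewrite /lact ax tE; last by lia.
    by rewrite /= h => ->; [congr take|]; lia.
  exists (d.+2); rewrite /= h; split; first by move: hd => /=; lia.
  move=> i hi; have := ht1 i; rewrite /lact ax tE; last by lia.
  rewrite /= h => ->; last lia.
  have -> : (i + d.+2 - (size w).+1 = (i + d - size w).-1.+2)%N by lia.
  by [].
have sH h m : size (actH h m) = size m by elim: m h => //= p m IHm h; rewrite IHm.
have tH h j m : actH h (take j m) = take j (actH h m).
  by elim: m j h => [|p m IHm] [|j] h //=; rewrite IHm.
exists d.+1; rewrite sH; split; first by lia.
move=> i hi; have := ht1 i; rewrite /lact ax => ->; last lia.
by rewrite tH; congr take; lia.
Qed.

Lemma gact_take g l : (size (rval g) <= size l)%N ->
  forall i, (size (rval g) <= i <= size l)%N ->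
  gact g (take i l) = take (i + size (gact g (take (size (rval g)) l)) - size (rval g)) (gact g l).
Proof.
move=> hs i hi; have [d [hd ht]] := act_take hs.
rewrite /gact ht // (ht (size (rval g))); last by rewrite leqnn.
by rewrite size_takel; [congr take|]; lia.
Qed.

Lemma act_cross w i : (i < size (act w [::]))%N -> exists p q s,
  w = p ++ (x, s) :: q /\
  let l := act w [::] in let v := act p [::] in let v' := act p [:: (1, s)] in
  v = take i l /\ v' = take i.+1 l \/ v' = take i l /\ v = take i.+1 l.
Proof.
elim/last_ind: w => [|w [y s] IH] //; rewrite -cats1 act_cat [act [:: _] _]/= /lact /=.
case: eqP => [->|_]; last first.
  move=> /IH [p [q [t [e h]]]]; exists p, (rcons q (y, s)), t.
  by rewrite -cats1 [in LHS]e -catA cat_cons.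
have [z [e|e]] : adjl (act w [::]) (act w [:: (1, s)]).
    by apply: adj_act; exists (1, s); left.
  rewrite e size_rcons ltnS leq_eqVlt; case/orP=> [/eqP ei|hi].
    exists w, [::], s; split=> //; left; rewrite e ei; split.
      by rewrite -cats1 take_size_cat.
    by rewrite take_oversize // size_rcons.
  have [p [q [t [ew h]]]] := IH hi; exists p, (rcons q (x, s)), t.
  split; first by rewrite -cats1 [in LHS]ew -catA cat_cons.
  by move: h; rewrite -cats1 !takel_cat //; lia.
move=> hi; have /IH [p [q [t [ew h]]]] : (i < size (act w [::]))%N.
  by rewrite e size_rcons ltnS ltnW.
exists p, (rcons q (x, s)), t.
split; first by rewrite -cats1 [in LHS]ew -catA cat_cons.
by move: h => /=; rewrite e -cats1 !takel_cat //; exact: ltnW.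
Qed.

Definition tval l : G := foldr (fun p v => p.1 * rlet Rl (x, p.2) * v) 1 l.

Lemma inL_H h : L h -> inA (predC1 x) h.
Proof. by apply: inA_sub => y /andP[]. Qed.

Lemma tval_actH h l : inA (predC1 x) h ->
  exists2 h', inA (predC1 x) h' & h * tval l = tval (actH h l) * h'.
Proof.
elim: l h => [|[c s] l IH] h Hh /=; first by exists h; rewrite ?mulg1 ?mul1g.
set d := cr (h * c); have Lk : L (d^-1 * h * c) by exact: Lrest.
have [h' Hh' e] := IH _ (inL_H Lk); exists h' => //.
have cm : commute (rlet Rl (x, s)) (d^-1 * h * c).
  rewrite rlet_gen; case: s; last apply/commute_sym/commuteV/commute_sym;
  exact: inA_lk_comm.
by rewrite -[RHS]mulgA -e [RHS]mulgA -[d * _ * _]mulgA cm !mulgA mulgV mul1g.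
Qed.

Lemma tval_act w l : exists2 h, inA (predC1 x) h & rmk Rl w * tval l = tval (act w l) * h.
Proof.
elim: w => [|[y b] w [h Hh IH]]; first by exists 1; rewrite ?rmk_nil ?mul1g ?mulg1 //; exact: inA1.
rewrite rmk_cons -mulgA IH /= /lact /= mulgA; case: eqP => [->|/eqP yx].
  exists h => //; congr (_ * _); case: (act w l) => [|[c t] m] /=.
    by rewrite mul1g mulg1.
  case: ifP => [/andP[/eqP -> tb]|_] /=; last by rewrite mul1g.
  have -> : t = ~~ b by case: t b tb => [] [].
  by rewrite rletV mul1g mulgA mulgV mul1g.
have [|h' Hh' ->] := @tval_actH (rlet Rl (y, b)) (act w l); first exact: inA_let.
by exists (h' * h); rewrite ?mulgA //; apply: inAM.
Qed.

(** By [tval_act], an element that fixes the root lies in the group without [x]. This group acts by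
    [actH], and there fixing the trivial coset means lying in [L]. *)
Lemma stab_edge f s : gact f [::] = [::] -> gact f [:: (1, s)] = [:: (1, s)] -> L f.
Proof.
move=> f1 f2; have [h Hh] := tval_act (rval f) [::].
rewrite rvalK -/(gact f _) f1 /= mulg1 mul1g => fh.
rewrite -fh in Hh; case: Hh => w hw fw; move: f2; rewrite fw gact_mk; last first.
  by rewrite /tok /= cr1 eqxx.
have -> l : tok l -> act w l = actH (rmk Rl w) l.
  move=> okl; elim: w hw {fw} => [|[y b] w IH] /=; first by rewrite actH1.
  by case/andP=> yx /IH ->; rewrite /lact /= (negbTE yx) actHM -rmk_cons.
  by rewrite /= mulg1 => -[/cr_1P].
by rewrite /tok /= cr1 eqxx.
Qed.

Section Ray.
Variable g : G.
Hypothesis eg : (rexp x g <> 0)%R.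
Notation D := (size (rval g)).
Definition orb N := gact (g ^+ N) [::].
(** The ray from the root to the attracting end of [g]. The orbit of the root moves in steps of
    length at most [D] and its [N]-th point has depth at least [N], so the first [i] entries are
    stable from [i + D] on. *)
Definition ray i := take i (orb (i + D)).

Lemma orb_ok N : tok (orb N). Proof. exact: gact_ok. Qed.

Lemma orb_size N : (N <= size (orb N))%N.
Proof.
apply: leq_trans (ht_size _); rewrite /orb ht_gact.
rewrite (ihomX (fun g h => rexpM x g h)) /ht big_nil; nia.
Qed.

Lemma orb_near N : near D (orb N) (orb N.+1).
Proof.
rewrite /orb expgSr gactM // {2}/gact -(rvalK g) gact_mk // -act_cat.
by rewrite rvalK /gact; exact: near_word.
Qed.

Lemma ray_orb i N : (i + D <= N)%N -> take i (orb N) = ray i.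
Proof.
move=> h; rewrite -(subnK h) addnC; elim: (N - _) => [|m IH]; first by rewrite addn0.
rewrite addnS; have [_ _ <- //] := orb_near (i + D + m).
by apply: leq_trans (orb_size _); rewrite leq_addr.
Qed.

Lemma ray_size i : size (ray i) = i.
Proof. by rewrite size_takel //; apply: leq_trans (orb_size _); rewrite leq_addr. Qed.

Lemma ray_take i j : (i <= j)%N -> take i (ray j) = ray i.
Proof. by move=> h; rewrite take_takel // ray_orb // leq_add2r. Qed.

Lemma ray_ok i : tok (ray i).
Proof.
have /andP[a s] := orb_ok (i + D); rewrite /tok take_sorted // andbT.
by move: a; rewrite -{1}(cat_take_drop i (orb (i + D))) all_cat => /andP[].
Qed.

(** By [act_take], [g] shifts the ray by a constant from depth [D] on. A shift that is not positive
    would keep the depth of the orbit bounded. *)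
Lemma ray_shift : exists2 t, (0 < t)%N & forall i, (D <= i)%N -> gact g (ray i) = ray (i + t).
Proof.
have oS N : gact g (orb N) = orb N.+1 by rewrite /orb expgS gactM.
pose d := size (gact g (ray D)).
have sh i : (D <= i)%N -> gact g (ray i) = ray (i + d - D).
  move=> hi; have [N hN] : exists N, N = (i + d + D + D)%N by eexists.
  have sN : (N <= size (orb N))%N := orb_size N.
  rewrite -(@ray_orb i N); last lia.
  rewrite gact_take; [|lia|lia].
  by rewrite oS (@ray_orb D) ?ray_orb //; lia.
case: (ltnP D d) => hd.
  by exists (d - D); [lia|move=> i hi; rewrite sh //; congr ray; lia].
have dec N : (D + D <= N)%N -> (size (orb N.+1) <= size (orb N))%N.
  move=> hN; have hs := orb_size N.
  have hD : (D <= size (orb N))%N by lia.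
  have /(_ (size (orb N))) := gact_take hD; rewrite leqnn hD take_size oS => /(_ isT) e.
  rewrite e size_take_min ray_orb; last lia.
  by rewrite -/d; lia.
have bd m : (size (orb (D + D + m)) <= size (orb (D + D)))%N.
  elim: m => [|m IH]; rewrite ?addn0 // addnS; apply: leq_trans IH; apply: dec; lia.
have := bd (size (orb (D + D))).+1; have := orb_size (D + D + (size (orb (D + D))).+1); lia.
Qed.

(** [f] moves the points obtained from [ray I] by powers of [h] by one bounded distance, so it fixes
    the end of the ray and shifts the ray by a constant. *)
Lemma ray_commute h t f : (0 < t)%N ->
  (exists I, forall i, (I <= i)%N -> gact h (ray i) = ray (i + t)) -> commute f h ->
  exists d, forall i, (size (rval f) <= i)%N -> gact f (ray i) = ray (i + d - size (rval f)).
Proof.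
move=> t0 [I hI] fh; set F := size (rval f).
exists (size (gact f (ray F))) => i hi; set d := size _.
have hX M : gact (h ^+ M) (ray I) = ray (I + M * t).
  elim: M => [|M IH]; first by rewrite gact1 ?ray_ok // mul0n addn0.
  by rewrite expgS gactM ?ray_ok // IH hI ?leq_addr //; congr ray; lia.
pose B := (size (gact f (ray I)) + size (ray I))%N.
have [M eM] : exists M, M = (i + d + B + B + F + F)%N by eexists.
pose l := ray (I + M * t).
have sl : size l = (I + M * t)%N by exact: ray_size.
have hM : (M <= I + M * t)%N by nia.
have nr : near B (gact f l) l.
  rewrite /l -hX -gactM ?ray_ok // (commuteX _ fh : f * h ^+ M = _) gactM ?ray_ok //.
  rewrite /gact; apply: near_trans (near_nil _ _).1.
  by have [_] := near_nil (rval (h ^+ M)) (act (rval f) (ray I)).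
have e : gact f (ray i) = take (i + d - F) (gact f l).
  rewrite -(@ray_take i (I + M * t)); last by lia.
  rewrite gact_take ?sl; [|by lia|lia].
  by rewrite ray_take //; lia.
have [n1 n2 n3] := nr.
by rewrite e n3; [rewrite ray_take //|]; lia.
Qed.

(** Conjugation by a power of [h] carries a statement on remote points of the ray back to depth [J],
    which does not depend on [f]. Thus one edge will be fixed by all elements in question. *)
Lemma ray_uniform h t f p q J : (0 < t)%N ->
  (forall i, (J <= i)%N -> gact h (ray i) = ray (i + t)) -> commute f h ->
  (exists I, forall i, (I <= i)%N -> gact f (ray (i + p)) = ray (i + q)) ->
  forall i, (J <= i + p)%N -> (J <= i + q)%N -> gact f (ray (i + p)) = ray (i + q).
Proof.
move=> t0 hJ fh [I hI] i h1 h2.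
have hX M j : (J <= j)%N -> gact (h ^+ M) (ray j) = ray (j + M * t).
  move=> hj; elim: M => [|M IH]; first by rewrite gact1 ?ray_ok // mul0n addn0.
  by rewrite expgS gactM ?ray_ok // IH hJ; [congr ray|]; lia.
apply: (@gact_inj (h ^+ I)); rewrite ?gact_ok ?ray_ok //.
rewrite -gactM ?ray_ok // -(commuteX _ fh : f * h ^+ I = _) gactM ?ray_ok // !hX //.
rewrite (_ : i + p + I * t = i + I * t + p)%N; last lia.
rewrite (_ : i + q + I * t = i + I * t + q)%N; last lia.
by apply: hI; nia.
Qed.

(** [k] commutes with [g'], not necessarily with [g]. Still [g'] shifts the ray, and by a nonzero
    amount as its exponent sum is nonzero; so [k] shifts the ray too. It preserves heights, while
    the heights along the ray drift, so its shift is zero. *)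
Lemma ray_fixed g' k : commute g' g -> (rexp x g' <> 0)%R -> commute k g' ->
  (rexp x k = 0)%R -> forall i, (D <= i)%N -> gact k (ray i) = ray i.
Proof.
move=> cg eg' ck ek; have [t t0 ht0] := ray_shift.
have drift i m : (D <= i)%N -> (ht (ray (i + m * t)) = ht (ray i) + rexp x g *+ m)%R.
  move=> hi; elim: m => [|m IH]; first by rewrite mul0n addn0 GRing.mulr0n GRing.addr0.
  have := ht0 (i + m * t) (leq_trans hi (leq_addr _ _)) => /(congr1 ht).
  rewrite ht_gact IH (_ : i + m * t + t = i + m.+1 * t)%N; last lia.
  by move=> <-; rewrite GRing.mulrSr GRing.addrA.
have [d' hd'] := ray_commute t0 (ex_intro _ D ht0) cg.
set D' := size (rval g') in hd'.
(* [h] is [g'] or its inverse, whichever shifts the ray away from the root. *)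
have [h [t' [t'0 ht' ch]]] : exists h t', [/\ (0 < t')%N,
    (forall i, (D <= i)%N -> gact h (ray i) = ray (i + t')) & commute k h].
  case: (ltngtP D' d') => dd.
  - exists g', (d' - D')%N; split=> //; first lia.
    move=> i hi; have := @ray_uniform g t g' 0 (d' - D') D t0 ht0 cg _ i.
    rewrite addn0; apply=> //; last lia.
    by exists D' => j hj; rewrite addn0 hd' //; congr ray; lia.
  - exists g'^-1, (D' - d')%N; split=> //; [lia| |exact: commuteV].
    move=> i hi; have := @ray_uniform g t g'^-1 0 (D' - d') D t0 ht0 _ _ i.
    rewrite addn0; apply=> //; last lia.
      exact/commute_sym/commuteV/commute_sym.
    exists D' => j hj; rewrite addn0; apply: (@gact_inj g'); rewrite ?gact_ok ?ray_ok //.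
    rewrite -gactM ?ray_ok // mulgV gact1 ?ray_ok // hd'; last lia.
    by congr ray; lia.
  - have /(congr1 ht) := hd' D' (leqnn _); rewrite ht_gact -dd.
    by rewrite addnK => /eqP; rewrite -GRing.subr_eq0; move/eqP: eg'; lia.
have [d hd] := ray_commute t'0 (ex_intro _ D ht') ch.
set K := size (rval k) in hd.
(* A period [s] of the heights, iterated [t] times, would change them by [s] times the exponent sum
   of [g]; hence [s] is 0. *)
have per s : (exists I, forall i, (I <= i)%N -> ht (ray (i + s)) = ht (ray i)) -> s = 0%N.
  case=> I hI.
  have it m i : (I <= i)%N -> ht (ray (i + m * s)) = ht (ray i).
    move=> hi; elim: m => [|m IH]; first by rewrite mul0n addn0.
    rewrite (_ : i + m.+1 * s = i + m * s + s)%N; last lia.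
    by rewrite hI ?IH //; lia.
  have := it t (I + D)%N (leq_addr _ _); rewrite mulnC drift ?leq_addl //.
  by move/eqP: eg; nia.
have dK : d = K.
  case: (leqP K d) => h1.
    suff : (d - K = 0)%N by lia.
    apply: per; exists K => i hi; have /(congr1 ht) := hd i hi; rewrite ht_gact ek GRing.addr0 => ->.
    by congr (ht (ray _)); lia.
  suff : (K - d = 0)%N by lia.
  apply: per; exists K => i hi; have hK : (K <= i + (K - d))%N by lia.
  have /(congr1 ht) := hd _ hK; rewrite ht_gact ek GRing.addr0.
  by move=> ->; congr (ht (ray _)); lia.
move=> i hi; have := @ray_uniform h t' k 0 0 D t'0 ht' ch _ i; rewrite addn0; apply=> //.
by exists K => j hj; rewrite addn0 hd // dK addnK.
Qed.
End Ray.

(* The centralizers in question fix the axis of g in the Bass-Serre tree of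
   the HNN extension with stable letter x, hence one common edge of it. *)
Lemma hyperbolic_centralizer (W : pred X) g : inA W g -> (rexp x g <> 0)%R ->
  exists2 u, inA W u & forall g' k, commute g' g -> (rexp x g' <> 0)%R ->
    commute k g' -> (rexp x k = 0)%R -> L (u^-1 * k * u).
Proof.
move=> Wg eg; set D := size (rval g).
(* For this power the geodesic from the root to its translate follows the ray up to depth [D.+1], so
   it contains the edge of the ray between the depths [D] and [D.+1], from which on [ray_fixed]
   applies. *)
have : inA W (g ^+ (D.+1 + D)).
  by elim: (D.+1 + D)%N => [|m IH]; [exact: inA1|rewrite expgS; exact: inAM].
case=> w hw ew.
have ow : act w [::] = orb g (D.+1 + D) by rewrite -(gact_mk w) // -ew.
have hs : (D < size (act w [::]))%N.
  by rewrite ow; apply: leq_trans (orb_size eg _); lia.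
have [p [q [s [e /= h]]]] := act_cross hs.
have r1 : take D (act w [::]) = ray g D by rewrite ow ray_orb //; lia.
have r2 : take D.+1 (act w [::]) = ray g D.+1 by rewrite ow ray_orb.
exists (rmk Rl p); first by exists p => //; move: hw; rewrite e all_cat => /andP[].
move=> g' k cg eg' ck ek; have fx := ray_fixed eg cg eg' ck ek.
have ok1 : tok [:: (1, s)] by rewrite /tok /= cr1 eqxx.
have [f1 f2] : gact k (act p [::]) = act p [::] /\
               gact k (act p [:: (1, s)]) = act p [:: (1, s)].
  by case: h => -[-> ->]; rewrite r1 r2 !fx.
have st l : tok l -> gact k (act p l) = act p l ->
    gact ((rmk Rl p)^-1 * k * rmk Rl p) l = l.
  move=> okl fl; rewrite !gactM ?gact_ok // gact_mk // fl -(gact_mk p) //.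
  by rewrite -gactM // mulVg gact1.
by apply: (@stab_edge _ s); apply: st.
Qed.
End Tree.

(** * Commuting elements that permute strands *)

Section ThreeCycles.
Local Open Scope group_scope.
Variable T : finType.
Implicit Types (i j k m : T) (p : {perm T}).

(** A 3-cycle written as a commutator of transpositions: every lift of this product has exponent
    sums 0. *)
Definition c3 i j k : {perm T} := tperm i j * tperm j k * (tperm i j)^-1 * (tperm j k)^-1.

Lemma c3E i j k : uniq [:: i; j; k] ->
  [/\ c3 i j k i = j, c3 i j k j = k & c3 i j k k = i].
Proof.
rewrite /= !inE negb_or andbT => /andP[/andP[ij ik] jk].
have [ji ki kj] : [/\ j != i, k != i & k != j] by rewrite !(eq_sym _ i) (eq_sym k).
rewrite /c3 !tpermV; split; rewrite !permM.
- by rewrite tpermL tpermL (tpermD ik jk) tpermR.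
- by rewrite tpermR (tpermD ji ki) tpermL tpermL.
- by rewrite (tpermD ik jk) tpermR tpermR (tpermD ji ki).
Qed.

Lemma c3D i j k m : m \notin [:: i; j; k] -> c3 i j k m = m.
Proof.
rewrite !inE !negb_or => /and3P[mi mj mk]; rewrite /c3 !tpermV !permM.
by rewrite !tpermD // eq_sym.
Qed.

Lemma commute_perm (p q : {perm T}) m : commute p q -> p (q m) = q (p m).
Proof. by move=> h; rewrite -!permM h. Qed.

Lemma c3_mem p i j k m : uniq [:: i; j; k] -> commute p (c3 i j k) ->
  m \in [:: i; j; k] -> p m \in [:: i; j; k].
Proof.
move=> u h mi; apply: contraT => /c3D; rewrite -(commute_perm _ h) => /perm_inj.
have [e1 e2 e3] := c3E u; move: u; rewrite /= !inE negb_or andbT => /andP[/andP[ij ik] jk].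
move: mi; rewrite !inE => /or3P[] /eqP ->; rewrite (e1, e2, e3) => /eqP.
- by rewrite eq_sym (negbTE ij).
- by rewrite eq_sym (negbTE jk).
- by rewrite (negbTE ik).
Qed.

Lemma c3_fix p i j k : uniq [:: i; j; k] -> commute p (c3 i j k) ->
  p k = k -> p i = i /\ p j = j.
Proof.
move=> u h pk; have [e1 e2 e3] := c3E u.
have pi : p i = i by rewrite -e3 (commute_perm _ h) pk.
by split=> //; rewrite -e1 (commute_perm _ h) pi.
Qed.

Lemma tperm_mem p i j m : i != j -> commute p (tperm i j) -> m \in [:: i; j] ->
  p m \in [:: i; j].
Proof.
move=> ij h mi; apply: contraT; rewrite !inE negb_or => /andP[pi pj].
have : tperm i j (p m) = p m by rewrite tpermD // eq_sym.
rewrite -(commute_perm _ h) => /perm_inj /eqP.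
by move: mi; rewrite !inE => /orP[] /eqP ->; rewrite ?tpermL ?tpermR (negbTE ij, eq_sym) ?(negbTE ij).
Qed.

Lemma perm_or_tperm p i j : (forall m, m \notin [:: i; j] -> p m = m) ->
  p = 1 \/ p = tperm i j.
Proof.
move=> h; have ps : forall m, m \in [:: i; j] -> p m \in [:: i; j].
  by move=> m mi; apply: contraT => n; move: (h _ n) => /perm_inj e; rewrite e mi in n.
have [e|ne] := eqVneq (p i) i.
  left; apply/permP => m; rewrite perm1; have [->//|mi] := eqVneq m i.
  have [->|mj] := eqVneq m j; last by apply: h; rewrite !inE negb_or mi.
  have := ps j; rewrite !inE eqxx orbT => /(_ isT)/orP[/eqP pj|/eqP//].
  by rewrite (perm_inj (etrans pj (esym e))) e.
right; have pi : p i = j by have := ps i; rewrite !inE eqxx (negbTE ne) => /(_ isT)/eqP.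
apply/permP => m; case: tpermP => [->//|->|/eqP mi /eqP mj]; last first.
  by apply: h; rewrite !inE negb_or mi.
have := ps j; rewrite !inE eqxx orbT => /(_ isT)/orP[/eqP//|/eqP pj].
by move: ne; rewrite pi => /eqP[]; apply: (@perm_inj _ p); rewrite pj pi.
Qed.
End ThreeCycles.

Definition zexpg (G : groupType) (g : G) (m : int) : G :=
  match m with Posz k => (g ^+ k)%g | Negz k => (g ^- k.+1)%g end.

(** * Algebraic obstructions from commuting exchanges *)

Section Obstructions.
Import GRing.Theory.
Local Open Scope group_scope.
Variables (X : finType) (Rl : rel X).
Notation G := (raag Rl).
Notation gen := (@rgen X Rl).
Notation rexpMx x := (fun g h : raag Rl => rexpM x g h).

Lemma commuteZ (g h : G) m : commute g h -> commute g (zexpg h m).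
Proof. by move=> c; case: m => k; [exact: commuteX|apply/commuteV/commuteX]. Qed.

Lemma ihomZ (e : G -> int) : (forall g h, e (g * h)%g = e g + e h)%R ->
  forall g m, (e (zexpg g m) = m * e g)%R.
Proof.
move=> eM g [k|k] /=; first by rewrite (ihomX eM) -mulr_natl natz.
by rewrite (ihomV eM) (ihomX eM) NegzE mulNr -mulr_natl natz.
Qed.

Lemma commuteJ (u g h : G) : commute (u^-1 * g * u) h <-> commute g (u * h * u^-1).
Proof.
rewrite /commute; split=> e.
  apply: (mulgI u^-1); apply: (mulIg u); rewrite !mulgA mulgVK mulVg mul1g.
  by move: e; rewrite !mulgA => ->; rewrite -!mulgA.
apply: (mulgI u); apply: (mulIg u^-1); rewrite !mulgA mulgK mulgV mul1g.
by move: e; rewrite !mulgA => <-; rewrite -!mulgA.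
Qed.

Lemma commuteJJ (u g h : G) : commute g h -> commute (u * g * u^-1) (u * h * u^-1).
Proof. by move=> e; rewrite /commute !mulgA !mulgVK -!(mulgA u) e. Qed.

Lemma commute_quotient (t w g : G) : t^-1 * g * t = w^-1 * g * w -> commute (t * w^-1) g.
Proof.
move=> e; rewrite /commute; apply: (mulIg w); apply: (mulgI t^-1).
by rewrite !mulgA mulVg mul1g mulgVK e.
Qed.

(** The form in which [hyperbolic_centralizer] is mostly applied: the link group commutes with [x],
    and [u] depends on [g] alone. *)
Lemma axis_generator x (g : G) : (rexp x g <> 0)%R -> exists u, forall g' k,
  commute g' g -> (rexp x g' <> 0)%R -> commute k g' -> (rexp x k = 0)%R ->
  commute k (u * gen x * u^-1) /\ inA (rlk Rl x) (u^-1 * k * u).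
Proof.
move=> eg; have [u _ hu] := hyperbolic_centralizer (inA_all g) eg.
exists u => g' k h1 h2 h3 h4; have L := hu _ _ h1 h2 h3 h4; split=> //.
by apply/commuteJ/commute_sym/inA_lk_comm.
Qed.

Section Permutations.
Variables (T : finType) (rho : G -> {perm T}).
Hypothesis rhoM : forall g h, rho (g * h) = rho g * rho h.

Lemma rho1 : rho 1 = 1.
Proof. by apply: (mulgI (rho 1)); rewrite -rhoM !mulg1. Qed.
Lemma rhoV g : rho g^-1 = (rho g)^-1.
Proof. by apply: (mulgI (rho g)); rewrite -rhoM !mulgV rho1. Qed.
Lemma rho_commute g h : commute g h -> commute (rho g) (rho h).
Proof. by rewrite /commute -!rhoM => ->. Qed.
Lemma odd_rhoJ u g : odd_perm (rho (u * g * u^-1)) = odd_perm (rho g).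
Proof. by rewrite !rhoM rhoV !odd_permM odd_permV addbAC addbb. Qed.

(** The sign of [rho g] is the parity of the sum [s g] of the exponents of the odd generators. For
    odd [g] this sum is nonzero, so one of its terms is. *)
Lemma odd_generator g : odd_perm (rho g) -> exists2 x, odd_perm (rho (gen x)) & (rexp x g <> 0)%R.
Proof.
move=> og; pose s (h : G) : int := (\sum_(x | odd_perm (rho (gen x))) rexp x h)%R.
have sM (h k : G) : (s (h * k)%g = s h + s k)%R.
  by rewrite /s -big_split; apply: eq_bigr => x _; exact: rexpM.
have par h : exists m : int, (s h = Posz (odd_perm (rho h)) + m + m)%R.
  elim/(@inA_ind X Rl predT): (inA_all h) => [|x b {}h _ [m IH]].
    by exists 0%R; rewrite rho1 odd_perm1 (ihom1 sM).
  have [m' e] : exists m', (s (rlet Rl (x, b)) = Posz (odd_perm (rho (rlet Rl (x, b)))) + m' + m')%R.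
    have e1 : s (gen x) = Posz (odd_perm (rho (gen x))).
      rewrite /s; case ox: (odd_perm _).
        rewrite (bigD1 x) //= rexp_gen eqxx big1 ?GRing.addr0 // => y /andP[_ yx].
        by rewrite rexp_gen eq_sym (negbTE yx).
      rewrite big1 // => y oy; rewrite rexp_gen; case: eqP => // e.
      by rewrite -e ox in oy.
    rewrite rlet_gen; case: b; first by exists 0%R; rewrite e1; lia.
    exists (- Posz (odd_perm (rho (gen x))))%R.
    by rewrite (ihomV sM) e1 rhoV odd_permV; lia.
  rewrite sM e IH rhoM odd_permM.
  by case: (odd_perm _); case: (odd_perm _) => /=;
    solve [exists (m + m')%R; lia | exists (m + m' + 1)%R; lia].
have [m sg] := par g; rewrite og in sg.
have : s g <> 0%R by rewrite sg; lia.
move=> sn0; apply: contrapT => ne; apply: sn0; apply: big1 => x ox.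
by apply: contrapT => ex; apply: ne; exists x.
Qed.

Definition pair_data (sa sb : G) (t1 t2 t3 t4 : T) :=
  [/\ uniq [:: t1; t2; t3; t4], commute sa sb, rho sa = tperm t1 t2 /\ rho sb = tperm t3 t4,
   (forall j k, j \notin [:: t1; t2] -> k \notin [:: t1; t2] ->
     exists2 g, commute g sa & rho g = tperm j k) &
   (forall j k, j \notin [:: t3; t4] -> k \notin [:: t3; t4] ->
     exists2 g, commute g sb & rho g = tperm j k)].

Lemma pair_data_sym sa sb t1 t2 t3 t4 :
  pair_data sa sb t1 t2 t3 t4 -> pair_data sb sa t3 t4 t1 t2.
Proof.
case=> u c [ra rb] ca cb; split=> //.
by rewrite (uniq_catC [:: t3; t4] [:: t1; t2]).
Qed.

Lemma c3_centralizer s (A : seq T) i j k :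
  (forall j k, j \notin A -> k \notin A -> exists2 g, commute g s & rho g = tperm j k) ->
  i \notin A -> j \notin A -> k \notin A ->
  exists g, [/\ commute g s, rho g = c3 i j k & forall x, rexp x g = 0%R].
Proof.
move=> h hi hj hk; have [g cg rg] := h _ _ hi hj; have [g' cg' rg'] := h _ _ hj hk.
exists (g * g' * g^-1 * g'^-1); split.
- by apply/commute_sym; do ![apply: commuteM]; try apply: commuteV; apply: commute_sym.
- by rewrite !rhoM !rhoV rg rg'.
- by move=> x; rewrite !rexpM !(ihomV (rexpMx x)); lia.
Qed.

Hypothesis T5 : (5 <= #|T|)%N.

Lemma fifth t1 t2 t3 t4 : exists t5 : T, t5 \notin [:: t1; t2; t3; t4].
Proof.
apply: contrapT => h; have : (#|T| <= 4)%N.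
  rewrite cardT; apply: (@uniq_leq_size _ (enum T) [:: t1; t2; t3; t4]) => [|t _].
    exact: enum_uniq.
  by apply: contraT => n; case: h; exists t.
by rewrite leqNgt T5.
Qed.

(** Otherwise the conjugate [x'] of [x] commutes with the 3-cycles off either pair. With a fifth
    point [t5], both [t3, t4, t5] and [t1, t2, t5] are preserved, so [t5] is fixed and with it every
    point, contrary to the parity of [x]. *)
Lemma pair_not_both sa sb t1 t2 t3 t4 x : pair_data sa sb t1 t2 t3 t4 ->
  odd_perm (rho (gen x)) -> (rexp x sa <> 0)%R -> (rexp x sb = 0)%R.
Proof.
case=> u c [ra rb] ca cb ox ea; apply: contrapT => eb.
have [v hv] := axis_generator ea; set x' := v * gen x * v^-1 in hv.
have [t5 h5] := fifth t1 t2 t3 t4.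
move: u h5; rewrite /= !inE !negb_or !andbT => /and3P[/and3P[n12 n13 n14] /andP[n23 n24] n34].
case/and4P=> n51 n52 n53 n54.
have Pa i j k : i \notin [:: t1; t2] -> j \notin [:: t1; t2] -> k \notin [:: t1; t2] ->
    commute (rho x') (c3 i j k).
  move=> hi hj hk; have [g [cg <- eg]] := c3_centralizer ca hi hj hk.
  by apply/rho_commute/commute_sym; have [] := hv sa g (commute_refl _) ea cg (eg x).
have Pb i j k : i \notin [:: t3; t4] -> j \notin [:: t3; t4] -> k \notin [:: t3; t4] ->
    commute (rho x') (c3 i j k).
  move=> hi hj hk; have [g [cg <- eg]] := c3_centralizer cb hi hj hk.
  by apply/rho_commute/commute_sym; have [] := hv sb g (commute_sym c) eb cg (eg x).
have u345 : uniq [:: t3; t4; t5] by rewrite /= !inE negb_or n34 !(eq_sym _ t5) n53 n54.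
have u125 : uniq [:: t1; t2; t5] by rewrite /= !inE negb_or n12 !(eq_sym _ t5) n51 n52.
have q345 : commute (rho x') (c3 t3 t4 t5).
  by apply: Pa; rewrite !inE negb_or ?n51 // !(eq_sym t3, eq_sym t4) ?n13 ?n23 ?n14 ?n24.
have q125 : commute (rho x') (c3 t1 t2 t5).
  by apply: Pb; rewrite !inE negb_or ?n53 ?n54 // ?n13 ?n14 ?n23 ?n24.
have f5 : rho x' t5 = t5.
  have := c3_mem u345 q345; move=> /(_ t5); rewrite !inE eqxx !orbT => /(_ isT) h1.
  have := c3_mem u125 q125; move=> /(_ t5); rewrite !inE eqxx !orbT => /(_ isT) h2.
  case/or3P: h1 => /eqP e; rewrite e in h2 *; rewrite // !(eq_sym t3, eq_sym t4) in h2.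
    by rewrite (negbTE n13) (negbTE n23) (negbTE n53) in h2.
  by rewrite (negbTE n14) (negbTE n24) (negbTE n54) in h2.
have [f1 f2] := c3_fix u125 q125 f5.
have [f3 f4] := c3_fix u345 q345 f5.
have r1 : rho x' = 1.
  apply/permP => m; rewrite perm1.
  have [->//|m1] := eqVneq m t1; have [->//|m2] := eqVneq m t2.
  have [->//|m3] := eqVneq m t3; have [->//|m5] := eqVneq m t5.
  have u : uniq [:: m; t5; t3] by rewrite /= !inE negb_or m5 m3 n53.
  have q : commute (rho x') (c3 m t5 t3).
    by apply: Pa; rewrite !inE negb_or ?m1 ?m2 ?n51 ?n52 // !(eq_sym t3) n13.
  by have [] := c3_fix u q f3.
by move: ox; rewrite -(odd_rhoJ v) -/x' r1 odd_perm1.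
Qed.

(** Only the 3-cycles off [t1, t2] are available here. Since [x] has exponent sum 0 in [sb],
    commutation with [sb] replaces the others and makes [t5] a fixed point. *)
Lemma pair_monodromy sa sb t1 t2 t3 t4 x v : pair_data sa sb t1 t2 t3 t4 ->
  odd_perm (rho (gen x)) -> (rexp x sa <> 0)%R ->
  (forall k, commute k sa -> (rexp x k = 0)%R -> commute k (v * gen x * v^-1)) ->
  rho (v * gen x * v^-1) = tperm t1 t2.
Proof.
move=> hp ox ea hv; set x' := v * gen x * v^-1 in hv *.
have eb := pair_not_both hp ox ea; case: hp => u c [ra rb] ca cb.
have cab : commute (rho x') (tperm t3 t4).
  by rewrite -rb; apply/rho_commute/commute_sym; apply: hv; rewrite // commute_sym.
have [t5 h5] := fifth t1 t2 t3 t4.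
move: u h5; rewrite /= !inE !negb_or !andbT => /and3P[/and3P[n12 n13 n14] /andP[n23 n24] n34].
case/and4P=> n51 n52 n53 n54.
have Pa i j k : i \notin [:: t1; t2] -> j \notin [:: t1; t2] -> k \notin [:: t1; t2] ->
    commute (rho x') (c3 i j k).
  move=> hi hj hk; have [g [cg <- eg]] := c3_centralizer ca hi hj hk.
  by apply/rho_commute/commute_sym/hv.
have u345 : uniq [:: t3; t4; t5] by rewrite /= !inE negb_or n34 !(eq_sym _ t5) n53 n54.
have q345 : commute (rho x') (c3 t3 t4 t5).
  by apply: Pa; rewrite !inE negb_or ?n51 // !(eq_sym t3, eq_sym t4) ?n13 ?n23 ?n14 ?n24.
have f5 : rho x' t5 = t5.
  have mt m : m \in [:: t3; t4] -> rho x' m \in [:: t3; t4] := tperm_mem n34 cab.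
  have := c3_mem u345 q345; move=> /(_ t5); rewrite !inE eqxx !orbT => /(_ isT).
  have st : t5 = (rho x')^-1 (rho x' t5) by rewrite permK.
  have cV : commute (rho x')^-1 (tperm t3 t4) by apply/commute_sym/commuteV/commute_sym.
  have := tperm_mem n34 cV; move=> /(_ (rho x' t5)); rewrite permK !inE (negbTE n53) (negbTE n54).
  move=> h1 /or3P[] /eqP e //; by move: h1; rewrite e eqxx ?orbT => /(_ isT).
have [f3 f4] := c3_fix u345 q345 f5.
have : rho x' = 1 \/ rho x' = tperm t1 t2.
  apply: perm_or_tperm => m; rewrite !inE negb_or => /andP[m1 m2].
  have [->//|m3] := eqVneq m t3; have [->//|m5] := eqVneq m t5.
  have u : uniq [:: m; t5; t3] by rewrite /= !inE negb_or m5 m3 n53.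
  have q : commute (rho x') (c3 m t5 t3).
    by apply: Pa; rewrite !inE negb_or ?m1 ?m2 ?n51 ?n52 // !(eq_sym t3) n13.
  by have [] := c3_fix u q f3.
case=> // r1; by move: ox; rewrite -(odd_rhoJ v) -/x' r1 odd_perm1.
Qed.

(** One element [v] has to conjugate both generators. The axis for [y] is taken inside the link
    group of [x], where the conjugate of [sb] lies; the correction [u2] stays in that group and so
    commutes with [x]. For this purpose [hyperbolic_centralizer] keeps track of [W]. *)
Lemma pair_generators sa sb t1 t2 t3 t4 : pair_data sa sb t1 t2 t3 t4 ->
  exists x y v, [/\ (rexp x sa <> 0)%R, (rexp y sb <> 0)%R,
    rho (v * gen x * v^-1) = tperm t1 t2 & rho (v * gen y * v^-1) = tperm t3 t4].
Proof.
move=> hp; have := hp; case=> u c [ra rb] ca cb.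
move: u; rewrite /= !inE !negb_or !andbT => /and3P[/and3P[n12 _ _] _ n34].
have [|x ox ex] := @odd_generator sa; first by rewrite ra odd_tperm.
have [|y oy ey] := @odd_generator sb; first by rewrite rb odd_tperm.
have xb := pair_not_both hp ox ex.
have [u hu] := axis_generator ex.
have [_ Lw] := hu sa sb (commute_refl _) ex (commute_sym c) xb.
set w := u^-1 * sb * u in Lw.
have ew : (rexp y w <> 0)%R by rewrite (ihomJ (rexpMx y)).
have [u2 Lu2 hu2] := hyperbolic_centralizer Lw ew.
have ux : u * u2 * gen x * (u * u2)^-1 = u * gen x * u^-1.
  rewrite invgM !mulgA; congr (_ * _); rewrite -!mulgA; congr (_ * _).
  by rewrite mulgA -(inA_lk_comm Lu2) mulgK.
exists x, y, (u * u2); split=> //.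
  apply: (pair_monodromy hp) => // k ck ek; rewrite ux.
  by have [] := hu sa k (commute_refl _) ex ck ek.
apply: (pair_monodromy (pair_data_sym hp)) => // k ck ek.
apply/commuteJ; have -> : (u * u2)^-1 * k * (u * u2) = u2^-1 * (u^-1 * k * u) * u2.
  by rewrite invgM !mulgA.
apply/commute_sym/inA_lk_comm/(hu2 w) => //.
  apply/commuteJ; rewrite /w !mulgA mulgV mul1g mulgK; exact: ck.
by rewrite (ihomJ (rexpMx y)).
Qed.

Lemma pair_homologous sa sb t1 t2 t3 t4 : pair_data sa sb t1 t2 t3 t4 ->
  (forall x, rexp x sb = - rexp x sa)%R -> False.
Proof.
move=> hp h; have := hp; case=> u c [ra rb] ca cb.
move: u; rewrite /= !inE !negb_or !andbT => /and3P[/and3P[n12 _ _] _ n34].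
have [|x ox ex] := @odd_generator sa; first by rewrite ra odd_tperm.
have := pair_not_both hp ox ex; rewrite h; lia.
Qed.

(** Up to conjugation [k] lies in the link groups of [x] and of [y], hence in that of the common
    link, and commutes with both generators. Its permutation then preserves two disjoint pairs, so
    that its square fixes four points. *)
Lemma triple_obstruction sa sb t1 t2 t3 t4 k d2 d3 d : pair_data sa sb t1 t2 t3 t4 ->
  (forall x, rexp x k = 0)%R ->
  commute k (d2 * sa * d2^-1) -> commute (d * k * d^-1) (d3 * sb * d3^-1) ->
  (forall s : seq T, uniq s -> size s = 4 -> (forall m, m \in s -> (rho k * rho k) m = m) -> False) ->
  False.
Proof.
move=> hp ek ck1 ck2 hf; have [x [y [v [ex ey rx ry]]]] := pair_generators hp.
have conjL z s f : (rexp z s <> 0)%R -> commute k (f * s * f^-1) ->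
    exists2 p, inA (rlk Rl z) (p^-1 * k * p) & True.
  move=> ez /commuteJ ck; have [u hu] := axis_generator ez.
  have [_] := hu s _ (commute_refl _) ez ck (etrans (ihomJ (rexpMx z) _ _) (ek z)).
  by move=> h; exists (f * u) => //; move: h; rewrite invgM !mulgA.
have [p Lp _] := conjL _ _ _ ex ck1.
have [q Lq _] : exists2 q, inA (rlk Rl y) (q^-1 * k * q) & True.
  apply: (conjL y sb (d^-1 * d3) ey); move: ck2; rewrite -{1}(invgK d) => /commuteJ.
  by rewrite invgM invgK !mulgA.
pose r := rret (Rl := Rl) (rlk Rl x); set a := p^-1 * k * p in Lp; set b := q^-1 * k * q in Lq.
(* Retracting the conjugation between [a] and [b] to the link group of [x] produces the conjugate
   [r b], which lies in the group of the common link. *)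
have ea : a = r (p^-1 * q) * r b * (r (p^-1 * q))^-1.
  rewrite -(rret_id Lp) -/r -rretV -!rretM; congr rret.
  by rewrite /a /b invgM invgK !mulgA !mulgK.
have Lb := rret_in (rlk Rl x) Lq; rewrite -/(r b) in Lb.
set z := p * r (p^-1 * q).
have kz : k = z * r b * z^-1.
  have -> : k = p * a * p^-1 by rewrite /a !mulgA mulgV mul1g mulgK.
  by rewrite ea /z invgM !mulgA.
have cb w : rlk Rl x w -> commute (r b) (gen x) /\ commute (r b) (gen y).
  by move=> _; split; apply/commute_sym/inA_lk_comm/(inA_sub _ Lb) => j /andP[].
have [cx cy] : commute (r b) (gen x) /\ commute (r b) (gen y).
  by split; apply/commute_sym/inA_lk_comm/(inA_sub _ Lb) => j /andP[].
have cJ g h := @commuteJJ v g h.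
pose D := rho (v * r b * v^-1).
have D1 : commute D (tperm t1 t2) by rewrite -rx; exact/rho_commute/cJ.
have D2 : commute D (tperm t3 t4) by rewrite -ry; exact/rho_commute/cJ.
case: (hp) => u _ _ _ _.
have fD i j : i != j -> commute D (tperm i j) -> D (D i) = i /\ D (D j) = j.
  move=> ij c; have [mi mj] : D i \in [:: i; j] /\ D j \in [:: i; j].
    by split; apply: (tperm_mem ij c); rewrite !inE eqxx ?orbT.
  move: mi mj; rewrite !inE => /orP[/eqP e1|/eqP e1] /orP[/eqP e2|/eqP e2]; rewrite ?e1 ?e2 ?e1 //.
    by move: ij; rewrite -(inj_eq (@perm_inj _ D)) e1 e2 eqxx.
  by move: ij; rewrite -(inj_eq (@perm_inj _ D)) e1 e2 eqxx.
have fixD m : m \in [:: t1; t2; t3; t4] -> D (D m) = m.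
  move: u; rewrite /= !inE !negb_or !andbT => /and3P[/and3P[n12 _ _] _ n34].
  have [a1 a2] := fD _ _ n12 D1; have [a3 a4] := fD _ _ n34 D2.
  by case/or4P=> /eqP ->.
pose f := rho (v * z^-1).
have Dk : D = f * rho k * f^-1.
  by rewrite /D /f -rhoV -!rhoM; congr rho; rewrite kz !invgM !invgK !mulgA !mulgVK.
apply: (hf (map f [:: t1; t2; t3; t4])); rewrite ?size_map //.
  by rewrite map_inj_uniq //; exact: perm_inj.
move=> _ /mapP[m /fixD hm ->]; rewrite permM.
have e j : rho k (f j) = f (D j) by rewrite Dk !permM permKV.
by rewrite !e hm.
Qed.
End Permutations.

(** * The algebraic obstruction for a round trip on a cycle *)

Section Cycle.
Local Open Scope ring_scope.
Variables (sa sb qa qb t : G) (ca ca' la cb cb' lb : G -> int).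
Definition ihom (e : G -> int) := forall g h, e (g * h)%g = e g + e h.
(** Commuting elements of the Heisenberg group have proportional images in its abelianization; this
    is that condition for two coordinates. *)
Definition heis (e f : G -> int) := forall g h, commute g h -> e g * f h = f g * e h.

(** Were the exponent sum nonzero, then for every [g] commuting with [s2] the element [zexpg g (rexp
    x s2) * zexpg s2 (- rexp x g)], of exponent sum 0, would commute with one conjugate of [x]. The
    Heisenberg relation for [g = q] then gives [c (gen x) = 0]. *)
Lemma heis_axis (s q s2 : G) (c c' : G -> int) x : ihom c -> ihom c' -> heis c c' ->
  commute q s2 -> commute s s2 -> c s <> 0 -> c' s = 0 -> c q = 0 -> c' q <> 0 ->
  c s2 = 0 -> c' s2 = 0 -> c (gen x) <> 0 -> rexp x s2 = 0.
Proof.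
move=> hc hc' H qs2 ss2 cs c's cq c'q cs2 c's2 cx; apply: contrapT => e2.
have [u hu] := axis_generator e2; set x' := (u * gen x * u^-1)%g in hu.
have comm g : commute g s2 ->
    commute (zexpg g (rexp x s2) * zexpg s2 (- rexp x g))%g x'.
  move=> cg; have [] // := hu s2 (zexpg g (rexp x s2) * zexpg s2 (- rexp x g))%g (commute_refl _) e2.
    apply/commute_sym/commuteM; apply: commuteZ => //; exact: commute_sym.
  by rewrite rexpM !(ihomZ (rexpMx x)); lia.
have cx' (e : G -> int) : ihom e -> e x' = e (gen x).
  by move=> he; rewrite /x' !he (ihomV he); lia.
have h1 := H _ _ (comm _ ss2); have h2 := H _ _ (comm _ qs2).
rewrite !cx' // !(hc, hc') !(ihomZ hc) !(ihomZ hc') c's cs2 c's2 cq in h1 h2.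
have {}h1 : rexp x s2 * c s * c' (gen x) = 0 by lia.
have {}h2 : rexp x s2 * c' q * c (gen x) = rexp x s2 * 0 * 0 by lia.
have n1 : rexp x s2 * c s != 0 by rewrite mulf_neq0 //; apply/eqP.
have n2 : rexp x s2 * c' q != 0 by rewrite mulf_neq0 //; apply/eqP.
move/eqP: h2; rewrite mulr0 mulf_eq0 (negbTE n2) /= => /eqP; exact: cx.
Qed.

Hypotheses (hca : ihom ca) (hca' : ihom ca') (hla : ihom la) (hcb : ihom cb)
  (hcb' : ihom cb') (hlb : ihom lb).
Hypotheses (Ha1 : heis ca ca') (Ha2 : heis ca la) (Hb1 : heis cb cb') (Hb2 : heis cb lb).
Hypotheses (lab : forall g, lb g = - la g).
Hypotheses (c1 : commute sa sb) (c2 : commute sa (t * sb * t^-1)%g)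
  (c3' : commute qa sb) (c4 : commute qb sa).
Hypotheses (va : ca sa <> 0) (va' : ca' sa = 0) (va0 : la sa = 0) (vqa : ca qa = 0) (vqa' : ca' qa <> 0)
  (vab : ca sb = 0) (vab' : ca' sb = 0).
Hypotheses (vb : cb sb <> 0) (vb' : cb' sb = 0) (vb0 : lb sb = 0) (vqb : cb qb = 0) (vqb' : cb' qb <> 0)
  (vba : cb sa = 0) (vba' : cb' sa = 0).

Lemma ihom_support (e : G -> int) g : ihom e -> e g <> 0 ->
  exists2 x, rexp x g <> 0 & e (gen x) <> 0.
Proof.
move=> he; rewrite (ihom_raag he) => h; apply: contrapT => n; apply: h.
apply: big1 => x _; case: (eqVneq (rexp x g) 0) => [->|h1]; first by rewrite mul0r.
case: (eqVneq (e (gen x)) 0) => [->|h2]; first by rewrite mulr0.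
by case: n; exists x; apply/eqP.
Qed.

(** [x] and [y] are taken from the supports of [ca] on [sa] and of [cb] on [sb]. As [x'] commutes
    with [sb] and [y'] with [sa], the Heisenberg relations make [la] vanish on both, and then on
    everything that commutes with [x'] or with [y']. It remains to factor [t]. *)
Lemma cycle_obstruction : la t = 0.
Proof.
have [x ex cx] := ihom_support hca va; have [y ey cy] := ihom_support hcb vb.
have xb : rexp x sb = 0 := heis_axis hca hca' Ha1 c3' c1 va va' vqa vqa' vab vab' cx.
have ya : rexp y sa = 0 :=
  heis_axis hcb hcb' Hb1 c4 (commute_sym c1) vb vb' vqb vqb' vba vba' cy.
have [u hu] := axis_generator ex; have [v hv] := axis_generator ey.
set x' := (u * gen x * u^-1)%g in hu; set y' := (v * gen y * v^-1)%g in hv.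
have cJ w z (e : G -> int) : ihom e -> e (w * z * w^-1)%g = e z.
  by move=> he; rewrite !he (ihomV he); lia.
have hx k : commute k sa -> rexp x k = 0 -> commute k x'.
  by move=> ck ek; have [] := hu sa k (commute_refl _) ex ck ek.
have hy k : commute k sb -> rexp y k = 0 -> commute k y' /\ inA (rlk Rl y) (v^-1 * k * v)%g.
  by move=> ck ek; exact: (hv sb k (commute_refl _) ey ck ek).
have lx : la (gen x) = 0.
  have := Hb2 (hx _ (commute_sym c1) xb); rewrite vb0 !cJ // lab => /eqP.
  by rewrite mul0r mulf_eq0 => /orP[/eqP //|/eqP]; lia.
have ly : la (gen y) = 0.
  have := Ha2 (hy _ c1 ya).1; rewrite va0 !cJ // => /eqP.
  by rewrite mul0r mulf_eq0 => /orP[/eqP //|/eqP].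
have xy : x != y by apply/eqP => e; rewrite -e in ey.
have ex' : rexp y x' = 0 by rewrite (cJ _ _ _ (rexpMx y)) rexp_gen (negbTE xy).
have tx : commute (t * sb * t^-1)%g x'.
  by apply: hx; [exact: commute_sym|rewrite (cJ _ _ _ (rexpMx x))].
have L1 := (hy x' (commute_sym (hx _ (commute_sym c1) xb)) ex').2.
have L2 : inA (rlk Rl y) (v^-1 * (t^-1 * x' * t) * v)%g.
  apply: (hy _ _ _).2; first by apply/commuteJ/commute_sym.
  by rewrite (ihomJ (rexpMx y)).
set a1 := (v^-1 * x' * v)%g in L1; set a2 := (_ * _ * v)%g in L2.
(* [x'] and its conjugate by [t] both lie in one conjugate of the link group of [y]. By retraction
   [t] acts on [x'] like an element [w] that commutes with [y'], so the quotient [c] commutes with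
   [x']. *)
pose r := rret (Rl := Rl) (rlk Rl y) (v^-1 * t * v)%g.
have Lr : inA (rlk Rl y) r.
  by apply: (inA_sub _ (rret_in _ (inA_all _))) => j /andP[].
have e2 : a2 = (r^-1 * a1 * r)%g.
  rewrite -(rret_id L2) -(rret_id L1) /r -rretV -!rretM; congr rret.
  by rewrite /a1 /a2 !invgM !invgK !mulgA !mulgK.
pose w := (v * r * v^-1)%g; pose c := (t * w^-1)%g.
have wy : commute w y'.
  by apply/commuteJJ/commute_sym/inA_lk_comm.
have xw : (t^-1 * x' * t = w^-1 * x' * w)%g.
  have -> : (t^-1 * x' * t = v * a2 * v^-1)%g by rewrite /a2 !mulgA mulgV mul1g mulgK.
  by rewrite e2 /w /a1 !invgM !invgK !mulgA.
have cx' : commute c x'.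
  exact: commute_quotient.
have tcw : t = (c * w)%g by rewrite /c mulgVK.
have lw : la w = 0.
  have := Hb2 wy; rewrite !cJ // !lab ly oppr0 mulr0 => /eqP.
  by rewrite eq_sym mulf_eq0 => /orP[/eqP|/eqP //]; lia.
have lc : la c = 0.
  have := Ha2 cx'; rewrite !cJ // lx mulr0 => /esym/eqP.
  by rewrite mulf_eq0 => /orP[/eqP //|/eqP].
by rewrite tcw hla lw lc.
Qed.
End Cycle.
End Obstructions.

(** * Moves of tokens along the edges of a graph *)

Section TokenMoves.
Local Open Scope group_scope.
Variables (V : finType) (adj : rel V).
Hypothesis adjC : symmetric adj.
Implicit Types (S : {set V}) (u v w : V) (ms : seq (V * V)) (R : pred V).

Definition mvok S u w := [&& adj u w, u \in S & w \notin S].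
Definition mvS S u w := w |: S :\ u.
Definition mva u w v := if v == u then w else v.
Fixpoint mok S ms := if ms is m :: ms' then mvok S m.1 m.2 && mok (mvS S m.1 m.2) ms' else true.
Fixpoint mfin S ms := if ms is m :: ms' then mfin (mvS S m.1 m.2) ms' else S.
Fixpoint mact ms v := if ms is m :: ms' then mact ms' (mva m.1 m.2 v) else v.
Definition msupp R ms := all (fun m => R m.1 && R m.2) ms.
Definition mrev ms := rev (map (fun m : V * V => (m.2, m.1)) ms).

Lemma mok_cat S ms ms' : mok S (ms ++ ms') = mok S ms && mok (mfin S ms) ms'.
Proof. by elim: ms S => //= m ms IH S; rewrite IH andbA. Qed.
Lemma mfin_cat S ms ms' : mfin S (ms ++ ms') = mfin (mfin S ms) ms'.
Proof. by elim: ms S => //=. Qed.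
Lemma mact_cat ms ms' v : mact (ms ++ ms') v = mact ms' (mact ms v).
Proof. by elim: ms v => //=. Qed.
Lemma msupp_cat R ms ms' : msupp R (ms ++ ms') = msupp R ms && msupp R ms'.
Proof. exact: all_cat. Qed.
Lemma msupp_sub R R' ms : (forall v, R v -> R' v) -> msupp R ms -> msupp R' ms.
Proof. by move=> h; apply: sub_all => m /andP[/h -> /h ->]. Qed.
Lemma msupp_rev R ms : msupp R (mrev ms) = msupp R ms.
Proof. by rewrite /msupp all_rev all_map; apply: eq_all => m /=; rewrite andbC. Qed.

Lemma mvS_back S u w : mvok S u w -> mvS (mvS S u w) w u = S.
Proof.
case/and3P=> _ uS wS; apply/setP => v; rewrite !inE.
have [->|vu] := eqVneq v u; first by rewrite uS.
by have [->|vw] /= := eqVneq v w; rewrite ?(negbTE wS).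
Qed.

Lemma mvok_back S u w : mvok S u w -> mvok (mvS S u w) w u.
Proof.
case/and3P=> a uS wS; rewrite /mvok adjC a !inE eqxx /=.
by rewrite eqxx orbF; apply: contraNneq wS => <-.
Qed.

Lemma card_mvS S u w : mvok S u w -> #|mvS S u w| = #|S|.
Proof.
case/and3P=> _ uS wS; rewrite cardsU1 !inE negb_and wS orbT /=.
by rewrite (cardsD1 u S) uS.
Qed.

Lemma card_mfin S ms : mok S ms -> #|mfin S ms| = #|S|.
Proof. by elim: ms S => //= m ms IH S /andP[h /IH ->]; exact: card_mvS. Qed.

Lemma mrev_ok S ms : mok S ms -> mok (mfin S ms) (mrev ms) /\ mfin (mfin S ms) (mrev ms) = S.
Proof.
elim: ms S => //= m ms IH S /andP[h /IH[h1 h2]].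
rewrite /mrev map_cons rev_cons -cats1 mok_cat mfin_cat -/(mrev ms) h1 h2 /=.
by rewrite mvok_back // mvS_back.
Qed.

Lemma mact_revK S ms v : mok S ms -> v \in S -> mact (mrev ms) (mact ms v) = v.
Proof.
elim: ms S v => //= m ms IH S v /andP[h hms] vS.
rewrite /mrev map_cons rev_cons -cats1 mact_cat -/(mrev ms) /=.
have vS' : mva m.1 m.2 v \in mvS S m.1 m.2.
  by rewrite !inE /mva; case: (eqVneq v m.1) => [_|vm]; rewrite ?eqxx ?vS ?vm ?orbT.
rewrite (IH _ _ hms vS') /mva; case: (eqVneq v m.1) => [->|vm]; first by rewrite eqxx.
by case: eqVneq => // e; case/and3P: h => _ _; rewrite -e vS.
Qed.

Lemma mact_out R ms v : msupp R ms -> ~~ R v -> mact ms v = v.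
Proof.
elim: ms v => //= m ms IH v /andP[/andP[h1 h2] hs] nR.
by rewrite /mva; case: eqVneq => [e|_]; [rewrite e h1 in nR|exact: IH].
Qed.

(** Locality: moves inside [R] depend only on the occupied vertices of [R]. *)
Lemma mok_frame R S S' ms : msupp R ms -> (forall v, R v -> (v \in S) = (v \in S')) ->
  mok S ms = mok S' ms /\ (forall v, R v -> (v \in mfin S ms) = (v \in mfin S' ms)).
Proof.
elim: ms S S' => //= m ms IH S S' /andP[/andP[h1 h2] hs] e.
have e' v : R v -> (v \in mvS S m.1 m.2) = (v \in mvS S' m.1 m.2).
  by move=> Rv; rewrite !inE e.
have [-> h] := IH _ _ hs e'; split=> //.
by rewrite /mvok !e.
Qed.

Lemma mfin_out R S ms v : msupp R ms -> ~~ R v -> (v \in mfin S ms) = (v \in S).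
Proof.
elim: ms S => //= m ms IH S /andP[/andP[h1 h2] hs] nR; rewrite IH // !inE.
by have [e|_] := eqVneq v m.2; [rewrite e h2 in nR|have [e|_] := eqVneq v m.1; [rewrite e h1 in nR|]].
Qed.

Lemma mok_disjoint R R' S ms ms' : (forall v, R v -> ~~ R' v) -> msupp R ms -> msupp R' ms' ->
  mok (mfin S ms) ms' = mok S ms'.
Proof.
move=> d h h'; apply: (mok_frame h' _).1 => v Rv; apply: (mfin_out _ h).
by apply/negP => /d; rewrite Rv.
Qed.

Lemma mfin_disjoint R R' S ms ms' : (forall v, R v -> ~~ R' v) -> msupp R ms -> msupp R' ms' ->
  mfin (mfin S ms) ms' = mfin (mfin S ms') ms.
Proof.
move=> d h h'; apply/setP => v; case Rv: (R v).
  have R'v := d _ Rv; rewrite (mfin_out _ h' R'v).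
  by apply/esym/(mok_frame h _).2 => // z Rz; apply: (mfin_out _ h'); exact: d.
rewrite [RHS](mfin_out _ h) ?Rv //; case R'v: (R' v).
  by apply: (mok_frame h' _).2 => // z Rz; apply: (mfin_out _ h); apply/negP => /d; rewrite Rz.
by rewrite !(mfin_out _ h') ?R'v // (mfin_out _ h) ?Rv.
Qed.

Lemma mfin_act S ms : mok S ms -> mfin S ms = mact ms @: S.
Proof.
elim: ms S => [|m ms IH] S /=; first by rewrite imset_id.
case/andP=> h /IH ->; rewrite -[in RHS](mvS_back h); apply/setP => v.
apply/imsetP/imsetP => -[z zS ->].
  exists (mva m.2 m.1 z).
    by rewrite !inE /mva; case: (eqVneq z m.2) => [e|ne]; rewrite ?eqxx // ?ne ?orbT //;
       move: zS; rewrite !inE (negbTE ne) /= => /andP[-> ->]; rewrite ?orbT.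
  rewrite /mva; case: (eqVneq z m.2) => [->|ne]; first by rewrite eqxx.
  by move: zS; rewrite !inE (negbTE ne) /= => /andP[/negbTE ->].
exists (mva m.1 m.2 z) => //; move: zS; rewrite mvS_back // => zS.
by rewrite !inE /mva; case: (eqVneq z m.1) => [_|ne]; rewrite ?eqxx ?zS ?ne ?orbT.
Qed.

Section Elements.
Variables (n : nat) (G : groupType) (M : {set V} -> V -> V -> G).
Hypothesis Minv : forall S u w, #|S| = n -> mvok S u w -> M (mvS S u w) w u = (M S u w)^-1.
Hypothesis Msq : forall S u w u' w', #|S| = n -> mvok S u w -> mvok S u' w' ->
  uniq [:: u; w; u'; w'] ->
  M S u w * M (mvS S u w) u' w' = M S u' w' * M (mvS S u' w') u w.

Fixpoint el S ms : G := if ms is m :: ms' then M S m.1 m.2 * el (mvS S m.1 m.2) ms' else 1.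

Lemma el_cat S ms ms' : el S (ms ++ ms') = el S ms * el (mfin S ms) ms'.
Proof. by elim: ms S => [|m ms IH] S /=; rewrite ?mul1g // IH mulgA. Qed.

Lemma el_commute1 R S ms u w : #|S| = n -> msupp R ms -> ~~ R u -> ~~ R w ->
  mok S ms -> mvok S u w ->
  el S ms * M (mfin S ms) u w = M S u w * el (mvS S u w) ms.
Proof.
move=> + + Ru Rw; elim: ms S => [|[a b] ms IH] S hn /=; first by rewrite mulg1 mul1g.
case/andP=> /andP[/= Ra Rb] hs /andP[h hms] huw.
have nab : uniq [:: a; b; u; w].
  case/and3P: (h) => _ aS bS; case/and3P: (huw) => _ uS wS.
  rewrite /= !inE !negb_or !andbT; apply/and3P; split; last by apply: contraNneq wS => <-.
    apply/and3P; split; first by apply: contraNneq bS => <-.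
      by apply: contraNneq Ru => <-.
    by apply: contraNneq Rw => <-.
  by apply/andP; split; [apply: contraNneq Ru|apply: contraNneq Rw] => <-.
have huw' : mvok (mvS S a b) u w.
  have := @mok_disjoint R (predC R) S [:: (a, b)] [:: (u, w)].
  rewrite /= !andbT Ra Rb Ru Rw huw => -> // v Rv; by rewrite /= Rv.
rewrite -mulgA IH ?card_mvS // !mulgA Msq //; congr (_ * _).
by have := @mfin_disjoint R (predC R) S [:: (a, b)] [:: (u, w)]; rewrite /= Ra Rb Ru Rw => ->
  // v Rv; rewrite /= Rv.
Qed.

Lemma el_commute R R' S ms ms' : (forall v, R v -> ~~ R' v) -> #|S| = n ->
  msupp R ms -> msupp R' ms' -> mok S ms -> mok S ms' ->
  el S ms * el (mfin S ms) ms' = el S ms' * el (mfin S ms') ms.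
Proof.
move=> d hn hs; elim: ms' S hn => [|[u w] ms' IH] S hn /=; first by rewrite mulg1 mul1g.
case/andP=> /andP[/= Ru Rw] hs' hms /andP[huw hms'].
have nR z : R' z -> ~~ R z by move=> Rz; apply/negP => /d; rewrite Rz.
rewrite mulgA (el_commute1 hn hs (nR _ Ru) (nR _ Rw)) // -!mulgA; congr (_ * _).
have e : mvS (mfin S ms) u w = mfin (mvS S u w) ms.
  have := @mfin_disjoint R R' S ms [:: (u, w)]; rewrite /= Ru Rw => -> //.
rewrite e IH ?card_mvS //.
have := @mok_disjoint R' R S [:: (u, w)] ms; rewrite /= Ru Rw => -> //.
Qed.

Lemma el_loops R R' S ms ms' : (forall v, R v -> ~~ R' v) -> #|S| = n ->
  msupp R ms -> msupp R' ms' -> mok S ms -> mok S ms' -> mfin S ms = S -> mfin S ms' = S ->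
  commute (el S ms) (el S ms').
Proof. by move=> d hn h h' o o' e e'; have := el_commute d hn h h' o o'; rewrite e e'. Qed.

Lemma el_conj R R' S ms p : (forall v, R v -> ~~ R' v) -> #|S| = n ->
  msupp R ms -> msupp R' p -> mok S ms -> mok S p -> mfin S ms = S ->
  el (mfin S p) ms = (el S p)^-1 * el S ms * el S p.
Proof.
move=> d hn h h' o o' e; have := el_commute d hn h h' o o'.
by rewrite e -mulgA => ->; rewrite mulKg.
Qed.

Lemma loop_frame R R' S ms p : (forall v, R v -> ~~ R' v) ->
  msupp R ms -> msupp R' p -> mok S ms -> mfin S ms = S ->
  mok (mfin S p) ms /\ mfin (mfin S p) ms = mfin S p.
Proof.
move=> d h h' o e; rewrite (mok_disjoint (R := R') (R' := R)) //; last first.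
  by move=> v Rv; apply/negP => /d; rewrite Rv.
by rewrite -(mfin_disjoint S d h h') e.
Qed.
End Elements.

Section Ordered.
Variable T : finType.
Implicit Types (x y : T -> V) (s t z : seq T).

Definition im x : {set V} := [set x i | i in T].
Definition upd x i v : T -> V := fun j => if j == i then v else x j.

Lemma mem_im x i : x i \in im x. Proof. exact: imset_f. Qed.
Lemma card_im x : injective x -> #|im x| = #|T|. Proof. exact: card_imset. Qed.
Lemma im_perm x (s : {perm T}) : im (x \o s) = im x.
Proof.
apply/setP => v; apply/imsetP/imsetP => -[i _ ->]; first by exists (s i).
by exists ((s^-1)%g i); rewrite //= permKV.
Qed.

Lemma im_mact x ms : mok (im x) ms -> im (mact ms \o x) = mfin (im x) ms.
Proof. by move=> h; rewrite (mfin_act h) /im -imset_comp. Qed.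

Definition reach R x y := exists ms, [/\ msupp R ms, mok (im x) ms & mact ms \o x =1 y].

Lemma reach_refl R x : reach R x x. Proof. by exists [::]. Qed.
Lemma reach_im x y ms : mok (im x) ms -> mact ms \o x =1 y -> im y = mfin (im x) ms.
Proof. by move=> h e; rewrite -im_mact // /im; apply: eq_imset => i; rewrite -e. Qed.

Lemma reach_trans R x y (z : T -> V) : reach R x y -> reach R y z -> reach R x z.
Proof.
case=> ms [s o e] [ms' [s' o' e']]; exists (ms ++ ms'); split.
- by rewrite msupp_cat s.
- by rewrite mok_cat o -(reach_im o e).
- by move=> i; rewrite /= mact_cat -e' /= -e.
Qed.

Lemma reach_sym R x y : reach R x y -> reach R y x.
Proof.
case=> ms [s o e]; exists (mrev ms); rewrite msupp_rev (reach_im o e); split=> //.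
  exact: (mrev_ok o).1.
by move=> i; rewrite /= -e /= (mact_revK o) // mem_im.
Qed.

Lemma reach_perm R x y (s : {perm T}) : reach R x y -> reach R (x \o s) (y \o s).
Proof. by case=> ms [h o e]; exists ms; rewrite im_perm; split=> // i; rewrite /= -e. Qed.

Lemma reach_sub R R' x y : (forall v, R v -> R' v) -> reach R x y -> reach R' x y.
Proof. by move=> h [ms [s o e]]; exists ms; split=> //; apply: msupp_sub s. Qed.

Lemma reach_ext R x y y' : y =1 y' -> reach R x y -> reach R x y'.
Proof. by move=> e [ms [s o h]]; exists ms; split=> // i; rewrite h e. Qed.

Lemma reach_inj R x y : reach R x y -> injective x -> injective y.
Proof.
move=> [ms [s o e]] ix i j; rewrite -!e /= => /(congr1 (mact (mrev ms))).
by rewrite !(mact_revK o) ?mem_im // => /ix.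
Qed.

Lemma reach_out R x y i : reach R x y -> ~~ R (x i) -> y i = x i.
Proof. by move=> [ms [s o e]] n; rewrite -e /= (mact_out s). Qed.

Definition wlk u (p : seq V) := zip (belast u p) p.

Lemma wlk_supp R u p : R u -> all R p -> msupp R (wlk u p).
Proof. by elim: p u => //= v p IH u hu /andP[hv hp]; rewrite hu hv IH. Qed.

Lemma wlk_mfin S u p : u \in S -> path adj u p -> uniq (u :: p) -> all (fun v => v \notin S) p ->
  mok S (wlk u p) /\ mfin S (wlk u p) = last u p |: S :\ u.
Proof.
elim: p u S => [|v p IH] u S uS; first by rewrite /= finset.setD1K.
case/andP=> auv pth /andP[nu unq] /andP[vS pS] /=.
have h : mvok S u v by rewrite /mvok auv uS vS.
have [||||o e] := IH v (mvS S u v); rewrite ?inE ?eqxx //.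
  apply/allP => z zp; rewrite !inE negb_or negb_and (allP pS _ zp) orbT andbT.
  by apply: contraTneq zp => ->; case/andP: unq.
rewrite h o e; split=> //; apply/setP => z; rewrite !inE.
have [->|zl] /= := eqVneq z (last v p); first by [].
by have [->|zv] /= := eqVneq z v; rewrite ?(negbTE vS) ?andbF.
Qed.

Lemma wlk_act u p v : uniq (u :: p) -> v \notin u :: p -> mact (wlk u p) v = v.
Proof.
elim: p u => //= w p IH u /and3P[_ wp up]; rewrite inE negb_or => /andP[vu vwp].
by rewrite /mva (negbTE vu) IH //= wp.
Qed.
Lemma wlk_act_start u p : uniq (u :: p) -> mact (wlk u p) u = last u p.
Proof.
elim: p u => //= w p IH u /and3P[_ wp up].
by rewrite /mva eqxx IH //= wp.
Qed.

Lemma reach_walk R x i p : injective x -> path adj (x i) p -> uniq (x i :: p) -> R (x i) -> all R p ->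
  (forall j, x j \in p -> False) -> reach R x (upd x i (last (x i) p)).
Proof.
move=> ix pth un Ri Rp np; exists (wlk (x i) p); split; first exact: wlk_supp.
  apply: (wlk_mfin _ pth un _).1; first exact: mem_im.
  by apply/allP => v vp; apply/imsetP => -[j _ e]; apply: (np j); rewrite -e.
move=> j; rewrite /= /upd; case: (eqVneq j i) => [->|ji]; first exact: wlk_act_start.
apply: wlk_act => //; rewrite inE negb_or (inj_eq ix) ji /=.
by apply/negP => /np.
Qed.

(** Tokens piled up at both ends of a line, [s] read from its beginning and [s'] from its end, with
    no other token on it. The last token of a stack is free to travel to the other stack. *)
Definition stacks L s s' x := [/\ map x s = take (size s) L, map x s' = take (size s') (rev L),
  uniq (s ++ s') & forall i, x i \in L -> i \in s ++ s'].

Lemma line_step R L s s' x i : injective x -> uniq L -> sorted adj L -> all R L ->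
  stacks L (rcons s i) s' x -> (size s + size s' < size L)%N ->
  exists y, [/\ reach R x y, stacks L s (rcons s' i) y & forall j, j != i -> y j = x j].
Proof.
move=> ix uL aL RL [e1 e2 us off] hs.
pose A := take (size s) L; pose B := drop (size L - size s') L.
pose C := drop (size s) (take (size L - size s') L).
have eL : L = A ++ C ++ B.
  rewrite catA /A /C /B -{1}(cat_take_drop (size L - size s') L); congr (_ ++ _).
  by rewrite -{1}(cat_take_drop (size s) (take _ L)) take_takel //; lia.
have sA : size A = size s by rewrite size_takel //; lia.
have sB : size B = size s' by rewrite size_drop; lia.
have sC : (0 < size C)%N by rewrite /C size_drop size_takel; lia.
clearbody A B C; case: C eL sC => [|c p] // eL _.
have sr : size (rcons s i) = (size s).+1 by rewrite size_rcons.
have [eA ei] : map x s = A /\ x i = c.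
  move: e1; rewrite map_rcons sr eL take_cat sA ltnNge leqnSn /= subSnn /= take0 cats1.
  by move/rcons_inj => [].
have eB : map x s' = rev B.
  by rewrite e2 eL !rev_cat -catA take_size_cat // size_rev.
have sub : sorted adj (c :: p).
  by move: aL; rewrite eL => /cat_sorted2[_] /cat_sorted2[].
have ucp : uniq (c :: p) by move: uL; rewrite eL !cat_uniq => /and3P[_ _ /and3P[]].
have inL v : v \in c :: p -> v \in L by rewrite eL !mem_cat => ->; rewrite orbT.
have dA v : v \in A -> v \in c :: p ++ B -> False.
  by move: uL; rewrite eL cat_uniq => /and3P[_ /hasPn h _] vA /h /negP.
have dB v : v \in c :: p -> v \in B -> False.
  by move: uL; rewrite eL !cat_uniq => /and3P[_ _ /and3P[_ /hasPn h _]] vp /h /negP.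
exists (upd x i (last c p)); split.
- rewrite -ei; apply: reach_walk; rewrite ?ei //.
  + by apply: (allP RL); apply: inL; rewrite inE eqxx.
  + by apply/allP => v vp; apply: (allP RL); apply: inL; rewrite inE vp orbT.
  move=> j xj; have jL : x j \in L by apply: inL; rewrite inE xj orbT.
  have := off _ jL; rewrite mem_cat mem_rcons inE -orbA => /or3P[/eqP e|js|js'].
  + by move: ucp; rewrite /= -ei -e xj.
  + by apply: (dA (x j)); [rewrite -eA map_f|rewrite inE mem_cat xj orbT].
  + by apply: (dB (x j)); [rewrite inE xj orbT|rewrite -mem_rev -eB map_f].
- have [ns ns'] : i \notin s /\ i \notin s'.
    move: us; rewrite cat_uniq rcons_uniq => /and3P[/andP[h1 _] /hasPn h2 _]; split=> //.
    by apply/negP => /h2 /=; rewrite mem_rcons inE eqxx.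
  have mE (t : seq T) : i \notin t -> map (upd x i (last c p)) t = map x t.
    move=> nt; apply/eq_in_map => j jt; rewrite /upd; case: eqVneq => // e.
    by rewrite -e jt in nt.
  split.
  + by rewrite mE // eA eL take_size_cat.
  + rewrite map_rcons mE // eB /upd eqxx size_rcons eL !rev_cat -catA -sB -(size_rev B).
    rewrite take_cat ifF ?subSnn; last by apply/negbTE; rewrite -leqNgt leqnSn.
    by rewrite lastI rev_rcons /= take0 cats1.
  + have /perm_uniq -> // : perm_eq (s ++ rcons s' i) (rcons s i ++ s').
    by rewrite -!cats1 -catA perm_cat2l perm_catC.
  + move=> j; rewrite /upd; case: (eqVneq j i) => [->|ji].
      by rewrite mem_cat mem_rcons inE eqxx orbT.
    by move/off; rewrite !mem_cat !mem_rcons !inE (negbTE ji).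
- by move=> j ji; rewrite /upd (negbTE ji).
Qed.

Lemma line_transfer R L s z s' x : injective x -> uniq L -> sorted adj L -> all R L ->
  stacks L (s ++ z) s' x -> (size s + size z + size s' <= size L)%N ->
  exists y, [/\ reach R x y, stacks L s (s' ++ rev z) y & forall j, j \notin z -> y j = x j].
Proof.
move=> ix uL aL RL; elim/last_ind: z s' x ix => [|z i IH] s' x ix st hs.
  rewrite cats0 in st; exists x; split; rewrite ?cats0 //; exact: reach_refl.
rewrite size_rcons in hs; rewrite -rcons_cat in st.
have [|y [r1 st1 e1]] := line_step ix uL aL RL st; first by rewrite size_cat; lia.
have [|w [r2 st2 e2]] := IH _ _ (reach_inj r1 ix) st1; first by rewrite size_rcons; lia.
exists w; split.
- exact: reach_trans r1 r2.
- by rewrite rev_rcons -cat_rcons.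
- by move=> j; rewrite mem_rcons inE negb_or => /andP[ji jz]; rewrite e2 ?e1.
Qed.

(** Arms are listed from the centre outwards, so a stack is read from the tip inwards and its last
    token leaves first. *)
Definition ystate (c : V) (A B C : seq V) (s t z : seq T) x :=
  [/\ map x s = take (size s) (rev A), map x t = take (size t) (rev B),
      map x z = take (size z) (rev C), uniq (s ++ t ++ z) &
      forall i, x i \in c :: A ++ B ++ C -> i \in s ++ t ++ z].

Definition yarms (c : V) (A B C : seq V) :=
  [/\ uniq (c :: A ++ B ++ C), path adj c A, path adj c B & path adj c C].

Lemma yarms_swap c A B C : yarms c A B C -> yarms c B A C.
Proof. by case=> u pa pb pc; split=> //; move: u; rewrite /= !(mem_cat, catA) (orbC (c \in A)) -!catA uniq_catCA. Qed.
Lemma yarms_rot c A B C : yarms c A B C -> yarms c B C A.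
Proof. by case=> u pa pb pc; split=> //; rewrite catA cons_uniq mem_cat orbC -mem_cat uniq_catC -cons_uniq. Qed.
Lemma ystate_swap c A B C s t z x : ystate c A B C s t z x -> ystate c B A C t s z x.
Proof.
case=> e1 e2 e3 u off; split=> //; first by rewrite uniq_catCA.
move=> i hi; have := off i; rewrite !(inE, mem_cat) => h.
rewrite orbCA; apply: h; move: hi; rewrite !(inE, mem_cat).
by case/or4P=> -> //; rewrite ?orbT.
Qed.
Lemma ystate_rot c A B C s t z x : ystate c A B C s t z x -> ystate c B C A t z s x.
Proof.
case=> e1 e2 e3 u off; split=> //; first by rewrite catA uniq_catC.
move=> i hi; have := off i; rewrite !(inE, mem_cat) => h.
rewrite orbA orbC; apply: h; move: hi; rewrite !(inE, mem_cat).
by case/or4P=> -> //; rewrite ?orbT.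
Qed.

Lemma ytransfer R c A B C s (w : seq T) t z x : injective x -> yarms c A B C -> all R (c :: A ++ B ++ C) ->
  ystate c A B C (s ++ w) t z x -> (size s + size w <= size A)%N -> (size w + size t <= size B)%N ->
  (size z <= size C)%N ->
  exists y, [/\ reach R x y, ystate c A B C s (t ++ rev w) z y & forall j, j \notin w -> y j = x j].
Proof.
move=> ix [u pA pB pC] RA [e1 e2 e3 us off] h1 h2 h3.
pose L := rev A ++ c :: B.
have rL : rev L = rev B ++ c :: A by rewrite /L rev_cat rev_cons revK cat_rcons.
have uL : uniq L.
  move: u; rewrite catA -cat_cons cat_uniq => /and3P[u _ _].
  rewrite /L -cat_rcons -rev_cons cat_uniq rev_uniq; move: u; rewrite -cat_cons cat_uniq.
  case/and3P=> -> /hasPn h ->; rewrite /= andbT; apply/hasPn => v /h.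
  by rewrite /= mem_rev.
have sL : sorted adj L.
  rewrite /L sorted_cat_cons pB andbT -rev_cons rev_sorted /=.
  by rewrite (eq_path (e' := adj)) // => v w; rewrite adjC.
have st : stacks L (s ++ w) t x.
  split.
  - by rewrite e1 /L takel_cat // size_cat size_rev.
  - rewrite e2 rL takel_cat // size_rev; lia.
  - by move: us; rewrite !catA cat_uniq => /and3P[].
  move=> i iL; have := off i; rewrite /L !(mem_cat, inE, mem_rev) in iL *.
  have iC : x i \notin C.
    move: u; rewrite catA -cat_cons cat_uniq => /and3P[_ /hasPn h _].
    by apply/negP => /h /negP; apply; rewrite inE mem_cat; case/or3P: iL => ->; rewrite ?orbT.
  have iz : i \notin z.
    apply: contra iC => iz; have : x i \in map x z by exact: map_f.
    by rewrite e3 => /mem_take; rewrite mem_rev.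
  move=> h; have : [|| i \in s, i \in w, i \in t | i \in z].
    by rewrite !orbA in h *; apply: h; case/or3P: iL => ->; rewrite ?orbT.
  by rewrite (negbTE iz) orbF -!orbA.
have [||y [r st' ey]] := @line_transfer R L s w t x ix uL sL _ st.
- apply/allP => v; rewrite /L !(mem_cat, inE, mem_rev) => hv; apply: (allP RA).
  by rewrite !(inE, mem_cat); case/or3P: hv => ->; rewrite ?orbT.
- by rewrite /L size_cat size_rev /=; lia.
exists y; case: st' => f1 f2 fu foff; split=> //.
split.
- by rewrite f1 /L takel_cat // size_rev; lia.
- by rewrite f2 rL takel_cat // size_rev size_cat size_rev; lia.
- rewrite -e3; apply/eq_in_map => i iz; apply: ey.
  move: us; rewrite cat_uniq => /and3P[_ /hasPn h _]; have := h i.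
  by rewrite mem_cat iz orbT => /(_ isT); rewrite /= mem_cat negb_or => /andP[].
- have /perm_uniq -> // : perm_eq (s ++ (t ++ rev w) ++ z) ((s ++ w) ++ t ++ z).
  by apply/seq.permP => p; rewrite !count_cat count_rev; lia.
move=> i hi; have [iw|iw] := boolP (i \in w); first by rewrite !mem_cat mem_rev iw !orbT.
by move: hi; rewrite ey // => /off; rewrite !mem_cat mem_rev (negbTE iw) /= !orbF.
Qed.

Lemma yarms_swap23 c A B C : yarms c A B C -> yarms c A C B.
Proof. by move=> h; do 2!apply: yarms_rot; apply/yarms_swap/yarms_rot. Qed.
Lemma ystate_swap23 c A B C s t z x : ystate c A B C s t z x -> ystate c A C B s z t x.
Proof. by move=> h; do 2!apply: ystate_rot; apply/ystate_swap/ystate_rot. Qed.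

Lemma all_arms R c (A B C : seq V) : all R (c :: A ++ B ++ C) =
  [&& R c, all R A, all R B & all R C].
Proof. by rewrite /= !all_cat. Qed.

(** Shunting on three arms: the blocks [z], [t], [s] leave the arm [A] in turn, [z] and [s] for [B]
    and [t] for [C], each being reversed. They return in the order [t], [s], [z] and are reversed
    again. *)
Lemma yblock R c A B C s t z x : injective x -> yarms c A B C -> all R (c :: A ++ B ++ C) ->
  ystate c A B C (s ++ t ++ z) [::] [::] x -> (size (s ++ t ++ z) <= size A)%N ->
  (size (s ++ t ++ z) <= size B)%N -> (size (s ++ t ++ z) <= size C)%N ->
  exists y, [/\ reach R x y, ystate c A B C (t ++ s ++ z) [::] [::] y &
    forall j, j \notin s ++ t ++ z -> y j = x j].
Proof.
move=> ix Y; rewrite all_arms => /and4P[Rc RA RB RC] st.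
rewrite !size_cat => hA hB hC; rewrite catA in st.
have [||||x1 [r1 s1 o1]] := ytransfer (R := R) ix Y _ st; rewrite ?all_arms ?Rc ?RA ?RB ?RC ?size_cat //=; try lia.
have i1 := reach_inj r1 ix.
have [||||x2 [r2 s2 o2]] := ytransfer (R := R) i1 (yarms_swap23 Y) _ (ystate_swap23 s1);
  rewrite ?all_arms ?Rc ?RA ?RB ?RC ?size_cat ?size_rev //=; try lia.
have i2 := reach_inj r2 i1; rewrite -(cat0s s) in s2.
have [||||x3 [r3 s3 o3]] := ytransfer (R := R) i2 Y _ (ystate_swap23 s2);
  rewrite ?all_arms ?Rc ?RA ?RB ?RC ?size_cat ?size_rev //=; try lia.
have i3 := reach_inj r3 i2; rewrite -(cat0s ([::] ++ rev t)) in s3.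
have [||||x4 [r4 s4 o4]] := ytransfer (R := R) i3 (yarms_rot (yarms_rot Y)) _ (ystate_rot (ystate_rot s3));
  rewrite ?all_arms ?Rc ?RA ?RB ?RC ?size_cat ?size_rev //=; try lia.
have i4 := reach_inj r4 i3; rewrite /= revK in s4.
have [||||x5 [r5 s5 o5]] := ytransfer (R := R) i4 (yarms_swap Y) _ (ystate_swap (ystate_rot s4));
  rewrite ?all_arms ?Rc ?RA ?RB ?RC ?size_cat ?size_rev //=; try lia.
have i5 := reach_inj r5 i4; rewrite revK -(cat0s (rev z)) in s5.
have [||||x6 [r6 s6 o6]] := ytransfer (R := R) i5 (yarms_swap Y) _ s5;
  rewrite ?all_arms ?Rc ?RA ?RB ?RC ?size_cat ?size_rev //=; try lia.
exists x6; split.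
- exact: reach_trans r1 (reach_trans r2 (reach_trans r3 (reach_trans r4 (reach_trans r5 r6)))).
- by rewrite revK -catA in s6; exact: ystate_swap s6.
move=> j; rewrite !mem_cat !negb_or => /and3P[js jt jz].
by rewrite o6 ?o5 ?o4 ?o3 ?o2 ?o1 // ?mem_cat ?mem_rev.
Qed.

(** Exchanges of the two leading blocks generate all rearrangements of a list. *)
Lemma yperm_eq R c A B C s t x : injective x -> yarms c A B C -> all R (c :: A ++ B ++ C) ->
  ystate c A B C s [::] [::] x -> (size s <= size A)%N -> (size s <= size B)%N -> (size s <= size C)%N ->
  perm_eq s t -> exists y, [/\ reach R x y, ystate c A B C t [::] [::] y &
    forall j, j \notin s -> y j = x j].
Proof.
move=> ix Y RR st hA hB hC pst.
pose P t := perm_eq s t -> exists y, [/\ reach R x y, ystate c A B C t [::] [::] y &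
    forall j, j \notin s -> y j = x j].
suff : P t by apply.
apply: (@catCA_perm_ind _ P _ s) => //; last by move=> _; exists x; split=> //; exact: reach_refl.
move=> a b d IH p; have p' : perm_eq s (a ++ b ++ d).
  by rewrite (perm_trans p) // perm_catCA.
have [y [r sy oy]] := IH p'; have e := perm_size p'.
have [|||y' [r' sy' oy']] := yblock (reach_inj r ix) Y RR sy; rewrite -?e //.
exists y'; split=> //; first exact: reach_trans r r'.
by move=> j js; rewrite oy' ?oy // -(perm_mem p').
Qed.

Lemma yperm R c A B C s x (f : {perm T}) : injective x -> yarms c A B C ->
  all R (c :: A ++ B ++ C) -> ystate c A B C s [::] [::] x ->
  (size s <= size A)%N -> (size s <= size B)%N -> (size s <= size C)%N ->
  (forall i, i \notin s -> f i = i) -> reach R x (x \o f).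
Proof.
move=> ix Y RR st hA hB hC hf.
have us : uniq s by case: st => _ _ _ + _; rewrite /= cats0.
have fs i : (f i \in s) = (i \in s).
  have [h|h] := boolP (i \in s); last by rewrite hf // (negbTE h).
  by apply: contraTT h => nf; have /perm_inj e := hf _ nf; rewrite e in nf.
pose t := map (f^-1)%g s.
have pst : perm_eq s t.
  apply: uniq_perm => //; first by rewrite map_inj_uniq //; exact: perm_inj.
  move=> i; apply/idP/mapP => [h|[j js ->]].
    by exists (f i); rewrite ?fs // permK.
  by rewrite -fs permKV.
have [y [r [e1 _ _ _ _] oy]] := yperm_eq ix Y RR st hA hB hC pst.
apply: reach_ext r => i /=; have [h|h] := boolP (i \in s); last by rewrite oy // hf.
have : map y t = map x s.
  by case: st => -> _ _ _ _; rewrite e1 (perm_size pst).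
rewrite -map_comp => /eq_in_map/(_ (f i)); rewrite fs h /= permK; exact.
Qed.
End Ordered.
End TokenMoves.

(** * Unlabelled configurations in a connected region *)

Section Sliding.
Local Open Scope group_scope.
Variables (V : finType) (adj : rel V).
Hypothesis adjC : symmetric adj.
Variable T : finType.
Implicit Types (R : pred V) (x y : T -> V) (u v c : V).

Definition conn R := forall u v, R u -> R v -> exists p, [/\ path adj u p, all R p & last u p = v].

Lemma path_sym u p : path adj u p -> path adj (last u p) (rev (belast u p)).
Proof. by rewrite rev_path (eq_path (e' := adj)) // => a b; rewrite adjC. Qed.

Lemma conn_center R c : R c -> (forall v, R v -> exists p, [/\ path adj c p, all R p & last c p = v]) ->
  conn R.
Proof.
move=> Rc h u v Ru Rv; have [p [p1 p2 p3]] := h u Ru; have [q [q1 q2 q3]] := h v Rv.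
have e : last u (rev (belast c p)) = c.
  by case: (p) p3 => [|d p'] //= ; rewrite rev_cons last_rcons.
exists (rev (belast c p) ++ q); split.
- by rewrite cat_path e q1 andbT -p3; exact: path_sym.
- rewrite all_cat q2 andbT all_rev; apply/allP => z /mem_belast.
  by rewrite inE => /orP[/eqP ->|/(allP p2)].
- by rewrite last_cat e.
Qed.

Lemma conn_ext R R' : R =1 R' -> conn R -> conn R'.
Proof.
by move=> e h u v; rewrite -!e => Ru Rv; have [p [p1 p2 p3]] := h u v Ru Rv;
   exists p; split=> //; rewrite -(eq_all e).
Qed.

Lemma conn_union R R' z : R z -> R' z -> conn R -> conn R' -> conn (predU R R').
Proof.
move=> Rz R'z h h'; apply: (@conn_center _ z); first by rewrite /= Rz.
move=> v /orP[Rv|Rv].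
  have [p [p1 p2 p3]] := h z v Rz Rv; exists p; split=> //.
  by apply: sub_all p2 => w /= ->.
have [p [p1 p2 p3]] := h' z v R'z Rv; exists p; split=> //.
by apply: sub_all p2 => w /= ->; rewrite orbT.
Qed.

Lemma conn_path u p : path adj u p -> conn (mem (u :: p)).
Proof.
move=> h; apply: (@conn_center _ u); first exact: mem_head.
move=> v; rewrite /= inE => /orP[/eqP ->|/path.splitPr hp]; first by exists [::].
case: hp h => p1 p2 h; exists (rcons p1 v); split.
- by move: h; rewrite -cat_rcons cat_path => /andP[].
- by apply/allP => w; rewrite -cats1 !(inE, mem_cat) => /orP[->|->]; rewrite ?orbT.
- by rewrite last_rcons.
Qed.

Lemma yarms_conn c A B C : yarms adj c A B C -> conn (mem (c :: A ++ B ++ C)).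
Proof.
case=> _ pA pB pC.
apply: (@conn_ext (predU (mem (c :: A)) (predU (mem (c :: B)) (mem (c :: C))))).
  by move=> v; rewrite /= !(inE, mem_cat); case: (v == c).
apply: (@conn_union _ _ c); rewrite /= ?inE ?eqxx //; first exact: conn_path.
by apply: (@conn_union _ _ c); rewrite /= ?inE ?eqxx //; exact: conn_path.
Qed.

Lemma reach_step R x u v : injective x -> u \in im x -> v \notin im x -> adj u v -> R u -> R v ->
  exists y, reach adj R x y /\ im y = v |: im x :\ u.
Proof.
move=> ix uI vI a Ru Rv; have h : mok adj (im x) [:: (u, v)] by rewrite /= /mvok a uI vI.
exists (mact [:: (u, v)] \o x); split; last exact: (im_mact h).
by exists [:: (u, v)]; rewrite /= Ru Rv.
Qed.

Lemma slide_path R x u p : injective x -> path adj u p -> all R (u :: p) ->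
  u \in im x -> last u p \notin im x ->
  exists y, reach adj R x y /\ im y = last u p |: im x :\ u.
Proof.
elim/last_ind: p x => [|p v IH] x ix; first by move=> _ _ /= -> .
rewrite rcons_path last_rcons -cats1 -cat_cons all_cat /= andbT => /andP[pth a] /andP[Rp Rv] uI vI.
have uv : u != v by apply: contraNneq vI => <-.
have Ru' : R (last u p) := allP (Rp : all R (u :: p)) _ (mem_last _ _).
have [u'I|u'I] := boolP (last u p \in im x).
  have [x1 [r1 e1]] := reach_step ix u'I vI a Ru' Rv.
  have [e|ne] := eqVneq (last u p) u; first by exists x1; rewrite e1 e.
  have u'v : last u p != v by apply: contraNneq vI => <-.
  have [||y [r2 e2]] := IH x1 (reach_inj r1 ix) pth Rp; rewrite ?e1 ?inE.
  - by rewrite uI (eq_sym u (last u p)) ne orbT.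
  - by rewrite eqxx (negbTE u'v).
  exists y; split; first exact: reach_trans r1 r2.
  rewrite e2 e1; apply/setP => z; rewrite !inE.
  have [->|zu'] /= := eqVneq z (last u p); first by rewrite u'I (negbTE u'v) ne.
  by have [->|zv] /= := eqVneq z v; rewrite ?(eq_sym v) ?uv // andbF.
have [x1 [r1 e1]] := IH x ix pth Rp uI u'I.
have [e|u'v] := eqVneq (last u p) v; first by exists x1; rewrite e1 e.
have [||y [r2 e2]] := reach_step (reach_inj r1 ix) _ _ a Ru' Rv; rewrite ?e1 ?inE.
- by rewrite eqxx.
- by rewrite eq_sym (negbTE u'v) /= negb_and vI orbT.
exists y; split; first exact: reach_trans r1 r2.
rewrite e2 e1; apply/setP => z; rewrite !inE.
have [->|zv] //= := eqVneq z v.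
by have [->|zu'] //= := eqVneq z (last u p); rewrite (negbTE u'I) andbF.
Qed.

Lemma slide R x (S : {set V}) : conn R -> injective x -> #|S| = #|im x| ->
  (forall v, ~~ R v -> (v \in S) = (v \in im x)) ->
  exists y, reach adj R x y /\ im y = S.
Proof.
move=> cR; have [k] := ubnP #|S :\: im x|; elim: k S x => // k IH S x.
move=> + ix cS out; have [/eqP|[v vS]] := set_0Vmem (S :\: im x).
  rewrite finset.setD_eq0 => sub; exists x; split; first exact: reach_refl.
  by apply/eqP; rewrite eq_sym eqEcard sub cS leqnn.
have [/eqP|[u uS]] := set_0Vmem (im x :\: S).
  rewrite finset.setD_eq0 => sub; have e : im x = S by apply/eqP; rewrite eqEcard sub cS leqnn.
  by move: vS; rewrite e finset.setDv inE.
move: vS uS; rewrite !inE => /andP[vI vS] /andP[uS uI] hk.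
have Ru : R u by apply: contraT => /out; rewrite uI (negbTE uS).
have Rv : R v by apply: contraT => /out; rewrite vS (negbTE vI).
have [p [p1 p2 p3]] := cR _ _ Ru Rv; rewrite -p3 in vI.
have Rup : all R (u :: p) by rewrite /= Ru.
have [x1 [r1 e1]] := slide_path ix p1 Rup uI vI.
rewrite p3 in vI e1.
have uv : u != v by apply: contraNneq vI => <-.
have [||||y [r2 e2]] := IH S x1; last by exists y; split=> //; exact: reach_trans r1 r2.
- rewrite -ltnS; apply: leq_trans hk; rewrite ltnS; apply: proper_card; apply/properP; split.
    apply/fintype.subsetP => z; rewrite e1 !inE !negb_or !negb_and negbK => /andP[/andP[zv /orP[/eqP ->|->]] //].
    by rewrite (negbTE uS).
  by exists v; rewrite ?e1 !inE ?vS ?(negbTE vI) ?eqxx.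
- exact: reach_inj r1 ix.
- by rewrite cS !card_im //; exact: reach_inj r1 ix.
move=> z nz; rewrite out // e1 !inE.
have [e|_] := eqVneq z v; first by rewrite e Rv in nz.
by have [e|_] := eqVneq z u; first by rewrite e Ru in nz.
Qed.

Lemma ystate_of_set c A B C x m : injective x -> yarms adj c A B C -> (m <= size A)%N ->
  (forall v, v \in c :: A ++ B ++ C -> (v \in im x) = (v \in take m (rev A))) ->
  exists s, ystate c A B C s [::] [::] x /\ size s = m.
Proof.
move=> ix [u _ _ _] hm h; set l := take m (rev A).
have lA v : v \in l -> v \in A by move/mem_take; rewrite mem_rev.
have lI v : v \in l -> v \in im x by move=> vl; rewrite h // inE mem_cat lA // orbT.
have ul : uniq l.
  apply: take_uniq; rewrite rev_uniq.
  by move: u => /= /andP[_]; rewrite cat_uniq => /and3P[].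
have sl : size l = m by rewrite size_takel // size_rev.
have [s es] : exists s, map x s = l.
  clearbody l; elim: l lI {h lA ul sl} => [|v l IH] lI; first by exists [::].
  have [|s es] := IH; first by move=> w wl; apply: lI; rewrite inE wl orbT.
  have /imsetP[i _ ei] := lI v (mem_head _ _); exists (i :: s).
  by rewrite /= es -ei.
have ss : size s = m by rewrite -(size_map x) es.
exists s; split=> //; split; [by rewrite es ss|by rewrite take0|by rewrite take0| |].
  by rewrite /= cats0 -(map_inj_uniq ix) es.
move=> i hi; rewrite /= cats0; have := h _ hi; rewrite mem_im => /esym.
by rewrite -/l -es mem_map.
Qed.

(** The tokens in the Y are slid onto the arm [A], permuted there, and slid back by the inverse
    moves, which apply to the permuted labels as well. *)
Lemma yfull c A B C x (f : {perm T}) : injective x -> yarms adj c A B C ->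
  let U := c :: A ++ B ++ C in let m := #|im x :&: [set v in U]| in
  (m <= size A)%N -> (m <= size B)%N -> (m <= size C)%N ->
  (forall i, x i \notin U -> f i = i) -> reach adj (mem U) x (x \o f).
Proof.
move=> ix Y U m hA hB hC hf; have [u _ _ _] := Y.
have uA : uniq A by move: u => /= /andP[_]; rewrite cat_uniq => /and3P[].
have AU v : v \in take m (rev A) -> v \in U.
  by move/mem_take; rewrite mem_rev => vA; rewrite inE mem_cat vA orbT.
pose S := (im x :\: [set v in U]) :|: [set v in take m (rev A)].
have cS : #|S| = #|im x|.
  rewrite cardsU (_ : _ :&: _ = finset.set0) ?cards0 ?subn0; last first.
    by apply/setP => v; rewrite !inE; apply/negP => /andP[/andP[/negP h _] /AU].
  have ut : uniq (take m (rev A)) by rewrite take_uniq // rev_uniq.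
  have -> : #|[set v in take m (rev A)]| = m.
    by rewrite cardsE (card_uniqP ut) size_takel ?size_rev.
  by rewrite addnC -/m cardsID.
have [|y [r e]] := slide (yarms_conn Y) ix cS.
  by move=> v /= vU; rewrite /S !inE vU /= (contraNF (@AU v)) // orbF.
have iy := reach_inj r ix.
have [|s [st ss]] := @ystate_of_set c A B C y m iy Y hA.
  move=> v; rewrite -/U => vU.
  by rewrite e finset.in_setU finset.in_setD [v \in [set _ in U]]finset.in_set vU finset.in_set.
have rf : reach adj (mem U) y (y \o f).
  have aU : all (mem U) (c :: A ++ B ++ C) by apply/allP.
  apply: (yperm adjC iy Y aU st); rewrite ?ss //.
  move=> i ns; apply: hf; apply/negP => xU.
  case: st => e1 _ _ _ off; have [yU|yU] := boolP (y i \in U).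
    by have := off _ yU; rewrite /= cats0 (negbTE ns).
  have := reach_out (reach_sym adjC r) yU; move=> e2; by rewrite -e2 xU in yU.
exact: reach_trans r (reach_trans rf (reach_perm f (reach_sym adjC r))).
Qed.

(** The exchange of the tokens at [p] and [o] in a vertex [a] of valency three: the token from [p]
    waits at the free neighbour [q] while the other one passes. *)
Definition star (a p o q : V) := [:: (p, a); (a, q); (o, a); (a, p); (q, a); (a, o)].

Lemma star_ok a p o q (S : {set V}) : uniq [:: a; p; o; q] -> adj a p -> adj a o -> adj a q ->
  p \in S -> o \in S -> a \notin S -> q \notin S ->
  [/\ mok adj S (star a p o q), mfin S (star a p o q) = S, mact (star a p o q) p = o,
      mact (star a p o q) o = p & forall v, v \notin [:: a; p; o; q] -> mact (star a p o q) v = v].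
Proof.
move=> u4 ep eo eq pS oS aS qS.
have [/and3P[ap ao aq] /andP[po pq] oq] :
  [/\ [&& a != p, a != o & a != q], (p != o) && (p != q) & o != q].
  by move: u4; rewrite /= !inE !negb_or !andbT => /and3P.
have [pa oa qa] : [/\ p != a, o != a & q != a] by rewrite ![_ == a]eq_sym.
have [op qp qo] : [/\ o != p, q != p & q != o] by rewrite !(eq_sym _ p) (eq_sym q).
pose E := (eqxx, negbTE ap, negbTE ao, negbTE aq, negbTE pa, negbTE oa, negbTE qa, negbTE op,
  negbTE qp, negbTE qo, negbTE po, negbTE pq, negbTE oq).
have h : mok adj S (star a p o q).
  by rewrite /= /mvok !inE /= ?(adjC p) ?(adjC o) ?(adjC q) ep eo eq pS oS (negbTE aS) (negbTE qS)
   ?eqxx ?ap ?ao ?aq ?pa ?oa ?qa ?op ?qp ?qo ?po ?pq ?oq ?(negbTE ap) ?(negbTE ao) ?(negbTE aq)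
   ?(negbTE pa) ?(negbTE oa) ?(negbTE qa) ?(negbTE op) ?(negbTE qp) ?(negbTE qo) ?(negbTE po)
   ?(negbTE pq) ?(negbTE oq) /= ?andbF ?orbF.
have hp : mact (star a p o q) p = o.
  by rewrite /= /mva; do 8![rewrite ?E /=].
have ho : mact (star a p o q) o = p.
  by rewrite /= /mva; do 8![rewrite ?E /=].
have hv v : v \notin [:: a; p; o; q] -> mact (star a p o q) v = v.
  by rewrite !inE !negb_or => /and4P[/negbTE va /negbTE vp /negbTE vo /negbTE vq];
     rewrite /= /mva !(va, vp, vo, vq).
suff hS : mfin S (star a p o q) = S by split.
apply/eqP; rewrite eqEcard (card_mfin h) leqnn andbT.
rewrite (mfin_act h); apply/fintype.subsetP => _ /imsetP[v vS ->].
have [->|vp] := eqVneq v p; first by rewrite hp.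
have [->|vo] := eqVneq v o; first by rewrite ho.
rewrite hv // !inE !negb_or vp vo /=.
by apply/andP; split; [apply: contraNneq aS|apply: contraNneq qS] => <-.
Qed.
End Sliding.

(** * Disjoint segments of vertices *)

Section Segments.
Variable V : eqType.
Implicit Types (ss : seq (seq V)) (v : V).
(** Disjoint segments are told apart by their index, so that inclusion and disjointness of regions
    become case distinctions on a natural number. *)
Definition seg_tag ss v := find (fun s : seq V => v \in s) ss.

Lemma segE ss : uniq (flatten ss) -> forall v i, (i < size ss)%N ->
  (v \in nth [::] ss i) = (seg_tag ss v == i).
Proof.
move=> u v i hi; apply/idP/eqP => [|e]; last first.
  rewrite -e in hi *.
  by move: hi; rewrite /seg_tag -has_find => /(nth_find [::]).
elim: ss i u hi => [|s ss IH] [|i] //=; first by rewrite /seg_tag /= => _ _ ->.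
rewrite cat_uniq => /and3P[_ /hasPn h u] hi vi; rewrite /seg_tag /= ifN.
  by congr _.+1; exact: IH.
by apply: h; apply/flattenP; exists (nth [::] ss i) => //; apply: mem_nth.
Qed.

(** Disjoint segments may be selected, permuted and reversed; [kb] lists the indices, each with a
    flag for reversal. *)
Lemma uniq_segs ss (kb : seq (nat * bool)) : uniq (flatten ss) ->
  uniq (map fst kb) -> all (fun k => k.1 < size ss)%N kb ->
  uniq (flatten (map (fun k : nat * bool => if k.2 then rev (nth [::] ss k.1) else nth [::] ss k.1) kb)).
Proof.
move=> u; have us i : uniq (nth [::] ss i).
  case: (ltnP i (size ss)) => [hi|h]; last by rewrite nth_default.
  elim: ss i u hi => [|s ss IH] [|i] //=; rewrite cat_uniq => /and3P[] // _ _ h hi.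
  exact: IH.
elim: kb => [|[k f] kb IH] //= /andP[nk uk] /andP[hk ak]; rewrite cat_uniq IH // andbT.
have mE v (k0 : nat) (f0 : bool) : (v \in (if f0 then rev (nth [::] ss k0) else nth [::] ss k0))
    = (v \in nth [::] ss k0) by case: f0; rewrite ?mem_rev.
apply/andP; split; first by case: (f); rewrite ?rev_uniq us.
apply/hasPn => v /flattenP[_ /mapP[[k' f'] kin ->]]; rewrite /= !mE => v1.
have hk' : (k' < size ss)%N := allP ak _ kin.
rewrite segE // in v1; rewrite segE // (eqP v1); apply: contraNneq nk => <-.
by apply/mapP; exists (k', f').
Qed.
End Segments.

(** * Strand permutations and pairs of exchanges on an H-shaped tree *)

Section Braids.
Local Open Scope group_scope.
Variables (V : finType) (adj : rel V).
Hypothesis adjC : symmetric adj.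
Variables (X : finType) (Rl : rel X).
Notation G := (raag Rl).
Variable T : finType.
Notation n := #|T|.
Variable M : {set V} -> V -> V -> G.
Hypothesis Minv : forall (S : {set V}) u w, #|S| = n -> mvok adj S u w -> M (mvS S u w) w u = (M S u w)^-1.
Hypothesis Msq : forall (S : {set V}) u w u' w', #|S| = n -> mvok adj S u w -> mvok adj S u' w' ->
  uniq [:: u; w; u'; w'] ->
  M S u w * M (mvS S u w) u' w' = M S u' w' * M (mvS S u' w') u w.
Variable rho : G -> {perm T}.
Hypothesis rhoM : forall g h, rho (g * h) = rho g * rho h.
Variable kp : (T -> V) -> {perm T}.
Hypothesis kp_perm : forall x (s : {perm T}), injective x -> kp (x \o s) = s * kp x.
Hypothesis rho_move : forall x i w, injective x -> adj (x i) w -> w \notin im x ->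
  rho (M (im x) (x i) w) = (kp x)^-1 * kp (upd x i w).
Implicit Types (R : pred V) (x y : T -> V).

Lemma rho_el x ms : injective x -> mok adj (im x) ms ->
  rho (el M (im x) ms) = (kp x)^-1 * kp (mact ms \o x).
Proof.
elim: ms x => [|[u w] ms IH] x ix /=.
  by move=> _; rewrite (rho1 rhoM) (_ : _ \o x = x) ?mulVg.
case/andP=> h hms; have /and3P[/= a /imsetP[i _ ei] wI] := h.
rewrite ei in a h hms *; rewrite rhoM rho_move //.
have e : upd x i w = mva (x i) w \o x.
  by apply: funext => j; rewrite /upd /mva /= (inj_eq ix).
have h1 : mok adj (im x) [:: (x i, w)] by rewrite /= h.
have e' : im (upd x i w) = mvS (im x) (x i) w by rewrite e; exact: (im_mact h1).
rewrite -e' in hms *; rewrite IH //; first by rewrite e mulgA mulgK.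
move=> j k; rewrite /upd; case: (eqVneq j i) => [->|ji]; case: (eqVneq k i) => [->|ki] //.
- by move=> e1; rewrite e1 mem_im in wI.
- by move=> e1; rewrite -e1 mem_im in wI.
by move/ix.
Qed.

Lemma rho_loop x ms (s : {perm T}) : injective x -> mok adj (im x) ms -> mact ms \o x =1 x \o s ->
  rho (el M (im x) ms) = (kp x)^-1 * s * kp x.
Proof. by move=> ix o e; rewrite rho_el // (funext e) kp_perm // mulgA. Qed.

Lemma loop_fin x ms (s : {perm T}) : mok adj (im x) ms -> mact ms \o x =1 x \o s ->
  mfin (im x) ms = im x.
Proof. by move=> o e; rewrite -(reach_im o e) im_perm. Qed.

(** Conjugation by [kp x] turns the permutation of a loop at [im x] into the one that its moves
    effect on the labels of [x] ([rhoat_loop]). *)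
Definition rhoat x g := kp x * rho g * (kp x)^-1.
Lemma rhoatM x g h : rhoat x (g * h) = rhoat x g * rhoat x h.
Proof. by rewrite /rhoat rhoM !mulgA mulgVK. Qed.

Lemma rhoat_loop x ms (s : {perm T}) : injective x -> mok adj (im x) ms ->
  mact ms \o x =1 x \o s -> rhoat x (el M (im x) ms) = s.
Proof. by move=> ix o e; rewrite /rhoat (rho_loop ix o e) !mulgA mulgV mul1g mulgK. Qed.

Lemma pair_data_of x R R' ma mb t1 t2 t3 t4 : injective x -> (forall v, R v -> ~~ R' v) ->
  uniq [:: t1; t2; t3; t4] ->
  msupp R ma -> mok adj (im x) ma -> mact ma \o x =1 x \o tperm t1 t2 ->
  msupp R' mb -> mok adj (im x) mb -> mact mb \o x =1 x \o tperm t3 t4 ->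
  (forall j k, j \notin [:: t1; t2] -> k \notin [:: t1; t2] ->
     reach adj (predC R) x (x \o tperm j k)) ->
  (forall j k, j \notin [:: t3; t4] -> k \notin [:: t3; t4] ->
     reach adj (predC R') x (x \o tperm j k)) ->
  pair_data (rhoat x) (el M (im x) ma) (el M (im x) mb) t1 t2 t3 t4.
Proof.
move=> ix d u sa oa ea sb ob eb fa fb; have cx : #|im x| = n by exact: card_im.
have lp (Q : pred V) ms (s : {perm T}) (Q' : pred V) ms' (s' : {perm T}) : (forall v, Q v -> ~~ Q' v) -> msupp Q ms -> mok adj (im x) ms ->
    mact ms \o x =1 x \o s -> msupp Q' ms' -> mok adj (im x) ms' -> mact ms' \o x =1 x \o s' ->
    commute (el M (im x) ms) (el M (im x) ms').
  move=> dQ h1 h2 h3 h4 h5 h6; apply: (el_loops Msq dQ) => //; first exact: (loop_fin h2 h3).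
  exact: (loop_fin h5 h6).
split=> //; first exact: (lp R _ _ R').
- by split; [exact: (rhoat_loop ix oa ea)|exact: (rhoat_loop ix ob eb)].
- move=> j k hj hk; have [ms [h1 h2 h3]] := fa j k hj hk.
  exists (el M (im x) ms); last exact: rhoat_loop.
  by apply: (lp (predC R) _ _ R) => //.
move=> j k hj hk; have [ms [h1 h2 h3]] := fb j k hj hk.
exists (el M (im x) ms); last exact: rhoat_loop.
by apply: (lp (predC R') _ _ R') => //.
Qed.

Lemma place (ts : seq T) (l : seq V) : perm_eq ts (enum T) -> uniq l -> size l = size ts ->
  exists x, injective x /\ map x ts = l.
Proof.
move=> p ul sl; have uts : uniq ts by rewrite (perm_uniq p) enum_uniq.
have in_ts t : t \in ts by rewrite (perm_mem p) mem_enum.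
case: l ul sl => [|v0 l] ul sl.
  have h (t : T) : False by have := in_ts t; case: (ts) sl.
  by exists (fun t => match h t with end); split=> [t|]; [case: (h t)|case: (ts) sl].
exists (fun t => nth v0 (v0 :: l) (index t ts)); split.
  move=> s t /eqP; rewrite nth_uniq // ?sl ?index_mem // => /eqP e.
  by rewrite -(nth_index s (in_ts s)) e nth_index.
apply: (@eq_from_nth _ v0) => [|i]; rewrite size_map // => hi.
case: (ts) sl uts hi => [|t0 ts'] sl' uts hi //.
by rewrite (nth_map t0) // index_uniq.
Qed.

Section HTree.
Variables (a b O O' P P' Q Q' : V) (wi Pa Qa Pb Qb : seq V).
Definition hsegs := [:: [:: a]; [:: b]; [:: O]; [:: O']; [:: P]; [:: P']; [:: Q]; [:: Q'];
  wi; Pa; Qa; Pb; Qb].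
(** Two branch points [a] and [b] joined by the path [O, wi, O'], with free arms beginning with [P],
    [Q] at [a] and with [P'], [Q'] at [b]. Each arm has room for all tokens. *)
Record htree : Prop := HTree {
  ht_uniq : uniq (flatten hsegs);
  ht_w : path adj a (O :: rcons wi O') && adj O' b;
  ht_Pa : path adj a (P :: Pa); ht_Qa : path adj a (Q :: Qa);
  ht_Pb : path adj b (P' :: Pb); ht_Qb : path adj b (Q' :: Qb);
  ht_swi : (n <= size wi)%N; ht_sPa : (n <= size Pa)%N; ht_sQa : (n <= size Qa)%N;
  ht_sPb : (n <= size Pb)%N; ht_sQb : (n <= size Qb)%N }.
End HTree.

Lemma htree_sym a b O O' P P' Q Q' wi Pa Qa Pb Qb : htree a b O O' P P' Q Q' wi Pa Qa Pb Qb ->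
  htree b a O' O P' P Q' Q (rev wi) Pb Qb Pa Qa.
Proof.
case=> u /andP[w wb] h1 h2 h3 h4 h5 h6 h7 h8 h9; split; rewrite ?size_rev //.
  have := uniq_segs u (kb := [:: (1, false); (0, false); (3, false); (2, false); (5, false);
    (4, false); (7, false); (6, false); (8, true); (11, false); (12, false); (9, false);
    (10, false)]%N) isT isT.
  by rewrite /hsegs /= !cats0.
have /andP[wO w'] := w; rewrite /= adjC wb adjC wO andbT /=.
by have := path_sym adjC w'; rewrite last_rcons belast_rcons rev_cons.
Qed.

Lemma ht_yarms a b O O' P P' Q Q' wi Pa Qa Pb Qb : htree a b O O' P P' Q Q' wi Pa Qa Pb Qb ->
  yarms adj a (O :: wi) (P :: Pa) (Q :: Qa).
Proof.
case=> u /andP[w wb] h1 h2 h3 h4 h5 h6 h7 h8 h9; split=> //; last first.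
  by move: w; rewrite -cats1 -cat_cons cat_path => /andP[].
have := uniq_segs u (kb := [:: (0, false); (2, false); (8, false); (4, false); (9, false); (6, false); (10, false)]%N).
by rewrite /= ?cats0; apply.
Qed.

Section HTreePair.
Variables (a b O O' P P' Q Q' : V) (wi Pa Qa Pb Qb : seq V).
Hypothesis H : htree a b O O' P P' Q Q' wi Pa Qa Pb Qb.
Variables (t1 t2 t3 t4 : T) (r : seq T).
Hypothesis tsP : perm_eq [:: t1, t2, t3, t4 & r] (enum T).

(** The remaining tokens wait on the joining path, within reach of both branch points. *)
Lemma ht_place : exists x, [/\ injective x, map x [:: t1; t2; t3; t4] = [:: P; O; P'; O'] &
  map x r = take (n - 4) wi].
Proof.
have sr : size r = (n - 4)%N by have := perm_size tsP; rewrite -cardE /= => <-; rewrite !subSS subn0.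
have n4 : (4 <= n)%N by have := perm_size tsP; rewrite -cardE /= => <-.
have [||x [ix e]] := @place _ ([:: P; O; P'; O'] ++ take (n - 4) wi) tsP.
- have := uniq_segs (ht_uniq H)
    (kb := [:: (4, false); (2, false); (5, false); (3, false); (8, false)]%N) isT isT.
  by rewrite /hsegs /= cats0 => h; exact: (@take_uniq _ [:: P, O, P', O' & wi] (n - 4).+4 h).
- by rewrite size_cat size_takel; [rewrite /= sr|exact: leq_trans (leq_subr _ _) (ht_swi H)].
by case: e => e1 e2 e3 e4 e5; exists x; split; rewrite //= e1 e2 e3 e4.
Qed.

(** The strands other than [t1, t2] all lie in the Y centred at [b], which avoids the exchange at
    [a], and vice versa. Shunting in the Y permutes them arbitrarily. *)
Lemma ht_pair x : injective x -> map x [:: t1; t2; t3; t4] = [:: P; O; P'; O'] ->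
  map x r = take (n - 4) wi ->
  pair_data (rhoat x) (el M (im x) (star a P O Q)) (el M (im x) (star b P' O' Q')) t1 t2 t3 t4.
Proof.
move=> ix [x1 x2 x3 x4] xr.
have uts : uniq [:: t1, t2, t3, t4 & r] by rewrite (perm_uniq tsP) enum_uniq.
have u4 : uniq [:: t1; t2; t3; t4].
  by have := @take_uniq _ [:: t1, t2, t3, t4 & r] 4 uts; rewrite /= take0.
have tcase t : t \in [:: t1, t2, t3, t4 & r] by rewrite (perm_mem tsP) mem_enum.
have rw t : t \in r -> x t \in wi by move/(map_f x); rewrite xr => /mem_take.
have tE := segE (ht_uniq H); set tag := seg_tag _ in tE.
have E i v : (i < 13)%N -> _ := tE v i.
have [Ea Eb EO EO'] : [/\ forall v, (v == a) = (tag v == 0%N), forall v, (v == b) = (tag v == 1%N),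
   forall v, (v == O) = (tag v == 2) & forall v, (v == O') = (tag v == 3)].
  by split=> v; rewrite -tE //= inE.
have [EP EP' EQ EQ'] : [/\ forall v, (v == P) = (tag v == 4), forall v, (v == P') = (tag v == 5),
   forall v, (v == Q) = (tag v == 6) & forall v, (v == Q') = (tag v == 7)].
  by split=> v; rewrite -tE //= inE.
have Ew v : (v \in wi) = (tag v == 8) by rewrite -tE.
have EE := (Ea, Eb, EO, EO', EP, EP', EQ, EQ', Ew).
have [TP TO TP' TO'] : [/\ tag P = 4, tag O = 2, tag P' = 5 & tag O' = 3].
  by split; apply/eqP; rewrite -tE //= inE.
have imx v : v \in im x -> [|| tag v == 4, tag v == 2, tag v == 5, tag v == 3 | tag v == 8].
  case/imsetP=> t _ ->; have := tcase t; rewrite !inE => /or4P[/eqP->|/eqP->|/eqP->|/orP[/eqP->|/rw]].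
  - by rewrite x1 TP.
  - by rewrite x2 TO.
  - by rewrite x3 TP'.
  - by rewrite x4 TO'.
  - by rewrite Ew => ->; rewrite !orbT.
have st c p o q i j : uniq [:: c; p; o; q] -> adj c p -> adj c o -> adj c q -> x i = p -> x j = o ->
    c \notin im x -> q \notin im x -> mok adj (im x) (star c p o q) /\
    mact (star c p o q) \o x =1 x \o tperm i j.
  move=> uu a1 a2 a3 xi xj ni nq.
  have [||h1 h2 h3 h4 h5] := star_ok adjC (S := im x) uu a1 a2 a3 _ _ ni nq.
  - by rewrite -xi mem_im.
  - by rewrite -xj mem_im.
  split=> // t; rewrite [LHS]/comp [RHS]/comp; case: tpermP => [->|->|/eqP ti /eqP tj]; rewrite ?xi ?xj //.
  rewrite h5 // !inE !negb_or -xi -xj !(inj_eq ix) ti tj /=.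
  by apply/andP; split; [apply: contraNneq ni|apply: contraNneq nq] => <-; rewrite mem_im.
have [aP aO aQ] : [/\ adj a P, adj a O & adj a Q].
  by case: (H) => _ /andP[/= /andP[-> _] _] /= /andP[-> _] /andP[-> _].
have [bP bO bQ] : [/\ adj b P', adj b O' & adj b Q'].
  by case: (H) => _ /andP[_ h] _ _ /= /andP[-> _] /andP[-> _]; rewrite adjC h.
have nim v : tag v \notin [:: 4; 2; 5; 3; 8] -> v \notin im x.
  by apply: contra => /imx; rewrite !inE.
have [Ta Tb TQ TQ'] : [/\ tag a = 0%N, tag b = 1%N, tag Q = 6 & tag Q' = 7].
  by split; apply/eqP; rewrite -tE //= inE.
have [|||oa ea] := st a P O Q t1 t2 _ aP aO aQ x1 x2; rewrite ?nim ?Ta ?TQ //.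
  by rewrite /= !inE !EE ?Ta ?TP ?TO ?TQ.
have [|||ob eb] := st b P' O' Q' t3 t4 _ bP bO bQ x3 x4; rewrite ?nim ?Tb ?TQ' //.
  by rewrite /= !inE !EE ?Tb ?TP' ?TO' ?TQ'.
have full c A B C : yarms adj c A B C -> (n <= size A)%N -> (n <= size B)%N -> (n <= size C)%N ->
   forall (R : pred V) (l : seq T) j k, all (predC R) (c :: A ++ B ++ C) -> j \notin l -> k \notin l ->
   (forall i, i \notin l -> x i \in c :: A ++ B ++ C) -> reach adj (predC R) x (x \o tperm j k).
  move=> Y hA hB hC R l j k aR jl kl xl.
  apply: (@reach_sub _ _ _ (mem (c :: A ++ B ++ C))); first by move=> v; exact: (allP aR).
  have hm := subset_leq_card (finset.subsetIl (im x) [set v in c :: A ++ B ++ C]).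
  rewrite (card_im ix) in hm.
  apply: (yfull adjC ix Y); try exact: leq_trans hm _.
  move=> i /(contraNN (xl i)); rewrite negbK => il.
  by rewrite tpermD //; [apply: contraNneq jl|apply: contraNneq kl] => ->.
apply: (@pair_data_of x (mem [:: a; P; O; Q]) (mem [:: b; P'; O'; Q'])) => //.
- move=> v /=; rewrite !inE !EE.
  by case/or4P=> /eqP ->.
- by rewrite /= !inE !eqxx ?orbT.
- by rewrite /= !inE !eqxx ?orbT.
- move=> j k hj hk; apply: (full _ _ _ _ (ht_yarms (htree_sym H)) _ _ _ _ [:: t1; t2]) => //.
  + by rewrite /= size_rev; exact: leqW (ht_swi H).
  + exact: leqW (ht_sPb H).
  + exact: leqW (ht_sQb H).
  + apply/allP => v; rewrite /= !(inE, mem_cat, mem_rev) !EE (tE _ 11) // (tE _ 12) //.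
    by case: (tag v) => [|[|[|[|[|[|[|[|[|[|[|[|[|m]]]]]]]]]]]]].
  move=> i; have := tcase i; rewrite !inE !negb_or.
  case/or4P=> [/eqP->|/eqP->|/eqP->|/orP[/eqP->|/rw xi]]; rewrite ?eqxx ?orbF //= ?mem_cat ?inE ?mem_rev.
  + by rewrite andbF.
  + by rewrite x3 eqxx !orbT.
  + by rewrite x4 eqxx !orbT.
  + by rewrite xi !orbT.
move=> j k hj hk; apply: (full _ _ _ _ (ht_yarms H) _ _ _ _ [:: t3; t4]) => //.
- exact: leqW (ht_swi H).
- exact: leqW (ht_sPa H).
- exact: leqW (ht_sQa H).
- apply/allP => v; rewrite /= !(inE, mem_cat) !EE (tE _ 9) // (tE _ 10) //.
  by case: (tag v) => [|[|[|[|[|[|[|[|[|[|[|[|[|m]]]]]]]]]]]]].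
move=> i; have := tcase i; rewrite !inE !negb_or.
case/or4P=> [/eqP->|/eqP->|/eqP->|/orP[/eqP->|/rw xi]]; rewrite ?eqxx ?orbF //= ?mem_cat ?inE.
- by rewrite x1 eqxx !orbT.
- by rewrite x2 eqxx !orbT.
- by rewrite andbF.
- by rewrite xi !orbT.
Qed.
End HTreePair.
End Braids.

(** * Dihedral commutators with few fixed points *)

Section ListPerm.
Local Open Scope group_scope.
Import GRing.Theory.
Variables (T : finType) (s : seq T) (m' : nat).
Notation m := m'.+1.
Hypotheses (us : uniq s) (ss : size s = m).

Definition lperm_fun (g : 'I_m -> 'I_m) (t : T) : T :=
  if t \in s then nth t s (g (inord (index t s))) else t.

Lemma lperm_inj g : injective g -> injective (lperm_fun g).
Proof.
move=> ig t u; rewrite /lperm_fun.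
have hin (v : T) (j : 'I_m) : nth v s j \in s by rewrite mem_nth ?ss.
case: ifP => ts; case: ifP => usn //; last first.
- by move=> e; move: ts; rewrite e hin.
- by move=> e; move: usn; rewrite -e hin.
rewrite (set_nth_default u) ?ss // => /eqP; rewrite nth_uniq ?ss // => /eqP/val_inj/ig.
move=> /(congr1 val); rewrite /= !inordK -?ss ?index_mem // => e.
by rewrite -(nth_index t ts) e nth_index.
Qed.

Definition lperm g (ig : injective g) : {perm T} := perm (lperm_inj ig).

Lemma lperm_out g (ig : injective g) t : t \notin s -> lperm ig t = t.
Proof. by move=> h; rewrite permE /lperm_fun (negbTE h). Qed.

Lemma lperm_nth g (ig : injective g) t0 (i : 'I_m) : lperm ig (nth t0 s i) = nth t0 s (g i).
Proof.
rewrite permE /lperm_fun mem_nth ?ss // index_uniq ?ss // inord_val.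
by apply: set_nth_default; rewrite ss.
Qed.

Definition one_ord : 'I_m := inord 1.
Definition lcyc := lperm (@addIr _ one_ord).
Definition lflip := lperm (@oppr_inj 'I_m).

(** A reflection inverts the rotation, so the commutator is the square of the rotation. *)
Lemma lcomm_nth t0 (i : 'I_m) :
  (lcyc * lflip * lcyc^-1 * lflip^-1) (nth t0 s i) = nth t0 s (i + one_ord + one_ord)%R.
Proof.
rewrite !permM /lcyc lperm_nth /lflip lperm_nth.
have -> : (lperm (@addIr _ one_ord))^-1 (nth t0 s (- (i + one_ord))%R)
    = nth t0 s (- (i + one_ord) - one_ord)%R.
  by apply: (@perm_inj _ (lperm (@addIr _ one_ord))); rewrite permKV lperm_nth subrK.
apply: (@perm_inj _ (lperm (@oppr_inj 'I_m))); rewrite permKV lperm_nth.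
by rewrite !opprD.
Qed.

(** A rotation by four places is the square of the commutator; it has no fixed point, as an odd
    number greater than 1 does not divide 4. *)
Lemma four_ord (i : 'I_m) : odd m -> (1 < m)%N ->
  (i + one_ord + one_ord + one_ord + one_ord)%R != i.
Proof.
move=> om m1; rewrite -!addrA -subr_eq0 addrAC subrr add0r; apply/eqP => /(congr1 val) /=.
rewrite !modnDmr inordK // addnA modnDmr => h.
have : m %| 4 by rewrite /dvdn h.
move/(dvdn_leq (ltn0Sn _)) => m4.
have e : m' = 2 by lia.
by rewrite e in h.
Qed.

Lemma lcomm_moves t : odd m -> (1 < m)%N -> t \in s ->
  let k := lcyc * lflip * lcyc^-1 * lflip^-1 in (k * k) t <> t.
Proof.
move=> om m1 ts k; have hi : (index t s < m)%N by rewrite -ss index_mem.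
rewrite -{1}(nth_index t ts) -[index t s]/(val (Ordinal hi)) permM !lcomm_nth => e.
move/(congr1 (index^~ s)): e; rewrite index_uniq ?ss // => e.
by move/eqP: (four_ord (Ordinal hi) om m1); apply; apply: val_inj.
Qed.
End ListPerm.

Lemma commutator_few_fixed (T : finType) (s : seq T) : uniq s -> (3 <= size s)%N ->
  #|T| = (size s).+2 -> exists c b : {perm T},
  [/\ forall t, t \notin s -> c t = t, forall t, t \notin s -> b t = t &
   forall l : seq T, uniq l -> size l = 4 ->
   let k := (c * b * c^-1 * b^-1)%g in (forall t, t \in l -> (k * k)%g t = t) -> False].
Proof.
(* An odd number of points is rotated. At most one point of [s] and the two points outside [s]
   remain, fewer than four. *)
move=> us hs cT; pose q := (if odd (size s) then size s else (size s).-1).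
have [m' em] : exists m', q = m'.+1 by exists q.-1; rewrite /q; case: ifP; lia.
have oq : odd q by rewrite /q; case: ifP => //; lia.
have hq : (q <= size s)%N by rewrite /q; case: ifP; lia.
have hq' : (size s <= q.+1)%N by rewrite /q; case: ifP; lia.
have q1 : (1 < q)%N by rewrite /q; case: ifP; lia.
have ss : size (take q s) = m'.+1 by rewrite size_takel.
have ut : uniq (take q s) by exact: take_uniq.
exists (lcyc ut ss), (lflip ut ss); split.
- by move=> t ts; apply: lperm_out; apply: contra ts => /mem_take.
- by move=> t ts; apply: lperm_out; apply: contra ts => /mem_take.
move=> l ul sl k h.
have ucat : uniq (l ++ take q s).
  rewrite cat_uniq ul ut andbT /=; apply/hasPn => t ts; apply/negP => /= tl.
  have hm : odd m'.+1 by rewrite -em.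
  have hm1 : (1 < m'.+1)%N by rewrite -em.
  exact: (lcomm_moves hm hm1 ts (h t tl)).
have := uniq_leq_size ucat (fun t _ => mem_enum T t).
by rewrite size_cat -cardE cT sl size_takel //; lia.
Qed.

(** * The obstruction from three branch points *)

Section Tripod.
Local Open Scope group_scope.
Variables (V : finType) (adj : rel V).
Hypothesis adjC : symmetric adj.
Variables (X : finType) (Rl : rel X).
Notation G := (raag Rl).
Variable T : finType.
Notation n := #|T|.
Variable M : {set V} -> V -> V -> G.
Hypothesis Msq : forall (S : {set V}) u w u' w', #|S| = n -> mvok adj S u w -> mvok adj S u' w' ->
  uniq [:: u; w; u'; w'] ->
  M S u w * M (mvS S u w) u' w' = M S u' w' * M (mvS S u' w') u w.
Variable rho : G -> {perm T}.
Hypothesis rhoM : forall g h, rho (g * h) = rho g * rho h.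
Variable kp : (T -> V) -> {perm T}.
Hypothesis kp_perm : forall x (s : {perm T}), injective x -> kp (x \o s) = s * kp x.
Hypothesis rho_move : forall x i w, injective x -> adj (x i) w -> w \notin im x ->
  rho (M (im x) (x i) w) = (kp x)^-1 * kp (upd x i w).
Hypothesis n5 : (5 <= n)%N.

(* Two H-trees a - b and v - u: the arm v, B1, u leaves the path from a to b at v. *)
Variables (a b O O' P P' Q Q' v u : V) (w2 w3 Pa Qa Pb Qb B1 P1 Q1 : seq V).
Hypothesis H : htree adj T a b O O' P P' Q Q' (w2 ++ v :: w3) Pa Qa Pb Qb.
Definition tsegs := [:: [:: a]; [:: b]; [:: O]; [:: O']; [:: P]; [:: P']; [:: Q]; [:: Q'];
  w2; [:: v]; w3; Pa; Qa; Pb; Qb; B1; [:: u]; P1; Q1].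
Hypothesis uT : uniq (flatten tsegs).
Hypothesis pB : path adj v (B1 ++ u :: P1).
Hypothesis pQ1 : path adj u Q1.
Hypothesis sizes1 : [/\ (n <= size B1)%N, (n <= size P1)%N & (n <= size Q1)%N].

Lemma tripod_yarms : yarms adj u P1 Q1 (rev B1).
Proof.
move: pB; rewrite cat_path /= => /and3P[h1 h2 h3]; split=> //.
- have := uniq_segs uT (kb := [:: (16, false); (17, false); (18, false); (15, true)]%N) isT isT.
  by rewrite /= ?cats0.
case/lastP: (B1) h1 h2 => [|B z] //; rewrite last_rcons rcons_path => /andP[p1 p2] p3.
rewrite rev_rcons /= adjC p3 /=.
have h : path adj v (rcons B z) by rewrite rcons_path p1.
have := path_sym adjC h; rewrite last_rcons belast_rcons rev_cons rcons_path.
by case/andP.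
Qed.

Lemma commuteC4 (g h k : G) : commute g k -> commute h k -> commute (g * h * g^-1 * h^-1) k.
Proof.
move=> c c'; apply/commute_sym; do ![apply: commuteM]; try apply: commuteV; exact: commute_sym.
Qed.

Lemma conj_square (gT : groupType) (h k : gT) :
  h * (k * k * h^-1) = h * k * h^-1 * (h * k * h^-1).
Proof. by rewrite !mulgA mulgKV. Qed.

Lemma conjC4 (p g h : G) : p^-1 * (g * h * g^-1 * h^-1) * p =
  (p^-1 * g * p) * (p^-1 * h * p) * (p^-1 * g * p)^-1 * (p^-1 * h * p)^-1.
Proof. by rewrite !invgM !invgK !mulgA !mulgK. Qed.

Lemma tripod_contradiction : False.
Proof.
have [ts [tsP st]] : exists ts : seq T, perm_eq ts (enum T) /\ size ts = n.
  by exists (enum T); rewrite -cardE.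
case: ts tsP st => [|t1 [|t2 [|t3 [|t4 r]]]] tsP /= st; try by move: n5; rewrite -st.
have [x [ix xt xr]] := ht_place H tsP.
have hp := ht_pair adjC Msq rhoM kp_perm rho_move H tsP ix xt xr.
set sa := el M (im x) _ in hp; set sb := el M (im x) _ in hp.
have cx : #|im x| = n by exact: card_im.
have [sB sP1 sQ1] := sizes1.
(* All but two tokens are parked at the tip of an arm of the third branch point [u]; [Sy] keeps a
   pair at [a] and [Sz] a pair at [b]. *)
pose K := take (n - 2) (rev P1).
have uP1 : uniq P1.
  have := uniq_segs uT (kb := [:: (17, false)]%N) isT isT; by rewrite /= cats0.
have KP z : z \in K -> z \in P1 by move/mem_take; rewrite mem_rev.
have uK : uniq K by rewrite take_uniq // rev_uniq.
have sK : size K = (n - 2)%N by rewrite size_takel // size_rev; lia.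
have tE := segE uT; set tag := seg_tag _ in tE.
have [Ea Eb EO EO'] : [/\ forall z, (z == a) = (tag z == 0%N), forall z, (z == b) = (tag z == 1%N),
   forall z, (z == O) = (tag z == 2) & forall z, (z == O') = (tag z == 3)].
  by split=> z; rewrite -tE //= inE.
have [EP EP' EQ EQ'] : [/\ forall z, (z == P) = (tag z == 4), forall z, (z == P') = (tag z == 5),
   forall z, (z == Q) = (tag z == 6) & forall z, (z == Q') = (tag z == 7)].
  by split=> z; rewrite -tE //= inE.
have [Ew2 Ev Ew3 Eu] : [/\ forall z, (z \in w2) = (tag z == 8), forall z, (z == v) = (tag z == 9),
   forall z, (z \in w3) = (tag z == 10) & forall z, (z == u) = (tag z == 16)].
  by split=> z; rewrite -tE //= inE.
have [EB EP1 EQ1] : [/\ forall z, (z \in B1) = (tag z == 15), forall z, (z \in P1) = (tag z == 17)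
   & forall z, (z \in Q1) = (tag z == 18)] by split=> z; rewrite -tE.
have [EPa EQa EPb EQb] : [/\ forall z, (z \in Pa) = (tag z == 11), forall z, (z \in Qa) = (tag z == 12),
   forall z, (z \in Pb) = (tag z == 13) & forall z, (z \in Qb) = (tag z == 14)] by split=> z; rewrite -tE.
have EE := (Ea, Eb, EO, EO', EP, EP', EQ, EQ', Ew2, Ev, Ew3, Eu, EB, EP1, EQ1, (EPa, EQa, EPb, EQb)).
have [TP TO TP' TO'] : [/\ tag P = 4, tag O = 2, tag P' = 5 & tag O' = 3].
  by split; apply/eqP; rewrite -tE //= inE.
have tagK z : z \in K -> tag z = 17 by move/KP; rewrite EP1 => /eqP.
pose Sy : {set V} := [set z in [:: P, O & K]]; pose Sz : {set V} := [set z in [:: P', O' & K]].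
have cS p o : uniq [:: p; o] -> tag p != 17 -> tag o != 17 -> #|[set z in [:: p, o & K]]| = n.
  move=> po tp to; rewrite cardsE; have /card_uniqP -> : uniq [:: p, o & K].
    move: po; rewrite /= !inE andbT negb_or => ->; rewrite uK andbT /=.
    by apply/andP; split; [apply: contra tp|apply: contra to] => /tagK ->.
  by rewrite /= sK -addn2 subnK //; exact: leq_trans n5.
have cy : #|Sy| = n by apply: cS; rewrite ?TP ?TO //= inE EO TP.
have cz : #|Sz| = n by apply: cS; rewrite ?TP' ?TO' //= inE EO' TP'.
have imx z : (z \in im x) -> [|| tag z == 4, tag z == 2, tag z == 5, tag z == 3, tag z == 8, tag z == 9 | tag z == 10].
  case/imsetP=> t _ ->; have : x t \in map x ([:: t1; t2; t3; t4] ++ r).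
    by apply: map_f; rewrite (perm_mem tsP) mem_enum.
  rewrite map_cat xt xr mem_cat !inE !EE => /orP[|/mem_take].
    by case/or4P=> ->; rewrite ?orbT.
  by rewrite mem_cat inE !EE => /or3P[] ->; rewrite ?orbT.
have inx : [/\ P \in im x, O \in im x, P' \in im x & O' \in im x].
  by case: xt => <- <- <- <-; split; exact: mem_im.
have [iP iO iP' iO'] := inx.
pose U1 := u :: P1 ++ Q1 ++ rev B1.
have cB : conn adj (mem (v :: B1 ++ u :: P1)) := conn_path adjC pB.
(* [U2] leads from [x] to [Sy] without touching the exchange at [a], and [U3] from [x] to [Sz]
   without touching the one at [b]. The path [U4] leads from [Sy] to [Sz] and avoids the Y at
   [u]. *)
pose U2 := predU (mem (b :: (O' :: rev (w2 ++ v :: w3)) ++ (P' :: Pb) ++ (Q' :: Qb)))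
  (mem (v :: B1 ++ u :: P1)).
pose U3 := predU (mem (a :: (O :: (w2 ++ v :: w3)) ++ (P :: Pa) ++ (Q :: Qa)))
  (mem (v :: B1 ++ u :: P1)).
have c2 : conn adj U2.
  apply: (@conn_union _ _ adjC _ _ v) => //; rewrite /= ?inE ?eqxx //.
    by rewrite !(mem_cat, inE, mem_rev) eqxx !orbT.
  exact: yarms_conn (ht_yarms (htree_sym adjC H)).
have c3 : conn adj U3.
  apply: (@conn_union _ _ adjC _ _ v) => //; rewrite /= ?inE ?eqxx //.
    by rewrite !(mem_cat, inE, mem_rev) eqxx !orbT.
  exact: yarms_conn (ht_yarms H).
have p4 : path adj P (a :: O :: rcons (w2 ++ v :: w3) O' ++ [:: b; P']).
  case: (H) => _ /andP[h1 h2] /= /andP[h3 _] _ /andP[h4 _] *.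
  move: h1 => /= /andP[h5 h6].
  by rewrite adjC h3 h5 /= cat_path h6 last_rcons /= h2 h4.
pose U4 := mem (P :: a :: O :: rcons (w2 ++ v :: w3) O' ++ [:: b; P']).
have c4 : conn adj U4 := conn_path adjC p4.
have [|y [ry ey]] := slide c2 ix (etrans cy (esym cx)).
  move=> z; rewrite /U2 /= !(inE, mem_cat, mem_rev) !EE => nz.
  apply/idP/idP => [|/imx].
    case/or3P=> [| |/tagK tz]; rewrite -?EE; [by move/eqP->|by move/eqP->|].
    by move: nz; rewrite tz.
  by move: nz; case: (tag z) => [|[|[|[|[|[|[|[|[|[|[|m]]]]]]]]]]].
have [|z [rz ez]] := slide c3 ix (etrans cz (esym cx)).
  move=> z; rewrite /U3 /= !(inE, mem_cat, mem_rev) !EE => nz.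
  apply/idP/idP => [|/imx].
    case/or3P=> [| |/tagK tz]; rewrite -?EE; [by move/eqP->|by move/eqP->|].
    by move: nz; rewrite tz.
  by move: nz; case: (tag z) => [|[|[|[|[|[|[|[|[|[|[|m]]]]]]]]]]].
have iy := reach_inj ry ix.
have cyz : #|Sz| = #|im y| by rewrite cz ey cy.
have [|z' [rz' ez']] := slide c4 iy cyz.
  move=> w; rewrite ey /U4 /Sy /Sz /= !(inE, mem_cat, mem_rcons) !EE => nz.
  by move: nz; case: (tag w) => [|[|[|[|[|[|m]]]]]].
case: ry => py [sy oy fy]; case: rz => pz [sz oz fz]; case: rz' => p [sp op fp].
have My : mfin (im x) py = Sy by rewrite -ey; apply/esym/(reach_im oy fy).
have Mz : mfin (im x) pz = Sz by rewrite -ez; apply/esym/(reach_im oz fz).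
have Mp : mfin Sy p = Sz by rewrite -ey -ez'; apply/esym/(reach_im op fp).
rewrite ey in op.
have [aP aO aQ] : [/\ adj a P, adj a O & adj a Q].
  by case: (H) => _ /andP[/= /andP[-> _] _] /= /andP[-> _] /andP[-> _].
have [bP bO bQ] : [/\ adj b P', adj b O' & adj b Q'].
  by case: (H) => _ /andP[_ h] _ _ /= /andP[-> _] /andP[-> _]; rewrite adjC h.
have [Ta Tb TQ TQ'] : [/\ tag a = 0%N, tag b = 1%N, tag Q = 6 & tag Q' = 7].
  by split; apply/eqP; rewrite -tE //= inE.
have nim w : tag w \in [:: 0; 1; 6; 7]%N -> w \notin im x.
  by move=> tw; apply/negP => /imx; move: tw; case: (tag w) => [|[|[|[|[|[|[|[|k]]]]]]]].
have [na nb nQ nQ'] : [/\ a \notin im x, b \notin im x, Q \notin im x & Q' \notin im x].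
  by split; apply: nim; rewrite ?Ta ?Tb ?TQ ?TQ'.
have ua : uniq [:: a; P; O; Q] by rewrite /= !inE !EE ?Ta ?TP ?TO ?TQ.
have ub : uniq [:: b; P'; O'; Q'] by rewrite /= !inE !EE ?Tb ?TP' ?TO' ?TQ'.
have [oa fa _ _ _] := star_ok adjC ua aP aO aQ iP iO na nQ.
have [ob fb _ _ _] := star_ok adjC ub bP bO bQ iP' iO' nb nQ'.
pose R := mem [:: a; P; O; Q]; pose R' := mem [:: b; P'; O'; Q'].
have sa1 : msupp R (star a P O Q) by rewrite /= !inE !eqxx ?orbT.
have sb1 : msupp R' (star b P' O' Q') by rewrite /= !inE !eqxx ?orbT.
have d1 w : R w -> ~~ U2 w.
  rewrite /R /U2 /= !(inE, mem_cat, mem_rev) !EE.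
  by case: (tag w) => [|[|[|[|[|[|[|k]]]]]]].
have d2 w : R' w -> ~~ U3 w.
  rewrite /R' /U3 /= !(inE, mem_cat, mem_rev) !EE.
  by case: (tag w) => [|[|[|[|[|[|[|[|k]]]]]]]].
have d3 w : (mem U1) w -> ~~ R w.
  rewrite /R /U1 /= !(inE, mem_cat, mem_rev) !EE.
  by case: (tag w) => [|[|[|[|[|[|[|[|k]]]]]]]].
have d4 w : (mem U1) w -> ~~ R' w.
  rewrite /R' /U1 /= !(inE, mem_cat, mem_rev) !EE.
  by case: (tag w) => [|[|[|[|[|[|[|[|k]]]]]]]].
have d5 w : (mem U1) w -> ~~ U4 w.
  rewrite /U1 /U4 /= !(inE, mem_cat, mem_rev, mem_rcons) !EE.
  by case: (tag w) => [|[|[|[|[|[|[|[|[|[|[|[|k]]]]]]]]]]]].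
have ea := el_conj Msq d1 cx sa1 sy oa oy fa; have [oa2 fa2] := loop_frame d1 sa1 sy oa fa.
have eb := el_conj Msq d2 cx sb1 sz ob oz fb; have [ob2 fb2] := loop_frame d2 sb1 sz ob fb.
rewrite -/sa My in ea oa2 fa2; rewrite -/sb Mz in eb ob2 fb2.
(* The parked strands, which the Y at [u] permutes at will. They are all strands but two, as
   [commutator_few_fixed] requires. *)
pose s := [seq t <- enum T | y t \in K].
have us : uniq s by rewrite filter_uniq // enum_uniq.
have ins t : (t \in s) = (y t \in K) by rewrite mem_filter mem_enum andbT.
have ss : size s = (n - 2)%N.
  rewrite -sK -(size_map y); apply/perm_size/uniq_perm => //.
    by rewrite map_inj_uniq.
  move=> w; apply/mapP/idP => [[t + ->]|wK]; first by rewrite ins.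
  have : w \in im y by rewrite ey inE !inE wK !orbT.
  by case/imsetP=> t _ e; exists t; rewrite ?ins -?e.
have ns : (#|T| = (#|T| - 2).+2)%N by rewrite -addn2 subnK //; exact: leq_trans n5.
have s3 : (3 <= #|T| - 2)%N by rewrite leq_subRL //; exact: leq_trans n5.
have [||c [f [hc hf hk]]] := commutator_few_fixed us; rewrite ?ss //.
have loop (g : {perm T}) : (forall t, t \notin s -> g t = t) -> exists ms,
    [/\ msupp (mem U1) ms, mok adj Sy ms, mfin Sy ms = Sy &
        rho (el M Sy ms) = (kp y)^-1 * g * kp y].
  move=> hg; have hm := subset_leq_card (finset.subsetIl (im y) [set w in U1]).
  rewrite (card_im iy) in hm.
  have [||||ms [m1 m2 m3]] := yfull adjC (f := g) iy tripod_yarms.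
  - exact: leq_trans hm sP1.
  - exact: leq_trans hm sQ1.
  - by rewrite size_rev; exact: leq_trans hm sB.
  - move=> t yU; apply: hg; rewrite ins; apply: contra yU => /KP yP.
    by rewrite inE mem_cat yP orbT.
  have l1 := loop_fin m2 m3.
  have l2 := rho_loop rhoM kp_perm rho_move iy m2 m3.
  by exists ms; rewrite -ey; split.
have [mc [mc1 mc2 mc3 mc4]] := loop c hc; have [mf [mf1 mf2 mf3 mf4]] := loop f hf.
have ec := el_conj Msq d5 cy mc1 sp mc2 op mc3; have [oc2 fc2] := loop_frame d5 mc1 sp mc2 mc3.
have ef := el_conj Msq d5 cy mf1 sp mf2 op mf3; have [of2 ff2] := loop_frame d5 mf1 sp mf2 mf3.
rewrite Mp in ec oc2 fc2 ef of2 ff2.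
set gc := el M Sy mc in mc4 ec; set gf := el M Sy mf in mf4 ef.
apply: (triple_obstruction (rhoatM rhoM kp x) n5 hp (k := gc * gf * gc^-1 * gf^-1)
  (d2 := (el M (im x) py)^-1) (d3 := (el M (im x) pz)^-1) (d := (el M Sy p)^-1)).
- by move=> z1; rewrite !rexpM !(ihomV (fun g h => rexpM z1 g h)) GRing.addrAC GRing.addrK GRing.subrr.
- by rewrite invgK -ea; apply: commuteC4; apply: (el_loops Msq d3).
- by rewrite !invgK conjC4 -ec -ef -eb; apply: commuteC4; apply: (el_loops Msq d4).
move=> l ul sl hl; pose h := kp x * (kp y)^-1.
have hE : rhoat rho kp x (gc * gf * gc^-1 * gf^-1) = h * (c * f * c^-1 * f^-1) * h^-1.
  by rewrite /rhoat !rhoM !(rhoV rhoM) mc4 mf4 /h !invgM !invgK !mulgA !mulgK.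
apply: (hk (map h l)); rewrite ?size_map //; first by rewrite map_inj_uniq //; exact: perm_inj.
move=> _ /mapP[t /hl + ->]; rewrite hE => e.
apply: (@perm_inj _ h^-1); rewrite permK -[RHS]e -!permM; congr (_ _ t).
exact: conj_square.
Qed.
End Tripod.

(** * Exponent sums on a theta graph *)

Section Theta.
Local Open Scope group_scope.
Variables (V : finType) (adj : rel V).
Hypothesis adjC : symmetric adj.
Variables (X : finType) (Rl : rel X).
Notation G := (raag Rl).
Variable T : finType.
Notation n := #|T|.
Variable M : {set V} -> V -> V -> G.
Hypothesis Minv : forall (S : {set V}) u w, #|S| = n -> mvok adj S u w -> M (mvS S u w) w u = (M S u w)^-1.
Hypothesis Msq : forall (S : {set V}) u w u' w', #|S| = n -> mvok adj S u w -> mvok adj S u' w' ->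
  uniq [:: u; w; u'; w'] ->
  M S u w * M (mvS S u w) u' w' = M S u' w' * M (mvS S u' w') u w.
Implicit Types (p q : seq V) (Z : {set V}) (u z : V).

Section Weights.
Variable e : G -> int.
Hypothesis eM : ihom e.
Import GRing.Theory.
Local Open Scope ring_scope.

Definition weight (S : {set V}) ms : int := e (el M S ms).

Lemma weight_cat S ms ms' : weight S (ms ++ ms') = weight S ms + weight (mfin S ms) ms'.
Proof. by rewrite /weight el_cat eM. Qed.

Lemma weight_back (S : {set V}) u w : #|S| = n -> mvok adj S u w ->
  weight (mvS S u w) [:: (w, u)] = - weight S [:: (u, w)].
Proof. by move=> c h; rewrite /weight /= !mulg1 Minv // (ihomV eM). Qed.

Lemma weight_square (R R' : pred V) (S : {set V}) ms ms' : (forall v, R v -> ~~ R' v) -> #|S| = n ->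
  msupp R ms -> msupp R' ms' -> mok adj S ms -> mok adj S ms' ->
  weight S ms + weight (mfin S ms) ms' = weight S ms' + weight (mfin S ms') ms.
Proof. by move=> d c h h' o o'; rewrite /weight -!eM (el_commute Msq d). Qed.

(** The weight of carrying one token along [p] while the others rest on [Z]. The comparison of the
    two exchanges rests on how this varies with [Z]. *)
Definition seg u p Z := weight (u |: Z) (wlk u p).

Definition segok u p Z := [/\ path adj u p, uniq (u :: p), all (fun v => v \notin Z) (u :: p) & (#|Z|).+1 = n].

Lemma segP u p Z : segok u p Z -> [/\ #|u |: Z| = n, mok adj (u |: Z) (wlk u p) &
  mfin (u |: Z) (wlk u p) = last u p |: Z].
Proof.
case=> pth un /= /andP[uZ aZ] cZ.
have [||h1 h2] := wlk_mfin (S := u |: Z) _ pth un; rewrite ?setU11 //.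
  apply/allP => v vp; rewrite !inE negb_or (allP aZ _ vp) andbT.
  by apply: contraTneq vp => ->; case/andP: un.
by split=> //; [rewrite cardsU1 uZ|rewrite h2 setU1K].
Qed.

(** For two tokens on disjoint paths, the change of the first path's weight caused by moving the
    second token equals the change of the second path's weight caused by moving the first token. *)
Lemma seg_square u p z q (Z : {set V}) : path adj u p -> path adj z q -> uniq ((u :: p) ++ z :: q) ->
  all (fun v => v \notin Z) ((u :: p) ++ z :: q) -> (#|Z|).+2 = n ->
  seg u p (z |: Z) + seg z q (last u p |: Z) = seg z q (u |: Z) + seg u p (last z q |: Z).
Proof.
move=> pu pz; rewrite cat_uniq all_cat => /and3P[uu /hasPn d uz] /andP[aZu aZz] cZ.
have nz v w : v \in u :: p -> w \in z :: q -> v != w.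
  by move=> h1 h2; apply: contraTneq h1 => ->; exact: d.
have ok1 w : w \in z :: q -> segok u p (w |: Z).
  move=> wq; split=> //; last by rewrite cardsU1 (allP aZz _ wq).
  by apply/allP => v vp; rewrite !inE negb_or (allP aZu _ vp) andbT nz.
have ok2 w : w \in u :: p -> segok z q (w |: Z).
  move=> wp; split=> //; last by rewrite cardsU1 (allP aZu _ wp).
  by apply/allP => v vq; rewrite !inE negb_or (allP aZz _ vq) andbT eq_sym nz.
have [c1 o1 f1] := segP (ok1 z (mem_head _ _)); have [_ o2 f2] := segP (ok2 u (mem_head _ _)).
have E (v w : V) : v |: (w |: Z) = w |: (v |: Z) by rewrite finset.setUCA.
have := @weight_square (mem (u :: p)) (mem (z :: q)) (u |: (z |: Z)) (wlk u p) (wlk z q).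
rewrite o1 f1 !(E u) o2 f2 /seg !(E u) !(E z) (E (last z q)) => -> //.
- by move=> v /= vp; apply/negP => /d; rewrite vp.
- by apply: wlk_supp; rewrite /= ?mem_head //; apply/allP => v vp; exact: mem_behead.
- by apply: wlk_supp; rewrite /= ?mem_head //; apply/allP => v vp; exact: mem_behead.
Qed.

(** The same with a sequence of moves in place of the second path, as needed on the crowded arc,
    where several tokens have to move. *)
Lemma seg_env (R : pred V) u p ms (Z Z' : {set V}) : segok u p Z -> all (predC R) (u :: p) -> msupp R ms ->
  mok adj (u |: Z) ms -> mfin (u |: Z) ms = u |: Z' ->
  seg u p Z + weight (last u p |: Z) ms = weight (u |: Z) ms + seg u p Z'.
Proof.
move=> ok aR sR om fm; have [c o f] := segP ok; rewrite /seg -f -fm.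
apply: (@weight_square (mem (u :: p)) R) => //.
- by move=> v /= vp; exact: (allP aR).
- by apply: wlk_supp; rewrite /= ?mem_head //; apply/allP => v vp; exact: mem_behead.
Qed.

Lemma seg_step u v p Z : segok u (v :: p) Z -> seg u (v :: p) Z = seg u [:: v] Z + seg v p Z.
Proof.
case=> /= /andP[a pth] /and3P[+ vp up] /and3P[uZ vZ aZ] cZ; rewrite inE negb_or => /andP[uv nu].
have ok : segok u [:: v] Z by split; rewrite /= ?a ?inE ?uv ?uZ ?vZ.
have [c o f] := segP ok; rewrite /seg.
by have -> : wlk u (v :: p) = wlk u [:: v] ++ wlk v p by []; rewrite weight_cat f.
Qed.

Lemma seg_back u w (Z : {set V}) : adj u w -> u != w -> u \notin Z -> w \notin Z -> (#|Z|).+1 = n ->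
  seg w [:: u] Z = - seg u [:: w] Z.
Proof.
move=> a uw uZ wZ cZ; have ok : segok u [:: w] Z by split; rewrite /= ?a ?inE ?uw ?uZ ?wZ.
have [c o f] := segP ok; rewrite /seg -f /= -(weight_back c) //.
by move: o => /= /andP[].
Qed.

(** Each edge at [a] is traversed once in either direction, with the other token in two different
    places; so the weight is a sum of three differences. *)
Lemma weight_star a P O Q (R : {set V}) : uniq [:: a; P; O; Q] -> adj a P -> adj a O -> adj a Q ->
  all (fun v => v \notin R) [:: a; P; O; Q] -> (#|R|).+2 = n ->
  weight (P |: (O |: R)) (star a P O Q) =
    seg P [:: a] (O |: R) - seg Q [:: a] (O |: R) + seg O [:: a] (Q |: R) - seg P [:: a] (Q |: R)
    + seg Q [:: a] (P |: R) - seg O [:: a] (P |: R).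
Proof.
move=> u4 aP aO aQ /= /and5P[aR PR OR QR _] cR.
have [/and3P[naP naO naQ] /andP[PO PQ] OQ] :
  [/\ [&& a != P, a != O & a != Q], (P != O) && (P != Q) & O != Q].
  by move: u4; rewrite /= !inE !negb_or !andbT => /and3P.
have cE w : w \notin R -> (#|w |: R|).+1 = n by move=> h; rewrite cardsU1 h.
have ok v w z : v != a -> w != a -> v != w -> z != v -> z != a -> z != w -> adj a v -> adj a w ->
   v \notin R -> w \notin R -> z \notin R -> segok v [:: a; w] (z |: R).
  move=> va wa vw zv za zw av aw vR wR zR; split; last exact: cE.
  - by rewrite /= adjC av aw.
  - by rewrite /= !inE negb_or va vw eq_sym wa.
  - by rewrite /= !inE !negb_or !(eq_sym _ z) zv za zw vR aR wR.
have bk v w : v != a -> w != a -> v != w -> adj a v -> v \notin R -> w \notin R ->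
   seg a [:: v] (w |: R) = - seg v [:: a] (w |: R).
  move=> va wa vw av vR wR; apply: seg_back; rewrite 1?adjC ?cE ?inE ?negb_or //.
    by rewrite vw.
  by rewrite eq_sym wa.
have ok1 : segok P [:: a; Q] (O |: R) by apply: ok => //; rewrite eq_sym.
have ok2 : segok O [:: a; P] (Q |: R) by apply: ok => //; rewrite eq_sym.
have ok3 : segok Q [:: a; O] (P |: R) by apply: ok => //; rewrite eq_sym.
have [_ _ f1] := segP ok1; have [_ _ f2] := segP ok2.
have -> : star a P O Q = wlk P [:: a; Q] ++ wlk O [:: a; P] ++ wlk Q [:: a; O] by [].
have e1 : Q |: (O |: R) = O |: (Q |: R) by exact: finset.setUCA.
have e2 : P |: (Q |: R) = Q |: (P |: R) by exact: finset.setUCA.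
rewrite !weight_cat f1 [last P _]/= e1 f2 [last O _]/= e2 -/(seg P _ _) -/(seg O _ _) -/(seg Q _ _).
rewrite (seg_step ok1) (seg_step ok2) (seg_step ok3) (bk Q O) // 1?eq_sym //.
rewrite (bk P Q) // 1?eq_sym // (bk O P) // 1?eq_sym //.
by rewrite !addrA.
Qed.
End Weights.

Variable rho : G -> {perm T}.
Hypothesis rhoM : forall g h, rho (g * h) = rho g * rho h.
Variable kp : (T -> V) -> {perm T}.
Hypothesis kp_perm : forall x (s : {perm T}), injective x -> kp (x \o s) = s * kp x.
Hypothesis rho_move : forall x i w, injective x -> adj (x i) w -> w \notin im x ->
  rho (M (im x) (x i) w) = (kp x)^-1 * kp (upd x i w).
Variables (a b O O' P P' Q Q' : V) (wi Pa Qa Pb Qb : seq V).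
Hypothesis H : htree adj T a b O O' P P' Q Q' wi Pa Qa Pb Qb.
Hypotheses (hP : adj (last P Pa) (last P' Pb)) (hQ : adj (last Q Qa) (last Q' Qb)).
Hypothesis n5 : (5 <= n)%N.

Lemma close_path (p p' : V) (Pp Pp' : seq V) (c c' : V) : path adj c (p :: Pp) -> path adj c' (p' :: Pp') ->
  adj (last p Pp) (last p' Pp') -> path adj p (Pp ++ rev (p' :: Pp')) /\
  last p (Pp ++ rev (p' :: Pp')) = p'.
Proof.
move=> /= /andP[_ h1] /andP[_ h2] h; split; last by rewrite last_cat rev_cons last_rcons.
rewrite cat_path h1 (lastI p') rev_rcons /= h.
exact: path_sym h2.
Qed.

Lemma theta_contradiction : False.
Proof.
have [hPa hQa hPb hQb] : [/\ path adj a (P :: Pa), path adj a (Q :: Qa), path adj b (P' :: Pb) &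
  path adj b (Q' :: Qb)] by case: (H).
have [p2 l2] := close_path hPa hPb hP; have [p3 l3] := close_path hQa hQb hQ.
set f2 := Pa ++ _ in p2 l2; set f3 := Qa ++ _ in p3 l3.
have [ts [tsP st]] : exists ts : seq T, perm_eq ts (enum T) /\ size ts = n.
  by exists (enum T); rewrite -cardE.
case: ts tsP st => [|t1 [|t2 [|t3 [|t4 r]]]] tsP /= st; try by move: n5; rewrite -st.
have [x [ix xt xr]] := ht_place H tsP.
have hp := ht_pair adjC Msq rhoM kp_perm rho_move H tsP ix xt xr.
set sa := el M (im x) _ in hp; set sb := el M (im x) _ in hp.
apply: (pair_homologous (rhoatM rhoM kp x) n5 hp) => g.
have cx : #|im x| = n by exact: card_im.
have tE := segE (ht_uniq H); set tag := seg_tag _ in tE.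
have [Ea Eb EO EO'] : [/\ forall v, (v == a) = (tag v == 0%N), forall v, (v == b) = (tag v == 1%N),
   forall v, (v == O) = (tag v == 2) & forall v, (v == O') = (tag v == 3)].
  by split=> v; rewrite -tE //= inE.
have [EP EP' EQ EQ'] : [/\ forall v, (v == P) = (tag v == 4), forall v, (v == P') = (tag v == 5),
   forall v, (v == Q) = (tag v == 6) & forall v, (v == Q') = (tag v == 7)].
  by split=> v; rewrite -tE //= inE.
have [Ew EPa EQa [EPb EQb]] : [/\ forall v, (v \in wi) = (tag v == 8), forall v, (v \in Pa) = (tag v == 9),
  forall v, (v \in Qa) = (tag v == 10) & (forall v, (v \in Pb) = (tag v == 11)) /\
  forall v, (v \in Qb) = (tag v == 12)] by split=> [v|v|v|]; [| | |split=> v]; rewrite -tE.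
have EE := (Ea, Eb, EO, EO', EP, EP', EQ, EQ', Ew, EPa, EQa, EPb, EQb).
have [TP TO TP' TO'] : [/\ tag P = 4, tag O = 2, tag P' = 5 & tag O' = 3].
  by split; apply/eqP; rewrite -tE //= inE.
have [Ta Tb TQ TQ'] : [/\ tag a = 0%N, tag b = 1%N, tag Q = 6 & tag Q' = 7].
  by split; apply/eqP; rewrite -tE //= inE.
have TT := (Ta, Tb, TP, TO, TP', TO', TQ, TQ').
(* With [n - 2] tokens parked on the first arc, each exchange involves just two further tokens, near
   [a] or near [b]. *)
pose R : {set V} := [set v in take (n - 2) wi].
have uw : uniq wi.
  by have := uniq_segs (ht_uniq H) (kb := [:: (8, false)]%N) isT isT; rewrite /hsegs /= cats0.
have RE v : v \in R -> tag v = 8 by rewrite inE => /mem_take; rewrite Ew => /eqP.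
have cR : (#|R|).+2 = n.
  rewrite cardsE (card_uniqP (take_uniq _ uw)) size_takel.
    by rewrite -addn2 subnK //; exact: leq_trans n5.
  by apply: leq_trans (ht_swi H); exact: leq_subr.
have nR v : tag v != 8 -> v \notin R by apply: contra => /RE ->.
have [aP aO aQ] : [/\ adj a P, adj a O & adj a Q].
  by case: (H) => _ /andP[/= /andP[-> _] _] /= /andP[-> _] /andP[-> _].
have [bP bO bQ] : [/\ adj b P', adj b O' & adj b Q'].
  by case: (H) => _ /andP[_ h] _ _ /= /andP[-> _] /andP[-> _]; rewrite adjC h.
have imx v : v \in im x -> [|| tag v == 4, tag v == 2, tag v == 5, tag v == 3 | tag v == 8].
  case/imsetP=> t _ ->; have : x t \in map x ([:: t1; t2; t3; t4] ++ r).
    by apply: map_f; rewrite (perm_mem tsP) mem_enum.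
  rewrite map_cat xt xr mem_cat !inE !EE => /orP[|/mem_take].
    by case/or4P=> ->; rewrite ?orbT.
  by rewrite Ew => ->; rewrite ?orbT.
have inx : [/\ P \in im x, O \in im x, P' \in im x & O' \in im x].
  by case: xt => <- <- <- <-; split; exact: mem_im.
have [iP iO iP' iO'] := inx.
have cc (p o : V) : tag p != tag o -> tag p != 8 -> tag o != 8 -> #|p |: (o |: R)| = n.
  move=> po hp' ho; rewrite !cardsU1 finset.in_setU1 negb_or !nR // andbT.
  by case: eqVneq => [e|_]; [rewrite e eqxx in po|].
pose Ca : {set V} := P |: (O |: R); pose Cb : {set V} := P' |: (O' |: R).
have pA : path adj P' (b :: O' :: rev wi).
  case: (H) => _ /andP[/= /andP[_ h1] h2] _ _ /= /andP[h3 _] _ *.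
  have := path_sym adjC h1; rewrite last_rcons belast_rcons rev_cons -cats1 cat_path => /andP[-> _].
  by rewrite adjC h3 adjC h2.
have pB : path adj P (a :: O :: wi).
  case: (H) => _ /andP[/= /andP[h1 h2] _] /= /andP[h3 _] *.
  by rewrite adjC h3 h1; move: h2; rewrite -cats1 cat_path => /andP[-> _].
have cCa : #|Ca| = n by apply: cc; rewrite !TT.
have cCb : #|Cb| = n by apply: cc; rewrite !TT.
have [|y [[py [sy oy fy]] ey]] := slide (conn_path adjC pA) ix (etrans cCa (esym cx)).
  move=> v; rewrite /Ca /= !(inE, mem_rev) !EE => nz.
  apply/idP/idP => [|/imx].
    case/or3P=> [| |/mem_take vR]; rewrite -?EE; [by move/eqP->|by move/eqP->|].
    by move: vR nz; rewrite Ew => /eqP ->.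
  by move: nz; case: (tag v) => [|[|[|[|[|[|[|[|[|m]]]]]]]]].
have [|y' [[py' [sy' oy' fy']] ey']] := slide (conn_path adjC pB) ix (etrans cCb (esym cx)).
  move=> v; rewrite /Cb /= !inE !EE => nz.
  apply/idP/idP => [|/imx].
    case/or3P=> [| |/mem_take vR]; rewrite -?EE; [by move/eqP->|by move/eqP->|].
    by move: vR nz; rewrite Ew => /eqP ->.
  by move: nz; case: (tag v) => [|[|[|[|[|[|[|[|[|m]]]]]]]]].
have [na nb nQ nQ'] : [/\ a \notin im x, b \notin im x, Q \notin im x & Q' \notin im x].
  by split; apply/negP => /imx; rewrite !TT.
have ua : uniq [:: a; P; O; Q] by rewrite /= !inE !EE !TT.
have ub : uniq [:: b; P'; O'; Q'] by rewrite /= !inE !EE !TT.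
have [oa fa _ _ _] := star_ok adjC ua aP aO aQ iP iO na nQ.
have [ob fb _ _ _] := star_ok adjC ub bP bO bQ iP' iO' nb nQ'.
have eM : ihom (fun z : G => rexp g z) by move=> z z'; exact: rexpM.
have cnj (z w : G) : rexp g (w^-1 * z * w) = rexp g z.
  by rewrite !eM (ihomV eM) GRing.addrAC GRing.addNr GRing.add0r.
have da v : (mem [:: a; P; O; Q]) v -> ~~ (mem [:: P', b, O' & rev wi]) v.
  by rewrite /= !(inE, mem_rev) !EE; case: (tag v) => [|[|[|[|[|[|[|k]]]]]]].
have db v : (mem [:: b; P'; O'; Q']) v -> ~~ (mem [:: P, a, O & wi]) v.
  by rewrite /= !(inE, mem_rev) !EE; case: (tag v) => [|[|[|[|[|[|[|[|k]]]]]]]].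
have spa : msupp (mem [:: a; P; O; Q]) (star a P O Q) by rewrite /= !inE !eqxx ?orbT.
have spb : msupp (mem [:: b; P'; O'; Q']) (star b P' O' Q') by rewrite /= !inE !eqxx ?orbT.
have nRa : all (fun v => v \notin R) [:: a; P; O; Q] by rewrite /= !nR // !TT.
have nRb : all (fun v => v \notin R) [:: b; P'; O'; Q'] by rewrite /= !nR // !TT.
have wsa := weight_star (e := rexp g) eM ua aP aO aQ nRa cR.
have wsb := weight_star (e := rexp g) eM ub bP bO bQ nRb cR.
have ea : rexp g sa = weight (rexp g) Ca (star a P O Q).
  have h := el_conj Msq da cx spa sy oa oy fa.
  by rewrite /weight -ey (reach_im oy fy) h cnj.
have eb : rexp g sb = weight (rexp g) Cb (star b P' O' Q').
  have h := el_conj Msq db cx spb sy' ob oy' fb.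
  by rewrite /weight -ey' (reach_im oy' fy') h cnj.
rewrite ea eb.
have iy : injective y by apply: reach_inj ix; exists py; split; [exact: sy|exact: oy|exact: fy].
(* The moves [mu] have the effect of a token passing from [O] to [O'] through the crowded arc. The
   same sequence works for any position [u] of the other token off that arc ([env]). *)
have pE : path adj O (rcons wi O') by case: (H) => _ /andP[/= /andP[_ ->]].
have cS : #|P |: (O' |: R)| = #|im y| by rewrite ey cCa; apply: cc; rewrite !TT.
have [|z [[mu [smu omu fmu]] ez]] := slide (conn_path adjC pE) iy cS.
  move=> v; rewrite ey /Ca /= !(inE, mem_rcons) !EE => nz.
  by move: nz; case: (tag v) => [|[|[|[|m]]]].
have zmu := reach_im omu fmu; rewrite ez ey in zmu; rewrite ey in omu.
have env (u : V) : tag u \notin [:: 2; 3; 8]%N -> mok adj (u |: (O |: R)) mu /\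
    mfin (u |: (O |: R)) mu = u |: (O' |: R).
  rewrite !inE !negb_or => /and3P[u2 u3 u8].
  have ag (v w : V) : v \in O :: rcons wi O' -> (v \in P |: (w |: R)) = (v \in u |: (w |: R)).
    move=> hv; rewrite !(inE, mem_rcons) !EE in hv *.
    have [e|_] := eqVneq v u; first by move: hv u2 u3 u8; rewrite -e => /or3P[] ->.
    by move: hv; case: (tag v) => [|[|[|[|[|m]]]]].
  have [h1 h2] := mok_frame adj (S := Ca) (S' := u |: (O |: R)) smu (fun v h => ag v O h).
  split; [by rewrite -h1|apply/setP => v].
  have [hv|hv] := boolP (v \in O :: rcons wi O').
    by rewrite -h2; [rewrite -zmu ag|].
  rewrite (mfin_out _ smu hv); move: hv; rewrite !(inE, mem_rcons) !EE => hv.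
  by move: hv; case: (tag v) => [|[|[|[|m]]]].
pose sel (k : nat * bool) := if k.2 then rev (nth [::] (hsegs a b O O' P P' Q Q' wi Pa Qa Pb Qb) k.1)
  else nth [::] (hsegs a b O O' P P' Q Q' wi Pa Qa Pb Qb) k.1.
have selR (ka : seq (nat * bool)) : all (fun k => k.1 < 13)%N ka -> 8 \notin map fst ka ->
    all (fun v => v \notin R) (flatten (map sel ka)).
  move=> h8 n8; apply/allP => v /flattenP[_ /mapP[k kin ->] vk]; apply: nR.
  have hk : (k.1 < 13)%N := allP h8 _ kin.
  have : v \in nth [::] (hsegs a b O O' P P' Q Q' wi Pa Qa Pb Qb) k.1.
    by move: vk; rewrite /sel; case: ifP; rewrite ?mem_rev.
  rewrite (tE v k.1 hk) => /eqP ->; apply/eqP => e8; move/negP: n8; apply; rewrite -e8.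
  exact: (map_f fst kin).
have sq (ka kb : seq (nat * bool)) (u : V) (p : seq V) (z' : V) (q : seq V) :
    u :: p = flatten (map sel ka) -> z' :: q = flatten (map sel kb) ->
    uniq (map fst (ka ++ kb)) -> all (fun k => k.1 < 13)%N (ka ++ kb) -> 8 \notin map fst (ka ++ kb) ->
    path adj u p -> path adj z' q ->
    (seg (rexp g) u p (z' |: R) + seg (rexp g) z' q (last u p |: R) =
     seg (rexp g) z' q (u |: R) + seg (rexp g) u p (last z' q |: R))%R.
  move=> e1 e2 uk ak n8 h1 h2.
  have A1 : uniq ((u :: p) ++ z' :: q).
    rewrite e1 e2 -flatten_cat -map_cat; exact: (uniq_segs (ht_uniq H) uk ak).
  have A2 : all (fun v => v \notin R) ((u :: p) ++ z' :: q).
    rewrite e1 e2 -flatten_cat -map_cat; exact: selR ak n8.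
  exact: (seg_square eM h1 h2 A1 A2 cR).
have ev (ka : seq (nat * bool)) (u : V) (p : seq V) :
    u :: p = flatten (map sel ka) ->
    uniq (map fst ka) -> all (fun k => k.1 < 13)%N ka -> all (fun k => k \notin [:: 2; 3; 8]%N) (map fst ka) ->
    path adj u p ->
    (seg (rexp g) u p (O |: R) + weight (rexp g) (last u p |: (O |: R)) mu =
     weight (rexp g) (u |: (O |: R)) mu + seg (rexp g) u p (O' |: R))%R.
  move=> e1 uk ak n8 h1.
  have tg v : v \in u :: p -> tag v \notin [:: 2; 3; 8]%N.
    rewrite e1 => /flattenP[_ /mapP[k kin ->] vk].
    have hk : (k.1 < 13)%N := allP ak _ kin.
    have : v \in nth [::] (hsegs a b O O' P P' Q Q' wi Pa Qa Pb Qb) k.1.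
      by move: vk; rewrite /sel; case: ifP; rewrite ?mem_rev.
    by rewrite (tE v k.1 hk) => /eqP ->; apply: (allP n8); exact: (map_f fst kin).
  have [ o1 f1] := env u (tg _ (mem_head _ _)).
  have A1 : uniq (u :: p) by rewrite e1; exact: (uniq_segs (ht_uniq H) uk ak).
  have A2 : all (fun v => v \notin O |: R) (u :: p).
    apply/allP => v /tg; rewrite finset.in_setU1 !inE !negb_or EO => /and3P[-> _ t8].
    by have := nR _ t8; rewrite inE.
  have A3 : (#|O |: R|).+1 = n by rewrite cardsU1 nR ?TO.
  have A4 : all (predC (mem (O :: rcons wi O'))) (u :: p).
    by apply/allP => v /tg; rewrite /= !(inE, mem_rcons) !negb_or !EE => /and3P[-> -> ->].
  exact: (seg_env eM (And4 h1 A1 A2 A3) A4 smu o1 f1).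
(* The pieces of the theta graph by segment indices: [ka i] and [kb i] are single edges at [a] and
   at [b], [k2] and [k3] the second and the third arc. *)
pose ka (i : nat) := [:: (i, false); (0, false)]%N.
pose kb (i : nat) := [:: (i, false); (1, false)]%N.
pose k2 := [:: (4, false); (9, false); (11, true); (5, false)]%N.
pose k3 := [:: (6, false); (10, false); (12, true); (7, false)]%N.
have e2 : P :: f2 = flatten (map sel k2) by rewrite /sel /f2 /= rev_cons -cats1.
have e3 : Q :: f3 = flatten (map sel k3) by rewrite /sel /f3 /= rev_cons -cats1.
have wa (v : V) (h : adj a v) : path adj v [:: a] := introT andP (conj (etrans (adjC v a) h) isT).
have wb (v : V) (h : adj b v) : path adj v [:: b] := introT andP (conj (etrans (adjC v b) h) isT).
have r1 := sq (ka 2) k2 O [:: a] P f2 erefl e2 isT isT isT (wa _ aO) p2.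
have r2 := sq (ka 2) k3 O [:: a] Q f3 erefl e3 isT isT isT (wa _ aO) p3.
have r3 := sq (ka 2) (kb 5) O [:: a] P' [:: b] erefl erefl isT isT isT (wa _ aO) (wb _ bP).
have r4 := sq (ka 2) (kb 7) O [:: a] Q' [:: b] erefl erefl isT isT isT (wa _ aO) (wb _ bQ).
have r5 := sq (ka 4) k3 P [:: a] Q f3 erefl e3 isT isT isT (wa _ aP) p3.
have r6 := sq (ka 6) k2 Q [:: a] P f2 erefl e2 isT isT isT (wa _ aQ) p2.
have r7 := sq k2 k3 P f2 Q f3 e2 e3 isT isT isT p2 p3.
have r8 := sq (ka 6) (kb 5) Q [:: a] P' [:: b] erefl erefl isT isT isT (wa _ aQ) (wb _ bP).
have r9 := sq (ka 6) (kb 7) Q [:: a] Q' [:: b] erefl erefl isT isT isT (wa _ aQ) (wb _ bQ).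
have s1 := sq (kb 3) k2 O' [:: b] P f2 erefl e2 isT isT isT (wb _ bO) p2.
have s2 := sq (kb 3) k3 O' [:: b] Q f3 erefl e3 isT isT isT (wb _ bO) p3.
have s3 := sq (kb 3) (ka 4) O' [:: b] P [:: a] erefl erefl isT isT isT (wb _ bO) (wa _ aP).
have s4 := sq (kb 3) (ka 6) O' [:: b] Q [:: a] erefl erefl isT isT isT (wb _ bO) (wa _ aQ).
have s5 := sq (kb 5) k3 P' [:: b] Q f3 erefl e3 isT isT isT (wb _ bP) p3.
have s6 := sq (kb 7) k2 Q' [:: b] P f2 erefl e2 isT isT isT (wb _ bQ) p2.
have s8 := sq (ka 4) (kb 5) P [:: a] P' [:: b] erefl erefl isT isT isT (wa _ aP) (wb _ bP).
have s9 := sq (ka 4) (kb 7) P [:: a] Q' [:: b] erefl erefl isT isT isT (wa _ aP) (wb _ bQ).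
have v1 := ev (ka 4) P [:: a] erefl isT isT isT (wa _ aP).
have v2 := ev (ka 6) Q [:: a] erefl isT isT isT (wa _ aQ).
have v3 := ev (kb 5) P' [:: b] erefl isT isT isT (wb _ bP).
have v4 := ev (kb 7) Q' [:: b] erefl isT isT isT (wb _ bQ).
have v5 := ev k2 P f2 e2 isT isT isT p2.
have v6 := ev k3 Q f3 e3 isT isT isT p3.
(* Carrying the two tokens over to [b] along the arcs turns the differences at [a] into those at [b]
   with opposite sign. All relations are linear in the weights. *)
rewrite wsa wsb; move: r1 r2 r3 r4 r5 r6 r7 r8 r9 s1 s2 s3 s4 s5 s6 s8 s9 v1 v2 v3 v4 v5 v6.
rewrite l2 l3; clear - adjC => /=; lia.
Qed.
End Theta.

(** * Counting passages through gates *)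

Section Gates.
Import GRing.Theory.
Local Open Scope ring_scope.
Variables (V : finType) (adj : rel V).
Hypothesis adjC : symmetric adj.
Variables (X : finType) (Rl : rel X).
Notation G := (raag Rl).
Variable n : nat.
Variable M : {set V} -> V -> V -> G.
Implicit Types (p q : seq V) (S : {set V}) (u z : V).

(* [v al] records the passages through the edge [a r]: a token going from [a] to [r] while
   [k] tokens lie in [D] contributes [al k], the opposite passage contributes [- al k]. *)
Record gate (a r : V) (D : {set V}) (v : (nat -> int) -> G -> int) (c : (nat -> int) -> {set V} -> int) : Prop := Gate {
  gate_hom : forall al, ihom (v al);
  gate_heis : forall al al', heis (v al) (v al');
  gate_move : forall al S u w, #|S| = n -> mvok adj S u w -> v al (M S u w) = c al S - c al (mvS S u w) +
    (if (u == a) && (w == r) then al #|S :&: D| else if (u == r) && (w == a) then - al #|S :&: D| else 0) }.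

Section OneGate.
Variables (a r : V) (D : {set V}) (v : (nat -> int) -> G -> int) (c : (nat -> int) -> {set V} -> int).
Hypothesis gt : gate a r D v c.
Variable al : nat -> int.

Fixpoint passage S ms : int := if ms is m :: ms' then
  (if (m.1 == a) && (m.2 == r) then al #|S :&: D| else if (m.1 == r) && (m.2 == a) then - al #|S :&: D| else 0)
  + passage (mvS S m.1 m.2) ms' else 0.

Lemma gate_el S ms : #|S| = n -> mok adj S ms -> v al (el M S ms) = c al S - c al (mfin S ms) + passage S ms.
Proof.
elim: ms S => [|[u w] ms IH] S cS /=; first by move=> _; rewrite (ihom1 (gate_hom gt al)) subrr add0r.
case/andP=> h hms; rewrite (gate_hom gt) (gate_move gt) // IH ?(card_mvS h) //.
by rewrite addrACA subrKA -!addrA; congr (_ + _); rewrite addrCA.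
Qed.

Lemma gate_loop S ms : #|S| = n -> mok adj S ms -> mfin S ms = S -> v al (el M S ms) = passage S ms.
Proof. by move=> cS o f; rewrite gate_el // f subrr add0r. Qed.

Lemma passage_out (R : pred V) S ms : ~~ R a -> msupp R ms -> passage S ms = 0.
Proof.
move=> nR; elim: ms S => //= [[u w] ms] IH S /andP[/= /andP[Ru Rw] hms]; rewrite IH // addr0.
have -> : (u == a) = false by apply: contraNF nR => /eqP <-.
have -> : (w == a) = false by apply: contraNF nR => /eqP <-.
by rewrite andbF.
Qed.

Lemma card_mvSI S u w : mvok adj S u w -> (#|mvS S u w :&: D| + (u \in D) = #|S :&: D| + (w \in D))%N.
Proof.
case/and3P=> _ uS wS; have uw : u != w by apply: contraNneq wS => <-.
have h1 : (#|S :&: D| = (u \in D) + #|(S :\ u) :&: D|)%N.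
  rewrite (cardsD1 u) inE uS /=; congr (_ + _)%N; apply: eq_card => x.
  by rewrite !inE andbA.
have h2 : (#|mvS S u w :&: D| = (w \in D) + #|(S :\ u) :&: D|)%N.
  rewrite (cardsD1 w) !inE eqxx /=; congr (_ + _)%N; apply: eq_card => x; rewrite !inE.
  by case: (eqVneq x w) => //= ->; rewrite (negbTE wS) andbF.
by rewrite h1 h2; lia.
Qed.

(** The token from [P] leaves through the gate with [k] tokens in [D]. It returns after the other
    token has moved to [P], hence with [k.+1] tokens in [D]. *)
Lemma passage_star S P O k : uniq [:: a; P; O; r] -> mok adj S (star a P O r) ->
  P \in D -> O \notin D -> a \notin D -> r \notin D -> #|S :&: D| = k.+1 ->
  passage S (star a P O r) = al k - al k.+1.
Proof.
move=> u4 + PD OD aD rD hk.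
have [/and3P[nP nO nr] /andP[nPO nPr] nOr] :
  [/\ [&& a != P, a != O & a != r], (P != O) && (P != r) & O != r].
  by move: u4; rewrite /= !inE !negb_or !andbT => /and3P.
rewrite /star [mok _ _ _]/= => /and5P[m1 m2 m3 m4 /and3P[m5 _ _]].
have d1 := card_mvSI m1; have d2 := card_mvSI m2; have d3 := card_mvSI m3; have d4 := card_mvSI m4.
rewrite PD (negbTE OD) (negbTE aD) (negbTE rD) hk in d1 d2 d3 d4.
rewrite !addn0 ?addn1 in d1 d2 d3 d4; case: d1 => d1; rewrite d3 d2 d1 in d4.
rewrite /= d1 d4 !eqxx !(eq_sym _ a) (negbTE nP) (negbTE nO) (negbTE nr) (negbTE nPr) (negbTE nOr) /=.
by rewrite ?andbF ?add0r ?addr0 ?(eq_sym r) ?(negbTE nr) /= ?add0r.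
Qed.
End OneGate.

Lemma slide_sets (R : pred V) (S S' : {set V}) : conn adj R -> #|S'| = #|S| ->
  (forall v, ~~ R v -> (v \in S') = (v \in S)) ->
  exists ms, [/\ msupp R ms, mok adj S ms & mfin S ms = S'].
Proof.
move=> cR cS out; pose x (i : 'I_#|S|) := enum_val i.
have ix : injective x by exact: enum_val_inj.
have ex : im x = S.
  apply/setP => v; apply/imsetP/idP => [[i _ ->]|vS]; first exact: enum_valP.
  by exists (enum_rank_in vS v); rewrite // /x enum_rankK_in.
have [||y [[ms [h o f]] ey]] := @slide _ adj _ R x S' cR ix; rewrite ?ex //.
have := reach_im o f; rewrite ex ey in o * => ->.
by exists ms.
Qed.

Lemma conj_telescope (gT : groupType) (x y g : gT) :
  (x * y * (y^-1 * g * y) * (x * y)^-1 = x * g * x^-1)%g.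
Proof. by rewrite invgM !mulgA !mulgK. Qed.

Hypothesis Minv : forall S u w, #|S| = n -> mvok adj S u w -> M (mvS S u w) w u = (M S u w)^-1%g.
Hypothesis Msq : forall S u w u' w', #|S| = n -> mvok adj S u w -> mvok adj S u' w' ->
  uniq [:: u; w; u'; w'] ->
  (M S u w * M (mvS S u w) u' w' = M S u' w' * M (mvS S u' w') u w)%g.

Variables (a b O O' P P' Q Q' Y Z : V) (lw up Pa Pb : seq V) (Da Db : {set V}).
Hypothesis uni : uniq (flatten [:: [:: a]; [:: b]; [:: O]; [:: O']; [:: P]; [:: P']; [:: Q]; [:: Q'];
  [:: Y]; [:: Z]; lw; up; Pa; Pb]).
Hypotheses (pL : path adj a (O :: Y :: lw ++ [:: O'; b])) (pU : path adj a (Q :: Z :: up ++ [:: Q'; b]))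
  (pPa : path adj a (P :: Pa)) (pPb : path adj b (P' :: Pb)) (sPa : (n <= size Pa)%N) (sPb : (n <= size Pb)%N).
Hypotheses (DaP : {subset P :: Pa <= Da}) (DbP : {subset P' :: Pb <= Db}).
Hypotheses (nDa : all (fun v => v \notin Da) [:: a; O; Q; Y; O'; P'])
  (nDb : all (fun v => v \notin Db) ([:: b; O; O'; Q'; Y; P] ++ Pa)).
Variables (va vb : (nat -> int) -> G -> int) (ca cb : (nat -> int) -> {set V} -> int).
Hypotheses (ga : gate a Q Da va ca) (gb : gate b Q' Db vb cb).
Hypothesis lam : forall g, vb (fun=> 1) g = - va (fun=> 1) g.
Hypothesis n5 : (5 <= n)%N.

Lemma cycle_contradiction : False.
Proof.
have tE := segE uni; set tag := seg_tag _ in tE.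
have [Ea Eb EO EO'] : [/\ forall v, (v == a) = (tag v == 0%N), forall v, (v == b) = (tag v == 1%N),
   forall v, (v == O) = (tag v == 2) & forall v, (v == O') = (tag v == 3)].
  by split=> v; rewrite -tE //= inE.
have [EP EP' EQ EQ'] : [/\ forall v, (v == P) = (tag v == 4), forall v, (v == P') = (tag v == 5),
   forall v, (v == Q) = (tag v == 6) & forall v, (v == Q') = (tag v == 7)].
  by split=> v; rewrite -tE //= inE.
have [EY EZ] : (forall v, (v == Y) = (tag v == 8)) /\ forall v, (v == Z) = (tag v == 9).
  by split=> v; rewrite -tE //= inE.
have [Elw Eup EPa EPb] : [/\ forall v, (v \in lw) = (tag v == 10), forall v, (v \in up) = (tag v == 11),
   forall v, (v \in Pa) = (tag v == 12) & forall v, (v \in Pb) = (tag v == 13)].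
  by split=> v; rewrite -tE.
have EE := (Ea, Eb, EO, EO', EP, EP', EQ, EQ', EY, EZ, (Elw, Eup, EPa, EPb)).
have [TP TO TP' TO'] : [/\ tag P = 4, tag O = 2, tag P' = 5 & tag O' = 3].
  by split; apply/eqP; rewrite -tE //= inE.
have [Ta Tb TQ TQ'] : [/\ tag a = 0%N, tag b = 1%N, tag Q = 6 & tag Q' = 7].
  by split; apply/eqP; rewrite -tE //= inE.
have [TY TZ] : tag Y = 8 /\ tag Z = 9 by split; apply/eqP; rewrite -tE //= inE.
have TT := (Ta, Tb, TP, TO, TP', TO', TQ, TQ', TY, TZ).
have uPa : uniq Pa by have := uniq_segs uni (kb := [:: (12, false)]%N) isT isT; rewrite /= cats0.
pose b1 := head b Pb.
have ePb : Pb = b1 :: behead Pb by rewrite /b1; case: (Pb) sPb n5 => //= h1 h2; have := leq_trans h2 h1.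
have Tb1 : tag b1 = 13 by apply/eqP; rewrite -EPb ePb mem_head.
have u9 : uniq [:: P; O; P'; O'; Y] by rewrite /= !inE !EE !TT.
pose conf (l : seq V) k : {set V} := [set v in l ++ take k Pa].
have confE l k v : (v \in conf l k) = (v \in l) || (v \in take k Pa) by rewrite inE mem_cat.
have inPa k v : v \in take k Pa -> tag v = 12 by move/mem_take; rewrite EPa => /eqP.
have cc (l : seq V) k : (k <= n)%N -> uniq l -> all (fun v => tag v != 12) l -> #|conf l k| = (size l + k)%N.
  move=> kn ul nl; rewrite cardsE; have /card_uniqP -> : uniq (l ++ take k Pa).
    rewrite cat_uniq ul take_uniq // andbT /=; apply/hasPn => v /inPa tv; apply/negP => /(allP nl).
    by rewrite tv.
  by rewrite size_cat size_takel //; exact: leq_trans sPa.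
(* Five tokens have prescribed places, namely the two exchanged pairs and a traveller at [Y]; the
   remaining [k] wait on the arm at [a]. *)
pose k := (n - 5)%N.
have nk : n = (k + 5)%N by rewrite /k subnK.
(* [S1] has the traveller on the other arc. [S2] and [S3] have it on the arm at [a] or at [b], where
   it raises the number of tokens that the gate there observes. *)
pose S0 := conf [:: P; O; O'; Y; P'] k; pose S1 := conf [:: P; O; O'; Z; P'] k.
pose S2 := conf [:: P; O; P'; O'] k.+1; pose S3 := conf [:: P; O; O'; P'; b1] k.
have e5 : (5 + k = n)%N by rewrite addnC nk.
have e4 : (4 + k.+1 = n)%N by rewrite addnS -addSn.
have kn : (k <= n)%N by rewrite -e5 leq_addl.
have k1n : (k.+1 <= n)%N by rewrite -e4 leq_addl.
have c0 : #|S0| = n by rewrite cc //= ?inE ?EE ?TT.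
have c1 : #|S1| = n by rewrite cc //= ?inE ?EE ?TT.
have c2 : #|S2| = n by rewrite cc //= ?inE ?EE ?TT.
have c3 : #|S3| = n by rewrite cc //= ?inE ?(eq_sym _ b1) ?EE ?TT ?Tb1.
have [aP aO aQ] : [/\ adj a P, adj a O & adj a Q].
  by move: pL pU pPa => /= /andP[-> _] /andP[-> _] /andP[-> _].
have [OY YL] : adj O Y /\ path adj Y (lw ++ [:: O'; b]) by move: pL => /= /and3P[].
have [QZ ZU] : adj Q Z /\ path adj Z (up ++ [:: Q'; b]) by move: pU => /= /and3P[].
have [bP bO bQ] : [/\ adj b P', adj b O' & adj b Q'].
  move: pPb YL ZU => /= /andP[-> _]; rewrite !cat_path /= => /and4P[_ _ h1 _] /and4P[_ _ h2 _].
  by rewrite adjC h1 adjC h2.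
(* the fifth token passes from [Y] to [Z] along the arcs and [b], avoiding [a] *)
have pt1 : path adj Y (lw ++ [:: O', b, Q' & rev up ++ [:: Z]]).
  move: YL; rewrite !cat_path /= => /and4P[-> -> -> _]; rewrite bQ /=.
  have := path_sym adjC ZU; rewrite last_cat belast_cat /= -cat_rcons -lastI cats1.
  by rewrite rev_rcons rev_cons -cats1 /= => /andP[].
have [|t1 [st1 ot1 ft1]] := slide_sets (conn_path adjC pt1) (etrans c1 (esym c0)).
  by move=> v; rewrite /S0 /S1 !confE /= !(inE, mem_cat, mem_rev) !EE;
     case: (tag v) => [|[|[|[|[|[|[|[|[|[|m]]]]]]]]]].
have pq : path adj Y [:: O, a, P & Pa].
  by move: pPa => /= /andP[_ ->]; rewrite adjC OY adjC aO aP.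
have [|qa [sqa oqa fqa]] := slide_sets (conn_path adjC pq) (etrans c2 (esym c0)).
  move=> v; rewrite /S0 /S2 !confE /= !inE !EE => nv.
  have h j : (v \in take j Pa) = false by apply/negP => /inPa tv; rewrite tv in nv.
  by rewrite !h; move: nv; case: (tag v) => [|[|[|[|[|[|[|[|[|[|m]]]]]]]]]].
have pq' : path adj Y (lw ++ [:: O', b, P' & Pb]).
  by move: YL pPb; rewrite !cat_path /= => /and4P[-> -> -> _] /andP[-> ->].
have [|qb [sqb oqb fqb]] := slide_sets (conn_path adjC pq') (etrans c3 (esym c0)).
  move=> v; rewrite /S0 /S3 !confE /= !(inE, mem_cat) !EE => nv.
  have -> : (v == b1) = false by apply: contraNF nv => /eqP ->; rewrite Tb1.
  by move: nv; case: (tag v) => [|[|[|[|[|[|[|[|[|[|m]]]]]]]]]].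
(* The rest of the round trip, which avoids [b]: the token at [O] steps to [Y], and the traveller
   takes its place by way of [Q] and [a]. *)
pose t2 := [:: (O, Y); (Z, Q); (Q, a); (a, O)].
have nK j v : tag v != 12 -> (v \in take j Pa) = false.
  by move=> tv; apply/negP => /inPa e; rewrite e in tv.
have t2E : t2 = wlk O [:: Y] ++ wlk Z [:: Q; a; O] by [].
have [ot2 ft2] : mok adj S1 t2 /\ mfin S1 t2 = S0.
  have [||||o1 f1] := @wlk_mfin _ adj S1 O [:: Y].
  - by rewrite confE !inE eqxx orbT.
  - by rewrite /= OY.
  - by rewrite /= inE EY TO.
  - by rewrite /= confE !inE !EE !TT nK ?TT.
  have [||||o2 f2] := @wlk_mfin _ adj (Y |: S1 :\ O) Z [:: Q; a; O].
  - by rewrite !(finset.in_setU1, finset.in_setD1) confE !inE !EE !TT.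
  - by rewrite /= adjC QZ adjC aQ aO.
  - by rewrite /= !inE !EE !TT.
  - by rewrite /= !(finset.in_setU1, finset.in_setD1) !confE !inE !EE !TT !nK ?TT.
  rewrite t2E mok_cat mfin_cat o1 f1 o2 f2; split=> //; apply/setP => v.
  rewrite !(finset.in_setU1, finset.in_setD1) !confE /= !inE !EE.
  have [e|ne] := eqVneq (tag v) 12; first by rewrite e.
  by rewrite nK //; case: (tag v) ne => [|[|[|[|[|[|[|[|[|[|m]]]]]]]]]].
have ua : uniq [:: a; P; O; Q] by rewrite /= !inE !EE !TT.
have ub : uniq [:: b; P'; O'; Q'] by rewrite /= !inE !EE !TT.
have conf_star (c p o q : V) (l : seq V) j : uniq [:: c; p; o; q] -> adj c p -> adj c o -> adj c q ->
    p \in l -> o \in l -> c \notin l -> q \notin l -> tag c != 12 -> tag q != 12 ->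
    mok adj (conf l j) (star c p o q) /\ mfin (conf l j) (star c p o q) = conf l j.
  move=> u4 a1 a2 a3 pl ol cl ql tc tq.
  have pS : p \in conf l j by rewrite confE pl.
  have oS : o \in conf l j by rewrite confE ol.
  have cS : c \notin conf l j by rewrite confE negb_or cl nK.
  have qS : q \notin conf l j by rewrite confE negb_or ql nK.
  by have [h1 h2 _ _ _] := star_ok adjC u4 a1 a2 a3 pS oS cS qS.
have sta (l : seq V) j : {subset [:: P; O; P'; O'] <= l} -> a \notin l -> Q \notin l ->
    mok adj (conf l j) (star a P O Q) /\ mfin (conf l j) (star a P O Q) = conf l j.
  by move=> sl al ql; apply: conf_star; rewrite ?TT //; apply: sl; rewrite !inE eqxx ?orbT.
have stb (l : seq V) j : {subset [:: P; O; P'; O'] <= l} -> b \notin l -> Q' \notin l ->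
    mok adj (conf l j) (star b P' O' Q') /\ mfin (conf l j) (star b P' O' Q') = conf l j.
  by move=> sl al ql; apply: conf_star; rewrite ?TT //; apply: sl; rewrite !inE eqxx ?orbT.
have sub (z : V) : {subset [:: P; O; P'; O'] <= [:: P; O; O'; z; P']}.
  by move=> v; rewrite !inE => /or4P[] ->; rewrite ?orbT.
have sub' (z : V) : {subset [:: P; O; P'; O'] <= [:: P; O; O'; P'; z]}.
  by move=> v; rewrite !inE => /or4P[] ->; rewrite ?orbT.
have [q1 q2] : a \notin [:: P; O; O'; Y; P'] /\ Q \notin [:: P; O; O'; Y; P'] by rewrite !inE !EE !TT.
have [q3 q4] : b \notin [:: P; O; O'; Y; P'] /\ Q' \notin [:: P; O; O'; Y; P'] by rewrite !inE !EE !TT.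
have [q5 q6] : a \notin [:: P; O; P'; O'] /\ Q \notin [:: P; O; P'; O'] by rewrite !inE !EE !TT.
have [q7 q8] : b \notin [:: P; O; O'; Z; P'] /\ Q' \notin [:: P; O; O'; Z; P'] by rewrite !inE !EE !TT.
have [q9 q0] : b \notin [:: P; O; O'; P'; b1] /\ Q' \notin [:: P; O; O'; P'; b1].
  by rewrite !inE !(eq_sym _ b1) !EE !TT Tb1.
have [oa0 fa0] := sta _ k (sub Y) q1 q2; have [ob0 fb0] := stb _ k (sub Y) q3 q4.
have [oa2 fa2] := sta [:: P; O; P'; O'] k.+1 (fun _ h => h) q5 q6.
have [ob1 fb1] := stb _ k (sub Z) q7 q8; have [ob3 fb3] := stb _ k (sub' b1) q9 q0.
rewrite -/S0 -/S1 -/S2 -/S3 in oa0 fa0 ob0 fb0 oa2 fa2 ob1 fb1 ob3 fb3.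
pose Ra := mem [:: a; P; O; Q]; pose Rb := mem [:: b; P'; O'; Q'].
have spa : msupp Ra (star a P O Q) by rewrite /= !inE !eqxx ?orbT.
have spb : msupp Rb (star b P' O' Q') by rewrite /= !inE !eqxx ?orbT.
have dab v : Ra v -> ~~ Rb v.
  by rewrite /Ra /Rb /= !inE !EE; case: (tag v) => [|[|[|[|[|[|[|[|m]]]]]]]].
have dba v : Rb v -> ~~ Ra v by apply: contraL => /dab.
pose sa := el M S0 (star a P O Q); pose sb := el M S0 (star b P' O' Q').
pose ga2 := el M S2 (star a P O Q); pose gb3 := el M S3 (star b P' O' Q').
move: nDa; rewrite /= andbT => /and5P[naD nOD nQD nYD /andP[nO'D nP'D]].
move: nDb => /= /and5P[nbD nOB nO'B nQ'B /and3P[nYB nPB nPaB]].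
have PD : P \in Da by apply: DaP; rewrite mem_head.
have P'D : P' \in Db by apply: DbP; rewrite mem_head.
have b1D : b1 \in Db by apply: DbP; rewrite ePb !inE eqxx orbT.
have card_a l j : (j <= n)%N -> all (fun v => v \notin Da) l -> #|conf (P :: l) j :&: Da| = j.+1.
  move=> hj nl; have -> : conf (P :: l) j :&: Da = conf [:: P] j.
    apply/setP => v; rewrite finset.in_setI !confE !inE; have [->|vP] := eqVneq v P; first by rewrite PD.
    have [vk|vk] := boolP (v \in take j Pa); first by rewrite orbT DaP // inE (mem_take vk) orbT.
    by rewrite orbF; apply/negP => /andP[/(allP nl)/negP].
  by rewrite cc //= TP.
have card_b l j : all (fun v => v \notin Db) l -> conf l j :&: Db = finset.set0.
  move=> nl; apply/setP => v; rewrite finset.in_setI confE !inE; apply/negP => /andP[/orP[/(allP nl)/negP //|vk]].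
  by have := allP nPaB _ (mem_take vk) => /negP.
have card_b' (l l' : seq V) j : all (fun v => v \notin Db) l -> {subset l' <= Db} -> uniq l' ->
    #|conf (l ++ l') j :&: Db| = size l'.
  move=> nl sl ul; rewrite -(card_uniqP ul); apply: eq_card => v.
  rewrite finset.in_setI confE mem_cat; have [vl|vl] := boolP (v \in l'); first by rewrite orbT sl.
  rewrite orbF; apply/negP => /andP[h vD].
  have : v \in conf l j :&: Db by rewrite finset.in_setI confE h.
  by rewrite card_b // inE.
have kA0 : #|S0 :&: Da| = k.+1 by apply: card_a; rewrite //= nOD nP'D nO'D nYD.
have kA2 : #|S2 :&: Da| = k.+2 by apply: card_a; rewrite //= nOD nP'D nO'D.
have kB0 : #|S0 :&: Db| = 1%N.
  have h1 : all (fun v => v \notin Db) [:: P; O; O'; Y] by rewrite /= nPB nOB nO'B nYB.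
  have h2 : {subset [:: P'] <= Db} by move=> v; rewrite inE => /eqP ->.
  exact: (card_b' _ _ k h1 h2 isT).
have kB3 : #|S3 :&: Db| = 2%N.
  have h1 : all (fun v => v \notin Db) [:: P; O; O'] by rewrite /= nPB nOB nO'B.
  have h2 : {subset [:: P'; b1] <= Db} by move=> v; rewrite !inE => /orP[] /eqP ->.
  have h3 : uniq [:: P'; b1] by rewrite /= inE (eq_sym _ b1) EE Tb1.
  exact: (card_b' _ _ k h1 h2 h3).
(* Weights concentrated on one number of tokens. By [passage_star] the coordinates for [dl k] and
   [dl k.+2] are 1, 0 on [sa] and 0, -1 on the exchange with one token more in [Da]; at [b] the
   numbers are 0 and 2. *)
pose dl (m : nat) : nat -> int := fun j => (j == m)%:Z.
have hJ (e : G -> int) (y g : G) : ihom e -> e (y * g * y^-1)%g = e g.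
  by move=> he; rewrite !he (ihomV he) addrAC subrr add0r.
have Vsa al : va al sa = al k - al k.+1.
  by rewrite (gate_loop ga) // (passage_star (D := Da) al ua oa0 PD nOD naD nQD kA0).
have Vqa al y : va al (y * ga2 * y^-1)%g = al k.+1 - al k.+2.
  by rewrite (hJ _ _ _ (gate_hom ga al)) (gate_loop ga) // (passage_star (D := Da) al ua oa2 PD nOD naD nQD kA2).
have Vsb al : vb al sb = al 0%N - al 1%N.
  by rewrite (gate_loop gb) // (passage_star (D := Db) al ub ob0 P'D nO'B nbD nQ'B kB0).
have Vqb al y : vb al (y * gb3 * y^-1)%g = al 1%N - al 2.
  by rewrite (hJ _ _ _ (gate_hom gb al)) (gate_loop gb) // (passage_star (D := Db) al ub ob3 P'D nO'B nbD nQ'B kB3).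
have nd (i j : nat) : i != j -> (i == j)%:Z = 0 by move=> /negbTE ->.
have D1 : va (dl k) sa <> 0 by rewrite Vsa /dl eqxx nd // neq_ltn ltnSn orbT.
have D2 : va (dl k.+2) sa = 0 by rewrite Vsa /dl !nd // neq_ltn ?ltnSn // ltnS leqnSn.
have D3 : va (fun=> 1) sa = 0 by rewrite Vsa subrr.
have D4 y : va (dl k) (y * ga2 * y^-1)%g = 0.
  by rewrite Vqa /dl !nd // neq_ltn ?ltnSn ?orbT // ltnS leqnSn orbT.
have D5 y : va (dl k.+2) (y * ga2 * y^-1)%g <> 0 by rewrite Vqa /dl eqxx nd // neq_ltn ltnSn.
have E1 : vb (dl 0%N) sb <> 0 by rewrite Vsb.
have E2 : vb (dl 2) sb = 0 by rewrite Vsb.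
have E3 : vb (fun=> 1) sb = 0 by rewrite Vsb.
have E4 y : vb (dl 0%N) (y * gb3 * y^-1)%g = 0 by rewrite Vqb.
have E5 y : vb (dl 2) (y * gb3 * y^-1)%g <> 0 by rewrite Vqb.
have nRb : ~~ Rb a by rewrite /= !inE !EE !TT.
have nRa : ~~ Ra b by rewrite /= !inE !EE !TT.
have Vab al : va al sb = 0 by rewrite (gate_loop ga) // (passage_out _ _ _ _ nRb).
have Vba al : vb al sa = 0 by rewrite (gate_loop gb) // (passage_out _ _ _ _ nRa).
pose x1 := el M S0 t1; pose x2 := el M S1 t2; pose ya := el M S0 qa; pose yb := el M S0 qb.
have d1 v : Ra v -> ~~ (mem [:: Y & lw ++ [:: O', b, Q' & rev up ++ [:: Z]]]) v.
  rewrite /Ra /= !(inE, mem_cat, mem_rev) !EE.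
  by case: (tag v) => [|[|[|[|[|[|[|[|m]]]]]]]].
have d2 v : Rb v -> ~~ (mem [:: O; Y; Z; Q; a]) v.
  by rewrite /Rb /= !inE !EE; case: (tag v) => [|[|[|[|[|[|[|[|m]]]]]]]].
have d3 v : Rb v -> ~~ (mem [:: Y, O, a, P & Pa]) v.
  by rewrite /Rb /= !inE !EE; case: (tag v) => [|[|[|[|[|[|[|[|m]]]]]]]].
have d4 v : Ra v -> ~~ (mem [:: Y & lw ++ [:: O', b, P' & Pb]]) v.
  rewrite /Ra /= !(inE, mem_cat) !EE.
  by case: (tag v) => [|[|[|[|[|[|[|[|m]]]]]]]].
have st2 : msupp (mem [:: O; Y; Z; Q; a]) t2 by rewrite /= !inE !eqxx ?orbT.
have ea1 := el_conj Msq d1 c0 spa st1 oa0 ot1 fa0; have [oa1 fa1] := loop_frame d1 spa st1 oa0 fa0.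
have eb1 := el_conj Msq d2 c1 spb st2 ob1 ot2 fb1.
have eb2 := el_conj Msq d3 c0 spb sqa ob0 oqa fb0; have [ob2 fb2] := loop_frame d3 spb sqa ob0 fb0.
have ea3 := el_conj Msq d4 c0 spa sqb oa0 oqb fa0; have [oa3 fa3] := loop_frame d4 spa sqb oa0 fa0.
rewrite ft1 in ea1 oa1 fa1; rewrite ft2 in eb1; rewrite fqa in eb2 ob2 fb2; rewrite fqb in ea3 oa3 fa3.
have cm1 : commute sa sb := el_loops Msq dab c0 spa spb oa0 ob0 fa0 fb0.
have cm2 : commute sa (x1 * x2 * sb * (x1 * x2)^-1)%g.
  have -> : (x1 * x2 * sb * (x1 * x2)^-1 = x1 * el M S1 (star b P' O' Q') * x1^-1)%g.
    by rewrite /sb eb1; exact: conj_telescope.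
  by apply/commuteJ; rewrite -ea1; exact: (el_loops Msq dab c1 spa spb oa1 ob1 fa1 fb1).
have cm3 : commute (ya * ga2 * ya^-1)%g sb.
  apply/commute_sym/commuteJ; rewrite -eb2.
  exact: (el_loops Msq dba c2 spb spa ob2 oa2 fb2 fa2).
have cm4 : commute (yb * gb3 * yb^-1)%g sa.
  apply/commute_sym/commuteJ; rewrite -ea3.
  exact: (el_loops Msq dab c3 spa spb oa3 ob3 fa3 fb3).
(* Only the step from [Q] to [a] passes the gate. *)
have Vt : va (fun=> 1) (x1 * x2)%g = - 1.
  rewrite (gate_hom ga) !(gate_el ga) // ft1 ft2 (passage_out _ _ _ _ (_ : ~~ _ a) st1); last first.
    by rewrite /= !(inE, mem_cat, mem_rev) !EE !TT.
  by rewrite /t2 /= !EE !TT /=; move: (ca _ S0) (ca _ S1); clear; lia.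
suff : va (fun=> 1) (x1 * x2)%g = 0 by rewrite Vt.
apply: (cycle_obstruction (gate_hom ga (dl k)) (gate_hom ga (dl k.+2)) (gate_hom ga (fun=> 1))
  (gate_hom gb (dl 0%N)) (gate_hom gb (dl 2)) (gate_hom gb (fun=> 1)) (gate_heis ga _ _) (gate_heis ga _ _)
  (gate_heis gb _ _) (gate_heis gb _ _) lam cm1 cm2 cm3 cm4 D1 D2 D3 (D4 _) (D5 _) (Vab _) (Vab _) E1 E2 E3 (E4 _) (E5 _) (Vba _) (Vba _)).
Qed.
End Gates.

(** * Paths of configurations and holonomy *)

Section RelOpen.
Import Order.TTheory GRing.Theory Num.Theory.
Local Open Scope ring_scope.
Local Open Scope classical_set_scope.

Definition II : set RR := [set t | 0 <= t <= 1].
Definition sq : set (RR * RR) := [set p | II p.1 /\ II p.2].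

Lemma rel_open01P (A : set RR) : rel_open01 A <-> (forall t, II t -> A t -> nbhs t (fun u => II u -> A u)).
Proof.
split=> [|h]; first case=> O [oO OA] t It At.
  have : nbhs t O by apply: open_nbhs_nbhs; split=> //; apply/OA.
  by apply: filterS => u Ou Iu; apply/OA.
exists (interior [set u | II u -> A u]); split; first exact: open_interior.
move=> t It; split=> [At|/nbhs_singleton]; [exact: h|exact].
Qed.

Lemma rel_open_sqP (A : set (RR * RR)) :
  rel_open_sq A <-> (forall p, sq p -> A p -> nbhs p (fun q => sq q -> A q)).
Proof.
split=> [|h]; first case=> O [oO OA] [s t] [/= Is It] At.
  have : nbhs (s, t) O by apply: open_nbhs_nbhs; split=> //; apply/OA.
  by apply: filterS => -[s' t'] Ou [/= Iu Iu']; apply/OA.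
exists (interior [set u | sq u -> A u]); split; first exact: open_interior.
move=> s t Is It; split=> [At|/nbhs_singleton]; [exact: h|exact].
Qed.
End RelOpen.

Section ConfigPaths.
Import Order.TTheory GRing.Theory Num.Theory.
Local Open Scope ring_scope.
Local Open Scope classical_set_scope.
Variables (G : graph) (n : nat).
Notation pt := (gpt G).
Notation conf := (set pt).

(** Continuity on [D] for the topology of [uopen], stated by neighbourhoods so as to cover paths and
    homotopies alike. *)
Definition good (E : topologicalType) (D : set E) (H : E -> conf) :=
  (forall p, D p -> uconf n (H p)) /\
  forall U, uopen n U -> forall p, D p -> U (H p) -> nbhs p (fun q => D q -> U (H q)).

Definition tgood (E : topologicalType) (D : set E) (h : E -> pt) :=
  forall W, gopen W -> forall p, D p -> W (h p) -> nbhs p (fun q => D q -> W (h q)).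

Lemma good_tokens (E : topologicalType) (D : set E) (y : E -> 'I_n -> pt) :
  (forall p, D p -> oconf (y p)) -> (forall i, tgood D (y^~ i)) -> good D (fun p => range (y p)).
Proof.
move=> oy ty; split=> [p /oy o|U oU p Dp Up]; first by exists (y p).
have [W [hW hU]] := oU _ (oy _ Dp) Up.
have h : nbhs p (fun q => forall i, D q -> W i (y q i)).
  by apply: filter_forall => i; have [gW Wi] := hW i; exact: ty.
by apply: filterS h => q hq Dq; apply: hU => [|i]; [exact: oy|exact: hq].
Qed.

Lemma good_comp (E E' : topologicalType) (D : set E) (D' : set E') (H : E -> conf) (th : E' -> E) :
  good D H -> continuous th -> (forall q, D' q -> D (th q)) -> good D' (H \o th).
Proof.
move=> [h1 h2] ct hD; split=> [q /hD /h1 //|U oU q Dq Uq].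
have h : nbhs q (fun x => D (th x) -> U (H (th x))) := ct q _ (h2 U oU _ (hD _ Dq) Uq).
by apply: filterS h => r h /hD /h.
Qed.

Lemma good_ext (E : topologicalType) (D : set E) (H H' : E -> conf) :
  (forall p, D p -> H p = H' p) -> good D H -> good D H'.
Proof.
move=> e [h1 h2]; split=> [p Dp|U oU p Dp]; rewrite -e //; first exact: h1.
by move=> /(h2 U oU p Dp); apply: filterS => q h Dq; rewrite -e //; exact: h.
Qed.

Lemma good_sub (E : topologicalType) (D D' : set E) H : (forall p, D' p -> D p) -> good D H -> good D' H.
Proof. by move=> h g; apply: (good_comp (th := id) g) => // x. Qed.

Lemma good_glue (E : topologicalType) (D D1 D2 : set E) H : (forall p, ~ D1 p -> nbhs p (~` D1)) -> (forall p, ~ D2 p -> nbhs p (~` D2)) ->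
  (forall p, D p -> D1 p \/ D2 p) -> good (D `&` D1) H -> good (D `&` D2) H -> good D H.
Proof.
move=> c1 c2 cov [h1 g1] [h2 g2]; split=> [p Dp|U oU p Dp Up].
  by case: (cov _ Dp) => ?; [apply: h1|apply: h2].
have loc (C : set E) : (forall p, ~ C p -> nbhs p (~` C)) -> good (D `&` C) H -> nbhs p (fun q => (D `&` C) q -> U (H q)).
  move=> cC [_ gC]; have [Cp|nC] := pselect (C p); first exact: gC.
  by apply: filterS (cC _ nC) => q nq [_ Cq].
apply: filterS (filterI (loc _ c1 (conj h1 g1)) (loc _ c2 (conj h2 g2))) => q [a1 a2] Dq.
by case: (cov _ Dq) => Cq; [apply: a1|apply: a2].
Qed.

Lemma ucont01P f : ucont01 n f <-> good II f.
Proof.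
split=> -[h1 h2]; split=> // U oU; last by apply/rel_open01P => t; exact: h2.
by apply/rel_open01P; exact: h2.
Qed.

Lemma ucont_sqP H : ucont_sq n H <-> good sq H.
Proof.
split=> -[h1 h2]; split.
- by move=> [s t] [/= Is It]; exact: h1.
- by move=> U oU; apply/rel_open_sqP; exact: h2.
- by move=> s t Is It; exact: h1.
- by move=> U oU; apply/rel_open_sqP; exact: h2.
Qed.

Definition ispath (S S' : conf) (f : RR -> conf) := [/\ good II f, f 0 = S & f 1 = S'].

Definition phom (S S' : conf) (f g : RR -> conf) := [/\ ispath S S' f, ispath S S' g &
  exists H, [/\ good sq H, forall t, II t -> H (0, t) = f t /\ H (1, t) = g t &
    forall s, II s -> H (s, 0) = S /\ H (s, 1) = S']].

Lemma II0 : II 0. Proof. by rewrite /II /= lexx ler01. Qed.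
Lemma II1 : II 1. Proof. by rewrite /II /= lexx ler01. Qed.

Lemma continuous_pairs (E : topologicalType) (a b : E -> RR) : continuous a -> continuous b ->
  continuous (fun x => (a x, b x)).
Proof. by move=> ca cb x; apply: (cvg_pair (ca x) (cb x)). Qed.

Lemma cont_add (E : topologicalType) (a b : E -> RR) : continuous a -> continuous b -> continuous (fun x => a x + b x).
Proof. by move=> ca cb x; exact: (@cvgD RR RR^o _ _ _ _ _ _ _ (ca x) (cb x)). Qed.

Lemma cont_mul (E : topologicalType) (a b : E -> RR) : continuous a -> continuous b -> continuous (fun x => a x * b x).
Proof. by move=> ca cb x; apply: cvgM; [exact: ca|exact: cb]. Qed.

Lemma cont_opp (E : topologicalType) (a : E -> RR) : continuous a -> continuous (fun x => - a x).
Proof. by move=> ca x; exact: (@cvgN RR RR^o _ _ _ _ _ (ca x)). Qed.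

Lemma cont_cst (E : topologicalType) (c : RR) : continuous (fun _ : E => c).
Proof. by move=> x; exact: cvg_cst. Qed.

Lemma cont_fst : continuous (fun p : RR * RR => p.1). Proof. by move=> p; exact: cvg_fst. Qed.
Lemma cont_snd : continuous (fun p : RR * RR => p.2). Proof. by move=> p; exact: cvg_snd. Qed.
Lemma cont_id : continuous (fun t : RR => t). Proof. by move=> t; exact: cvg_id. Qed.

Lemma cont_comp (E E' : topologicalType) (a : E' -> RR) (th : E -> E') : continuous a -> continuous th ->
  continuous (fun x => a (th x)).
Proof. by move=> ca ct x; apply: continuous_comp; [exact: ct|exact: ca]. Qed.

Lemma cont_max (E : topologicalType) (a b : E -> RR) : continuous a -> continuous b ->
  continuous (fun x => Num.max (a x) (b x)).
Proof. by move=> ca cb x; apply: continuous_max; [exact: ca|exact: cb]. Qed.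

Lemma cont_min (E : topologicalType) (a b : E -> RR) : continuous a -> continuous b ->
  continuous (fun x => Num.min (a x) (b x)).
Proof. by move=> ca cb x; apply: continuous_min; [exact: ca|exact: cb]. Qed.

Lemma cont_gt (E : topologicalType) (a : E -> RR) c p : continuous a -> c < a p -> nbhs p [set x | c < a x].
Proof. move=> ca h; have h2 : nbhs (a p) [set x | c < x] by apply: open_nbhs_nbhs; split=> //; exact: open_gt.
exact: (ca p _ h2). Qed.

Lemma cont_lt (E : topologicalType) (a : E -> RR) c p : continuous a -> a p < c -> nbhs p [set x | a x < c].
Proof. move=> ca h; have h2 : nbhs (a p) [set x | x < c] by apply: open_nbhs_nbhs; split=> //; exact: open_lt.
exact: (ca p _ h2). Qed.

(** Straight lines in the square join the two parameter paths. Reparametrization, the inverse law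
    and the commutation of disjoint moves are instances. *)
Lemma phom_square (Q : RR * RR -> conf) S S' (a1 a2 b1 b2 : RR -> RR) : good sq Q ->
  continuous a1 -> continuous a2 -> continuous b1 -> continuous b2 ->
  (forall t, II t -> [/\ II (a1 t), II (a2 t), II (b1 t) & II (b2 t)]) ->
  a1 0 = b1 0 -> a2 0 = b2 0 -> a1 1 = b1 1 -> a2 1 = b2 1 ->
  Q (a1 0, a2 0) = S -> Q (a1 1, a2 1) = S' ->
  phom S S' (fun t => Q (a1 t, a2 t)) (fun t => Q (b1 t, b2 t)).
Proof.
move=> gQ ca1 ca2 cb1 cb2 hI e1 e2 e3 e4 eS eS'.
have gp (a b : RR -> RR) : continuous a -> continuous b -> (forall t, II t -> II (a t) /\ II (b t)) ->
    good II (fun t => Q (a t, b t)).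
  move=> ca cb h; apply: (good_comp (th := fun t => (a t, b t)) gQ); first exact: continuous_pairs.
  by move=> t /h.
split; first by split=> //; apply: gp => // t /hI [].
  by split=> //; [apply: gp => // t /hI []|rewrite -e1 -e2|rewrite -e3 -e4].
pose lin (a b : RR -> RR) (p : RR * RR) := (1 - p.1) * a p.2 + p.1 * b p.2.
have clin a b : continuous a -> continuous b -> continuous (lin a b).
  move=> ca cb; apply: cont_add; apply: cont_mul.
  - by apply: cont_add; [exact: cont_cst|apply: cont_opp; exact: cont_fst].
  - by apply: (cont_comp (th := snd) ca); exact: cont_snd.
  - exact: cont_fst.
  - by apply: (cont_comp (th := snd) cb); exact: cont_snd.
have hlin (a b : RR -> RR) p : sq p -> II (a p.2) -> II (b p.2) -> II (lin a b p).
  by case=> /andP[? ?] _ /andP[? ?] /andP[? ?]; rewrite /II /lin /=; apply/andP; split; nra.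
exists (fun p => Q (lin a1 b1 p, lin a2 b2 p)); split.
- apply: (good_comp (th := fun p => (lin a1 b1 p, lin a2 b2 p)) gQ).
    by apply: continuous_pairs; exact: clin.
  by move=> p hp; have [h1 h2 h3 h4] := hI _ hp.2; split; exact: hlin.
- by move=> t It; rewrite /lin /= !subr0 subrr !mul0r !mul1r !addr0 !add0r.
- by move=> s Is; rewrite /lin /= -e1 -e2 -e3 -e4 -!mulrDl !subrK !mul1r.
Qed.

Lemma phom_refl S S' f : ispath S S' f -> phom S S' f f.
Proof.
move=> pf; have [gf f0 f1] := pf; split=> //; exists (fun p => f p.2); split=> //.
by apply: (good_comp (th := snd) gf) => [p|p []//]; exact: cvg_snd.
Qed.

Lemma phom_sym S S' f g : phom S S' f g -> phom S S' g f.
Proof.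
case=> pf pg [H [gH e1 e2]]; split=> //; exists (fun p => H (1 - p.1, p.2)); split.
- apply: (good_comp (th := fun p : RR * RR => (1 - p.1 : RR, p.2)) gH).
    apply: continuous_pairs; last exact: cont_snd.
    by apply: cont_add; [exact: cont_cst|apply: cont_opp; exact: cont_fst].
  by move=> p [/andP[h1 h2] h3]; split=> //; rewrite /II /=; lra.
- by move=> t /e1[h1 h2]; rewrite /= subr0 subrr.
- by move=> s /andP[h1 h2]; apply: e2; rewrite /II /=; lra.
Qed.

Lemma good_half (E : topologicalType) (D : set E) (a : E -> RR) (H F1 F2 : E -> conf) : continuous a ->
  (forall p, D p -> a p <= 2^-1 -> H p = F1 p) -> (forall p, D p -> 2^-1 <= a p -> H p = F2 p) ->
  good (D `&` [set p | a p <= 2^-1]) F1 -> good (D `&` [set p | 2^-1 <= a p]) F2 -> good D H.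
Proof.
move=> ca e1 e2 g1 g2; apply: (@good_glue _ _ [set p | a p <= 2^-1] [set p | 2^-1 <= a p]).
- move=> p /negP; rewrite -ltNge => h; apply: filterS (cont_gt ca h) => x /= hx.
  by apply/negP; rewrite -ltNge.
- move=> p /negP; rewrite -ltNge => h; apply: filterS (cont_lt ca h) => x /= hx.
  by apply/negP; rewrite -ltNge.
- by move=> p _ /=; case: (leP (a p) 2^-1) => h; [left|right; exact: ltW].
- by apply: good_ext g1 => p [Dp ap]; rewrite e1.
- by apply: good_ext g2 => p [Dp ap]; rewrite e2.
Qed.

Lemma phom_trans S S' f g h : phom S S' f g -> phom S S' g h -> phom S S' f h.
Proof.
case=> pf pg [H [gH e1 e2]] [_ ph [H' [gH' e1' e2']]]; split=> //.
have sq1 p : sq p /\ p.1 <= 2^-1 -> sq (2 * p.1, p.2).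
  by case=> -[/andP[? ?] ?] ?; split=> //; rewrite /II /=; lra.
have sq2 p : sq p /\ 2^-1 <= p.1 -> sq (2 * p.1 - 1, p.2).
  by case=> -[/andP[? ?] ?] ?; split=> //; rewrite /II /=; lra.
exists (fun p => if p.1 <= 2^-1 then H (2 * p.1, p.2) else H' (2 * p.1 - 1, p.2)); split.
- refine (@good_half _ sq _ _ (fun p => H (2 * p.1, p.2)) (fun p => H' (2 * p.1 - 1, p.2)) cont_fst _ _ _ _).
  + by move=> p _ ->.
  + move=> p [Ip1 Ip2] hp; case: ifP => // h'; have -> : p.1 = 2^-1 by lra.
    by rewrite mulfV ?subrr ?(e1 _ Ip2).2 ?(e1' _ Ip2).1.
  + apply: (good_comp (th := fun p : RR * RR => (2 * p.1 : RR, p.2)) gH) => //.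
    apply: continuous_pairs; last exact: cont_snd.
    by apply: cont_mul; [exact: cont_cst|exact: cont_fst].
  + apply: (good_comp (th := fun p : RR * RR => (2 * p.1 - 1 : RR, p.2)) gH') => //.
    apply: continuous_pairs; last exact: cont_snd.
    by apply: cont_add; [apply: cont_mul; [exact: cont_cst|exact: cont_fst]|exact: cont_cst].
- move=> t It; rewrite /= mulr0 invr_ge0 ler0n (e1 _ It).1; split=> //.
  rewrite ifF; last by apply/negbTE; lra.
  by rewrite (_ : 2 * 1 - 1 = 1 :> RR) ?(e1' _ It).2 //; lra.
move=> s Is; case: ifP => hs; [apply: e2|apply: e2'].
  by have [] := sq1 (s, 0) (conj (conj Is II0) hs).
by move: Is hs => /andP[h1 h2] /negbT /=; rewrite -ltNge /II /= => h3; apply/andP; split; lra.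
Qed.

Lemma ispath_concat S S' S'' f g : ispath S S' f -> ispath S' S'' g -> ispath S S'' (pconcat f g).
Proof.
case=> gf f0 f1 [gg g0 g1]; split.
- refine (@good_half _ II _ _ (fun t => f (2 * t)) (fun t => g (2 * t - 1)) cont_id _ _ _ _).
  + by move=> p _ h; rewrite /pconcat h.
  + move=> p _ h; rewrite /pconcat; case: ifP => // h'; have -> : p = 2^-1 by lra.
    by rewrite mulfV // subrr f1 g0.
  + apply: (good_comp (th := fun t : RR => (2 * t : RR)) gf).
      by apply: cont_mul; [exact: cont_cst|exact: cont_id].
    by move=> t [/andP[? ?] /= ?]; rewrite /II /=; lra.
  + apply: (good_comp (th := fun t : RR => (2 * t - 1 : RR)) gg).
      by apply: cont_add; [apply: cont_mul; [exact: cont_cst|exact: cont_id]|exact: cont_cst].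
    by move=> t [/andP[? ?] /= ?]; rewrite /II /=; lra.
- by rewrite /pconcat mulr0 invr_ge0 ler0n.
- rewrite /pconcat ifF; last by apply/negbTE; lra.
  by rewrite (_ : 2 * 1 - 1 = 1 :> RR) //; lra.
Qed.

Definition pinv (f : RR -> conf) : RR -> conf := fun t => f (1 - t).

Lemma pinvK f : pinv (pinv f) = f.
Proof. by apply: funext => t; rewrite /pinv opprB addrC subrK. Qed.

Lemma ispath_inv S S' f : ispath S S' f -> ispath S' S (pinv f).
Proof.
case=> gf f0 f1; split; rewrite /pinv ?subr0 ?subrr //.
apply: (good_comp (th := fun t : RR => (1 - t : RR)) gf).
  by apply: cont_add; [exact: cont_cst|apply: cont_opp; exact: cont_id].
by move=> t /andP[? ?]; rewrite /II /=; lra.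
Qed.

Lemma phom_concat S S' S'' f f' g g' : phom S S' f f' -> phom S' S'' g g' ->
  phom S S'' (pconcat f g) (pconcat f' g').
Proof.
case=> pf pf' [H [gH e1 e2]] [pg pg' [H' [gH' e1' e2']]].
split; [exact: ispath_concat pf pg|exact: ispath_concat pf' pg'|].
exists (fun p => if p.2 <= 2^-1 then H (p.1, 2 * p.2) else H' (p.1, 2 * p.2 - 1)); split.
- refine (@good_half _ sq _ _ (fun p => H (p.1, 2 * p.2)) (fun p => H' (p.1, 2 * p.2 - 1)) cont_snd _ _ _ _).
  + by move=> p _ ->.
  + move=> p [Ip1 Ip2] h; case: ifP => // h'; have -> : p.2 = 2^-1 by lra.
    by rewrite mulfV ?subrr ?(e2 _ Ip1).2 ?(e2' _ Ip1).1.
  + apply: (good_comp (th := fun p : RR * RR => (p.1, 2 * p.2 : RR)) gH).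
      apply: continuous_pairs; first exact: cont_fst.
      by apply: cont_mul; [exact: cont_cst|exact: cont_snd].
    by move=> p [[? /andP[? ?]] /= ?]; split=> //; rewrite /II /=; lra.
  + apply: (good_comp (th := fun p : RR * RR => (p.1, 2 * p.2 - 1 : RR)) gH').
      apply: continuous_pairs; first exact: cont_fst.
      by apply: cont_add; [apply: cont_mul; [exact: cont_cst|exact: cont_snd]|exact: cont_cst].
    by move=> p [[? /andP[? ?]] /= ?]; split=> //; rewrite /II /=; lra.
- move=> t /andP[t0 t1]; rewrite /pconcat /=; case: ifP => h; [apply: e1|apply: e1']; rewrite /II /=; lra.
move=> s Is; rewrite /= mulr0 invr_ge0 ler0n (e2 _ Is).1; split=> //.
rewrite ifF; last by apply/negbTE; lra.
by rewrite (_ : 2 * 1 - 1 = 1 :> RR) ?(e2' _ Is).2 //; lra.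
Qed.

Lemma phom_reparam S S' f (a : RR -> RR) : ispath S S' f -> continuous a ->
  (forall t, II t -> II (a t)) -> a 0 = 0 -> a 1 = 1 -> phom S S' (fun t => f (a t)) f.
Proof.
case=> gf f0 f1 ca ha a0 a1.
have gF : good sq (fun p => f p.2) by apply: (good_comp (th := snd) gf cont_snd) => p [].
apply: (phom_square (a1 := fun=> 0) (b1 := fun=> 0) gF); rewrite /= ?a0 ?a1 //.
- exact: cont_cst.
- exact: cont_cst.
- exact: cont_id.
by move=> t It; split=> //; [exact: II0|exact: ha|exact: II0].
Qed.

Lemma phom_ext S S' f g h : (forall t, II t -> f t = g t) -> phom S S' g h -> phom S S' f h.
Proof.
move=> e [[gg g0 g1] ph [H [gH e1 e2]]]; split=> //.
  split; rewrite ?e //; [|exact: II0|exact: II1].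
  by apply: good_ext gg => t It; rewrite e.
by exists H; split=> // t It; rewrite e //; exact: e1.
Qed.

Lemma phom_assoc S1 S2 S3 S4 f g h : ispath S1 S2 f -> ispath S2 S3 g -> ispath S3 S4 h ->
  phom S1 S4 (pconcat f (pconcat g h)) (pconcat (pconcat f g) h).
Proof.
(* The piecewise linear change of parameter between the two bracketings, with slopes 1/2, 1 and
   2. *)
move=> pf pg ph; pose a (t : RR) : RR := Num.max (t * 2^-1) (Num.max (t - 4^-1) (2 * t - 1)).
have ca : continuous a.
  apply: cont_max; first by apply: cont_mul; [exact: cont_id|exact: cont_cst].
  apply: cont_max; first by apply: cont_add; [exact: cont_id|exact: cont_cst].
  by apply: cont_add; [apply: cont_mul; [exact: cont_cst|exact: cont_id]|exact: cont_cst].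
have aE t : a t = if t <= 2^-1 then t * 2^-1 else if t <= 3 * 4^-1 then t - 4^-1 else 2 * t - 1.
  rewrite /a; case: (leP (t - 4^-1) (2 * t - 1)) => ?; [case: (leP (t * 2^-1) (2 * t - 1))|case: (leP (t * 2^-1) (t - 4^-1))] => ?; do ![case: ifPn => ?]; lra.
apply: phom_ext (phom_reparam (ispath_concat (ispath_concat pf pg) ph) ca _ _ _).
- move=> t _; rewrite aE /pconcat.
  have [t1|t1] := boolP (t <= 2^-1).
    rewrite !ifT; [by congr f; lra|lra|lra].
  have [t2|t2] := boolP (t <= 3 * 4^-1).
    rewrite [if 2 * t - 1 <= _ then _ else _]ifT; last by lra.
    rewrite ifT; last by lra.
    by rewrite ifF; [congr g; lra|apply/negbTE; lra].
  by rewrite !ifF; first (congr h; lra); apply/negbTE; lra.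
- by move=> t /andP[? ?]; rewrite aE /II /=; do ![case: ifPn => ?]; lra.
- by rewrite aE; do ![case: ifPn => ?]; lra.
- by rewrite aE; do ![case: ifPn => ?]; lra.
Qed.

Lemma ispath_cst S : uconf n S -> ispath S S (fun=> S).
Proof. by move=> cS; split=> //; split=> // U oU p _ Up; apply: filterE. Qed.

Lemma ispath_conf S S' f : ispath S S' f -> uconf n S /\ uconf n S'.
Proof. by case=> -[h _] <- <-; split; apply: h; [exact: II0|exact: II1]. Qed.

Lemma phom_idl S S' f : ispath S S' f -> phom S S' (pconcat (fun=> S) f) f.
Proof.
move=> pf; pose a (t : RR) : RR := Num.max 0 (2 * t - 1).
have ca : continuous a.
  apply: cont_max; first exact: cont_cst.
  by apply: cont_add; [apply: cont_mul; [exact: cont_cst|exact: cont_id]|exact: cont_cst].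
have aE t : a t = if t <= 2^-1 then 0 else 2 * t - 1.
  by rewrite /a /Num.max /=; do ![case: ifPn => ?]; lra.
apply: phom_ext (phom_reparam pf ca _ _ _).
- by move=> t _; rewrite aE /pconcat; case: ifP => //; case: pf.
- by move=> t /andP[? ?]; rewrite aE /II /=; do ![case: ifPn => ?]; lra.
- by rewrite aE; do ![case: ifPn => ?]; lra.
- by rewrite aE; do ![case: ifPn => ?]; lra.
Qed.

Lemma phom_inv S S' f : ispath S S' f -> phom S S (pconcat f (pinv f)) (fun=> S).
Proof.
move=> pf; have [gf f0 f1] := pf; pose a (t : RR) : RR := Num.min (2 * t) (2 - 2 * t).
have ca : continuous a.
  apply: cont_min; first by apply: cont_mul; [exact: cont_cst|exact: cont_id].
  apply: cont_add; [exact: cont_cst|apply: cont_opp].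
  by apply: cont_mul; [exact: cont_cst|exact: cont_id].
have aE t : a t = if t <= 2^-1 then 2 * t else 2 - 2 * t.
  by rewrite /a /Num.min; do ![case: ifPn => ?]; lra.
clearbody a; have gF : good sq (fun p => f p.2) by apply: (good_comp (th := snd) gf cont_snd) => p [].
apply: (@phom_ext _ _ _ (fun t => f (a t))).
  by move=> t _; rewrite aE /pconcat /pinv; case: ifP => // _; congr f; lra.
have -> : (fun=> S) = (fun t : RR => f ((fun=> 0) t)) by rewrite f0.
apply: (phom_square (a1 := fun=> 0) (b1 := fun=> 0) (b2 := fun=> 0) gF) => //.
- exact: cont_cst.
- exact: cont_cst.
- exact: cont_cst.
- move=> t /andP[? ?]; split; try exact: II0.
  by rewrite aE /II /=; do ![case: ifPn => ?]; lra.
- by rewrite aE; do ![case: ifPn => ?]; lra.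
- by rewrite aE; do ![case: ifPn => ?]; lra.
- by rewrite /= aE ifT ?mulr0 ?f0 //; lra.
- rewrite /= aE ifF; last by apply/negbTE; lra.
  by rewrite mulr1 subrr f0.
Qed.

Lemma phom_invl S S' f : ispath S S' f -> phom S' S' (pconcat (pinv f) f) (fun=> S').
Proof. by move=> /ispath_inv pf; have := phom_inv pf; rewrite pinvK. Qed.
End ConfigPaths.

(** * Connectedness of the unit interval *)

Section IntervalInduction.
Import Order.TTheory GRing.Theory Num.Theory.
Local Open Scope ring_scope.
Local Open Scope classical_set_scope.

(** The supremum of the points reached from 0 cannot be less than 1. This replaces Lebesgue numbers
    when local sections are patched along an interval. *)
Lemma interval_ind (P : RR -> RR -> Prop) :
  (forall x y z, x <= y -> y <= z -> P x y -> P y z -> P x z) ->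
  (forall t, II t -> exists2 d, 0 < d & forall x y, t - d < x -> x <= y -> y < t + d -> P x y) ->
  P 0 1.
Proof.
move=> add loc; pose A : set RR := [set t | II t /\ P 0 t].
have A0 : A 0.
  split; first exact: II0.
  by have [d d0 h] := loc _ II0; apply: h => //; lra.
have bA : has_sup A by split; [exists 0|exists 1 => t [/andP[]]].
have c0 : 0 <= sup A by apply: sup_ubound => //; case: bA.
have c1 : sup A <= 1 by apply: ge_sup; [exists 0|move=> t [/andP[]]].
have Ic : II (sup A) by apply/andP.
have [d d0 h] := loc _ Ic.
have [a [Ia Pa] ha] := sup_adherent d0 bA.
have ac : a <= sup A by apply: sup_ubound => //; case: bA.
pose y := Num.min 1 (sup A + d / 2).
have yd : y < sup A + d by rewrite /y gt_min; apply/orP; right; lra.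
have ay : a <= y by rewrite /y le_min; move: Ia => /andP[? ?]; apply/andP; split; lra.
have Py : P 0 y by move: (Ia) => /andP[? ?]; apply: (add 0 a y) => //; apply: h.
have Ay : A y by split=> //; move: Ia => /andP[? ?]; apply/andP; split; [lra|rewrite /y ge_min lexx].
have yc : y <= sup A by apply: sup_ubound => //; case: bA.
have -> // : 1 = y by move: yc; rewrite /y ge_min => /orP[h1|h1]; [apply/esym/min_idPl; lra|lra].
Qed.

Lemma nbhs_interval (t : RR) (P : RR -> Prop) : nbhs t P -> exists2 d, 0 < d & forall u, t - d < u -> u < t + d -> P u.
Proof.
move=> /nbhs_ballP[d /= d0 h]; exists d => // u h1 h2; apply: h.
by rewrite /ball /= /ball_ ltr_norml; apply/andP; split; lra.
Qed.

Lemma locally_constant (T : Type) (f : RR -> T) (a b : RR) : a <= b ->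
  (forall t, a <= t <= b -> nbhs t (fun u => a <= u <= b -> f u = f t)) -> f a = f b.
Proof.
move=> ab h; pose g t := a + t * (b - a).
have -> : a = g 0 by rewrite /g mul0r addr0.
have -> : f b = f (g 1) by rewrite /g mul1r addrC subrK.
have gI t : II t -> a <= g t <= b by move=> /andP[? ?]; rewrite /g; apply/andP; split; nra.
suff : (0 : RR) <= 0 -> (1 : RR) <= 1 -> f (g 0) = f (g 1) by apply.
apply: (@interval_ind (fun x y => 0 <= x -> y <= 1 -> f (g x) = f (g y))).
  by move=> x y z xy yz h1 h2 x0 z1; rewrite h1 ?h2 //; lra.
move=> t It; have cg : continuous g.
  by apply: cont_add; [exact: cont_cst|apply: cont_mul; [exact: cont_id|exact: cont_cst]].
have [d d0 hd] := nbhs_interval (cg t _ (h _ (gI _ It))).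
exists d => // x y h1 xy h2 x0 y1.
by rewrite (hd x) ?(hd y) //; try (apply: gI; apply/andP; split); lra.
Qed.
End IntervalInduction.

(** * Flat sections and their holonomy *)

Section Holonomy.
Import Order.TTheory GRing.Theory Num.Theory.
Local Open Scope ring_scope.
Local Open Scope classical_set_scope.
Variables (G : graph) (n : nat).
Notation pt := (gpt G).
Notation conf := (set pt).

(* Charts [s i : U i -> K] of a principal bundle with discrete structure group [K], glued by
   left multiplications. *)
Record charts (K : groupType) := Charts {
  ch_idx : Type;
  ch_dom : ch_idx -> set conf;
  ch_map : ch_idx -> conf -> K;
  ch_open : forall i, uopen n (ch_dom i);
  ch_cover : forall S, uconf n S -> exists i, ch_dom i S;
  ch_glue : forall i j S, uconf n S -> ch_dom i S -> ch_dom j S ->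
    exists W, [/\ uopen n W, W S & forall S', uconf n S' -> W S' -> ch_dom i S' -> ch_dom j S' ->
      (ch_map i S' * (ch_map j S')^-1 = ch_map i S * (ch_map j S)^-1)%g] }.

Arguments ch_open {K} c i.
Arguments ch_cover {K} c {S}.
Arguments ch_glue {K c i j S}.

Section Flat.
Variables (K : groupType) (C : charts K).
Notation U := (ch_dom (c := C)).
Notation s := (ch_map (c := C)).

(** In every chart [F] is the chart map times a locally constant factor on the left. Neither [F] nor
    the chart maps need be locally constant. *)
Definition flat (E : topologicalType) (D : set E) (H : E -> conf) (F : E -> K) :=
  forall p, D p -> forall i, U i (H p) ->
    nbhs p (fun q => D q -> (F q * (s i (H q))^-1 = F p * (s i (H p))^-1)%g).

(** The transition functions are locally constant, so one chart at each point is enough. *)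
Lemma flatI (E : topologicalType) (D : set E) H F : good n D H ->
  (forall p, D p -> exists2 i, U i (H p) &
    nbhs p (fun q => D q -> (F q * (s i (H q))^-1 = F p * (s i (H p))^-1)%g)) -> flat D H F.
Proof.
move=> [gH oH] h p Dp j Uj; have [i Ui hi] := h _ Dp.
have [W [oW WS hW]] := ch_glue (gH _ Dp) Ui Uj.
apply: filterS (filterI hi (filterI (oH _ oW _ Dp WS) (filterI (oH _ (ch_open C i) _ Dp Ui) (oH _ (ch_open C j) _ Dp Uj)))).
move=> q [h1 [h2 [h3 h4]]] Dq.
have e := hW _ (gH _ Dq) (h2 Dq) (h3 Dq) (h4 Dq); have {}h1 := h1 Dq.
have -> : (F q * (s j (H q))^-1 = F q * (s i (H q))^-1 * (s i (H q) * (s j (H q))^-1))%g.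
  by rewrite mulgA mulgVK.
by rewrite h1 e mulgA mulgVK.
Qed.

Lemma flat_comp (E E' : topologicalType) (D : set E) (D' : set E') H F (th : E' -> E) :
  flat D H F -> continuous th -> (forall q, D' q -> D (th q)) -> flat D' (H \o th) (F \o th).
Proof.
move=> fF ct hD q Dq i Ui.
have h : nbhs q (fun x => D (th x) -> (F (th x) * (s i (H (th x)))^-1 = F (th q) * (s i (H (th q)))^-1)%g)
  := ct q _ (fF _ (hD _ Dq) i Ui).
by apply: filterS h => x h /hD /h.
Qed.

Lemma flat_ratio (E : topologicalType) (D : set E) H F F' : good n D H -> flat D H F -> flat D H F' ->
  forall p, D p -> nbhs p (fun q => D q -> (F q * (F' q)^-1 = F p * (F' p)^-1)%g).
Proof.
move=> [gH oH] h h' p Dp; have [i Ui] := ch_cover C (gH _ Dp).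
apply: filterS (filterI (h _ Dp i Ui) (h' _ Dp i Ui)) => q [h1 h2] Dq.
have {}h1 := h1 Dq; have {}h2 := h2 Dq.
have e (a b c : K) : (a * b^-1 = a * c^-1 * (b * c^-1)^-1)%g by rewrite invgM invgK mulgA mulgVK.
by rewrite (e _ _ (s i (H q))) h1 h2 -e.
Qed.

Lemma flat_scale (E : topologicalType) (D : set E) H F (g : K) : flat D H F -> flat D H (fun p => g * F p)%g.
Proof. by move=> h p Dp i Ui; apply: filterS (h p Dp i Ui) => q e Dq; rewrite -!mulgA e. Qed.

Lemma flat_ext (E : topologicalType) (D : set E) H F F' : (forall p, D p -> F p = F' p) -> flat D H F -> flat D H F'.
Proof. by move=> e h p Dp i Ui; rewrite -e //; apply: filterS (h p Dp i Ui) => q hq Dq; rewrite -e // hq. Qed.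

Lemma flat_glue (E : topologicalType) (D D1 D2 : set E) H F :
  (forall p, ~ D1 p -> nbhs p (~` D1)) -> (forall p, ~ D2 p -> nbhs p (~` D2)) ->
  (forall p, D p -> D1 p \/ D2 p) -> flat (D `&` D1) H F -> flat (D `&` D2) H F -> flat D H F.
Proof.
move=> c1 c2 cov f1 f2 p Dp i Ui.
have loc (A : set E) : (forall p, ~ A p -> nbhs p (~` A)) -> flat (D `&` A) H F ->
    nbhs p (fun q => (D `&` A) q -> (F q * (s i (H q))^-1 = F p * (s i (H p))^-1)%g).
  move=> cA fA; have [Ap|nA] := pselect (A p); first exact: fA.
  by apply: filterS (cA _ nA) => q nq [_ Aq].
apply: filterS (filterI (loc _ c1 f1) (loc _ c2 f2)) => q [a1 a2] Dq.
by case: (cov _ Dq) => Aq; [apply: a1|apply: a2].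
Qed.

(* Two flat functions over the parts [a <= c] and [c <= a] of [D] are matched along the
   segment [a = c]. *)
Lemma flat_join (E : topologicalType) (D : set E) (a : E -> RR) c H F1 F2 (e : RR -> E) (x y : RR) :
  continuous a -> continuous e -> good n D H -> x <= y ->
  (forall p, D p -> a p = c -> exists2 t, x <= t <= y & p = e t) ->
  (forall t, x <= t <= y -> D (e t) /\ a (e t) = c) ->
  flat (D `&` [set p | a p <= c]) H F1 -> flat (D `&` [set p | c <= a p]) H F2 ->
  exists F, flat D H F.
Proof.
move=> ca ce gH xy he De f1 f2; pose r t := (F1 (e t) * (F2 (e t))^-1)%g.
have fe1 : flat [set t | x <= t <= y] (H \o e) (F1 \o e).
  by apply: (flat_comp f1) => // t /De[h1 h2]; split=> //=; rewrite h2.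
have fe2 : flat [set t | x <= t <= y] (H \o e) (F2 \o e).
  by apply: (flat_comp f2) => // t /De[h1 h2]; split=> //=; rewrite h2.
have ge : good n [set t | x <= t <= y] (H \o e) by apply: (good_comp gH) => // t /De[].
have rc t : x <= t <= y -> r x = r t.
  move=> /andP[xt ty]; apply: locally_constant => // u /andP[xu ut].
  have hu : x <= u <= y by rewrite xu /=; lra.
  apply: filterS (flat_ratio ge fe1 fe2 hu) => v h /andP[xv vt].
  by apply: h; rewrite /= xv /=; lra.
exists (fun p => if a p <= c then F1 p else (r x * F2 p)%g).
apply: (@flat_glue _ _ [set p | a p <= c] [set p | c <= a p]).
- move=> p /negP; rewrite -ltNge => h; apply: filterS (cont_gt ca h) => q /= hq.
  by apply/negP; rewrite -ltNge.
- move=> p /negP; rewrite -ltNge => h; apply: filterS (cont_lt ca h) => q /= hq.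
  by apply/negP; rewrite -ltNge.
- by move=> p _ /=; case: (leP (a p) c) => h; [left|right; exact: ltW].
- by apply: flat_ext f1 => p [Dp /= ->].
apply: flat_ext (flat_scale (r x) f2) => p [Dp /= cp]; case: ifP => // pc.
have [|t ht ->] := he _ Dp; first lra.
by rewrite (rc _ ht) /r mulgVK.
Qed.

Lemma flat_local (E : topologicalType) (D : set E) H i : good n D H -> (forall p, D p -> U i (H p)) ->
  flat D H (fun p => s i (H p)).
Proof.
move=> gH hU; apply: flatI => // p Dp; exists i; first exact: hU.
by apply: filterE => q Dq; rewrite !mulgV.
Qed.

Lemma flat_sub (E : topologicalType) (D D' : set E) H F : (forall p, D' p -> D p) -> flat D H F -> flat D' H F.
Proof. by move=> h f; apply: (flat_comp (th := id) f) => // x. Qed.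

Definition rect (s1 s2 x y : RR) : set (RR * RR) := [set p | s1 <= p.1 <= s2 /\ x <= p.2 <= y].

Lemma nbhs_box (p : RR * RR) (P : RR * RR -> Prop) : nbhs p P ->
  exists2 d, 0 < d & forall q, p.1 - d < q.1 -> q.1 < p.1 + d -> p.2 - d < q.2 -> q.2 < p.2 + d -> P q.
Proof.
move=> /nbhs_ballP[d /= d0 h]; exists d => // q h1 h2 h3 h4; apply: h.
by split; rewrite /ball /= /ball_ ltr_norml; apply/andP; split; lra.
Qed.

(** Sections over small boxes are joined to a section over a thin strip around each [t0], and the
    strips to a section over the square. Each join runs along a segment, on which the ratio of two
    flat sections is constant. *)
Lemma flat_exists_plane (H : RR * RR -> conf) : good n setT H -> exists F, flat sq H F.
Proof.
move=> gH; have gr D : good n D H by apply: good_sub gH.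
have strip t0 : exists2 d, 0 < d & exists F, flat (rect (t0 - d) (t0 + d) 0 1) H F.
  apply: (@interval_ind (fun x y => exists2 d, 0 < d & exists F, flat (rect (t0 - d) (t0 + d) x y) H F)).
    move=> x y z xy yz [d d0 [F f]] [d' d0' [F' f']]; exists (Num.min d d'); first by rewrite lt_min d0.
    have hd : Num.min d d' <= d by rewrite ge_min lexx.
    have hd' : Num.min d d' <= d' by rewrite ge_min lexx orbT.
    have hd0 : 0 < Num.min d d' by rewrite lt_min d0.
    move: (Num.min d d') hd hd' hd0 => m hd hd' hd0.
    apply: (flat_join (a := snd) (c := y) (F1 := F) (F2 := F') (e := fun t => (t, y)) (x := t0 - m) (y := t0 + m)) => //.
    - exact: cont_snd.
    - by apply: continuous_pairs; [exact: cont_id|exact: cont_cst].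
    - lra.
    - by move=> [u v] [/= h1 h2] ->; exists u.
    - by move=> t ht; split=> //; split=> //=; rewrite xy.
    - by apply: flat_sub f => -[u v] [[/= /andP[? ?] /andP[? ?]] ?]; split=> /=; apply/andP; split; lra.
    - by apply: flat_sub f' => -[u v] [[/= /andP[? ?] /andP[? ?]] ?]; split=> /=; apply/andP; split; lra.
  move=> t _; have [i Ui] := ch_cover C (gH.1 (t0, t) I).
  have [d d0 hd] := nbhs_box (gH.2 _ (ch_open C i) (t0, t) I Ui).
  exists d => // x y h1 xy h2; exists (d / 2); first lra.
  exists (fun p => s i (H p)); apply: flat_local => // -[u v] [/= /andP[? ?] /andP[? ?]].
  by apply: hd => //=; lra.
suff [F f] : exists F, flat (rect 0 1 0 1) H F by exists F; apply: flat_sub f => p [].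
apply: (@interval_ind (fun x y => exists F, flat (rect x y 0 1) H F)).
  move=> x y z xy yz [F f] [F' f'].
  apply: (flat_join (a := fst) (c := y) (F1 := F) (F2 := F') (e := fun t => (y, t)) (x := 0) (y := 1)) => //.
  - exact: cont_fst.
  - by apply: continuous_pairs; [exact: cont_cst|exact: cont_id].
  - by move=> [u v] [/= h1 h2] ->; exists v.
  - by move=> t ht; split=> //; split=> //=; rewrite xy.
  - by apply: flat_sub f => -[u v] [[/= /andP[? ?] /andP[? ?]] ?]; split=> /=; apply/andP; split; lra.
  - by apply: flat_sub f' => -[u v] [[/= /andP[? ?] /andP[? ?]] ?]; split=> /=; apply/andP; split; lra.
move=> t _; have [d d0 [F f]] := strip t; exists d => // x y h1 xy h2; exists F.
by apply: flat_sub f => -[u v] [/= /andP[? ?] h]; split=> //=; apply/andP; split; lra.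
Qed.

(** The retraction of the line onto the unit interval; it extends maps from the square to the plane
    and so avoids boxes cut by the boundary. *)
Definition clamp (t : RR) : RR := Num.max 0 (Num.min 1 t).

Lemma clamp_cont : continuous clamp.
Proof. by apply: cont_max; [exact: cont_cst|apply: cont_min; [exact: cont_cst|exact: cont_id]]. Qed.

Lemma clamp_II t : II (clamp t).
Proof. by rewrite /II /clamp /= le_max lexx /= ge_max ler01 ge_min lexx. Qed.

Lemma clamp_id t : II t -> clamp t = t.
Proof. by move=> /andP[h0 h1]; rewrite /clamp (min_idPr h1) (max_idPr h0). Qed.

Lemma flat_exists_square (H : RR * RR -> conf) : good n sq H -> exists F, flat sq H F.
Proof.
move=> gH; pose th (p : RR * RR) := (clamp p.1, clamp p.2).
have cth : continuous th.
  apply: continuous_pairs; [apply: (cont_comp (th := fst) clamp_cont)|apply: (cont_comp (th := snd) clamp_cont)];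
    [exact: cont_fst|exact: cont_snd].
have g : good n setT (H \o th) by apply: (good_comp gH) => // p _; split; exact: clamp_II.
have [F f] := flat_exists_plane g; exists F => p sp i Ui.
have eH q : sq q -> (H \o th) q = H q by case: q => u v [/= h1 h2]; rewrite /th /= !clamp_id.
by have := f p sp i; rewrite eH // => /(_ Ui); apply: filterS => q h sq'; rewrite -(eH q) // h.
Qed.

Definition hol (f : RR -> conf) (k : K) := exists2 F, flat II f F & k = ((F 0%R)^-1 * F 1%R)%g.

Lemma hol_exists S S' f : ispath n S S' f -> exists k, hol f k.
Proof.
case=> gf _ _; have g : good n sq (fun p => f p.2).
  by apply: (good_comp (th := snd) gf) => [|p []//]; exact: cont_snd.
have [F fF] := flat_exists_square g; exists ((F (0, 0)%R)^-1 * F (0, 1)%R)%g, (fun t => F (0, t)) => //.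
apply: (flat_comp (th := fun t : RR => (0 : RR, t)) fF).
  by apply: continuous_pairs; [exact: cont_cst|exact: cont_id].
by move=> t It; split=> //; exact: II0.
Qed.

Lemma flat_unique f F F' : good n II f -> flat II f F -> flat II f F' ->
  ((F 0%R)^-1 * F 1%R = (F' 0%R)^-1 * F' 1%R)%g.
Proof.
move=> gf h h'; have e := flat_ratio gf h h'.
have {}e : (F 0%R * (F' 0%R)^-1 = F 1%R * (F' 1%R)^-1)%g by apply: (@locally_constant _ (fun t => (F t * (F' t)^-1)%g)).
by rewrite -[F 1](mulgVK (F' 1)) -e !mulgA mulVg mul1g.
Qed.

(** A flat section over the homotopy restricts to both paths, and it is constant on the two
    remaining sides, where the configuration does not change. *)
Lemma hol_phom S S' f g k k' : phom n S S' f g -> hol f k -> hol g k' -> k = k'.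
Proof.
case=> -[gf f0 f1] [gg g0 g1] [H [gH e1 e2]] [F fF ->] [F' fF' ->].
have [W fW] := flat_exists_square gH.
have row s0 : II s0 -> flat II (fun t => H (s0, t)) (fun t => W (s0, t)).
  move=> Is; apply: (flat_comp (th := fun t : RR => (s0, t)) fW) => // .
  by apply: continuous_pairs; [exact: cont_cst|exact: cont_id].
have fx f' h F0 : (forall t, II t -> f' t = h t) -> flat II f' F0 -> flat II h F0.
  move=> e fl t It i Ui; have := fl t It i; rewrite e // => /(_ Ui).
  by apply: filterS => u hu Iu; rewrite -e // hu.
have r0 := fx _ f _ (fun t It => (e1 t It).1) (row _ II0).
have r1 := fx _ g _ (fun t It => (e1 t It).2) (row _ II1).
rewrite (flat_unique gf fF r0) (flat_unique gg fF' r1).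
have side t T0 : (t = 0 \/ t = 1) -> (forall s0, II s0 -> H (s0, t) = T0) -> W (0, t) = W (1, t).
  move=> ht hT; apply: (@locally_constant _ (fun s0 => W (s0, t))) => // s0 Is.
  have It : II t by case: ht => ->; [exact: II0|exact: II1].
  have [i Ui] := ch_cover C (gH.1 (s0, t) (conj (Is : II s0) It)).
  have sst : sq (s0, t) by split.
  have cth : continuous (fun s0 : RR => (s0, t)) by apply: continuous_pairs; [exact: cont_id|exact: cont_cst].
  have hn : nbhs s0 (fun u => sq (u, t) -> (W (u, t) * (s i (H (u, t)))^-1 = W (s0, t) * (s i (H (s0, t)))^-1)%g)
    := cth s0 _ (fW _ sst i Ui).
  apply: filterS hn => u hu Iu.
  have := hu (conj Iu It); rewrite !hT // => /(congr1 (fun z => z * s i T0)%g).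
  by rewrite !mulgVK.
by rewrite (side 0 S) ?(side 1 S') //; [right|move=> s0 /e2[]|left|move=> s0 /e2[]].
Qed.

Lemma hol_concat S S' S'' f g k k' : ispath n S S' f -> ispath n S' S'' g -> hol f k -> hol g k' ->
  hol (pconcat f g) (k * k')%g.
Proof.
move=> pf pg [F1 h1 ->] [F2 h2 ->]; have pfg := ispath_concat pf pg.
have [_ [F fF _]] := hol_exists pfg; exists F => //.
have [gf f0 f1] := pf; have [gg g0 g1] := pg.
have fx (h th : RR -> RR) f' : continuous th -> (forall t, II t -> II (th t)) ->
    (forall t, II t -> pconcat f g (th t) = f' t) -> flat II f' (F \o th).
  move=> ct ht e t It i Ui; have := flat_comp fF ct ht It; rewrite /= e // => /(_ i Ui).
  by apply: filterS => u hu Iu; rewrite -e // hu.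
have b1 : flat II f (F \o (fun t : RR => 2^-1 * t)).
  apply: (fx id) => [|t /andP[? ?]|t /andP[? ?]].
  - by apply: cont_mul; [exact: cont_cst|exact: cont_id].
  - by rewrite /II /=; apply/andP; split; lra.
  - by rewrite /pconcat ifT ?mulVKf //; lra.
have b2 : flat II g (F \o (fun t : RR => 2^-1 + 2^-1 * t)).
  apply: (fx id) => [|t /andP[? ?]|t /andP[t0 t1]].
  - by apply: cont_add; [exact: cont_cst|apply: cont_mul; [exact: cont_cst|exact: cont_id]].
  - by rewrite /II /=; apply/andP; split; lra.
  - rewrite /pconcat; case: ifP => h.
      have -> : t = 0 by lra.
      by rewrite mulr0 addr0 mulfV // f1 g0.
    by congr g; lra.
rewrite (flat_unique gf h1 b1) (flat_unique gg h2 b2) /= !mulr0 !mulr1 addr0.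
have -> : (2^-1 + 2^-1 = 1 :> RR) by lra.
by rewrite mulgA mulgK.
Qed.

Lemma hol_inv S S' f k : ispath n S S' f -> hol f k -> hol (pinv f) k^-1%g.
Proof.
move=> pf [F fF ->]; exists (fun t => F (1 - t)).
  apply: (flat_comp (th := fun t : RR => (1 - t : RR)) fF).
    by apply: cont_add; [exact: cont_cst|apply: cont_opp; exact: cont_id].
  by move=> t /andP[? ?]; rewrite /II /=; apply/andP; split; lra.
by rewrite subr0 subrr invgM invgK.
Qed.
End Flat.

Section Naturality.
Variables (K K' : groupType) (C : charts K) (C' : charts K') (h : K -> K') (r : ch_idx C -> ch_idx C').
Hypothesis hM : forall x y, h (x * y)%g = (h x * h y)%g.
Hypothesis hr : forall i S, ch_dom i S -> ch_dom (r i) S /\ ch_map (r i) S = h (ch_map i S).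

(** A homomorphism of structure groups that matches the charts carries flat sections to flat
    sections. It serves to project the Heisenberg group to a coordinate. *)
Lemma hol_natural S S' f k : ispath n S S' f -> hol C f k -> hol C' f (h k).
Proof.
case=> gf _ _ [F fF ->].
have h1 : h 1%g = 1%g by apply: (@mulgI _ (h 1%g)); rewrite -hM !mulg1.
have hV x : h x^-1%g = (h x)^-1%g by apply: (@mulgI _ (h x)); rewrite -hM !mulgV.
exists (h \o F); last by rewrite hM hV.
apply: flatI => // t It; have [i Ui] := ch_cover C (gf.1 _ It); have [Ui' _] := hr Ui.
exists (r i) => //; apply: filterS (filterI (gf.2 _ (ch_open C i) _ It Ui) (fF t It i Ui)) => u [h2 h3] Iu.
by rewrite /= (hr (h2 Iu)).2 (hr Ui).2 -!hV -!hM h3.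
Qed.
End Naturality.
End Holonomy.

(* A subdivision of [G] described by its vertices: [nd e 0], ..., [nd e (len e)] are the
   vertices met along the edge [e]. *)
Record marking (G : graph) := Marking {
  mkV : finType; nd : gE G -> nat -> mkV; vx : gV G -> mkV; len : gE G -> nat;
  len3 : forall e, (2 < len e)%N;
  nd0 : forall e, nd e 0 = vx (gsrc e); ndl : forall e, nd e (len e) = vx (gtgt e);
  vx_inj : injective vx;
  nd_inj : forall e e' m m', (0 < m < len e)%N -> (0 < m' < len e')%N -> nd e m = nd e' m' -> e = e' /\ m = m';
  nd_vx : forall e m v, (0 < m < len e)%N -> nd e m <> vx v;
  mk_surj : forall A, (exists v, A = vx v) \/ exists e m, (0 < m < len e)%N /\ A = nd e m }.

(** * Barycentric coordinates on the realization of a graph *)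

Section Coordinates.
Import Order.TTheory GRing.Theory Num.Theory.
Local Open Scope ring_scope.
Local Open Scope classical_set_scope.
Variables (G : graph) (K : marking G).
Notation V := (mkV K).
Notation pt := (gpt G).
Implicit Types (A u w : V) (e : gE G).

Definition medge u w (em : gE G * nat) := (em.2 < len K em.1)%N /\
  ((nd K em.1 em.2 = u /\ nd K em.1 em.2.+1 = w) \/ (nd K em.1 em.2 = w /\ nd K em.1 em.2.+1 = u)).

Definition madj u w : bool := `[< exists em, medge u w em >].

Lemma medge_sym u w em : medge u w em <-> medge w u em.
Proof. by split=> -[h [[h1 h2]|[h1 h2]]]; split=> //; [right|left|right|left]. Qed.

Lemma madjC : symmetric madj.
Proof. by move=> u w; apply/asboolP/asboolP => -[em /medge_sym h]; exists em. Qed.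

Lemma nd_neq e m : (m < len K e)%N -> nd K e m <> nd K e m.+1.
Proof.
move=> hm; have l3 := len3 K e; case: (posnP m) => [->|m0].
  by rewrite nd0 => /esym; apply: nd_vx; lia.
have [hm'|hm'] := ltnP m.+1 (len K e); last first.
  have -> : m.+1 = len K e by lia.
  by rewrite ndl; apply: nd_vx; lia.
by move=> /nd_inj[]; [lia|lia|move=> _; lia].
Qed.

Lemma madj_neq u w : madj u w -> u != w.
Proof.
move=> /asboolP[[e m] [/= h [[<- <-]|[<- <-]]]]; apply/eqP; first exact: nd_neq.
by move/esym; exact: nd_neq.
Qed.

Definition hat (x : RR) : RR := Num.max 0 (1 - `|x|).

Definition bfun e A (t : RR) : RR := \sum_(m < (len K e).+1) (nd K e m == A)%:R * hat ((len K e)%:R * t - m%:R).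

(** The barycentric coordinate of [q] at the vertex [A] of the subdivision, piecewise linear on
    every edge. *)
Definition beta A (q : pt) : RR :=
  match q with inl v => (vx K v == A)%:R | inr (e, t) => bfun e A t end.

Lemma hat_far (x : RR) : 1 <= `|x| -> hat x = 0.
Proof. by move=> h; rewrite /hat; apply/max_idPl; lra. Qed.

Lemma hat_near (x : RR) : `|x| <= 1 -> hat x = 1 - `|x|.
Proof. by move=> h; rewrite /hat; apply/max_idPr; lra. Qed.

Lemma bfunE e A j (s : RR) t : (j < len K e)%N -> 0 <= s <= 1 -> (len K e)%:R * t = j%:R + s ->
  bfun e A t = (1 - s) * (A == nd K e j)%:R + s * (A == nd K e j.+1)%:R.
Proof.
move=> hj /andP[s0 s1] et; have h1 : (j < (len K e).+1)%N by lia.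
have h2 : (j.+1 < (len K e).+1)%N by lia.
rewrite /bfun et (bigD1 (Ordinal h1)) //= (bigD1 (Ordinal h2)) /=; last by apply/eqP => -[]; lia.
rewrite big1 => [|m /andP[m1 m2]]; last first.
  rewrite hat_far ?mulr0 //.
  have [h|h] := ltnP m j.
    have h' : m%:R + 1 <= j%:R :> RR by rewrite natr1 ler_nat.
    by rewrite ger0_norm; lra.
  have h' : j%:R + 2 <= m%:R :> RR.
    rewrite -natrD ler_nat; move/eqP: m1; move/eqP: m2 => m2 m1.
    have n1 : (m : nat) <> j by move=> e1; apply: m1; apply: val_inj.
    have n2 : (m : nat) <> j.+1 by move=> e1; apply: m2; apply: val_inj.
    by lia.
  by rewrite ler0_norm; lra.
rewrite addr0 !(eq_sym A) addrAC subrr add0r hat_near; last by rewrite ger0_norm.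
have -> : j%:R + s - j.+1%:R = s - 1 :> RR by rewrite -natr1; ring.
have a1 : `|s - 1| = 1 - s by rewrite ler0_norm; lra.
by rewrite hat_near a1 ?(ger0_norm s0); [ring|lra].
Qed.

Lemma len_gt0 e : 0 < (len K e)%:R :> RR.
Proof. by rewrite ltr0n; have := len3 K e; lia. Qed.

Lemma edge_param e (t : RR) : II t -> exists j s, [/\ (j < len K e)%N, 0 <= s <= 1 & (len K e)%:R * t = j%:R + s].
Proof.
move=> /andP[t0 t1]; have l0 := len_gt0 e; pose x := (len K e)%:R * t.
have x0 : 0 <= x by rewrite /x; nra.
have xl : x <= (len K e)%:R by rewrite /x; nra.
have /andP[h1 h2] := Num.Theory.truncn_itv x0; rewrite -/x.
have [h|h] := ltnP (Num.truncn x) (len K e).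
  exists (Num.truncn x), (x - (Num.truncn x)%:R); split=> //; last by rewrite addrC subrK.
  by move: h2; rewrite -natr1 => h2; apply/andP; split; lra.
have l3 := len3 K e; exists (len K e).-1, 1; split; [lia|by rewrite ler01 lexx|].
rewrite natr1 prednK; last lia.
by apply/le_anti; rewrite xl /=; apply: le_trans h1; rewrite ler_nat.
Qed.

Lemma beta_gchar A e t : II t -> beta A (gchar e t) = bfun e A t.
Proof.
move=> It; have l3 := len3 K e; have /andP[t0 t1] := It; rewrite /gchar; case: ifP => h.
  have -> : t = 0 by lra.
  rewrite (@bfunE e A 0 0) ?lexx ?ler01 //; [|lia|by rewrite mulr0 addr0].
  by rewrite subr0 mul1r mul0r addr0 nd0 /= eq_sym.
case: ifP => h' //; have -> : t = 1 by lra.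
rewrite (@bfunE e A (len K e).-1 1) ?lexx ?ler01 //; [|lia|by rewrite mulr1 natr1 prednK //; lia].
by rewrite subrr mul0r mul1r add0r prednK ?ndl /= 1?eq_sym //; lia.
Qed.

Lemma cont_abs (E : topologicalType) (a : E -> RR) : continuous a -> continuous (fun x => `|a x|).
Proof. by move=> ca x; apply: (@cvg_norm RR RR^o); exact: ca. Qed.

Lemma bfun_cont e A : continuous (bfun e A).
Proof.
rewrite /bfun; elim: (index_enum _) => [|m r IH].
  by under eq_fun do rewrite big_nil; exact: cont_cst.
under eq_fun do rewrite big_cons; apply: cont_add => //.
apply: cont_mul; first exact: cont_cst.
apply: cont_max; first exact: cont_cst.
apply: cont_add; [exact: cont_cst|apply: cont_opp; apply: cont_abs].
by apply: cont_add; [apply: cont_mul; [exact: cont_cst|exact: cont_id]|exact: cont_cst].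
Qed.

Lemma gopen_fun (f : pt -> RR) (O : set RR) (g : gE G -> RR -> RR) : open O -> (forall e, continuous (g e)) ->
  (forall e t, II t -> f (gchar e t) = g e t) -> gopen [set q | O (f q)].
Proof.
move=> oO cg fg e; apply/rel_open01P => t It /= Ot; rewrite fg // in Ot.
have h : nbhs (g e t) O by apply: open_nbhs_nbhs.
have h' : nbhs t (fun x : RR => O (g e x)) := cg e t _ h.
by apply: filterS h' => x /= hx Ix; rewrite fg.
Qed.

Lemma gopen_beta A (O : set RR) : open O -> gopen [set q | O (beta A q)].
Proof. by move=> oO; apply: (gopen_fun oO (bfun_cont^~ A)) => e t; exact: beta_gchar. Qed.

Lemma gopenI (W W' : set pt) : gopen W -> gopen W' -> gopen (W `&` W').
Proof.
move=> h h' e; apply/rel_open01P => t It [w w'].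
move/rel_open01P: (h e) => /(_ t It w) h1; move/rel_open01P: (h' e) => /(_ t It w') h2.
by apply: filterS (filterI h1 h2) => u [a b] Iu; split; [exact: a|exact: b].
Qed.

Lemma gopenT : gopen [set: pt].
Proof. by move=> e; apply/rel_open01P => t It _; apply: filterE. Qed.

(** Points are separated by real functions. On edges [kv v] is linear and detects the vertex [v];
    [he e k] is [t * (1 - t) * t ^+ k] on the edge [e], and its values for [k = 0] and [k = 1]
    together determine an inner point of [e]. *)
Lemma hausdorff (q q' : pt) : gvalid q -> gvalid q' -> q <> q' ->
  exists W W', [/\ gopen W, gopen W', W q, W' q' & forall z, W z -> W' z -> False].
Proof.
have sep (f : pt -> RR) (g : gE G -> RR -> RR) : (forall e, continuous (g e)) ->
  (forall e t, II t -> f (gchar e t) = g e t) -> forall q q', f q < f q' ->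
  exists W W', [/\ gopen W, gopen W', W q, W' q' & forall z, W z -> W' z -> False].
  move=> cg fg z z' h; exists [set x | [set y | y < (f z + f z') / 2] (f x)], [set x | [set y | (f z + f z') / 2 < y] (f x)].
  split; rewrite /= ?midf_lt //.
  - have o1 : open [set y : RR | y < (f z + f z') / 2] by exact: open_lt.
    exact: (gopen_fun o1 cg fg).
  - have o1 : open [set y : RR | (f z + f z') / 2 < y] by exact: open_gt.
    exact: (gopen_fun o1 cg fg).
  - by move=> y /= h1 h2; lra.
have sep2 (f : pt -> RR) (g : gE G -> RR -> RR) : (forall e, continuous (g e)) -> (forall e t, II t -> f (gchar e t) = g e t) ->
  f q <> f q' -> exists W W', [/\ gopen W, gopen W', W q, W' q' & forall z, W z -> W' z -> False].
  move=> cg fg /eqP; rewrite neq_lt => /orP[|] h; first exact: sep cg fg _ _ h.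
  by have [W [W' [h1 h2 h3 h4 h5]]] := sep f g cg fg _ _ h; exists W', W; split=> // z hz hz'; apply: (h5 z).
pose kv (v : gV G) (z : pt) : RR := match z with inl v' => (v' == v)%:R
  | inr (e, t) => (gsrc e == v)%:R * (1 - t) + (gtgt e == v)%:R * t end.
pose he e (k : nat) (z : pt) : RR := match z with inl v => 0 | inr (e', t) => (e' == e)%:R * (t * (1 - t) * t ^+ k) end.
have ckv v : forall e, continuous (fun t : RR => (gsrc e == v)%:R * (1 - t) + (gtgt e == v)%:R * t : RR).
  move=> e; apply: cont_add; (apply: cont_mul; first exact: cont_cst); last exact: cont_id.
  by apply: cont_add; [exact: cont_cst|apply: cont_opp; exact: cont_id].
have ekv v e t : II t -> kv v (gchar e t) = (gsrc e == v)%:R * (1 - t) + (gtgt e == v)%:R * t.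
  move=> /andP[t0 t1]; rewrite /gchar; case: ifP => h /=.
    have -> : t = 0 by lra.
    by rewrite subr0 mulr1 mulr0 addr0.
  case: ifP => h' //=; have -> : t = 1 by lra.
  by rewrite subrr mulr0 mulr1 add0r.
have che e k : forall e', continuous (fun t : RR => (e' == e)%:R * (t * (1 - t) * t ^+ k) : RR).
  move=> e'; apply: cont_mul; first exact: cont_cst.
  apply: cont_mul.
    by apply: cont_mul; [exact: cont_id|apply: cont_add; [exact: cont_cst|apply: cont_opp; exact: cont_id]].
  elim: k => [|k IH]; first exact: cont_cst.
  under eq_fun do rewrite exprS; apply: cont_mul => //; exact: cont_id.
have ehe e k e' t : II t -> he e k (gchar e' t) = (e' == e)%:R * (t * (1 - t) * t ^+ k).
  move=> /andP[t0 t1]; rewrite /gchar; case: ifP => h /=.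
    have -> : t = 0 by lra.
    by rewrite !mul0r mulr0.
  case: ifP => h' //=; have -> : t = 1 by lra.
  by rewrite subrr mulr0 mul0r mulr0.
case: q q' sep2 => [v|[e t]] [v'|[e' t']] sep2 /= vq vq' ne.
- apply: (sep2 (kv v) _ (ckv v) (ekv v)); rewrite /kv eqxx; case: eqVneq => [e|_] h; last by move: h => /eqP; rewrite oner_eq0.
  by apply: ne; rewrite e.
- apply: (sep2 (he e' 0%N) _ (che e' 0%N) (ehe e' 0%N)); rewrite /he eqxx expr0 mul1r mulr1 => hh; case/andP: vq' => a1 a2.
  have : 0 < t' * (1 - t') by nra.
  by rewrite -hh ltxx.
- apply: (sep2 (he e 0%N) _ (che e 0%N) (ehe e 0%N)); rewrite /he eqxx expr0 mul1r mulr1 => hh; case/andP: vq => a1 a2.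
  have : 0 < t * (1 - t) by nra.
  by rewrite hh ltxx.
case/andP: vq => t0 t1; case/andP: vq' => t0' t1'.
have [h0|h0] := pselect (he e 0%N (inr (e, t)) = he e 0%N (inr (e', t'))); last first.
  exact: (sep2 (he e 0%N) _ (che e 0%N) (ehe e 0%N)).
apply: (sep2 (he e 1%N) _ (che e 1%N) (ehe e 1%N)) => h1.
move: h0 h1; rewrite /he eqxx !expr0 !expr1 !mulr1 !mul1r.
case: (eqVneq e' e) => [ee|_]; last first.
  have h2 : 0 < t * (1 - t) by rewrite mulr_gt0 // subr_gt0.
  by rewrite !mul0r => h _; rewrite h ltxx in h2.
rewrite !mul1r => -> h; apply: ne; rewrite ee; congr (inr (_, _)).
by apply: (@mulfI _ (t' * (1 - t'))) => //; rewrite gt_eqF // mulr_gt0 // subr_gt0.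
Qed.

Lemma mk_point A : exists q : pt, gvalid q /\ ((exists2 v, A = vx K v & q = inl v) \/
  exists e m, [/\ (0 < m < len K e)%N, A = nd K e m & q = inr (e, m%:R / (len K e)%:R)]).
Proof.
case: (mk_surj A) => [[v ->]|[e [m [hm ->]]]]; first by exists (inl v); split=> //; left; exists v.
exists (inr (e, m%:R / (len K e)%:R)); split; last by right; exists e, m.
have l0 := len_gt0 e; case/andP: hm => m0 ml.
by rewrite /gvalid ltr_pdivlMr ?ltr_pdivrMr // mul0r mul1r ltr0n ltr_nat m0.
Qed.

Definition mpt A : pt := projT1 (cid (mk_point A)).

Lemma mpt_valid A : gvalid (mpt A).
Proof. by rewrite /mpt; case: cid => q []. Qed.

Lemma mpt_vx v : mpt (vx K v) = inl v.
Proof.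
rewrite /mpt; case: cid => q /= [_ [[v' /vx_inj h ->]|[e [m [hm /esym h _]]]]]; first by rewrite h.
by case: (nd_vx hm h).
Qed.

Lemma mpt_nd e m : (m <= len K e)%N -> mpt (nd K e m) = gchar e (m%:R / (len K e)%:R).
Proof.
have l0 := len_gt0 e; have l3 := len3 K e; move=> hm.
have [->|m0] := posnP m; first by rewrite nd0 mpt_vx mul0r /gchar lexx.
have [ml|ml] := ltnP m (len K e); last first.
  have -> : m = len K e by lia.
  by rewrite ndl mpt_vx divff ?gt_eqF // /gchar ler10 lexx.
have hm' : (0 < m < len K e)%N by rewrite m0.
rewrite /mpt; case: cid => q [vq [[v' h _]|[e' [m' [h1 h2 h3]]]]] /=; first by have := nd_vx hm' h.
have [ee em] := nd_inj hm' h1 h2; rewrite h3 in vq *; subst e' m'.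
by rewrite /gchar; case/andP: vq => a1 a2; rewrite !ifF //; apply/negbTE; rewrite -ltNge.
Qed.

Lemma beta_mpt A B : beta A (mpt B) = (A == B)%:R.
Proof.
case: (mk_surj B) => [[v ->]|[e [m [/andP[m0 ml] ->]]]]; first by rewrite mpt_vx /= eq_sym.
have l0 := len_gt0 e; rewrite mpt_nd 1?ltnW // beta_gchar; last first.
  by rewrite /II /= ler_pdivlMr ?ler_pdivrMr // mul0r mul1r ler0n ler_nat ltnW.
rewrite (@bfunE e A m 0) ?lexx ?ler01 //; last by rewrite mulrCA divff ?gt_eqF // mulr1 addr0.
by rewrite subr0 mul1r mul0r addr0.
Qed.

(** A token moving linearly from [u] to an adjacent [w]. The chosen edge may be directed either way,
    hence the inner test; the case [u == w] is a resting token, so that all tokens of a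
    configuration have one form. *)
Definition etok u w (t : RR) : pt :=
  if u == w then mpt u else
  match pselect (exists em, medge u w em) with
  | left h => let em := projT1 (cid h) in
      gchar em.1 ((em.2%:R + (if nd K em.1 em.2 == u then t else 1 - t)) / (len K em.1)%:R)
  | right _ => mpt u
  end.

Lemma tok_edge u w em t : medge u w em -> u != w -> exists e m, [/\ medge u w (e, m),
  (nd K e m = u -> etok u w t = gchar e ((m%:R + t) / (len K e)%:R)) &
  (nd K e m = w -> etok u w t = gchar e ((m%:R + (1 - t)) / (len K e)%:R))].
Proof.
move=> hem uw; rewrite /etok (negbTE uw); case: pselect => [h|[]]; last by exists em.
case: cid => -[e m] /= he; exists e, m; split=> // ->; rewrite ?eqxx //.
by rewrite eq_sym (negbTE uw).
Qed.

Lemma seg_II e m (s : RR) : (m < len K e)%N -> II s -> II ((m%:R + s) / (len K e)%:R).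
Proof.
move=> hm /andP[s0 s1]; have l0 := len_gt0 e.
have h : m%:R + 1 <= (len K e)%:R :> RR by rewrite natr1 ler_nat.
have m0 : 0 <= m%:R :> RR by rewrite ler0n.
by rewrite /II /= ler_pdivlMr ?ler_pdivrMr // mul0r mul1r; apply/andP; split; lra.
Qed.

Lemma beta_tok A u w t : (u == w) || madj u w -> II t ->
  beta A (etok u w t) = (1 - t) * (A == u)%:R + t * (A == w)%:R.
Proof.
case: eqVneq => [<- _ _|uw /= /asboolP[em hem] It].
  by rewrite /etok eqxx beta_mpt -mulrDl subrK mul1r.
have It' : II (1 - t) by move: It => /andP[? ?]; rewrite /II /=; apply/andP; split; lra.
have [e [m [[/= hm he] h1 h2]]] := tok_edge t hem uw; have l0 := len_gt0 e.
case: he => -[e1 e2]; [rewrite h1 //|rewrite h2 //]; rewrite beta_gchar; try exact: seg_II.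
  by rewrite (bfunE _ hm It) ?e1 ?e2 // mulrCA divff ?gt_eqF // mulr1.
rewrite (bfunE _ hm It') ?e1 ?e2 //; last by rewrite mulrCA divff ?gt_eqF // mulr1.
by rewrite subKr addrC.
Qed.

Lemma gchar_valid e t : gvalid (gchar e t).
Proof. by rewrite /gchar; case: ifPn => // h; case: ifPn => // h'; rewrite /= !ltNge h h'. Qed.

Lemma tok_valid u w t : gvalid (etok u w t).
Proof.
rewrite /etok; case: eqVneq => _; first exact: mpt_valid.
by case: pselect => [h|_]; [exact: gchar_valid|exact: mpt_valid].
Qed.

Lemma tgood_gchar (E : topologicalType) (D : set E) e (a : E -> RR) : continuous a ->
  (forall p, D p -> II (a p)) -> tgood D (fun p => gchar e (a p)).
Proof.
move=> ca ha W gW p Dp Wp; move/rel_open01P: (gW e) => /(_ _ (ha _ Dp) Wp) h.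
have h' : nbhs p (fun q => II (a q) -> W (gchar e (a q))) := ca p _ h.
by apply: filterS h' => q hq Dq; apply: hq; exact: ha.
Qed.

Lemma tgood_cst (E : topologicalType) (D : set E) (q : pt) : tgood D (fun=> q).
Proof. by move=> W _ p _ Wq; apply: filterE. Qed.

Lemma tgood_tok (E : topologicalType) (D : set E) u w (a : E -> RR) : continuous a ->
  (forall p, D p -> II (a p)) -> tgood D (fun p => etok u w (a p)).
Proof.
move=> ca ha; rewrite /etok; case: eqVneq => _; first exact: tgood_cst.
case: pselect => [h|_]; last exact: tgood_cst.
case: cid => -[e m] [/= hm _]; have It t : II t -> II (1 - t).
  by move=> /andP[? ?]; rewrite /II /=; apply/andP; split; lra.
case: (nd K e m == u); apply: tgood_gchar.
- by apply: cont_mul; [apply: cont_add; [exact: cont_cst|]|exact: cont_cst].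
- by move=> p /ha; exact: seg_II.
- apply: cont_mul; [apply: cont_add; [exact: cont_cst|]|exact: cont_cst].
  by apply: cont_add; [exact: cont_cst|exact: cont_opp].
- by move=> p /ha/It; exact: seg_II.
Qed.

Lemma tok0 u w : (u == w) || madj u w -> etok u w 0 = mpt u.
Proof.
case: eqVneq => [->|uw /= /asboolP[em hem]]; first by rewrite /etok eqxx.
have [e [m [[/= hm he] h1 h2]]] := tok_edge 0 hem uw.
case: he => -[e1 e2]; first by rewrite h1 // addr0 -mpt_nd ?e1 // ltnW.
by rewrite h2 // subr0 natr1 -mpt_nd ?e2.
Qed.

Lemma tok_rev u w t : (u == w) || madj u w -> etok w u t = etok u w (1 - t).
Proof.
rewrite /etok (eq_sym w); case: eqVneq => [->//|uw /= /asboolP ex].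
have e : medge w u = medge u w by apply: funext => em; apply: propext; exact: medge_sym.
rewrite e; case: pselect => [h|//].
case: cid => -[e0 m] [/= hm [[e1 e2]|[e1 e2]]]; rewrite ?e1 eqxx ?(eq_sym w) ?(negbTE uw) ?subKr //.
Qed.

Lemma tok1 u w : (u == w) || madj u w -> etok u w 1 = mpt w.
Proof. by move=> h; rewrite -[1]subr0 -tok_rev // tok0 // eq_sym madjC. Qed.
End Coordinates.

(** * Moves as paths of configurations *)

Section VertexConfigs.
Import Order.TTheory GRing.Theory Num.Theory.
Local Open Scope ring_scope.
Local Open Scope classical_set_scope.
Variables (G : graph) (K : marking G) (n : nat).
Notation V := (mkV K).
Notation pt := (gpt G).
Notation conf := (set pt).
Notation adj := (@madj G K).
Implicit Types (S : {set V}) (u w v : V) (x y : 'I_n -> V).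

Definition CS S : conf := [set q | exists2 v, v \in S & q = mpt v].

Lemma set_ordering S : #|S| = n -> exists x, injective x /\ im x = S.
Proof.
move=> cS; exists (fun i => enum_val (cast_ord (esym cS) i)); split.
  by move=> i j /enum_val_inj/cast_ord_inj.
apply/setP => v; apply/imsetP/idP => [[i _ ->]|vS]; first exact: enum_valP.
exists (cast_ord cS (enum_rank_in vS v)) => //.
by rewrite cast_ordK enum_rankK_in.
Qed.

(** Tokens on edges without common ends never meet, as their barycentric coordinates have disjoint
    supports. *)
Lemma tokens_oconf x y (th : 'I_n -> RR) : (forall i, II (th i)) -> (forall i, (x i == y i) || adj (x i) (y i)) ->
  (forall i j, i != j -> [/\ x i != x j, x i != y j & y i != y j]) -> oconf (fun i => etok (x i) (y i) (th i)).
Proof.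
move=> It a d; split=> [i|i j e]; first exact: tok_valid.
apply/eqP; apply: contraT => ij; have [d1 d2 d3] := d _ _ ij.
have [_ d4 _] := d j i (introN eqP (fun h => negP ij (introT eqP (esym h)))).
have hb (A : V) := congr1 (beta A) e; have /andP[t0 t1] := It i.
have h1 := hb (x i); have h2 := hb (y i).
rewrite !beta_tok // !eqxx (negbTE d1) (negbTE d2) in h1.
rewrite !beta_tok // !eqxx (eq_sym _ (x j)) (negbTE d4) (negbTE d3) in h2.
case: eqVneq h1 h2 => [_|ne] h1 h2; first by move: h1; rewrite !mulr1 !mulr0; lra.
by move: h1 h2; rewrite !mulr1 !mulr0; lra.
Qed.

Lemma range_mpt x : range (mpt (K := K) \o x) = CS (im x).
Proof.
apply/seteqP; split=> q /=.
  by move=> [i _ <-]; exists (x i); first exact: mem_im.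
by move=> [v /imsetP[i _ ->] ->]; exists i.
Qed.

Definition mv S u w (t : RR) : conf := [set q | (exists2 v, v \in S :\ u & q = mpt v) \/ q = etok u w t].

Lemma tok_id u t : etok u u t = mpt u.
Proof. by rewrite /etok eqxx. Qed.

Lemma mvE x i w t : injective x ->
  mv (im x) (x i) w t = range (fun j => etok (x j) (upd x i w j) (if j == i then t else 0)).
Proof.
move=> ix; apply/seteqP; split=> q /=.
  case=> [[v /setD1P[vi /imsetP[j _ ej]] ->]|->].
    exists j => //; have ji : j != i by apply: contraNneq vi => <-; rewrite ej.
    by rewrite /upd (negbTE ji) tok_id ej.
  by exists i => //; rewrite /upd eqxx.
move=> [j _ <-]; rewrite /upd; case: (eqVneq j i) => [->|ji]; first by right.
by left; exists (x j); rewrite ?tok_id // finset.in_setD1 (inj_eq ix) ji mem_im.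
Qed.

Lemma upd_edges x i w : adj (x i) w -> forall j, (x j == upd x i w j) || adj (x j) (upd x i w j).
Proof. by move=> a j; rewrite /upd; case: (eqVneq j i) => [->|_]; rewrite ?a ?orbT ?eqxx. Qed.

Lemma upd_disjoint x i w : injective x -> w \notin im x ->
  forall j k, j != k -> [/\ x j != x k, x j != upd x i w k & upd x i w j != upd x i w k].
Proof.
move=> ix nw j k jk; have xw l : x l != w by apply: contraNneq nw => <-; exact: mem_im.
rewrite /upd; split; rewrite ?(inj_eq ix) //.
  by case: ifP; rewrite ?xw ?(inj_eq ix).
case: (eqVneq j i) => [ji|ji]; case: (eqVneq k i) => [ki|ki]; rewrite ?(inj_eq ix) //.
- by rewrite ji ki eqxx in jk.
- by rewrite eq_sym xw.
Qed.

Lemma mv_path S u w : #|S| = n -> mvok adj S u w -> ispath n (CS S) (CS (mvS S u w)) (mv S u w).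
Proof.
move=> cS /and3P[a uS wS]; have [x [ix ex]] := set_ordering cS.
have /imsetP[i _ ei] : u \in im x by rewrite ex.
rewrite -ex ei in a wS *; split.
- refine (@good_ext _ _ _ II (fun t : RR => range (fun j => etok (x j) (upd x i w j) (if j == i then t else 0))) _ _ _).
    by move=> t _; rewrite mvE.
  apply: good_tokens => [t It|j].
    apply: tokens_oconf; [|exact: upd_edges|exact: upd_disjoint].
    by move=> j; case: ifP => _ //; exact: II0.
  apply: tgood_tok; first by case: (j == i); [exact: cont_id|exact: cont_cst].
  by move=> t It; case: ifP => _ //; exact: II0.
- rewrite mvE // -range_mpt; apply: (congr1 (fun h : 'I_n -> pt => range h)); apply: funext => j.
  by rewrite if_same tok0 //; exact: upd_edges.
have -> : mvS (im x) (x i) w = im (upd x i w).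
  apply/setP => v; rewrite !inE; apply/orP/imsetP => [[/eqP ->|/andP[vi /imsetP[j _ ej]]]|[j _ ->]].
  - by exists i; rewrite // /upd eqxx.
  - by exists j; rewrite // /upd; case: eqVneq => // e; rewrite ej e eqxx in vi.
  rewrite /upd; case: (eqVneq j i) => [_|ji]; first by rewrite eqxx; left.
  by right; rewrite (inj_eq ix) ji mem_im.
rewrite mvE // -range_mpt; apply: (congr1 (fun h : 'I_n -> pt => range h)); apply: funext => j; rewrite /=.
case: eqVneq => [->|ji]; first by rewrite tok1 //; exact: upd_edges.
by rewrite /upd (negbTE ji) tok_id.
Qed.

Lemma mv_rev S u w : mvok adj S u w -> mv (mvS S u w) w u = pinv (mv S u w).
Proof.
case/and3P=> a uS wS; apply: funext => t; rewrite /mv /pinv tok_rev ?a ?orbT //.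
have -> // : mvS S u w :\ w = S :\ u.
by apply/setP => v; rewrite !inE; have [->|_] //= := eqVneq v w; rewrite (negbTE wS) andbF.
Qed.

Definition mv2 S u w u' w' (p : RR * RR) : conf :=
  [set q | (exists2 v, v \in S :\ u :\ u' & q = mpt v) \/ q = etok u w p.1 \/ q = etok u' w' p.2].

Lemma mv2_sym S u w u' w' s t : mv2 S u w u' w' (s, t) = mv2 S u' w' u w (t, s).
Proof.
have e : S :\ u :\ u' = S :\ u' :\ u by apply/setP => v; rewrite !inE; case: eqVneq; case: eqVneq.
by rewrite /mv2 e; apply/seteqP; split=> q /= [h|[h|h]]; [left|right; right|right; left|left|right; right|right; left].
Qed.

Lemma mv2_first S u w u' w' t : (u == w) || adj u w -> (u' == w') || adj u' w' -> u' \in S -> u != u' ->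
  mv2 S u w u' w' (t, 0) = mv S u w t.
Proof.
move=> a a' uS' ne; rewrite /mv2 /mv /= tok0 //; apply/seteqP; split=> q /=.
  case=> [[v + ->]|[->|->]]; [|by right|].
    by rewrite !inE => /and3P[h1 h2 h3]; left; exists v; rewrite ?inE ?h2 ?h3.
  by left; exists u'; rewrite // !inE eq_sym ne.
case=> [[v + ->]|->]; last by right; left.
rewrite !inE => /andP[h1 h2]; have [->|h3] := eqVneq v u'; first by right; right.
by left; exists v; rewrite // !inE h1 h2 h3.
Qed.

Lemma mv2_last S u w u' w' t : (u == w) || adj u w -> w \notin S -> u \in S -> w != u' ->
  mv2 S u w u' w' (1, t) = mv (mvS S u w) u' w' t.
Proof.
move=> a wS uS ne; rewrite /mv2 /mv /= tok1 //; apply/seteqP; split=> q /=.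
  case=> [[v + ->]|[->|->]]; [| |by right].
    by rewrite !inE => /and3P[h1 h2 h3]; left; exists v; rewrite // !inE h1 h2 h3 orbT.
  by left; exists w; rewrite // !inE ne eqxx.
case=> [[v + ->]|->]; last by right; right.
rewrite !inE => /andP[h1 /orP[/eqP ->|/andP[h2 h3]]]; first by right; left.
by left; exists v; rewrite // !inE h1 h2 h3.
Qed.

Lemma mv2_good S u w u' w' : #|S| = n -> mvok adj S u w -> mvok adj S u' w' -> uniq [:: u; w; u'; w'] ->
  good n sq (mv2 S u w u' w').
Proof.
move=> cS /and3P[a uS wS] /and3P[a' uS' wS'] un; have [x [ix ex]] := set_ordering cS.
have [nuu' nww'] : u != u' /\ w != w'.
  by move: un; rewrite /= !inE !negb_or !andbT => /and3P[/and3P[_ -> _] /andP[_ ->] _].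
have /imsetP[i _ ei] : u \in im x by rewrite ex.
have /imsetP[i' _ ei'] : u' \in im x by rewrite ex.
have ii : i != i' by apply: contraNneq nuu' => e; rewrite ei ei' e.
rewrite -ex in wS wS' *; rewrite ei ei' in a a' nuu' *.
pose y := upd (upd x i w) i' w'; pose th (p : RR * RR) j : RR := if j == i then p.1 else if j == i' then p.2 else 0.
have xw l : (x l != w) /\ (x l != w').
  by split; [apply: contraNneq wS|apply: contraNneq wS'] => <-; exact: mem_im.
have ye j : (x j == y j) || adj (x j) (y j).
  rewrite /y /upd; case: (eqVneq j i') => [->|_]; first by rewrite a' orbT.
  by case: (eqVneq j i) => [->|_]; rewrite ?a ?orbT ?eqxx.
have yd j k : j != k -> [/\ x j != x k, x j != y k & y j != y k].
  move=> jk; split; first by rewrite (inj_eq ix).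
    by rewrite /y /upd; do 2![case: ifP => _; rewrite ?(xw j).1 ?(xw j).2 ?(inj_eq ix) //].
  rewrite /y /upd.
  case: (eqVneq j i') => [ji'|ji']; case: (eqVneq k i') => [ki'|ki']; rewrite ?(inj_eq ix) //.
  - by rewrite ji' ki' eqxx in jk.
  - by case: ifP => _; rewrite eq_sym ?(xw k).2.
  - by case: ifP => _; rewrite ?(xw j).2.
  case: (eqVneq j i) => [ji|ji]; case: (eqVneq k i) => [ki|ki]; rewrite ?(inj_eq ix) ?(xw j).1 //.
  - by rewrite ji ki eqxx in jk.
  - by rewrite eq_sym (xw k).1.
have Ith p j : sq p -> II (th p j).
  by case=> h1 h2; rewrite /th; case: ifP => _ //; case: ifP => _ //; exact: II0.
apply: (good_ext (H := fun p => range (fun j => etok (x j) (y j) (th p j)))).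
  move=> p sp; apply/seteqP; split=> q /=.
    move=> [j _ <-]; rewrite /th /y /upd.
    case: (eqVneq j i) => [->|ji]; first by rewrite (negbTE ii); right; left.
    case: (eqVneq j i') => [->|ji']; first by right; right.
    by left; exists (x j); rewrite ?tok_id // !inE !(inj_eq ix) ji ji' mem_im.
  case=> [[v + ->]|[->|->]].
  - rewrite !inE => /and3P[vi' vi /imsetP[j _ ej]]; exists j => //; rewrite ej.
    have ji : j != i by apply: contraNneq vi => <-; rewrite ej.
    have ji' : j != i' by apply: contraNneq vi' => <-; rewrite ej.
    by rewrite /y /upd (negbTE ji) (negbTE ji') tok_id.
  - by exists i => //; rewrite /y /upd /th (negbTE ii) !eqxx.
  - by exists i' => //; rewrite /y /upd /th eqxx (eq_sym i') (negbTE ii).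
apply: good_tokens => [p sp|j]; first by apply: tokens_oconf => // j; exact: Ith.
apply: tgood_tok => [|p sp]; last exact: Ith.
by rewrite /th; case: (j == i); [exact: cont_fst|case: (j == i'); [exact: cont_snd|exact: cont_cst]].
Qed.

Lemma mv_square S u w u' w' : #|S| = n -> mvok adj S u w -> mvok adj S u' w' -> uniq [:: u; w; u'; w'] ->
  phom n (CS S) (CS (mvS (mvS S u w) u' w')) (pconcat (mv S u w) (mv (mvS S u w) u' w'))
    (pconcat (mv S u' w') (mv (mvS S u' w') u w)).
Proof.
move=> cS h h' un; have gQ := mv2_good cS h h' un.
have /and3P[a uS wS] := h; have /and3P[a' uS' wS'] := h'.
have [nuu' nwu' nw'u] : [/\ u != u', w != u' & w' != u].
  by move: un; rewrite /= !inE !negb_or !andbT => /and3P[/and3P[_ -> h1] /andP[-> _] _]; split=> //; rewrite eq_sym.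
(* The parameter paths [(lo, hi)] and [(hi, lo)] run from one corner of the square to the opposite
   one, each along two sides. *)
pose lo (t : RR) : RR := Num.min (2 * t) 1; pose hi (t : RR) : RR := Num.max 0 (2 * t - 1).
have clo : continuous lo.
  by apply: cont_min; [apply: cont_mul; [exact: cont_cst|exact: cont_id]|exact: cont_cst].
have chi : continuous hi.
  apply: cont_max; first exact: cont_cst.
  by apply: cont_add; [apply: cont_mul; [exact: cont_cst|exact: cont_id]|exact: cont_cst].
have loE t : lo t = if t <= 2^-1 then 2 * t else 1.
  by rewrite /lo /Num.min; do ![case: ifPn => ?]; lra.
have hiE t : hi t = if t <= 2^-1 then 0 else 2 * t - 1.
  by rewrite /hi /Num.max; do ![case: ifPn => ?]; lra.
clearbody lo hi.
have [l0 l1 h0 h1] : [/\ lo 0 = 0, lo 1 = 1, hi 0 = 0 & hi 1 = 1].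
  by split; rewrite ?loE ?hiE; do ![case: ifPn => ?]; lra.
have q1 t : pconcat (mv S u w) (mv (mvS S u w) u' w') t = mv2 S u w u' w' (lo t, hi t).
  rewrite /pconcat loE hiE; case: ifP => _; first by rewrite mv2_first ?a ?a' ?orbT.
  by rewrite mv2_last ?a ?orbT.
have q2 t : pconcat (mv S u' w') (mv (mvS S u' w') u w) t = mv2 S u w u' w' (hi t, lo t).
  rewrite /pconcat loE hiE mv2_sym; case: ifP => _; first by rewrite mv2_first ?a ?a' ?orbT // eq_sym.
  by rewrite mv2_last ?a' ?orbT.
rewrite (funext q1) (funext q2).
apply: (phom_square gQ clo chi chi clo); rewrite ?l0 ?l1 ?h0 ?h1 //.
- move=> t /andP[? ?]; rewrite /II /= loE hiE.
  by split; case: ifPn => ?; apply/andP; split; lra.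
- rewrite mv2_first ?a ?a' ?orbT //; have [_ -> _] := mv_path cS h; by [].
rewrite mv2_last ?a ?orbT //; have c' : #|mvS S u w| = n by rewrite (card_mvS h).
have hm : mvok adj (mvS S u w) u' w'.
  rewrite /mvok a' !inE uS' (eq_sym u' u) nuu' orbT /= negb_or negb_and wS' orbT andbT.
  by move: un; rewrite /= !inE !negb_or !andbT => /and3P[_ /andP[_ h2] _]; rewrite eq_sym.
by have [_ _ ->] := mv_path c' hm.
Qed.
End VertexConfigs.

(** * Classes of moves in the group *)

Section Classes.
Import Order.TTheory GRing.Theory Num.Theory.
Local Open Scope ring_scope.
Local Open Scope classical_set_scope.
Variables (G : graph) (K : marking G) (n : nat) (b : set (gpt G)).
Notation V := (mkV K).
Notation conf := (set (gpt G)).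
Notation adj := (@madj G K).
Implicit Types (S : {set V}).
Variables (X : finType) (Rl : rel X) (phi : (RR -> conf) -> seq (X * bool)).
Hypothesis phiE : forall f g, uloop n b f -> uloop n b g -> (uhomotopic n b f g <-> raag_eq Rl (phi f) (phi g)).
Hypothesis phi_onto : forall w, exists f, uloop n b f /\ raag_eq Rl (phi f) w.
Hypothesis phiM : forall f g, uloop n b f -> uloop n b g -> raag_eq Rl (phi (pconcat f g)) (phi f ++ phi g).

Definition Phi f : raag Rl := rmk Rl (phi f).

Lemma uloopP f : uloop n b f <-> ispath n b b f.
Proof. by split=> [[/ucont01P gf [f0 f1]]|[/ucont01P gf f0 f1]]; split. Qed.

Lemma Phi_phom f g : phom n b b f g -> Phi f = Phi g.
Proof.
case=> /uloopP lf /uloopP lg [H [/ucont_sqP gH e1 e2]]; apply/rmkP/phiE => //.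
by exists H; split=> //; split.
Qed.

Lemma Phi_concat f g : ispath n b b f -> ispath n b b g -> Phi (pconcat f g) = (Phi f * Phi g)%g.
Proof. by move=> /uloopP lf /uloopP lg; rewrite /Phi -rmk_cat; apply/rmkP/phiM. Qed.

Hypothesis base : forall S : {set V}, #|S| = n -> exists p, ispath n b (CS S) p.

Definition pth (S : {set V}) : RR -> conf :=
  match pselect (#|S| = n) with left h => projT1 (cid (base h)) | right _ => fun=> b end.

Lemma pthP S : #|S| = n -> ispath n b (CS S) (pth S).
Proof. by move=> h; rewrite /pth; case: pselect => // h'; case: cid. Qed.

Definition cl (S S' : {set V}) f := Phi (pconcat (pconcat (pth S) f) (pinv (pth S'))).

Section Cl.
Variables (S S' S'' : {set V}).
Hypotheses (cS : #|S| = n) (cS' : #|S'| = n) (cS'' : #|S''| = n).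

Lemma cl_loop f : ispath n (CS S) (CS S') f -> ispath n b b (pconcat (pconcat (pth S) f) (pinv (pth S'))).
Proof.
by move=> pf; apply: ispath_concat (ispath_inv (pthP cS')); apply: ispath_concat pf; exact: pthP.
Qed.

Lemma cl_phom f g : phom n (CS S) (CS S') f g -> cl S S' f = cl S S' g.
Proof.
move=> h; apply: Phi_phom; apply: phom_concat (phom_refl (ispath_inv (pthP cS'))).
by apply: phom_concat h; apply: phom_refl; exact: pthP.
Qed.

Lemma cl_concat f g : ispath n (CS S) (CS S') f -> ispath n (CS S') (CS S'') g ->
  cl S S'' (pconcat f g) = (cl S S' f * cl S' S'' g)%g.
Proof.
move=> pf pg; have p := pthP cS; have p' := pthP cS'; have p'' := pthP cS''.
have q' := ispath_inv p'; have q'' := ispath_inv p''.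
rewrite /cl -Phi_concat; last 2 first.
- exact: ispath_concat (ispath_concat p pf) q'.
- exact: ispath_concat (ispath_concat p' pg) q''.
apply: Phi_phom; have pfg := ispath_concat pf pg; have ppf := ispath_concat p pf.
have p'g := ispath_concat p' pg; have gq := ispath_concat pg q''.
(* both sides reduce to [(pth S . f) . (g . pth S''^-1)] *)
apply: (@phom_trans _ _ _ _ _ (pconcat (pconcat (pth S) f) (pconcat g (pinv (pth S''))))).
  apply: phom_trans (phom_sym (phom_assoc ppf pg q'')).
  by apply: phom_concat (phom_refl q''); exact: phom_assoc p pf pg.
apply: phom_sym; apply: phom_trans (phom_sym (phom_assoc ppf q' (ispath_concat p'g q''))) _.
apply: phom_concat (phom_refl ppf) _.
apply: phom_trans (phom_concat (phom_refl q') (phom_sym (phom_assoc p' pg q''))) _.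
apply: phom_trans (phom_assoc q' p' gq) _.
apply: phom_trans (phom_concat (phom_invl p') (phom_refl gq)) _.
exact: phom_idl gq.
Qed.
End Cl.

Lemma cl_cst S : #|S| = n -> cl S S (fun=> CS S) = 1%g.
Proof.
move=> cS; have [_ c] := ispath_conf (pthP cS); have pc := ispath_cst c.
have h := phom_idl pc; have := cl_phom cS cS h; rewrite (cl_concat cS cS cS pc pc).
by move=> e; apply: (@mulgI _ (cl S S (fun=> CS S))); rewrite mulg1.
Qed.

Lemma cl_inv S S' f : #|S| = n -> #|S'| = n -> ispath n (CS S) (CS S') f -> cl S' S (pinv f) = (cl S S' f)^-1%g.
Proof.
move=> cS cS' pf; have h := phom_inv pf; have := cl_phom cS cS h.
rewrite cl_cst // (cl_concat cS cS' cS pf (ispath_inv pf)) => e.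
by apply: (@mulgI _ (cl S S' f)); rewrite e mulgV.
Qed.

Definition Mv (S : {set V}) u w := cl S (mvS S u w) (mv S u w).

Lemma Mv_inv (S : {set V}) u w : #|S| = n -> mvok adj S u w -> Mv (mvS S u w) w u = (Mv S u w)^-1%g.
Proof.
move=> cS h; have c' : #|mvS S u w| = n by rewrite (card_mvS h).
rewrite /Mv (mvS_back h) (mv_rev h) cl_inv //; exact: mv_path.
Qed.

Lemma Mv_square (S : {set V}) u w u' w' : #|S| = n -> mvok adj S u w -> mvok adj S u' w' ->
  uniq [:: u; w; u'; w'] -> (Mv S u w * Mv (mvS S u w) u' w' = Mv S u' w' * Mv (mvS S u' w') u w)%g.
Proof.
move=> cS h h' un.
have un' : uniq [:: u'; w'; u; w] by rewrite -(cat1s u') (uniq_catC [:: u'; w'] [:: u; w]).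
have sub (v v' z z' : V) : mvok adj S v v' -> mvok adj S z z' -> uniq [:: v; v'; z; z'] -> mvok adj (mvS S v v') z z'.
  case/and3P=> _ _ _ /and3P[a zS zS']; rewrite /= !inE !negb_or !andbT => /and3P[/and3P[h1 h2 h3] /andP[h4 h5] h6].
  by rewrite /mvok a !inE zS (eq_sym z v) h2 orbT /= negb_or negb_and zS' orbT andbT eq_sym.
have c1 : #|mvS S u w| = n by rewrite (card_mvS h).
have c2 : #|mvS S u' w'| = n by rewrite (card_mvS h').
have h1 := sub _ _ _ _ h h' un; have h2 := sub _ _ _ _ h' h un'.
have e : mvS (mvS S u w) u' w' = mvS (mvS S u' w') u w.
  move: un; rewrite /= !inE !negb_or !andbT => /and3P[/and3P[n1 n2 n3] /andP[n4 n5] n6].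
  apply/setP => v; rewrite !inE.
  have [->|vw'] /= := eqVneq v w'; first by rewrite (eq_sym w' u) n3 orbT.
  have [->|vw] /= := eqVneq v w; first by rewrite n4.
  by case: eqVneq => //=; case: eqVneq.
have c3 : #|mvS (mvS S u w) u' w'| = n by rewrite (card_mvS h1).
rewrite /Mv -(cl_concat cS c1 c3 (mv_path cS h) (mv_path c1 h1)).
have p2 := mv_path c2 h2; rewrite -e in p2 *.
rewrite -(cl_concat cS c2 c3 (mv_path cS h') p2).
by apply: cl_phom => //; exact: mv_square.
Qed.

Section HolonomyHom.
Variables (L : groupType) (C : charts G n L).

Lemma hol_class (g : raag Rl) : exists k, exists f, [/\ ispath n b b f, Phi f = g & hol C f k].
Proof.
have [f [/uloopP lf e]] := phi_onto (rval g); have [k hk] := hol_exists C lf.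
by exists k, f; split=> //; rewrite -[g]rvalK; apply/rmkP.
Qed.

(** The holonomy of an arbitrary representing loop; by homotopy invariance the choice does not
    matter ([holG_Phi]). *)
Definition holG g := projT1 (cid (hol_class g)).

Lemma holG_Phi f k : ispath n b b f -> hol C f k -> holG (Phi f) = k.
Proof.
move=> lf hk; rewrite /holG; case: cid => k' [f' [lf' e hk']] /=.
suff h : phom n b b f' f by exact: (hol_phom h hk' hk).
split=> //; have /uloopP l := lf; have /uloopP l' := lf'.
have /(phiE l' l)[H [/ucont_sqP gH [e1 e2]]] : raag_eq Rl (phi f') (phi f) by apply/rmkP.
by exists H.
Qed.

Lemma holGM g h : holG (g * h)%g = (holG g * holG h)%g.
Proof.
have [f [/uloopP lf e]] := phi_onto (rval g); have [f' [/uloopP lf' e']] := phi_onto (rval h).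
have [k hk] := hol_exists C lf; have [k' hk'] := hol_exists C lf'.
have -> : g = Phi f by rewrite -[g]rvalK; apply/esym/rmkP.
have -> : h = Phi f' by rewrite -[h]rvalK; apply/esym/rmkP.
by rewrite -Phi_concat // (holG_Phi lf hk) (holG_Phi lf' hk') (holG_Phi _ (hol_concat lf lf' hk hk')) //; exact: ispath_concat lf lf'.
Qed.

Lemma base_hol S : exists k, #|S| = n -> hol C (pth S) k.
Proof.
have [h|h] := pselect (#|S| = n); last by exists 1%g.
by have [k hk] := hol_exists C (pthP h); exists k.
Qed.

Definition bhol S := projT1 (cid (base_hol S)).

(** The fixed paths to the base point contribute the coboundary of [bhol]. *)
Lemma holG_cl S S' f k : #|S| = n -> #|S'| = n -> ispath n (CS S) (CS S') f -> hol C f k ->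
  holG (cl S S' f) = (bhol S * k * (bhol S')^-1)%g.
Proof.
move=> cS cS' pf hk; apply: holG_Phi; first exact: cl_loop.
have h1 : hol C (pth S) (bhol S) by rewrite /bhol; case: cid => k1 /= ; exact.
have h2 : hol C (pth S') (bhol S') by rewrite /bhol; case: cid => k1 /= ; exact.
apply: (hol_concat _ (ispath_inv (pthP cS')) _ (hol_inv (pthP cS') h2)).
  by apply: ispath_concat pf; exact: pthP.
exact: (hol_concat (pthP cS) pf h1 hk).
Qed.
End HolonomyHom.
End Classes.

(** * The strand permutation and the gate cocycles *)

Section Boxes.
Import Order.TTheory GRing.Theory Num.Theory.
Local Open Scope group_scope.
Local Open Scope classical_set_scope.
Variables (G : graph) (n : nat).
Notation pt := (gpt G).
Notation conf := (set pt).
Implicit Types (x y z : 'I_n -> pt) (B : 'I_n -> set pt) (S : conf).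

Lemma oconf_perm x (s : {perm 'I_n}) : oconf x -> oconf (x \o s).
Proof. by move=> [v i]; split=> [j|j k /i/perm_inj //]; exact: v. Qed.

Lemma range_perm x (s : {perm 'I_n}) : range (x \o s) = range x.
Proof.
apply/seteqP; split=> q [i _ <-]; first by exists (s i).
by exists ((s^-1)%g i) => //=; rewrite permKV.
Qed.

Lemma oconf_match x y : injective x -> injective y -> range x = range y ->
  exists s : {perm 'I_n}, x = y \o s.
Proof.
move=> ix iy e; have ex i : exists j, y j = x i.
  have : range y (x i) by rewrite -e; exists i.
  by move=> [j _ h]; exists j.
pose f i := projT1 (cid (ex i)); have fE i : y (f i) = x i by rewrite /f; case: cid.
have fi : injective f by move=> i j h; apply: ix; rewrite -!fE h.
by exists (perm fi); apply: funext => i; rewrite /= permE fE.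
Qed.

Definition boxes B : set conf := [set S | exists y, [/\ oconf y, S = range y & forall i, B i (y i)]].

Lemma boxes_open B : (forall i, gopen (B i)) -> uopen n (boxes B).
Proof.
move=> gB x ox [y [oy e yB]]; have [s es] := oconf_match ox.2 oy.2 e.
exists (fun i => B (s i)); split=> [i|z oz zB]; first by rewrite es; split=> //=; exact: yB.
exists (z \o (s^-1)%g); split; [exact: oconf_perm|by rewrite range_perm|].
by move=> i /=; have := zB ((s^-1)%g i); rewrite permKV.
Qed.

Lemma nbhs_forall (E : topologicalType) (p : E) (P : 'I_n -> E -> Prop) : (forall i, nbhs p (P i)) ->
  nbhs p (fun q => forall i, P i q).
Proof. by move=> h; apply: filter_forall. Qed.

Lemma gopen_forall (F : 'I_n -> set pt) : (forall j, gopen (F j)) -> gopen [set q | forall j, F j q].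
Proof.
move=> gF e; apply/rel_open01P => t It Ft.
have h : nbhs t (fun u => forall j, II u -> F j (gchar e u)).
  apply: nbhs_forall => j; move/rel_open01P: (gF j e) => h; exact: (h t It (Ft j)).
by apply: filterS h => u hu Iu j; exact: hu.
Qed.

Lemma disjoint_boxes x : oconf x -> exists B, [/\ forall i, gopen (B i), forall i, B i (x i) &
  forall i j q, B i q -> B j q -> i = j].
Proof.
move=> [vx ix].
have h i j : exists W : set pt * set pt, i != j ->
    [/\ gopen W.1, gopen W.2, W.1 (x i), W.2 (x j) & forall q, W.1 q -> W.2 q -> False].
  case: (eqVneq i j) => [_|ij]; first by exists (setT, setT).
  have [W [W' hW]] := hausdorff (vx i) (vx j) (fun e => negP ij (introT eqP (ix _ _ e))).
  by exists (W, W').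
pose W i j := projT1 (cid (h i j)).
have hW i j : i != j -> [/\ gopen (W i j).1, gopen (W i j).2, (W i j).1 (x i), (W i j).2 (x j) &
   forall q, (W i j).1 q -> (W i j).2 q -> False] by rewrite /W; case: cid.
exists (fun i => [set q | forall j, i != j -> (W i j).1 q /\ (W j i).2 q]); split.
- move=> i; apply: gopen_forall => j; case: (eqVneq i j) => [_|ij].
    have -> : (fun q : pt => ~~ true -> (W i j).1 q /\ (W j i).2 q) = setT by apply/seteqP; split.
    exact: gopenT.
  have [g1 _ _ _ _] := hW _ _ ij; have ji : j != i by rewrite eq_sym.
  have [_ g2 _ _ _] := hW _ _ ji.
  have -> : (fun q : pt => ~~ false -> (W i j).1 q /\ (W j i).2 q) = (W i j).1 `&` (W j i).2.
    by apply/seteqP; split=> q; [apply|].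
  exact: gopenI.
- move=> i j ij; have [_ _ ? _ _] := hW _ _ ij; have ji : j != i by rewrite eq_sym.
  by have [_ _ _ ? _] := hW _ _ ji.
move=> i j q hi hj; apply/eqP; apply: contraT => ij; have [_ _ _ _ d] := hW _ _ ij.
have ji : j != i by rewrite eq_sym.
by case: (d q (hi _ ij).1 (hj _ ji).2).
Qed.

(** An arbitrary ordering of the tokens of each configuration, without any continuity. The ratios of
    chart maps do not depend on it. *)
Definition en S : option ('I_n -> pt) :=
  match pselect (uconf n S) with left h => Some (projT1 (cid h)) | right _ => None end.

Lemma enP S : uconf n S -> exists z, [/\ en S = Some z, oconf z & S = range z].
Proof.
by rewrite /en; case: pselect => // h _; case: cid => z [oz e]; exists z.
Qed.

Lemma kap_exists y : exists s : {perm 'I_n}, oconf y -> exists2 z, en (range y) = Some z & y = z \o s.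
Proof.
have [oy|h] := pselect (oconf y); last by exists 1%g.
have [|z [ez oz e]] := @enP (range y); first by exists y.
by have [s es] := oconf_match oy.2 oz.2 e; exists s => _; exists z.
Qed.

Definition kap y : {perm 'I_n} := projT1 (cid (kap_exists y)).

Lemma kapP y z : oconf y -> en (range y) = Some z -> y = z \o kap y.
Proof. by rewrite /kap; case: cid => s /= h oy e; have [z' e' h'] := h oy; move: e; rewrite e' => -[<-]. Qed.

Lemma kap_perm y (s : {perm 'I_n}) : oconf y -> kap (y \o s) = (s * kap y)%g.
Proof.
move=> oy; have [|z [ez oz e]] := @enP (range y); first by exists y.
have ez' : en (range (y \o s)) = Some z by rewrite range_perm.
have h1 := kapP oy ez; have h2 := kapP (oconf_perm s oy) ez'.
apply/permP => i; apply: oz.2; rewrite permM.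
by have := congr1 (fun f => f i) h2; rewrite /= => <-; have := congr1 (fun f => f (s i)) h1.
Qed.

Definition dboxes := {B : 'I_n -> set pt | (forall i, gopen (B i)) /\ forall i j q, B i q -> B j q -> i = j}.

(** Disjoint boxes order the tokens inside them; the value compares this ordering with [en]. *)
Definition box_map (B : 'I_n -> set pt) S : {perm 'I_n} :=
  match pselect (boxes B S) with left h => kap (projT1 (cid h)) | right _ => 1%g end.

Lemma box_mapE B y : (forall i j q, B i q -> B j q -> i = j) -> oconf y -> (forall i, B i (y i)) ->
  box_map B (range y) = kap y.
Proof.
move=> dB oy yB; rewrite /box_map; case: pselect => [h|[]]; last by exists y.
case: cid => z [oz e zB] /=; congr kap; apply: funext => i.
have : range z (y i) by rewrite -e; exists i.
by move=> [j _ ej]; rewrite -ej; congr z; apply: (dB _ _ (y i)); [exact: yB|rewrite -ej].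
Qed.

Lemma box_open (B : dboxes) : uopen n (boxes (sval B)).
Proof. by apply: boxes_open; have [] := svalP B. Qed.

Lemma box_cover S : uconf n S -> exists B : dboxes, boxes (sval B) S.
Proof.
move=> [x [ox ->]]; have [B [gB xB dB]] := disjoint_boxes ox.
by exists (exist _ B (conj gB dB)), x.
Qed.

Lemma box_glue (B B' : dboxes) S : uconf n S -> boxes (sval B) S -> boxes (sval B') S ->
  exists W, [/\ uopen n W, W S & forall S', uconf n S' -> W S' -> boxes (sval B) S' -> boxes (sval B') S' ->
      (box_map (sval B) S' * (box_map (sval B') S')^-1 = box_map (sval B) S * (box_map (sval B') S)^-1)%g].
Proof.
case: B B' => [B [gB dB]] [B' [gB' dB']] /= _ [y [oy -> yB]] [y' [oy' e yB']].
have [s es] := oconf_match oy'.2 oy.2 (esym e).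
have val z : oconf z -> (forall i, B i (z i)) -> (forall i, B' i (z (s i))) ->
    (box_map B (range z) * (box_map B' (range z))^-1 = s^-1)%g.
  move=> oz zB zB'; rewrite (box_mapE dB oz zB) -(range_perm z s) (box_mapE dB' (oconf_perm s oz) zB') kap_perm //.
  by rewrite invgM mulgA mulgV mul1g.
exists (boxes (fun i => B i `&` B' ((s^-1)%g i))); split.
- by apply: boxes_open => i; apply: gopenI.
- exists y; split=> // i; split; first exact: yB.
  by have := yB' ((s^-1)%g i); rewrite es /= permKV.
move=> _ _ [z [oz -> zB]] _ _; rewrite !val //.
- by move=> i; have := yB' i; rewrite es.
- by move=> i; have [] := zB i.
- by move=> i; have [_] := zB (s i); rewrite permK.
Qed.

Definition perm_charts : charts G n {perm 'I_n} := Charts box_open box_cover box_glue.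

(** Labels that follow the tokens along a path form a flat section. *)
Lemma hol_tokens (y : RR -> 'I_n -> pt) : (forall t, II t -> oconf (y t)) -> (forall i, tgood II (y^~ i)) ->
  hol perm_charts (fun t => range (y t)) ((kap (y 0%R))^-1 * kap (y 1%R))%g.
Proof.
move=> oy ty; have gy := good_tokens oy ty; exists (fun t => kap (y t)) => //.
apply: flatI => // t It; have [B [gB yB dB]] := disjoint_boxes (oy _ It).
exists (exist _ B (conj gB dB)) => /=; first by exists (y t); split=> //; exact: oy.
have h : nbhs t (fun u => forall i, II u -> B i (y u i)).
  by apply: nbhs_forall => i; apply: (ty i _ (gB i) _ It); exact: yB.
apply: filterS h => u hu Iu; rewrite (box_mapE dB (oy _ Iu) (fun i => hu i Iu)).
by rewrite (box_mapE dB (oy _ It) yB) !mulgV.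
Qed.

Variable K : marking G.
Local Notation adj := (@madj G K).

Lemma mpt_inj : injective (@mpt G K).
Proof.
by move=> u w e; apply/eqP; have := congr1 (beta u) e; rewrite !beta_mpt eqxx; case: eqVneq => // _ /eqP;
  rewrite GRing.oner_eq0.
Qed.

Lemma mpt_oconf (x : 'I_n -> mkV K) : injective x -> oconf (@mpt G K \o x).
Proof. by move=> ix; split=> [i|i j /mpt_inj/ix //]; exact: mpt_valid. Qed.

Lemma hol_move (x : 'I_n -> mkV K) i w : injective x -> adj (x i) w -> w \notin im x ->
  hol perm_charts (mv (im x) (x i) w) ((kap (@mpt G K \o x))^-1 * kap (@mpt G K \o upd x i w))%g.
Proof.
move=> ix a nw; pose y (t : RR) (j : 'I_n) := etok (x j) (upd x i w j) (if j == i then t else 0%R).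
have e : mv (im x) (x i) w = fun t => range (y t) by apply: funext => t; rewrite mvE.
have ye := upd_edges a.
have e0 : y 0%R = @mpt G K \o x by apply: funext => j; rewrite /y if_same tok0.
have e1 : y 1%R = @mpt G K \o upd x i w.
  apply: funext => j; rewrite /y /=; case: (eqVneq j i) => [->|ji]; first by rewrite tok1 // ye.
  by rewrite /upd (negbTE ji) tok_id.
rewrite e -e0 -e1; apply: hol_tokens => [t It|j].
  apply: tokens_oconf; [|exact: ye|exact: upd_disjoint].
  by move=> j; case: ifP => _ //; exact: II0.
apply: tgood_tok; first by case: (j == i); [exact: cont_id|exact: cont_cst].
by move=> t It; case: ifP => _ //; exact: II0.
Qed.
End Boxes.

(** * The integral Heisenberg group *)

Record hei := Hei { hval : int * int * int }.
HB.instance Definition _ := [isNew for hval].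
HB.instance Definition _ := [Choice of hei by <:].

Section HeisenbergGroup.
Import GRing.Theory.
Local Open Scope ring_scope.
Definition hx (p : hei) := (hval p).1.1.
Definition hy (p : hei) := (hval p).1.2.
Definition hz (p : hei) := (hval p).2.
Definition mkh x y z := Hei (x, y, z).
Definition hmul (p q : hei) := mkh (hx p + hx q) (hy p + hy q) (hz p + hz q + hx p * hy q).
Definition hinv (p : hei) := mkh (- hx p) (- hy p) (- hz p + hx p * hy p).
Definition hone := mkh 0 0 0.

Lemma hei_ext (p q : hei) : hx p = hx q -> hy p = hy q -> hz p = hz q -> p = q.
Proof. by case: p q => [[[? ?] ?]] [[[? ?] ?]]; rewrite /hx /hy /hz /= => -> -> ->. Qed.

Lemma hmulA : associative hmul.
Proof. by move=> p q r; apply: hei_ext; rewrite /hmul /mkh /hx /hy /hz /=; ring. Qed.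
Lemma hmul1 : left_id hone hmul.
Proof. by move=> p; apply: hei_ext; rewrite /hmul /mkh /hx /hy /hz /=; ring. Qed.
Lemma hmulr1 : right_id hone hmul.
Proof. by move=> p; apply: hei_ext; rewrite /hmul /mkh /hx /hy /hz /=; ring. Qed.
Lemma hmulV : left_inverse hone hinv hmul.
Proof. by move=> p; apply: hei_ext; rewrite /hmul /hinv /hone /mkh /hx /hy /hz /=; ring. Qed.
Lemma hmulrV : right_inverse hone hinv hmul.
Proof. by move=> p; apply: hei_ext; rewrite /hmul /hinv /hone /mkh /hx /hy /hz /=; ring. Qed.
HB.instance Definition _ := isGroup.Build hei hmulA hmul1 hmulr1 hmulV hmulrV.

Lemma hxM (p q : hei) : hx (p * q)%g = hx p + hx q. Proof. by []. Qed.
Lemma hxV (p : hei) : hx (p^-1)%g = - hx p. Proof. by []. Qed.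

(** The central coordinates of [p * q] and [q * p] differ by the determinant of the other two
    coordinates. *)
Lemma hei_comm (p q : hei) : (p * q = q * p)%g -> hx p * hy q = hx q * hy p.
Proof.
move=> /(congr1 hz); rewrite -[(p * q)%g]/(hmul p q) -[(q * p)%g]/(hmul q p) /hmul /mkh {1 4}/hz /=.
by rewrite (addrC (hz q)) => /addrI.
Qed.
End HeisenbergGroup.

(** * Charts for the passages through a gate *)

Section TokenRegions.
Import Order.TTheory GRing.Theory Num.Theory.
Local Open Scope ring_scope.
Local Open Scope classical_set_scope.
Variables (G : graph) (n : nat) (K : marking G).
Notation V := (mkV K).
Notation pt := (gpt G).
Notation conf := (set pt).
Local Notation adj := (@madj G K).
Implicit Types (A B u w : V) (D : {set V}) (q : pt) (S : conf).

(** Every point lies on an edge of the subdivision, so at most two coordinates are nonzero, and they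
    sum to 1. *)
Lemma beta_rep q : gvalid q -> exists u w t, [/\ (u == w) || adj u w, II t &
  forall A, beta A q = (1 - t) * (A == u)%:R + t * (A == w)%:R].
Proof.
case: q => [v|[e t]] /= vq.
  exists (vx K v), (vx K v), 0; split; [by rewrite eqxx|exact: II0|].
  by move=> A; rewrite subr0 mul1r mul0r addr0 eq_sym.
have It : II t by case/andP: vq => h1 h2; rewrite /II /= !ltW.
have [j [s [hj hs es]]] := edge_param K e It; exists (nd K e j), (nd K e j.+1), s; split=> //.
  by apply/orP; right; apply/asboolP; exists (e, j); split=> //; left.
by move=> A; rewrite (bfunE _ hj hs es).
Qed.

Lemma beta_bounds A q : gvalid q -> 0 <= beta A q <= 1.
Proof.
move=> /beta_rep[u [w [t [_ /andP[t0 t1] ->]]]].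
by case: (A == u); case: (A == w); rewrite ?mulr1 ?mulr0; apply/andP; split; lra.
Qed.

Lemma beta_two A B q : gvalid q -> A != B -> 0 < beta A q -> 0 < beta B q ->
  adj A B /\ beta A q + beta B q = 1.
Proof.
move=> /beta_rep[u [w [t [uw /andP[t0 t1] e]]]] ne; rewrite !e.
case: (eqVneq A u) => [Au|Au]; case: (eqVneq A w) => [Aw|Aw];
  case: (eqVneq B u) => [Bu|Bu]; case: (eqVneq B w) => [Bw|Bw];
  rewrite ?mulr1 ?mulr0 ?addr0 ?add0r ?ltxx //; try (by rewrite Au Bu eqxx in ne);
  try (by rewrite Aw Bw eqxx in ne); rewrite ?Au ?Aw ?Bu ?Bw => h1 h2.
- by split; [move: ne uw; rewrite Au Bw => /negbTE -> /=|lra].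
- by split; [move: ne uw; rewrite Aw Bu eq_sym madjC => /negbTE -> /=|lra].
Qed.

Lemma beta_three A B C q : gvalid q -> A != B -> A != C -> B != C ->
  0 < beta A q -> 0 < beta B q -> 0 < beta C q -> False.
Proof.
move=> /beta_rep[u [w [t [_ _ e]]]] ab ac bc; rewrite !e.
case: (eqVneq A u) => [Au|Au]; case: (eqVneq A w) => [Aw|Aw];
  case: (eqVneq B u) => [Bu|Bu]; case: (eqVneq B w) => [Bw|Bw];
  case: (eqVneq C u) => [Cu|Cu]; case: (eqVneq C w) => [Cw|Cw];
  rewrite ?mulr0 ?addr0 ?ltxx //; subst; rewrite ?eqxx in ab ac bc; by [].
Qed.

Lemma beta_pos A q : gvalid q -> beta A q < 1 -> exists2 B, B != A & 0 < beta B q.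
Proof.
move=> /beta_rep[u [w [t [uw /andP[t0 t1] e]]]]; rewrite e => h.
have [Au|Au] := eqVneq u A; have [Aw|Aw] := eqVneq w A.
- by exfalso; move: h; rewrite Au Aw eqxx !mulr1; lra.
- exists w => //; rewrite e eqxx; move: h; rewrite Au eqxx (eq_sym A) (negbTE Aw) => h.
  by rewrite mulr0 mulr1; move: h; rewrite !mulr1 !mulr0; lra.
- exists u => //; rewrite e eqxx; move: h; rewrite Aw eqxx (eq_sym A) (negbTE Au) => h.
  by rewrite mulr0 mulr1; move: h; rewrite !mulr1 !mulr0; lra.
have [t2|t2] := ltP 0 t.
  by exists w => //; rewrite e eqxx mulr1; case: (w == u); rewrite ?mulr1 ?mulr0; lra.
by exists u => //; rewrite e eqxx mulr1; case: (u == w); rewrite ?mulr1 ?mulr0; lra.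
Qed.

Lemma beta_vertex A q : gvalid q -> beta A q = 1 -> q = mpt A.
Proof.
case: q => [v _|[e t] vq]; first by rewrite /=; case: eqVneq => [<- _|_ /eqP]; rewrite ?mpt_vx // eq_sym oner_eq0.
have l0 := len_gt0 K e.
have It : II t by case/andP: vq => h1 h2; rewrite /II /= !ltW.
have qE : inr (e, t) = gchar e t by case/andP: vq => h1 h2; rewrite /gchar !ifF //; apply/negbTE; rewrite -ltNge.
have [j [s [hj hs es]]] := edge_param K e It; rewrite /= (bfunE _ hj hs es) => h.
have tE m : (len K e)%:R * t = m%:R -> t = m%:R / (len K e)%:R.
  by move=> <-; rewrite mulrAC divff ?gt_eqF // mul1r.
case/andP: hs => s0 s1; move: h; case: (eqVneq A (nd K e j)) => [e1|_]; case: (eqVneq A (nd K e j.+1)) => [e2|_] h.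
- by case: (nd_neq hj); rewrite -e1 -e2.
- by rewrite e1 mpt_nd 1?ltnW // qE; congr gchar; apply: tE; move: h; rewrite mulr1 mulr0 es; lra.
- by rewrite e2 mpt_nd // qE; congr gchar; apply: tE; move: h; rewrite mulr1 mulr0 es -natr1; lra.
- by move: h; rewrite !mulr0 addr0 => /esym/eqP; rewrite oner_eq0.
Qed.

Definition locp (P : pt -> Prop) q := exists W, [/\ gopen W, W q & forall q', gvalid q' -> W q' -> (P q' <-> P q)].

Lemma locp_true (P : pt -> Prop) q : gopen P -> P q -> locp P q.
Proof. by move=> oP Pq; exists P; split=> // q' _ Pq'; split. Qed.

Lemma locp_and P Q q : locp P q -> locp Q q -> locp (fun z => P z /\ Q z) q.
Proof.
move=> [W [oW Wq h]] [W' [oW' Wq' h']]; exists (W `&` W'); split=> //; first exact: gopenI.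
by move=> z vz [Wz Wz']; split=> -[/(h z vz Wz) ? /(h' z vz Wz') ?].
Qed.

Lemma locp_not P q : locp P q -> locp (fun z => ~ P z) q.
Proof. by move=> [W [oW Wq h]]; exists W; split=> // z vz /(h z vz) [h1 h2]; split=> nP ?; apply: nP; [exact: h2|exact: h1]. Qed.

Lemma gopen_gt A c : gopen [set q | c < beta A q].
Proof. by apply: (@gopen_beta _ _ A [set y : RR | c < y]); exact: open_gt. Qed.

Lemma gopen_lt A c : gopen [set q | beta A q < c].
Proof. by apply: (@gopen_beta _ _ A [set y : RR | y < c]); exact: open_lt. Qed.

Definition inD D q := exists2 A, A \in D & 0 < beta A q.

Definition closed_to D E := forall u w, u \in D -> adj u w -> w \in D :|: E.
Definition indep (E : {set V}) := forall u w, u \in E -> w \in E -> ~~ adj u w.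

(** A point that does not touch [D] has a positive coordinate at some [B] outside [D] and [E]. By
    closedness [B] is not adjacent to [D], so no point with positive coordinate at [B] touches
    [D]. *)
Lemma locp_inD D E q : closed_to D E -> indep E -> gvalid q -> (forall u, u \in E -> beta u q < 1) -> locp (inD D) q.
Proof.
move=> cD iE vq hE; have [[A AD Aq]|nq] := pselect (inD D q).
  exists [set z | 0 < beta A z]; split=> //; first exact: gopen_gt.
  by move=> z _ Az; split=> _; exists A.
have [B BE Bq] : exists2 B, B \notin E & 0 < beta B q.
  have [u [w [t [uw It e]]]] := beta_rep vq.
  have [A Aq] : exists A, 0 < beta A q.
    have [t2|t2] := ltP 0 t; case/andP: It => t0 t1.
      by exists w; rewrite e eqxx mulr1; case: (w == u); rewrite ?mulr1 ?mulr0; lra.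
    by exists u; rewrite e eqxx mulr1; case: (u == w); rewrite ?mulr1 ?mulr0; lra.
  have [AE|AE] := boolP (A \in E); last by exists A.
  have [B BA Bq] := beta_pos vq (hE _ AE); exists B => //.
  have [aBA _] := beta_two vq BA Bq Aq; apply: contraL aBA => BE; exact: iE.
have BD : B \notin D by apply/negP => BD; apply: nq; exists B.
exists [set z | 0 < beta B z]; split=> //; first exact: gopen_gt.
move=> z vz Bz; split=> // -[A AD Az]; exfalso.
have AB : A != B by apply: contraNneq BD => <-.
have [aAB _] := beta_two vz AB Az Bz.
by have := cD _ _ AD aAB; rewrite inE (negbTE BD) (negbTE BE).
Qed.

Lemma locp_side A r q : gvalid q -> 0 < beta A q -> beta A q < 1 -> r != A -> locp (fun z => 0 < beta r z) q.
Proof.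
move=> vq A0 A1 rA; have [h|h] := pselect (0 < beta r q); first by apply: locp_true => //; exact: gopen_gt.
have [B BA Bq] := beta_pos vq A1; have Br : B != r by apply: contra_notN h => /eqP <-.
exists ([set z | 0 < beta A z] `&` [set z | 0 < beta B z]); split=> //.
  by apply: gopenI; exact: gopen_gt.
move=> z vz [Az Bz]; split=> // rz; exfalso.
exact: (beta_three vz BA Br (introN eqP (fun h => negP rA (introT eqP (esym h)))) Bz Az rz).
Qed.

Definition cnt (P : pt -> Prop) S : nat := if @en G n S is Some z then #|[set i | `[< P (z i) >]]%SET| else 0%N.

Lemma cntE P (y : 'I_n -> pt) : oconf y -> cnt P (range y) = #|[set i | `[< P (y i) >]]%SET|.
Proof.
move=> oy; have [|z [ez oz e]] := @enP G n (range y); first by exists y.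
have [s es] := oconf_match oy.2 oz.2 e; rewrite /cnt ez es -[RHS](card_imset _ (@perm_inj _ s)).
apply: eq_card => i; apply/idP/imsetP => [|[j + ->]]; rewrite !finset.in_set //= => h.
by exists ((s^-1)%g i); rewrite ?finset.in_set /= permKV.
Qed.

Lemma cnt_ext P Q S : uconf n S -> (forall q, S q -> gvalid q -> (P q <-> Q q)) -> cnt P S = cnt Q S.
Proof.
move=> [y [oy ->]] h; rewrite !cntE //; apply: eq_card => i; rewrite !finset.in_set.
by apply/asboolP/asboolP => /h; apply => //; try exact: oy.1; exists i.
Qed.

Lemma cnt_local P (x : 'I_n -> pt) : oconf x -> (forall i, locp P (x i)) ->
  exists W, [/\ uopen n W, W (range x) & forall S', uconf n S' -> W S' -> cnt P S' = cnt P (range x)].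
Proof.
move=> ox h; pose F i := projT1 (cid (h i)).
have hF i : [/\ gopen (F i), F i (x i) & forall q', gvalid q' -> F i q' -> (P q' <-> P (x i))].
  by rewrite /F; case: cid.
exists (boxes F); split.
- by apply: boxes_open => i; have [] := hF i.
- by exists x; split=> // i; have [] := hF i.
move=> _ _ [y [oy -> yF]]; rewrite !cntE //; apply: eq_card => i; rewrite !finset.in_set.
have [_ _ e] := hF i; have {}e := e _ (oy.1 i) (yF i).
by apply/asboolP/asboolP => /e.
Qed.

Section GateCharts.
Variables (L : groupType) (g : nat -> L) (a r : V) (D : {set V}).
Hypotheses (ra : r != a) (rD : r \notin D) (aD : a \notin D) (cD : closed_to D [set a]%SET).

(** The chart [None] consists of the configurations without a token at [a], the chart [Some e] of
    those in which exactly one token, the special one, is within distance [e] of [a] and the others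
    are farther away, measured by [beta a]. *)
Definition gidx := option {e : RR | 0 < e < 1}.

Definition special (i : gidx) q : Prop := if i is Some e then is_true (1 - sval e < beta a q) else False.
Definition ordinary (i : gidx) q : Prop := if i is Some e then is_true (beta a q < 1 - sval e) else is_true (beta a q < 1).

Definition gdom (i : gidx) S := if i is Some _
  then exists q, [/\ S q, special i q & forall q', S q' -> q' <> q -> ordinary i q']
  else forall q, S q -> ordinary i q.

(** The value is 1 until the special token is on the edge towards [r]; then it is [g] of the number
    of other tokens in [D]. A passage from [a] to [r] thus changes a flat section by this factor. *)
Definition gmap (i : gidx) S : L := if (0 < cnt (fun q => special i q /\ (0 < beta r q)%R) S)%N
  then g (cnt (fun q => ordinary i q /\ inD D q) S) else 1%g.

Lemma not_both i q : special i q -> ordinary i q -> False.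
Proof. by case: i => //= e h1 h2; have := lt_trans h1 h2; rewrite ltxx. Qed.

Lemma gdom_cases i S q : gdom i S -> S q -> special i q \/ ordinary i q.
Proof.
case: i => [e|] /=; last by move=> h /h; right.
by move=> [q0 [S0 sp h]] Sq; have [->|ne] := pselect (q = q0); [left|right; exact: h].
Qed.

Lemma gopen_special i : gopen (special i).
Proof.
case: i => [e|] /=; first exact: gopen_gt.
by move=> e; exists set0; split; [exact: open0|].
Qed.

Lemma gopen_ordinary i : gopen (ordinary i).
Proof. by case: i => [e|] /=; exact: gopen_lt. Qed.

Lemma gdom_open i : uopen n (gdom i).
Proof.
case: i => [e|] x ox /=; last first.
  move=> h; exists (fun=> ordinary None); split=> [j|y oy hy q [j _ <-]]; last exact: hy.
  by split; [exact: (gopen_ordinary None)|apply: h; exists j].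
move=> [q [[i0 _ <-] sp h]].
exists (fun j => if j == i0 then special (Some e) else ordinary (Some e)); split=> [j|y oy hy].
  case: (eqVneq j i0) => [->|ji]; first by split; [exact: (gopen_special (Some e))|].
  split; [exact: (gopen_ordinary (Some e))|apply: h; first by exists j].
  by move/ox.2 => ej; rewrite ej eqxx in ji.
exists (y i0); split; first by exists i0.
  by have := hy i0; rewrite eqxx.
move=> q' [j _ <-] ne; have := hy j; case: (eqVneq j i0) => // ej.
by case: ne; rewrite ej.
Qed.

Lemma fin_below (m : nat) (f : 'I_m -> RR) (P : pred 'I_m) : (forall j, P j -> f j < 1) ->
  exists2 c, 0 < c < 1 & forall j, P j -> f j < 1 - c.
Proof.
move=> h; pose mx := \big[Num.max/0]_(j < m | P j) f j.
have m1 : mx < 1 by apply: bigmax_lt => //; exact: ltr01.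
have m0 : 0 <= mx by apply: bigmax_ge_id.
exists ((1 - mx) / 2); first by apply/andP; split; lra.
by move=> j Pj; have h2 : f j <= mx; [exact: le_bigmax_cond|move: m1 m0 h2; move: (f j) mx => u v; lra].
Qed.

Lemma gdom_cover S : uconf n S -> exists i, gdom i S.
Proof.
move=> [x [ox ->]]; have [[i0 h]|h] := pselect (exists i, beta a (x i) = 1); last first.
  exists None => q [i _ <-] /=; rewrite lt_neqAle; have /andP[_ ->] := beta_bounds a (ox.1 i).
  by rewrite andbT; apply/eqP => e; apply: h; exists i.
have [|c c01 hc] := @fin_below n (fun j => beta a (x j)) (fun j => j != i0).
  move=> j ji; rewrite lt_neqAle; have /andP[_ ->] := beta_bounds a (ox.1 j); rewrite andbT; apply/eqP => e.
  have := beta_vertex (ox.1 j) e; rewrite -(beta_vertex (ox.1 i0) h) => /ox.2 ej.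
  by rewrite ej eqxx in ji.
exists (Some (exist _ c c01)), (x i0); split; first by exists i0.
  by rewrite /special /= h; case/andP: c01 => ? ?; lra.
move=> q' [j _ <-] ne; apply: hc; apply/eqP => ej; apply: ne; by rewrite ej.
Qed.

Lemma special_const i (x : 'I_n -> pt) : oconf x -> gdom i (range x) -> forall k, locp (special i) (x k).
Proof.
move=> ox hd k; have [sp|od] := gdom_cases hd (ex_intro2 _ _ k I erefl : range x (x k)).
  exact: locp_true (gopen_special i) sp.
have [W [oW Wq h]] := locp_true (gopen_ordinary i) od; exists W; split=> // q' vq' Wq'.
have od' := (h _ vq' Wq').2 od.
by split=> sp; [case: (not_both sp od')|case: (not_both sp od)].
Qed.

Lemma ordinary_const i (x : 'I_n -> pt) : oconf x -> gdom i (range x) -> forall k, locp (ordinary i) (x k).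
Proof.
move=> ox hd k; have [sp|od] := gdom_cases hd (ex_intro2 _ _ k I erefl : range x (x k)); last first.
  exact: locp_true (gopen_ordinary i) od.
have [W [oW Wq h]] := locp_true (gopen_special i) sp; exists W; split=> // q' vq' Wq'.
have sp' := (h _ vq' Wq').2 sp.
by split=> od; [case: (not_both sp' od)|case: (not_both sp od)].
Qed.

Lemma indep1 : indep [set a]%SET.
Proof. by move=> u w; rewrite !inE => /eqP -> /eqP ->; apply/negP => /madj_neq; rewrite eqxx. Qed.

Lemma ordinary_lt i q : ordinary i q -> beta a q < 1.
Proof. by case: i => [[e /= /andP[? ?]]|] //= h; lra. Qed.

(** With no token at [a], a special token keeps to its side of [a], and no token can enter or leave
    [D], as it would have to pass [a]. So both counts are locally constant. *)
Lemma gmap_const i S : uconf n S -> gdom i S -> gdom None S ->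
  exists W, [/\ uopen n W, W S & forall S', uconf n S' -> W S' -> gmap i S' = gmap i S].
Proof.
move=> [x [ox ->]] hi h0.
have h1 k : locp (fun q => special i q /\ 0 < beta r q) (x k).
  have a1 : beta a (x k) < 1 by apply: h0; exists k.
  have [sp|nsp] := pselect (special i (x k)).
    apply: locp_and; first exact: special_const.
    apply: (locp_side (A := a)) => //; first exact: ox.1.
    by case: (i) sp => [[e /= /andP[? ?]]|] //= sp; lra.
  have [W [oW Wq h]] := special_const ox hi k; exists W; split=> // q' vq' Wq'.
  by split=> -[sp _]; [case: nsp; apply/(h q' vq' Wq')|case: (nsp sp)].
have h2 k : locp (fun q => ordinary i q /\ inD D q) (x k).
  have a1 : beta a (x k) < 1 by apply: h0; exists k.
  apply: locp_and; first exact: ordinary_const.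
  apply: (locp_inD cD indep1); first exact: ox.1.
  by move=> u; rewrite inE => /eqP ->.
have [W1 [oW1 m1 e1]] := cnt_local ox h1; have [W2 [oW2 m2 e2]] := cnt_local ox h2.
exists (W1 `&` W2); split=> // [y oy [y1 y2]|S' cS' [s1 s2]]; last by rewrite /gmap e1 // e2.
have [U1 [hU1 hU1']] := oW1 _ oy y1; have [U2 [hU2 hU2']] := oW2 _ oy y2.
exists (fun k => U1 k `&` U2 k); split=> [k|z oz hz].
  by have [? ?] := hU1 k; have [? ?] := hU2 k; split=> //; exact: gopenI.
by split; [apply: hU1' => // k; have [] := hz k|apply: hU2' => // k; have [] := hz k].
Qed.

Lemma gmap_None S : uconf n S -> gmap None S = 1%g.
Proof.
move=> [x [ox ->]]; rewrite /gmap cntE // (_ : #|_| = 0%N) //; apply: eq_card0 => i.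
by rewrite !finset.in_set; apply/asboolP => -[].
Qed.

(** The token that is special for the smaller [e] is special for the larger one as well, so both
    charts single out the same token. *)
Lemma gmap_Some (e e' : {e : RR | 0 < e < 1}) S : uconf n S -> gdom (Some e) S -> gdom (Some e') S ->
  gmap (Some e) S = gmap (Some e') S.
Proof.
wlog le : e e' / sval e <= sval e'.
  by move=> H cS h h'; case: (leP (sval e) (sval e')) => [|/ltW] l; [exact: H|apply/esym/H].
move=> cS [q [Sq sp od]] [q0 [Sq0 sp0 od0]].
have qq : q = q0.
  apply: contrapT => ne; apply: (@not_both (Some e') q); last exact: od0.
  by move: sp; rewrite /special /= => sp; lra.
subst q0; have E z : S z -> (special (Some e) z <-> z = q) /\ (special (Some e') z <-> z = q) /\
    (ordinary (Some e) z <-> z <> q) /\ (ordinary (Some e') z <-> z <> q).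
  move=> Sz; have [->|ne] := pselect (z = q).
    do !split=> //; by [move=> o; case: (not_both sp o)|move=> o; case: (not_both sp0 o)].
  have o1 := od _ Sz ne; have o2 := od0 _ Sz ne.
  do !split=> //; by [move=> s; case: (not_both s o1)|move=> s; case: (not_both s o2)].
rewrite /gmap.
have -> : cnt (fun z => special (Some e) z /\ 0 < beta r z) S = cnt (fun z => special (Some e') z /\ 0 < beta r z) S.
  by apply: cnt_ext => // z Sz _; have [e1 [e2 _]] := E _ Sz; split=> -[h ?]; split=> //; [exact: (e2.2 (e1.1 h))|exact: (e1.2 (e2.1 h))].
have -> // : cnt (fun z => ordinary (Some e) z /\ inD D z) S = cnt (fun z => ordinary (Some e') z /\ inD D z) S.
by apply: cnt_ext => // z Sz _; have [_ [_ [e1 e2]]] := E _ Sz; split=> -[h ?]; split=> //; [exact: (e2.2 (e1.1 h))|exact: (e1.2 (e2.1 h))].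
Qed.

Lemma gate_glue i j S : uconf n S -> gdom i S -> gdom j S ->
  exists W, [/\ uopen n W, W S & forall S', uconf n S' -> W S' -> gdom i S' -> gdom j S' ->
      (gmap i S' * (gmap j S')^-1 = gmap i S * (gmap j S)^-1)%g].
Proof.
move=> cS hi hj; case: i j hi hj => [e|] [e'|] hi hj.
- exists setT; split=> // [x ox _|S' cS' _ hi' hj'].
    by exists (fun=> setT); split=> // k; split=> //; exact: gopenT.
  by rewrite (gmap_Some cS' hi' hj') (gmap_Some cS hi hj) !mulgV.
- have [W [oW WS h]] := gmap_const cS hi hj; exists W; split=> // S' cS' WS' _ _.
  by rewrite !gmap_None // h.
- have [W [oW WS h]] := gmap_const cS hj hi; exists W; split=> // S' cS' WS' _ _.
  by rewrite !gmap_None // h.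
exists setT; split=> // [x ox _|S' cS' _ hi' hj'].
  by exists (fun=> setT); split=> // k; split=> //; exact: gopenT.
by rewrite !gmap_None.
Qed.

Definition gate_charts : charts G n L := Charts gdom_open gdom_cover gate_glue.
End GateCharts.
End TokenRegions.

(** * The holonomy of a single move *)

Section GateMoves.
Import Order.TTheory GRing.Theory Num.Theory.
Local Open Scope ring_scope.
Local Open Scope classical_set_scope.
Variables (G : graph) (n : nat) (K : marking G).
Notation V := (mkV K).
Notation pt := (gpt G).
Notation conf := (set pt).
Local Notation adj := (@madj G K).

Lemma cnt_gt0 P (S : conf) : uconf n S -> (0 < cnt n P S)%N <-> exists2 q, S q & P q.
Proof.
move=> [y [oy ->]]; rewrite cntE // card_gt0; split.
  by case/set0Pn => i; rewrite finset.in_set => /asboolP h; exists (y i) => //; exists i.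
by move=> [q [i _ <-] h]; apply/set0Pn; exists i; rewrite finset.in_set; apply/asboolP.
Qed.

Lemma hol_trivial (L : groupType) (C : charts G n L) i (f : RR -> conf) : good n II f ->
  (forall t, II t -> ch_dom i (f t)) -> (forall t, II t -> ch_map (c := C) i (f t) = 1%g) -> hol C f 1%g.
Proof.
move=> gf hd hm; exists (fun=> 1%g); last by rewrite invg1 mulg1.
apply: flat_ext (flat_local gf hd) => t It; exact: hm.
Qed.

Section Gate.
Variables (L : groupType) (g : nat -> L) (a r : V) (D : {set V}).
Hypotheses (ra : r != a) (rD : r \notin D) (aD : a \notin D) (cD : closed_to D [set a]%SET).
Let C := gate_charts n g ra cD.
Implicit Types (S : {set V}) (u w : V).

Let half01 : 0 < (2^-1 : RR) < 1.
Proof. by apply/andP; split; lra. Qed.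
Let half := exist (fun e : RR => is_true (0 < e < 1)) _ half01.

Lemma mv_beta S u w t A q : mvok adj S u w -> II t -> A != u -> A != w -> mv S u w t q -> q <> mpt A -> beta A q = 0.
Proof.
case/and3P=> aj uS wS It Au Aw [[v vS ->]|->] ne; last first.
  by rewrite beta_tok ?aj ?orbT // (negbTE Au) (negbTE Aw) !mulr0 addr0.
by rewrite beta_mpt; case: eqVneq => // Av; case: ne; rewrite Av.
Qed.

Lemma mv_uconf S u w t : #|S| = n -> mvok adj S u w -> II t -> uconf n (mv S u w t).
Proof. by move=> cS h It; have [[gm _] _ _] := mv_path cS h; exact: gm. Qed.

Lemma hol_away S u w : #|S| = n -> mvok adj S u w -> u != a -> w != a -> hol C (mv S u w) 1%g.
Proof.
move=> cS h ua wa; have [gm _ _] := mv_path cS h; have [aj uS wS] := and3P h.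
have [aS|aS] := boolP (a \in S); last first.
  apply: (@hol_trivial L C None) => // t It /=; last by apply: gmap_None; exact: mv_uconf.
  move=> q hq; rewrite /ordinary (mv_beta h It _ _ hq) ?ltr01 1?eq_sym //.
  case: hq => [[v /setD1P[_ vS] ->] /mpt_inj va|->]; first by rewrite -va vS in aS.
  move=> e; have := congr1 (beta a) e; rewrite beta_mpt eqxx beta_tok ?aj ?orbT //.
  by rewrite (eq_sym a) (negbTE ua) (eq_sym a) (negbTE wa) !mulr0 addr0 => /esym/eqP; rewrite oner_eq0.
have out t q : II t -> mv S u w t q -> q <> mpt a -> beta a q = 0.
  by move=> It; apply: (mv_beta h It); rewrite eq_sym.
apply: (@hol_trivial L C (Some half)) => // t It /=.
  exists (mpt a); split.
  - by left; exists a => //; apply/setD1P; rewrite eq_sym.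
  - by rewrite /= beta_mpt eqxx /=; lra.
  - by move=> q hq ne; rewrite /= (out t) //=; lra.
rewrite /gmap; case: ifP => // /(cnt_gt0 _ (mv_uconf cS h It)) [q hq [sp rq]].
have [e|ne] := pselect (q = mpt a); first by move: rq; rewrite e beta_mpt (negbTE ra) ltxx.
by exfalso; move: sp; rewrite /= (out t) //=; lra.
Qed.

Section Leave.
Variables (S : {set V}) (w : V).
Hypotheses (cS : #|S| = n) (h : mvok adj S a w).

Let aj : adj a w. Proof. by case/and3P: h. Qed.
Let aS : a \in S. Proof. by case/and3P: h. Qed.
Let wa : w != a. Proof. by apply: contraTneq aj => ->; apply/negP => /madj_neq; rewrite eqxx. Qed.

Let tok_a t : II t -> beta a (etok a w t) = 1 - t.
Proof. by move=> It; rewrite beta_tok ?aj ?orbT // eqxx (eq_sym a) (negbTE wa) mulr1 mulr0 addr0. Qed.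

Let tok_r t : II t -> beta r (etok a w t) = t * (r == w)%:R.
Proof. by move=> It; rewrite beta_tok ?aj ?orbT // (negbTE ra) mulr0 add0r. Qed.

Let rest_a v : v \in S :\ a -> beta a (mpt v) = 0.
Proof. by case/setD1P => va _; rewrite beta_mpt eq_sym (negbTE va). Qed.

Lemma leave_dom (e : {e : RR | 0 < e < 1}) t : II t -> t < sval e -> gdom a (Some e) (mv S a w t).
Proof.
move=> It te; exists (etok a w t); split; first by right.
  by rewrite /= tok_a //; lra.
move=> q [[v vS ->] _|->] //; rewrite /= rest_a //.
by case: (e) => /= e0 /andP[? ?]; lra.
Qed.

Lemma leave_dom1 : gdom a None (mv S a w 1).
Proof.
move=> q [[v vS ->]|->] /=; first by rewrite rest_a // ltr01.
by rewrite (tok_a II1) subrr ltr01.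
Qed.

Lemma leave_map (e : {e : RR | 0 < e < 1}) t : II t -> t < sval e ->
  gmap n g a r D (Some e) (mv S a w t) = if (w == r) && (0 < t) then g #|S :&: D|%SET else 1%g.
Proof.
move=> It te; have uc := mv_uconf cS h It; have /andP[t0 t1] := It.
have [e0 e1] : 0 < sval e /\ sval e < 1 by case: (e) => /= ? /andP.
have sp v : v \in S :\ a -> ~ special a (Some e) (@mpt G K v) by move=> vS; rewrite /= rest_a // => ?; lra.
rewrite /gmap; have -> : (0 < cnt n (fun q => special a (Some e) q /\ (0 < beta r q)%R) (mv S a w t))%N = (w == r) && (0 < t).
  apply/idP/idP => [/(cnt_gt0 _ uc)[q hq [sq rq]]|/andP[/eqP wr tp]].
    case: hq => [[v vS e']|e']; first by case: (sp v vS); rewrite -e'.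
    by move: rq; rewrite e' tok_r // eq_sym; case: eqVneq => _; rewrite ?mulr0 ?ltxx ?mulr1.
  by apply/(cnt_gt0 _ uc); exists (etok a w t); [right|split; [rewrite /= tok_a //; lra|rewrite tok_r // -wr eqxx mulr1]].
case: ifP => // /andP[/eqP wr tp]; congr g.
have [x [ix ex]] := set_ordering cS; have /imsetP[i _ ai] : a \in im x by rewrite ex.
have eS : mv S a w t = range (fun j => etok (x j) (upd x i w j) (if j == i then t else 0)) by rewrite -ex ai mvE.
have wS : w \notin im x by rewrite ex; case/and3P: h.
have ox : oconf (fun j => etok (x j) (upd x i w j) (if j == i then t else 0)).
  apply: tokens_oconf; [|apply: upd_edges|exact: upd_disjoint]; last by rewrite -ai.
  by move=> j; case: ifP => _ //; exact: II0.
have xj j : j != i -> etok (x j) (upd x i w j) (if j == i then t else 0) = mpt (x j).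
  by move=> ji; rewrite /upd (negbTE ji) tok_id.
rewrite eS cntE // -(card_imset _ ix); apply: eq_card => v; apply/imsetP/finset.setIP => [[j + ->]|[vS vD]].
  rewrite finset.in_set => /asboolP[od iD]; split; first by rewrite -ex mem_im.
  have ji : j != i.
    apply/eqP => ji; move: od; rewrite ji eqxx /upd eqxx -ai /= tok_a // => ?; lra.
  by move: iD; rewrite xj // => -[A AD]; rewrite beta_mpt; case: eqVneq => [<- //|_]; rewrite ltxx.
have /imsetP[j _ ej] : v \in im x by rewrite ex.
have ji : j != i by apply: contraNneq aD => ji; rewrite ai -ji -ej.
exists j => //; rewrite finset.in_set; apply/asboolP; rewrite xj // -ej; split.
  by rewrite /= beta_mpt; case: eqVneq => [av|_] /=; [by move: aD; rewrite av vD|lra].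
by exists v; rewrite // beta_mpt eqxx ltr01.
Qed.

Lemma hol_leave : hol C (mv S a w) (if w == r then g #|S :&: D|%SET else 1%g).
Proof.
(* [F] jumps right after time 0: at time 0 the token is at [a], not yet on the side of [r]. *)
have [gm _ _] := mv_path cS h; pose F (t : RR) := if (w == r) && (0 < t) then g #|S :&: D|%SET else 1%g.
exists F; last by rewrite /F ltxx ltr01 !andbT andbF invg1 mul1g.
apply: flatI => // t /andP[t0 t1]; have [tl|tl] := ltP t 1; last first.
  have -> : t = 1 by lra.
  exists None; first exact: leave_dom1.
  have hn : nbhs (1 : RR) (fun q : RR => 0 < q).
    by apply: open_nbhs_nbhs; split; [exact: open_gt|exact: ltr01].
  apply: filterS hn => q q0 Iq /=.
  have gN t' : II t' -> gmap n g a r D None (mv S a w t') = 1%g by move=> It'; apply: gmap_None; exact: mv_uconf.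
  by rewrite (gN _ Iq) (gN _ II1) /F q0 ltr01.
have e01 : 0 < (1 + t) / 2 < 1 by apply/andP; split; lra.
have te : t < (1 + t) / 2 by lra.
exists (Some (exist (fun e : RR => is_true (0 < e < 1)) _ e01)); first by apply: leave_dom => //; apply/andP.
have hn : nbhs t (fun q : RR => q < (1 + t) / 2).
  by apply: open_nbhs_nbhs; split; [exact: open_lt|].
apply: filterS hn => q qe Iq /=.
by rewrite !leave_map // /F ?mulgV //; apply/andP.
Qed.
End Leave.

Lemma hol_gate S u w : #|S| = n -> mvok adj S u w -> hol C (mv S u w)
  (if (u == a) && (w == r) then g #|S :&: D|%SET else if (u == r) && (w == a) then (g #|S :&: D|%SET)^-1%g else 1%g).
Proof.
move=> cS h; have [uw uS wS] := and3P h; have ne := madj_neq uw.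
have [ua|ua] := eqVneq u a.
  subst u; rewrite (eq_sym a) (negbTE ra) /=; exact: hol_leave.
have [wa|wa] := eqVneq w a; last by rewrite andbF; exact: hol_away.
subst w; rewrite andbT /=; have cS' : #|mvS S u a| = n by rewrite (card_mvS h).
have h' : mvok adj (mvS S u a) a u.
  by rewrite /mvok madjC uw /mvS finset.setU11 /= !inE negb_or ua eqxx.
have eS : mvS (mvS S u a) a u = S by exact: (mvS_back h).
have -> : mv S u a = pinv (mv (mvS S u a) a u) by rewrite -(mv_rev h') eS.
(* Neither [a] nor [r] lies in [D], so the count is the same before and after the move. *)
have -> : (if u == r then (g #|S :&: D|%SET)^-1 else 1)%g = (if u == r then g #|mvS S u a :&: D|%SET else 1%g)^-1%g.
  case: (eqVneq u r) => [ur|_]; last by rewrite invg1.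
  congr (g _)^-1%g; apply: eq_card => v; rewrite !inE.
  have [->|va] := eqVneq v a; first by rewrite (negbTE aD) !andbF.
  by have [->|//] := eqVneq v u; rewrite ur (negbTE rD) !andbF.
exact: (hol_inv (mv_path cS' h') (hol_leave cS' h')).
Qed.
End Gate.
End GateMoves.

(** * The gate homomorphisms *)

Section GateHolonomy.
Import Order.TTheory GRing.Theory Num.Theory.
Local Open Scope ring_scope.
Local Open Scope classical_set_scope.
Variables (G : graph) (K : marking G) (n : nat) (b : set (gpt G)).
Notation V := (mkV K).
Notation conf := (set (gpt G)).
Local Notation adj := (@madj G K).
Variables (X : finType) (Rl : rel X) (phi : (RR -> conf) -> seq (X * bool)).
Hypothesis phiE : forall f g, uloop n b f -> uloop n b g -> (uhomotopic n b f g <-> raag_eq Rl (phi f) (phi g)).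
Hypothesis phi_onto : forall w, exists f, uloop n b f /\ raag_eq Rl (phi f) w.
Hypothesis phiM : forall f g, uloop n b f -> uloop n b g -> raag_eq Rl (phi (pconcat f g)) (phi f ++ phi g).
Hypothesis base : forall S : {set V}, #|S| = n -> exists p, ispath n b (CS S) p.
Local Notation hG C := (@holG _ _ b _ Rl phi phi_onto _ C).
Local Notation M := (Mv Rl phi base).

Lemma holG_natural (L L' : groupType) (C : charts G n L) (C' : charts G n L') (h : L -> L') (r : ch_idx C -> ch_idx C') :
  (forall x y, h (x * y)%g = (h x * h y)%g) ->
  (forall i S, ch_dom i S -> ch_dom (r i) S /\ ch_map (r i) S = h (ch_map i S)) ->
  forall k, hG C' k = h (hG C k).
Proof.
move=> hM hr k; have [l [f [lf <- hl]]] := hol_class phi_onto C k.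
by rewrite (holG_Phi phiE phi_onto lf hl) (holG_Phi phiE phi_onto lf (hol_natural hM hr lf hl)).
Qed.

Section OneGate.
Variables (a r : V) (D : {set V}).
Hypotheses (ra : r != a) (rD : r \notin D) (aD : a \notin D) (cD : closed_to D [set a]%SET).

Definition heis_charts (al al' : nat -> int) := gate_charts n (fun k => mkh (al k) (al' k) 0) ra cD.
(** The second weight is set to 0, so that the homomorphism depends on [al] only. Projections to a
    coordinate axis identify it with either coordinate of a joint holonomy, and any two weights can
    be paired. *)
Definition gate_val (al : nat -> int) g := hx (hG (heis_charts al (fun=> 0)) g).
Definition gate_cobound (al : nat -> int) S := hx (bhol base (heis_charts al (fun=> 0)) S).

Lemma gate_mapN (L L' : groupType) (h : L -> L') (g : nat -> L) (g' : nat -> L') : (forall k, g' k = h (g k)) -> h 1%g = 1%g ->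
  forall i S, gmap n g' a r D i S = h (gmap n g a r D i S).
Proof. by move=> hg h1 i S; rewrite /gmap; case: ifP. Qed.

Lemma mkh_axis x y : (mkh x 0 0 * mkh y 0 0)%g = mkh (x + y) 0 0.
Proof. by apply: hei_ext; rewrite -[(_ * _)%g]/(hmul _ _) /hmul /mkh /hx /hy /hz /= ?mulr0 ?addr0. Qed.

Lemma gate_val_x al al' k : gate_val al k = hx (hG (heis_charts al al') k).
Proof.
pose h p := mkh (hx p) 0 0.
rewrite /gate_val (@holG_natural _ _ (heis_charts al al') (heis_charts al (fun=> 0)) h id) // => [p q|i S hd].
  by rewrite /h mkh_axis.
by split=> //; apply: (gate_mapN (h := h)).
Qed.

Lemma gate_val_y al al' k : gate_val al' k = hy (hG (heis_charts al al') k).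
Proof.
pose h p := mkh (hy p) 0 0.
rewrite /gate_val (@holG_natural _ _ (heis_charts al al') (heis_charts al' (fun=> 0)) h id) // => [p q|i S hd].
  by rewrite /h mkh_axis.
by split=> //; apply: (gate_mapN (h := h)).
Qed.

Lemma gateP : gate adj n M a r D gate_val gate_cobound.
Proof.
split=> [al g h|al al' g h gh|al S u w cS h].
- by rewrite /gate_val (holGM phiE phi_onto phiM) hxM.
- have := hei_comm (p := hG (heis_charts al al') g) (q := hG (heis_charts al al') h).
  rewrite -!(holGM phiE phi_onto phiM) gh -!gate_val_x -!gate_val_y => /(_ erefl) ->.
  by rewrite mulrC.
have hk := hol_gate (fun k => mkh (al k) 0 0) ra rD aD cD cS h.
have c' : #|mvS S u w| = n by rewrite (card_mvS h).
rewrite /gate_val /Mv (holG_cl phiE phi_onto base cS c' (mv_path cS h) hk) !hxM hxV addrAC -/(gate_cobound al S) -/(gate_cobound al (mvS S u w)).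
by congr (_ + _); case: ifP => // _; case: ifP.
Qed.
End OneGate.

Lemma cntS P (y : 'I_n -> gpt G) : oconf y -> cnt n P (range y) = (\sum_(j < n) `[< P (y j) >] : nat)%N.
Proof. by move=> oy; rewrite cntE // -sum1dep_card big_mkcond; apply: eq_bigr => j _; case: `[< _ >]. Qed.

Lemma cnt_split P Q R (S : conf) : uconf n S -> (forall q, gvalid q -> P q -> Q q -> False) ->
  cnt n R S = (cnt n (fun q => P q /\ R q) S + cnt n (fun q => Q q /\ R q) S +
    cnt n (fun q => ~ P q /\ (~ Q q /\ R q)) S)%N.
Proof.
move=> [y [oy ->]] d; rewrite !cntS // -!big_split /=; apply: eq_bigr => j _.
have dj := d _ (oy.1 j); rewrite !asbool_and !asbool_neg.
have : ~~ (`[< P (y j) >] && `[< Q (y j) >]).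
  by apply/negP => /andP[/asboolP p /asboolP q]; exact: dj.
by case: `[< P _ >]; case: `[< Q _ >]; case: `[< R _ >].
Qed.

(** Within [U] only [r] is adjacent to [a], so the special token touches [U] exactly when it is on
    the edge towards [r]. There is at most one such token, so the count is 0 or 1. *)
Lemma gate_count (a r : V) (D U : {set V}) i (S : conf) : uconf n S -> gdom a i S -> a \notin U -> r \in U ->
  (forall u, u \in U -> adj a u = (u == r)) ->
  hx (gmap n (fun=> mkh 1 0 0) a r D i S) = (cnt n (fun q => special a i q /\ inD U q) S)%:Z.
Proof.
move=> cS hd aU rU hU; rewrite /gmap.
have -> : cnt n (fun q => special a i q /\ (0 < beta r q)%R) S = cnt n (fun q => special a i q /\ inD U q) S.
  apply: cnt_ext => // q Sq vq; split=> -[sp h]; split=> //; first by exists r.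
  have a0 : 0 < beta a q by case: (i) sp => [[e /= /andP[? ?]]|] //= ?; lra.
  case: h => A AU A0; have ne : a != A by apply: contraNneq aU => ->.
  by have [] := beta_two vq ne a0 A0; rewrite hU // => /eqP <-.
set c := cnt _ _ _; have : (c <= 1)%N.
  have [y [oy yS]] := cS; rewrite /c yS cntE //; apply/card_le1_eqP => j k.
  rewrite !finset.in_set => /asboolP[sj _] /asboolP[sk _].
  case: (i) hd sj sk => [e|] //= [q0 [_ _ ho]] sj sk; apply: oy.2.
  have un m : 1 - sval e < beta a (y m) -> y m = q0.
    move=> h; apply: contrapT => ne; have ym : S (y m) by rewrite yS; exists m.
    by have := lt_trans h (ho _ ym ne); rewrite ltxx.
  by rewrite (un j sj) (un k sk).
by case: c => [|[|c]].
Qed.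

(* Tokens enter and leave [U] only through the two gates, and their number in [U] is the same at
   the beginning and at the end of a loop. *)
Lemma gates_opposite (a r b' r' : V) (D D' U : {set V}) (ra : r != a) (cD : closed_to D [set a]%SET)
    (rb : r' != b') (cD' : closed_to D' [set b']%SET) : closed_to U [set a; b']%SET -> a != b' -> ~~ adj a b' ->
  a \notin U -> b' \notin U -> (forall u, u \in U -> adj a u = (u == r)) -> (forall u, u \in U -> adj b' u = (u == r')) ->
  r \in U -> r' \in U ->
  forall g, gate_val rb cD' (fun=> 1) g = - gate_val ra cD (fun=> 1) g.
Proof.
move=> cU ab nab aU bU hU hU' rU rU' g.
have ar (s s' p p' F1 F2 F1' F2' z z1 z2 : int) : s + s' - z1 = - z -> p + p' - z2 = - z ->
  F1 - s = F2 - p -> F1' - s' = F2' - p' -> F1 + F1' - z1 = F2 + F2' - z2 by lia.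
pose Ca := heis_charts ra cD (fun=> 1) (fun=> 0); pose Cb := heis_charts rb cD' (fun=> 1) (fun=> 0).
have [l [f [lf <- hl]]] := hol_class phi_onto Ca g; have [l' hl'] := hol_exists Cb lf.
rewrite /gate_val (holG_Phi phiE phi_onto lf hl) (holG_Phi phiE phi_onto lf hl').
case: hl hl' => F fF -> [F' fF' ->]; have [gf f0 f1] := lf.
(* The chart values count the tokens of [U] close to the gates. Up to a locally constant term, [T]
   is therefore minus the number of the other tokens in [U], which cannot change locally. *)
pose T t := hx (F t) + hx (F' t) - (cnt n (inD U) (f t))%:Z.
suff : T 0 = T 1 by rewrite /T f0 f1 !hxM !hxV; move: (_%:Z) => z; lia.
apply: locally_constant => // t It; have uf u : II u -> uconf n (f u) by exact: gf.1.
have [i Ui] := ch_cover Ca (uf _ It); have [j Uj] := ch_cover Cb (uf _ It).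
pose R q := ~ special a i q /\ (~ special b' j q /\ inD U q).
have key u : II u -> ch_dom i (f u) -> ch_dom j (f u) ->
    hx (ch_map (c := Ca) i (f u)) + hx (ch_map (c := Cb) j (f u)) - (cnt n (inD U) (f u))%:Z = - (cnt n R (f u))%:Z.
  move=> Iu di dj; rewrite /= (gate_count D (uf _ Iu) di aU rU hU) (gate_count D' (uf _ Iu) dj bU rU' hU').
  have d q : gvalid q -> special a i q -> special b' j q -> False.
    move=> vq sa sb; have a0 : 0 < beta a q by case: (i) sa => [[e /= /andP[? ?]]|] //= ?; lra.
    have b0 : 0 < beta b' q by case: (j) sb => [[e /= /andP[? ?]]|] //= ?; lra.
    by have [h _] := beta_two vq ab a0 b0; rewrite h in nab.
  by rewrite (cnt_split (inD U) (uf _ Iu) d) -/R; lia.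
have [x [ox ex]] := uf _ It; have Ri k : locp R (x k).
  have di : gdom a i (range x) by rewrite -ex.
  have dj : gdom b' j (range x) by rewrite -ex.
  have h1 := locp_not (special_const ox di k); have h2 := locp_not (special_const ox dj k).
  have [si|ni] := pselect (special a i (x k)).
    have [W [oW Wx hW]] := h1; exists W; split=> // q vq Wq.
    by split=> -[n1 _]; [have := (hW q vq Wq).1 n1|case: n1].
  have [sj|nj] := pselect (special b' j (x k)).
    have [W [oW Wx hW]] := h2; exists W; split=> // q vq Wq.
    by split=> -[_ [n1 _]]; [have := (hW q vq Wq).1 n1|case: n1].
  apply: locp_and h1 _; apply: locp_and h2 _; apply: (locp_inD cU).
  - move=> u w; rewrite !inE => /orP[] /eqP -> /orP[] /eqP -> //; try by apply/negP => /madj_neq; rewrite eqxx.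
    by rewrite madjC.
  - exact: ox.1.
  have xr : range x (x k) by exists k.
  move=> u; rewrite !inE => /orP[] /eqP ->.
    by have [//|/ordinary_lt] := gdom_cases di xr.
  by have [//|/ordinary_lt] := gdom_cases dj xr.
have [W [oW Wx hW]] := cnt_local ox Ri.
have n1 := gf.2 _ (@ch_open _ _ _ Ca i) _ It Ui; have n2 := gf.2 _ (@ch_open _ _ _ Cb j) _ It Uj.
have n3 := gf.2 _ oW _ It; rewrite ex in n3; have {}n3 := n3 Wx.
have n4 := fF t It i Ui; have n5 := fF' t It j Uj.
apply: filterS (filterI n1 (filterI n2 (filterI n3 (filterI n4 n5)))) => u [h1 [h2 [h3 [h4 h5]]]] Iu.
have k1 := key _ Iu (h1 Iu) (h2 Iu); have k2 := key _ It Ui Uj.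
have k3 := hW _ (uf _ Iu) (h3 Iu); have k4 := congr1 hx (h4 Iu); have k5 := congr1 hx (h5 Iu).
rewrite k3 -ex in k1; rewrite !hxM !hxV in k4 k5; rewrite /T.
exact: (ar _ _ _ _ _ _ _ _ _ _ _ k1 k2 k4 k5).
Qed.
End GateHolonomy.

(** * Rounding configurations to vertices *)

Section BasePaths.
Import Order.TTheory GRing.Theory Num.Theory.
Local Open Scope ring_scope.
Local Open Scope classical_set_scope.
Variables (G : graph) (n : nat).
Notation pt := (gpt G).
Notation conf := (set pt).

(* [l] subdivides the edges finely enough to round the tokens of [x] down to distinct vertices. *)
Definition fine (l : gE G -> nat) (x : 'I_n -> pt) :=
  (forall i e t, x i = inr (e, t) -> 1 <= t * (l e)%:R) /\
  (forall i j e t t', x i = inr (e, t) -> x j = inr (e, t') -> t < t' -> 1 <= (t' - t) * (l e)%:R).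

Lemma fin_bound (I : finType) (P : I -> nat -> Prop) : (forall i N N', (N <= N')%N -> P i N -> P i N') ->
  (forall i, exists N, P i N) -> exists N, forall i, P i N.
Proof.
move=> mono h; pose f i := projT1 (cid (h i)); exists (\max_i f i) => i.
by apply: mono (leq_bigmax i) _; rewrite /f; case: cid.
Qed.

Lemma archi_mul (r : RR) : 0 < r -> exists N : nat, forall N', (N <= N')%N -> 1 <= r * N'%:R.
Proof.
move=> r0; have := Num.Theory.truncn_itv (ltW (_ : 0 < r^-1)); rewrite invr_gt0 => /(_ r0)/andP[_ h].
exists (Num.truncn r^-1).+1 => N' hN; have h2 : r^-1 <= N'%:R by apply: le_trans (ltW h) _; rewrite ler_nat.
by have := ler_wpM2l (ltW r0) h2; rewrite divff ?gt_eqF.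
Qed.

Lemma fine_exists (x : 'I_n -> pt) : oconf x -> exists N, forall l : gE G -> nat, (forall e, (N <= l e)%N) -> fine l x.
Proof.
move=> [vx _].
have [N1 h1] : exists N, forall i, forall M, (N <= M)%N -> forall e t, x i = inr (e, t) -> 1 <= t * M%:R.
  apply: fin_bound => [i N N' hN h M hM|i]; first by apply: h; lia.
  case ex : (x i) => [v|[e t]]; first by exists 0%N.
  have := vx i; rewrite ex => /andP[t0 _]; have [N hN] := archi_mul t0.
  by exists N => M hM e' t' [_ <-]; exact: hN.
have [N2 h2] : exists N, forall ij : 'I_n * 'I_n, forall M, (N <= M)%N -> forall e t t', x ij.1 = inr (e, t) ->
    x ij.2 = inr (e, t') -> t < t' -> 1 <= (t' - t) * M%:R.
  apply: fin_bound => [i N N' hN h M hM|[i j]] /=; first by apply: h; lia.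
  case ex : (x i) => [v|[e t]]; first by exists 0%N.
  case ey : (x j) => [v|[e' t']]; first by exists 0%N.
  have [tt|tt] := ltP t t'; last by exists 0%N => M _ e1 t1 t2 [_ <-] [_ <-]; rewrite ltNge tt.
  have d0 : 0 < t' - t by rewrite subr_gt0.
  have [N hN] := archi_mul d0.
  exists N => M hM e1 t1 t2 [_ <-] [_ <-] _; exact: hN.
exists (maxn N1 N2) => l hl; split=> [i e t|i j e t t'].
  by apply: h1; apply: leq_trans (hl e); rewrite leq_maxl.
by apply: (h2 (i, j)); apply: leq_trans (hl e); rewrite leq_maxr.
Qed.

Variable K : marking G.
Notation V := (mkV K).
Local Notation adj := (@madj G K).

Definition flr (e : gE G) (t : RR) := Num.truncn (t * (len K e)%:R).
Definition round (q : pt) : V := match q with inl v => vx K v | inr (e, t) => nd K e (flr e t) end.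
(** A token inside an edge moves linearly down to the last subdivision point not beyond it; fineness
    keeps the tokens of an edge in strict order. *)
Definition slope e (t s : RR) : RR := (1 - s) * t + s * ((flr e t)%:R / (len K e)%:R).
Definition glide (q : pt) (s : RR) : pt := match q with inl v => inl v | inr (e, t) => gchar e (slope e t s) end.

Section Rounding.
Variable x : 'I_n -> pt.
Hypotheses (ox : oconf x) (fx : fine (len K) x).

Lemma flr_bounds i e t : x i = inr (e, t) -> (0 < flr e t < len K e)%N /\
  0 < ((flr e t)%:R / (len K e)%:R : RR) <= t.
Proof.
move=> ei; have := ox.1 i; rewrite ei => /andP[t0 t1]; have l0 := len_gt0 K e.
have h1 := fx.1 _ _ _ ei; have p0 : 0 <= t * (len K e)%:R by lra.
have /andP[f1 f2] := Num.Theory.truncn_itv p0; rewrite -/(flr e t) in f1 f2.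
have fp : (0 < flr e t)%N.
  rewrite lt0n; apply: contraTneq f2 => ->; rewrite -leNgt; exact: h1.
have tl : t * (len K e)%:R < (len K e)%:R by rewrite gtr_pMl.
split; first by rewrite fp -(ltr_nat RR); apply: le_lt_trans f1 tl.
apply/andP; split; first by rewrite divr_gt0 // ltr0n.
by rewrite ler_pdivrMr.
Qed.

Lemma slope_bounds i e t s : x i = inr (e, t) -> II s -> 0 < slope e t s < 1.
Proof.
move=> ei /andP[s0 s1]; have := ox.1 i; rewrite ei => /andP[t0 t1].
have [_ /andP[c0 c1]] := flr_bounds ei; rewrite /slope; move: (_ / _) c0 c1 => c c0 c1.
have h1 : 0 <= s * (t - c) by rewrite mulr_ge0 ?subr_ge0.
have h2 : 0 <= (1 - s) * (t - c) by rewrite mulr_ge0 ?subr_ge0.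
by apply/andP; split; lra.
Qed.

Lemma glideE i e t s : x i = inr (e, t) -> II s -> glide (x i) s = inr (e, slope e t s).
Proof.
move=> ei Is; have /andP[h1 h2] := slope_bounds ei Is.
by rewrite ei /= /gchar leNgt h1 leNgt h2.
Qed.

Lemma flr_lt i j e t t' : x i = inr (e, t) -> x j = inr (e, t') -> t < t' -> (flr e t < flr e t')%N.
Proof.
move=> ei ej tt; have h := fx.2 _ _ _ _ _ ei ej tt; have l0 := len_gt0 K e.
have hi := fx.1 _ _ _ ei; have hj := fx.1 _ _ _ ej.
have p1 : 0 <= t * (len K e)%:R by lra.
have p2 : 0 <= t' * (len K e)%:R by lra.
have /andP[f1 f2] := Num.Theory.truncn_itv p1; have /andP[g1 g2] := Num.Theory.truncn_itv p2.
rewrite -ltnS -(ltr_nat RR); move: f1 f2 g1 g2 h; rewrite -/(flr e t) -/(flr e t') -!natr1 mulrBl.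
by move=> *; lra.
Qed.

Lemma slope_lt i j e t t' s : x i = inr (e, t) -> x j = inr (e, t') -> t < t' -> II s -> slope e t s < slope e t' s.
Proof.
move=> ei ej tt /andP[s0 s1]; have h := flr_lt ei ej tt; have l0 := len_gt0 K e.
have : (flr e t)%:R / (len K e)%:R < (flr e t')%:R / (len K e)%:R :> RR by rewrite ltr_pM2r ?invr_gt0 // ltr_nat.
rewrite /slope; move: (_ / _) (_ / _) => c' c cc.
have d1 : 0 <= (1 - s) * (t' - t) by rewrite mulr_ge0 // subr_ge0 // ltW.
have d2 : 0 <= s * (c' - c) by rewrite mulr_ge0 // subr_ge0 ltW.
have [s2|s2] := ltP s (2^-1).
  have : 0 < (1 - s) * (t' - t) by rewrite mulr_gt0 // subr_gt0 //; lra.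
  by lra.
have : 0 < s * (c' - c) by rewrite mulr_gt0 // ?subr_gt0 //; lra.
by lra.
Qed.

Lemma glide_oconf s : II s -> oconf (fun i => glide (x i) s).
Proof.
move=> Is; split=> [i|i j].
  case ei : (x i) => [v|[e t]] //; rewrite -ei (glideE ei Is); exact: slope_bounds ei Is.
case ei : (x i) => [v|[e t]]; case ej : (x j) => [v'|[e' t']].
- by move=> /= [vv]; apply: ox.2; rewrite ei ej vv.
- by rewrite -ej (glideE ej Is).
- by rewrite -ei (glideE ei Is).
rewrite -ei -ej (glideE ei Is) (glideE ej Is) => -[ee]; subst e' => st.
apply: ox.2; rewrite ei ej; have [tt|tt|-> //] := ltgtP t t'.
  by have := slope_lt ei ej tt Is; rewrite st ltxx.
by have := slope_lt ej ei tt Is; rewrite st ltxx.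
Qed.

Lemma round_inj : injective (round \o x).
Proof.
move=> i j /=; case ei : (x i) => [v|[e t]]; case ej : (x j) => [v'|[e' t']] /=.
- by move=> /vx_inj vv; apply: ox.2; rewrite ei ej vv.
- by have [h _] := flr_bounds ej => /esym/(nd_vx h).
- by have [h _] := flr_bounds ei => /(nd_vx h).
have [h _] := flr_bounds ei; have [h' _] := flr_bounds ej => /(nd_inj h h')[ee]; subst e' => ff.
apply: ox.2; rewrite ei ej; have [tt|tt|-> //] := ltgtP t t'.
  by have := flr_lt ei ej tt; rewrite ff ltnn.
by have := flr_lt ej ei tt; rewrite ff ltnn.
Qed.

Lemma glide_path : ispath n (range x) (CS (im (round \o x))) (fun s => range (fun i => glide (x i) s)).
Proof.
split.
- apply: good_tokens => [s Is|i]; first exact: glide_oconf.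
  case ei : (x i) => [v|[e t]]; first exact: tgood_cst.
  apply: tgood_gchar => [|s Is]; last by have /andP[? ?] := slope_bounds ei Is; apply/andP; split; exact: ltW.
  rewrite /slope; apply: cont_add; apply: cont_mul; try exact: cont_cst; last exact: cont_id.
  by apply: cont_add; [exact: cont_cst|apply: cont_opp; exact: cont_id].
- apply: (congr1 (fun h : 'I_n -> pt => range h)); apply: funext => i; case ei : (x i) => [v|[e t]] //.
  by rewrite -ei (glideE ei II0) ei /slope subr0 mul1r mul0r addr0.
rewrite -range_mpt; apply: (congr1 (fun h : 'I_n -> pt => range h)); apply: funext => i /=.
case ei : (x i) => [v|[e t]] /=; first by rewrite mpt_vx.
have [/andP[_ h] _] := flr_bounds ei; rewrite mpt_nd 1?ltnW //.
by rewrite /slope subrr mul0r mul1r add0r.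
Qed.

Lemma card_ord_im (y : 'I_n -> V) : injective y -> #|im y| = n.
Proof. by move=> iy; rewrite card_imset // card_ord. Qed.

Lemma moves_path (S : {set V}) ms : #|S| = n -> mok adj S ms -> exists p, ispath n (CS S) (CS (mfin S ms)) p.
Proof.
elim: ms S => [|[u w] ms IH] S cS /=.
  move=> _; exists (fun=> CS S); apply: ispath_cst.
  have [y [iy <-]] := set_ordering cS; rewrite -range_mpt; exists (@mpt G K \o y); split=> //.
  exact: mpt_oconf.
move=> /andP[h hs]; have c' : #|mvS S u w| = n by rewrite (card_mvS h).
have [p hp] := IH _ c' hs; exists (pconcat (mv S u w) p).
exact: ispath_concat (mv_path cS h) hp.
Qed.

Lemma base_path : conn adj predT -> forall S : {set V}, #|S| = n -> exists p, ispath n (range x) (CS S) p.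
Proof.
move=> cV S cS; have c0 := card_ord_im round_inj.
have [||ms [_ om fm]] := slide_sets (S := im (round \o x)) (S' := S) cV; [by rewrite c0|by []|].
have [p hp] := moves_path c0 om; rewrite fm in hp.
by exists (pconcat (fun s => range (fun i => glide (x i) s)) p); exact: ispath_concat glide_path hp.
Qed.
End Rounding.
End BasePaths.

(** * Subdivisions of subgraphs *)

Section Refinement.
Variables (G : graph) (k : gE G -> nat).
Hypothesis k2 : forall e, (1 < k e)%N.

Lemma sd_node_last e : sd_node k e (k e).+1 = inl (gtgt e).
Proof. by rewrite /= insubN // ltnn. Qed.

Lemma sd_nodeE e m (h : m < k e) : sd_node k e m.+1 = inr (existT (fun e0 => 'I_(k e0)) e (Ordinal h)).
Proof. by rewrite /= insubT. Qed.

Lemma sd_node_inj e e' m m' : 0 < m < (k e).+1 -> 0 < m' < (k e').+1 -> sd_node k e m = sd_node k e' m' -> e = e' /\ m = m'.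
Proof.
case: m => // m; case: m' => // m' h h'; rewrite (sd_nodeE (e := e) (m := m) h) (sd_nodeE (e := e') (m := m') h').
move=> E; split; first exact: (congr1 (fun z => if z is inr y then tag y else e) E).
exact: (congr1 (fun z : gV G + {e0 : gE G & 'I_(k e0)} => if z is inr y then (nat_of_ord (tagged y)).+1 else 0) E).
Qed.

Lemma sd_node_inner e m v : 0 < m < (k e).+1 -> sd_node k e m <> inl v.
Proof. by case: m => // m h; rewrite (sd_nodeE (e := e) (m := m) h). Qed.

Lemma sd_node_onto (A : gV (subdiv k)) : (exists v, A = inl v) \/ exists e m, 0 < m < (k e).+1 /\ A = sd_node k e m.
Proof.
case: A => [v|[e [i hi]]]; first by left; exists v.
by right; exists e, i.+1; split; [|rewrite (sd_nodeE hi)].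
Qed.

Definition subdiv_marking : marking G :=
  @Marking G (gV (subdiv k)) (sd_node k) (fun v => inl v) (fun e => (k e).+1)
    (fun e => k2 e) (fun=> erefl) sd_node_last (fun u v e => let: erefl := e in erefl) sd_node_inj sd_node_inner sd_node_onto.
End Refinement.

(** * Adjacency and distances in a marked graph *)

Section MarkedGraph.
Variables (G : graph) (K : marking G).
Notation V := (mkV K).
Local Notation adj := (@madj G K).
Local Notation len := (len K).
Implicit Types (A u w : V) (p : seq V).

Lemma adj_nd e m : m < len e -> adj (nd K e m) (nd K e m.+1).
Proof. by move=> h; apply/asboolP; exists (e, m); split=> //; left. Qed.

Lemma adj_inner e m w : 0 < m < len e -> adj (nd K e m) w -> w = nd K e m.-1 \/ w = nd K e m.+1.
Proof.
move=> hm /asboolP[[e' m'] [/= h' [[h1 h2]|[h1 h2]]]].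
  have m0 : 0 < m'.
    by rewrite lt0n; apply/eqP => e0; move: h1; rewrite e0 nd0 => /esym; exact: nd_vx.
  have [|ee mm] := nd_inj (_ : 0 < m' < len e') hm h1; first by rewrite m0.
  by subst; right.
have m0 : m'.+1 < len e'.
  rewrite ltn_neqAle h' andbT; apply/eqP => e0; move: h2; rewrite e0 ndl => /esym; exact: nd_vx.
have [|ee mm] := nd_inj (_ : 0 < m'.+1 < len e') hm h2; first by [].
by subst; left.
Qed.

Lemma adj_vx v w : adj (vx K v) w -> exists e, (gsrc e = v /\ w = nd K e 1) \/ (gtgt e = v /\ w = nd K e (len e).-1).
Proof.
move=> /asboolP[[e m] [/= h [[h1 h2]|[h1 h2]]]]; exists e.
  left; case: (posnP m) => [m0|m0]; last by case: (nd_vx (_ : 0 < m < len e) h1); rewrite m0.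
  by move: h1 h2; rewrite m0 nd0 => /vx_inj.
right; have [hm|hm] := ltnP m.+1 (len e); first by case: (nd_vx (_ : 0 < m.+1 < len e) h2).
have {}hm : m.+1 = len e by apply/eqP; rewrite eqn_leq h hm.
by rewrite -hm /=; move: h2; rewrite hm ndl => /vx_inj.
Qed.

Lemma vx_nadj v v' : ~~ adj (vx K v) (vx K v').
Proof.
apply/negP => /adj_vx[e [[_ /esym]|[_ /esym]]]; apply: nd_vx; have := len3 K e; lia.
Qed.

(** An inner vertex of an edge has only two neighbours. *)
Lemma vx_of_degree A x y z : uniq [:: x; y; z] -> adj A x -> adj A y -> adj A z -> exists v, A = vx K v.
Proof.
case: (mk_surj A) => [//|[e [m [hm ->]]]] u hx hy hz; exfalso.
move: u; rewrite /= !inE negb_or.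
by case: (adj_inner hm hx) => ->; case: (adj_inner hm hy) => ->; case: (adj_inner hm hz) => ->; rewrite eqxx ?andbF.
Qed.

(** A path shorter than [N] does not get farther than its length along an edge at [v], so its end is
    [v] or an inner vertex. *)
Lemma vx_dist N v v' p : (forall e, N <= len e) -> v != v' -> path adj (vx K v) p -> last (vx K v) p = vx K v' -> N <= size p.
Proof.
move=> hN vv; rewrite leqNgt => pp lp; apply/negP => sp.
have : last (vx K v) p = vx K v \/ exists e m, [/\ 0 < m < len e, last (vx K v) p = nd K e m &
    (gsrc e = v /\ m <= size p) \/ (gtgt e = v /\ len e - m <= size p)].
  elim/last_ind: p pp sp {lp} => [|p w IH]; first by left.
  rewrite rcons_path size_rcons last_rcons => /andP[pp aw] sp; have l3 := len3 K.
  case: (IH pp (ltnW sp)) => [e0|[e [m [hm e0 hs]]]]; rewrite e0 in aw.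
    have [e [[es ->]|[et ->]]] := adj_vx aw; right; have := l3 e => l3e.
      by exists e, 1; split=> //; [lia|left].
    by exists e, (len e).-1; split=> //; [lia|right; split=> //; lia].
  have le := hN e; case: (adj_inner hm aw) => ->.
    have [m1|m1] := posnP m.-1; last first.
      by right; exists e, m.-1; split=> //; [lia|case: hs => -[? ?]; [left|right]; split=> //; lia].
    by left; rewrite m1 nd0; case: hs => -[hv h2]; [rewrite hv|exfalso; lia].
  have [m1|m1] := ltnP m.+1 (len e).
    by right; exists e, m.+1; split=> //; case: hs => -[? ?]; [left|right]; split=> //; lia.
  left; have -> : m.+1 = len e by lia.
  by rewrite ndl; case: hs => -[hv h2]; [exfalso; lia|rewrite hv].
rewrite lp; case=> [/vx_inj e|[e [m [hm /esym h _]]]]; first by rewrite e eqxx in vv.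
exact: nd_vx hm h.
Qed.

Lemma nd_path e x k : x + k <= len e -> path adj (nd K e x) [seq nd K e m | m <- iota x.+1 k].
Proof.
elim: k x => //= k IH x h; rewrite adj_nd; last by lia.
by apply: IH; lia.
Qed.

Lemma nd_last e x k : last (nd K e x) [seq nd K e m | m <- iota x.+1 k] = nd K e (x + k).
Proof. by elim: k x => [|k IH] x /=; rewrite ?addn0 // IH addnS. Qed.

Lemma marking_conn : gconnected G -> conn adj predT.
Proof.
move=> [_ cG]; have cs : connect_sym adj by apply: sym_connect_sym; exact: madjC.
have hnd e m : m <= len e -> connect adj (vx K (gsrc e)) (nd K e m).
  move=> h; rewrite -nd0; apply/connectP; exists [seq nd K e m | m <- iota 1 m]; first exact: nd_path.
  by rewrite nd_last.
have hvx v v' : connect adj (vx K v) (vx K v').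
  have /connectP[p pp ->] := cG v v'; elim: p v pp => [|w p IH] v /=; first by rewrite connect0.
  move=> /andP[/existsP[e he] pp]; apply: connect_trans (IH _ pp).
  have he' : connect adj (vx K (gsrc e)) (vx K (gtgt e)) by rewrite -ndl; exact: hnd.
  by case/orP: he => /andP[/eqP <- /eqP <-] //; rewrite cs.
have hA A : exists v, connect adj (vx K v) A.
  case: (mk_surj A) => [[v ->]|[e [m [/andP[_ hm] ->]]]]; first by exists v; rewrite connect0.
  by exists (gsrc e); apply: hnd; exact: ltnW.
move=> A B _ _; have [v hv] := hA A; have [v' hv'] := hA B.
have /connectP[p pp e] : connect adj A B.
  by apply: connect_trans hv'; apply: connect_trans (hvx v v'); rewrite cs.
by exists p; split=> //; apply/allP.
Qed.
End MarkedGraph.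

(** * Graphs drawn in a graph *)

Section Carriers.
Variables (V : finType) (adj : rel V) (N : nat).
Hypothesis adjC : symmetric adj.

(* the graph [H] is drawn in [adj], an edge [e] becoming a path with inner vertices [L e] *)
Record carries (H : graph) (f : gV H -> V) (L : gE H -> seq V) := Carries {
  car_path : forall e, path adj (f (gsrc e)) (rcons (L e) (f (gtgt e)));
  car_inj : injective f;
  car_uniq : forall e, uniq (L e);
  car_out : forall e v, f v \notin L e;
  car_disj : forall e e' v, v \in L e -> v \in L e' -> e = e';
  car_size : forall e, N <= size (L e) }.

Lemma carries_sub (H D : graph) f L : subgraph H D -> @carries D f L -> exists f' L', @carries H f' L'.
Proof.
move=> [fV [fE [iV [iE h]]]] c.
pose L' e := if (fV (gsrc e) == gsrc (fE e)) && (fV (gtgt e) == gtgt (fE e)) then L (fE e) else rev (L (fE e)).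
have mL e v : (v \in L' e) = (v \in L (fE e)) by rewrite /L'; case: ifP => // _; rewrite mem_rev.
exists (f \o fV), L'; split=> [e|||e v|e e' v|e].
- rewrite /L' /=; case: ifP => [/andP[/eqP -> /eqP ->]|]; first exact: (car_path c).
  case: (h e) => [[-> ->]|[-> -> _]]; first by rewrite !eqxx.
  have := path_sym adjC (car_path c (fE e)); rewrite last_rcons belast_rcons rev_cons.
  by [].
- exact: inj_comp (car_inj c) iV.
- by move=> e; rewrite /L'; case: ifP => _; rewrite ?rev_uniq (car_uniq c).
- by rewrite mL; exact: (car_out c).
- by rewrite !mL => h1 h2; apply: iE; exact: (car_disj c h1 h2).
- by rewrite /L'; case: ifP => _; rewrite ?size_rev (car_size c).
Qed.

Lemma carries_unsubdivide (H : graph) (k : gE H -> nat) f L : @carries (subdiv k) f L -> exists f' L', @carries H f' L'.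
Proof.
move=> c; pose E e j : gE (subdiv k) := existT (fun e0 => 'I_(k e0).+1) e (inord j).
have Einj e e' j j' : j <= k e -> j' <= k e' -> E e j = E e' j' -> e = e' /\ j = j'.
  move=> hj hj' h; have ee : e = e' := congr1 (@tag _ _) h; subst e'; split=> //.
  have : inord j = inord j' :> nat := congr1 (fun z : gE (subdiv k) => nat_of_ord (tagged z)) h.
  by rewrite !inordK.
have srcE e j : j <= k e -> gsrc (E e j) = sd_node k e j by move=> h; rewrite /= inordK.
have tgtE e j : j <= k e -> gtgt (E e j) = sd_node k e j.+1 by move=> h; rewrite [LHS]/= inordK.
(* The drawings of the first [i.+1] pieces of the edge [e], with the subdivision vertices between
   them. *)
pose fix ch e i := if i is j.+1 then ch e j ++ f (sd_node k e i) :: L (E e i) else L (E e 0).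
have chP e i : i <= k e -> path adj (f (inl (gsrc e))) (rcons (ch e i) (f (sd_node k e i.+1))).
  elim: i => [|i IH] h.
    by have := car_path c (E e 0); rewrite srcE // tgtE.
  have := IH (ltnW h); have -> : ch e i.+1 = ch e i ++ f (sd_node k e i.+1) :: L (E e i.+1) by [].
  move=> p1; rewrite rcons_cat cat_path.
  have := car_path c (E e i.+1); rewrite srcE // tgtE // => p2.
  by move: p1; rewrite rcons_path => /andP[-> h1]; rewrite /= h1.
have chM e i v : i <= k e -> v \in ch e i -> (exists2 j, j <= i & v \in L (E e j)) \/ (exists2 j, 0 < j <= i & v = f (sd_node k e j)).
  elim: i => [|i IH] h /=; first by left; exists 0.
  rewrite mem_cat inE => /or3P[/(IH (ltnW h))[[j hj vj]|[j hj vj]]|/eqP ->|vj].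
  - by left; exists j => //; lia.
  - by right; exists j => //; lia.
  - by right; exists i.+1 => //; lia.
  - by left; exists i.+1.
have fout e e' i : i <= k e -> forall j, 0 < j <= k e' -> (i < j \/ e <> e') -> f (sd_node k e' j) \notin ch e i.
  move=> hi j hj ij; apply/negP => /(chM _ _ _ hi)[[j' _ h]|[j' hj' /(car_inj c) h]]; first by rewrite (negbTE (car_out c _ _)) in h.
  have [||ee jj] := sd_node_inj (_ : 0 < j < (k e').+1) (_ : 0 < j' < (k e).+1) h; [lia|lia|].
  by case: ij => [|[]]; [rewrite jj; lia|].
have chU e i : i <= k e -> uniq (ch e i).
  elim: i => [|i IH] h; first exact: (car_uniq c).
  have fo : f (sd_node k e i.+1) \notin ch e i by apply: fout; [lia|lia|left].
  rewrite -[ch e i.+1]/(ch e i ++ f (sd_node k e i.+1) :: L (E e i.+1)) cat_uniq IH 1?ltnW // cons_uniq.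
  rewrite (car_uniq c) (car_out c) !andbT; apply/hasPn => v; rewrite inE => /orP[/eqP -> //|vL].
  apply/negP => /(chM _ _ _ (ltnW h))[[j hj vj]|[j hj ev]].
    by have [||] := Einj e e j i.+1 _ _ (car_disj c vj vL); lia.
  by move: vL; rewrite ev (negbTE (car_out c _ _)).
exists (f \o inl), (fun e => ch e (k e)); split=> [e|u v /(car_inj c)[]|e|e v|e e' v|e] //=.
- by have := chP e (k e) (leqnn _); rewrite -(sd_node_last k e).
- exact: chU.
- apply/negP => /(chM _ _ _ (leqnn _))[[j _ h]|[j hj /(car_inj c) h]]; first by rewrite (negbTE (car_out c _ _)) in h.
  by have := sd_node_inner (_ : 0 < j < (k e).+1) (esym h); apply; lia.
- move=> /(chM _ _ _ (leqnn _))[[j hj vj]|[j hj ->]] /(chM _ _ _ (leqnn _))[[j' hj' vj']|[j' hj' ev]].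
  + by have [||//] := Einj e e' j j' _ _ (car_disj c vj vj').
  + by move: vj; rewrite ev (negbTE (car_out c _ _)).
  + by move: vj'; rewrite (negbTE (car_out c _ _)).
  + by have [||//] := sd_node_inj (_ : 0 < j < (k e).+1) (_ : 0 < j' < (k e').+1) (car_inj c ev); lia.
- have h i : i <= k e -> N <= size (ch e i).
    by elim: i => [|i IH] hi /=; [exact: (car_size c)|rewrite size_cat; apply: leq_trans (IH (ltnW hi)) (leq_addr _ _)].
  exact: h.
Qed.
End Carriers.

(** * A fine marking that refines a given subdivision *)

Section FineMarking.
Variables (G : graph) (k : gE G -> nat) (N : nat).
Hypothesis N2 : 2 < N.
(** Each of the [(k e).+1] pieces of [e] is cut into [N] edges; the number of new inner vertices is
    one less than the product. *)
Let kN e := ((k e).+1 * N).-1.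

Lemma kN_gt1 e : 1 < kN e.
Proof. by rewrite /kN; nia. Qed.

Definition fine_marking := subdiv_marking kN_gt1.

Lemma fine_len e : len fine_marking e = (k e).+1 * N.
Proof. by rewrite /= prednK // muln_gt0 /=; lia. Qed.

Definition fine_node (u : gV (subdiv k)) : mkV fine_marking :=
  match u with inl v => vx fine_marking v | inr (existT e i) => nd fine_marking e (i.+1 * N) end.

Lemma fine_nodeE e j : j <= (k e).+1 -> fine_node (sd_node k e j) = nd fine_marking e (j * N).
Proof.
case: j => [|j] hj //; have [h|h] := ltnP j (k e); first by rewrite (sd_nodeE h).
have -> : j = k e by lia.
by rewrite sd_node_last -fine_len ndl.
Qed.

Lemma carries_fine : carries (@madj G fine_marking) N.-1 (H := subdiv k) fine_node
  (fun a => [seq nd fine_marking (tag a) m | m <- iota (tagged a * N).+1 N.-1]).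
Proof.
have inn e j m : j <= k e -> m \in iota (j * N).+1 N.-1 -> [/\ 0 < m < len fine_marking e, m %/ N = j & m %% N != 0].
  rewrite mem_iota fine_len => hj hm; have hr : (m - j * N) < N by lia.
  have -> : m = j * N + (m - j * N) by lia.
  rewrite divnMDl; last by lia.
  rewrite modnMDl divn_small // modn_small // addn0; split=> //; [nia|lia].
have tl (a : gE (subdiv k)) : tagged a <= k (tag a) by case: a => e [i hi].
have ndmem a m e' m' : m \in iota (tagged (a : gE (subdiv k)) * N).+1 N.-1 -> 0 < m' < len fine_marking e' ->
    nd fine_marking (tag a) m = nd fine_marking e' m' -> tag a = e' /\ m = m'.
  by move=> hm hm'; have [h _ _] := inn _ _ _ (tl a) hm; exact: nd_inj.
have mul e (i : 'I_(k e)) : 0 < i.+1 * N < len fine_marking e by rewrite fine_len; have := ltn_ord i; nia.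
split=> [a|u v|a|a v|a a' v|a].
- have h := tl a; rewrite /gsrc /gtgt /= -/(sd_node k (tag a) (tagged a).+1) !fine_nodeE //; last exact: leqW.
  have -> : nd fine_marking (tag a) ((tagged a).+1 * N) = nd fine_marking (tag a) ((tagged a * N).+1 + N.-1).
    by congr (nd _ _ _); lia.
  rewrite -map_rcons -cats1 -[[:: _]]/(iota _ 1) -iotaD addn1.
  apply: (@nd_path G fine_marking (tag a) (tagged a * N) N.-1.+1); rewrite fine_len; nia.
- case: u v => [u|[e i]] [v|[e' i']] /=.
  + by case=> ->.
  + by move=> /esym/(nd_vx (mul _ _)).
  + by move=> /(nd_vx (mul _ _)).
  move=> /(nd_inj (mul _ _) (mul _ _))[ee]; subst e' => /eqP; rewrite eqn_pmul2r; last by lia.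
  by move=> /eqP[ii]; congr (inr (existT _ _ _)); apply: val_inj.
- rewrite map_inj_in_uniq ?iota_uniq // => m m' hm hm' h.
  have [b _ _] := inn _ _ _ (tl a) hm'; by have [] := ndmem _ _ _ _ hm b h.
- apply/mapP => -[m hm]; have [b _ hr] := inn _ _ _ (tl a) hm.
  case: v => [v|[e' i']] /= h; first by case: (nd_vx b (esym h)).
  have [_ mm] := ndmem _ _ _ _ hm (mul _ _) (esym h).
  by rewrite mm modnMl eqxx in hr.
- move=> /mapP[m hm ->] /mapP[m' hm' h]; have [b q _] := inn _ _ _ (tl a) hm; have [b' q' _] := inn _ _ _ (tl a') hm'.
  have [ee mm] := ndmem _ _ _ _ hm b' h; move: q q'; rewrite mm => -> qq.
  case: a a' ee {hm hm' h b b' mm} qq => [e i] [e' i'] /= ee; subst e' => /= ii.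
  by congr existT; apply: val_inj.
by rewrite size_map size_iota.
Qed.
End FineMarking.

(** * Ears of a cycle *)

Section Hanging.
Variables (V : finType) (adj : rel V) (C : seq V).
Hypothesis adjC : symmetric adj.
Hypothesis no_ear : forall c c' l, c \in C -> c' \in C -> c != c' -> path adj c (rcons l c') -> uniq l ->
  0 < size l -> all (fun v => v \notin C) l -> False.

Definition off := [rel x y | adj x y && (y \notin C)].
(** What is attached to the cycle at [c]. Without ears these sets are disjoint ([hang_disj]) and
    adjacent to no vertex of the cycle but [c] ([hang_base]), so they can serve as the sets [D] of
    gates. *)
Definition hang c := [set v | (v \notin C) && connect off c v]%SET.

Lemma hangE c v : (v \in hang c) = (v \notin C) && connect off c v.
Proof. by rewrite inE. Qed.

Lemma off_all x p : path off x p -> all (fun v => v \notin C) p.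
Proof. by elim: p x => //= y p IH x /andP[/andP[_ ->] /IH]. Qed.

Lemma off_adj x p : path off x p -> path adj x p.
Proof. by apply: sub_path => u v /andP[]. Qed.

Lemma hang_step c v w : v \in hang c -> adj v w -> w \notin C -> w \in hang c.
Proof.
rewrite !hangE => /andP[_ cv] a wC; rewrite wC; apply: connect_trans cv _.
by apply: connect1; rewrite /= a.
Qed.

(** A path off [C] from [c] to [v], made simple and prolonged to another vertex [w] of [C], would be
    an ear. *)
Lemma hang_base c v w : c \in C -> v \in hang c -> adj v w -> w \in C -> w = c.
Proof.
rewrite hangE => cC /andP[vC /connectP[p pp e]] a wC; apply/eqP; apply: contraT => wc; exfalso.
case: (shortenP pp) e => p' pp' up' _ e.
apply: (no_ear cC wC _ _ _ _ (off_all pp')); first by rewrite eq_sym.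
- by rewrite rcons_path (off_adj pp') -e.
- by case/andP: up'.
by case: p' e {pp' up'} => //= e; rewrite e cC in vC.
Qed.

Lemma hang_back c x p : c \in C -> path off x p -> last x p \in hang c -> x \in hang c \/ x = c.
Proof.
move=> cC; elim: p x => [|y p IH] x /=; first by left.
move=> /andP[/andP[a yC] pp] /(IH _ pp)[yh|yc]; last by rewrite yc cC in yC.
rewrite adjC in a; have [xC|xC] := boolP (x \in C); first by right; exact: hang_base yh a xC.
by left; exact: hang_step yh a xC.
Qed.

Lemma hang_disj c c' v : c \in C -> c' \in C -> c != c' -> v \in hang c -> v \notin hang c'.
Proof.
move=> cC c'C cc' vc; rewrite hangE; apply/negP => /andP[vC /connectP[p pp e]].
rewrite e in vc; case: (hang_back cC pp vc) => [|e']; first by rewrite hangE c'C.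
by rewrite e' eqxx in cc'.
Qed.

Lemma hang_path c p : path adj c p -> all (fun v => v \notin C) p -> {subset p <= hang c}.
Proof.
move=> pp ap v vp; rewrite hangE (allP ap) //=.
have po : path off c p.
  elim: p c {v vp} pp ap => //= y p IH c /andP[-> pp] /andP[-> ap] /=; exact: IH.
by apply: (path_connect po); rewrite inE vp orbT.
Qed.

Lemma hang_notin c v : v \in C -> v \notin hang c.
Proof. by move=> vC; rewrite hangE vC. Qed.
End Hanging.

Section Arcs.
Variables (V : eqType) (adj : rel V).
Hypothesis adjC : symmetric adj.

Lemma rev_arc c c' l : path adj c (rcons l c') -> path adj c' (rcons (rev l) c).
Proof.
move=> p; have : path adj (last c (rcons l c')) (rev (belast c (rcons l c'))).
  by rewrite rev_path (eq_path (e' := adj)) // => u v; rewrite adjC.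
by rewrite last_rcons belast_rcons rev_cons.
Qed.

(** An arc is cut into two arms, one at each of its ends, whose tips are adjacent. *)
Lemma arc_split c c' l m : path adj c (rcons l c') -> (m.+1).*2 <= size l ->
  exists P Pa P' Pb, [/\ l = P :: Pa ++ rev (P' :: Pb), path adj c (P :: Pa), path adj c' (P' :: Pb),
    adj (last P Pa) (last P' Pb) & (m <= size Pa) && (m <= size Pb)].
Proof.
move=> pl sl; have e := cat_take_drop m.+1 l.
set s1 := take _ l in e; set s2 := drop _ l in e.
have h1 : size s1 = m.+1 by rewrite size_takel //; lia.
have h2 : m.+1 <= size s2 by rewrite size_drop; lia.
rewrite -e rcons_cat cat_path in pl; have /andP[p1 p2] := pl.
have p3 := rev_arc p2; rewrite rcons_path in p3; have /andP[p4 p5] := p3.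
case es1 : s1 h1 => [//|P Pa] [h1]; case es2 : (rev s2) => [|P' Pb].
  by move: h2; rewrite -size_rev es2.
exists P, Pa, P', Pb; split=> //.
- by rewrite -e es1 -es2 revK.
- by rewrite -es1.
- by rewrite -es2.
- by rewrite adjC; move: p5; rewrite es1 es2.
by rewrite h1 leqnn /=; move: h2; rewrite -size_rev es2.
Qed.

Lemma ends2 (s : seq V) : 2 <= size s -> exists x m y, s = x :: rcons m y.
Proof.
case: s => [//|x s]; case/lastP: s => [//|s y] _; by exists x, s, y.
Qed.
End Arcs.

Section Theta.
Variables (V : finType) (adj : rel V) (n : nat).
Hypothesis adjC : symmetric adj.
Hypothesis no_theta : forall a b O O' P P' Q Q' wi Pa Qa Pb Qb, htree adj 'I_n a b O O' P P' Q Q' wi Pa Qa Pb Qb ->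
  adj (last P Pa) (last P' Pb) -> adj (last Q Qa) (last Q' Qb) -> False.

(** Two of the arcs are cut open. This leaves a tree with two branch points whose arms have room for
    all tokens. *)
Lemma three_arcs c c' l1 l2 l3 : uniq (c :: c' :: l1 ++ l2 ++ l3) ->
  path adj c (rcons l1 c') -> path adj c (rcons l2 c') -> path adj c (rcons l3 c') ->
  (n.+1).*2 <= size l1 -> (n.+1).*2 <= size l2 -> (n.+1).*2 <= size l3 -> False.
Proof.
move=> un p1 p2 p3 s1 s2 s3.
have [|O [wi [ O' e1]]] := @ends2 _ l1; first by lia.
have [P [Pa [P' [Pb [e2 pPa pPb aP /andP[sPa sPb]]]]]] := arc_split adjC p2 s2.
have [Q [Qa [Q' [Qb [e3 pQa pQb aQ /andP[sQa sQb]]]]]] := arc_split adjC p3 s3.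
apply: (no_theta (a := c) (b := c') (O := O) (O' := O') (wi := wi) _ aP aQ).
have {}un : uniq (flatten [:: [:: c]; [:: c']; [:: O]; wi; [:: O']; [:: P]; Pa; rev Pb; [:: P']; [:: Q]; Qa; rev Qb; [:: Q']]).
  by move: un; rewrite e1 e2 e3 /= !rev_cons -!cats1 /= -!catA /=.
split; rewrite ?card_ord //.
- have := uniq_segs un (kb := [:: (0, false); (1, false); (2, false); (4, false); (5, false); (8, false); (9, false);
    (12, false); (3, false); (6, false); (10, false); (7, true); (11, true)]) isT isT.
  by rewrite /= !revK.
- by move: p1; rewrite e1 rcons_path /= last_rcons.
by move: s1; rewrite e1 /= size_rcons; lia.
Qed.
End Theta.

(** * Ears and chords of a cycle in a fine subdivision *)

Section CycleEars.
Variables (G : graph) (K : marking G) (n N : nat).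
Local Notation V := (mkV K).
Local Notation adj := (@madj G K).
Local Notation adjC := (@madjC G K).
Hypothesis no_theta : forall a b O O' P P' Q Q' wi Pa Qa Pb Qb, htree adj 'I_n a b O O' P P' Q Q' wi Pa Qa Pb Qb ->
  adj (last P Pa) (last P' Pb) -> adj (last Q Qa) (last Q' Qb) -> False.
Hypotheses (hN : forall e, N <= len K e) (nN : (n.+1).*2 < N).
Variable C : seq V.
Hypotheses (uC : uniq C) (cC : path.cycle adj C) (sC : 2 < size C).

(** The cycle and an ear form a theta graph. Its branch points have three neighbours, so they are
    vertices of the original graph, and the fineness of the subdivision makes the three arcs between
    them long. *)
Lemma cycle_no_ear c c' l : c \in C -> c' \in C -> c != c' -> path adj c (rcons l c') -> uniq l ->
  0 < size l -> all (fun v => v \notin C) l -> False.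
Proof.
move=> hc hc' cc' pl ul sl /allP al; have [i p1 p2 _ _ e] := rot_to_arc uC hc hc' cc'.
have : path.cycle adj (rot i C) by rewrite rot_cycle.
have u : uniq (rot i C) by rewrite rot_uniq.
have mC v : (v \in rot i C) = (v \in C) by rewrite mem_rot.
have sz : 2 < size (rot i C) by rewrite size_rot.
rewrite e in u mC sz *; rewrite [path.cycle _ _]/= rcons_cat /= -cat_rcons cat_path last_rcons => /andP[a1 a2].
have a3 := rev_arc adjC a2; have a4 := rev_arc adjC a1; have pl' := rev_arc adjC pl.
have lout v : v \in l -> v \notin c :: p1 ++ c' :: p2 by move=> /al; rewrite mC.
have hd (x : V) s z : path adj x (rcons s z) -> adj x (head z s) by case: s => [|y s] /= /andP[].
have hin (s : seq V) z : head z s \in rcons s z by case: s => [|y s]; rewrite /= ?mem_head ?inE ?eqxx.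
have hl (s : seq V) z : 0 < size s -> head z s \in s by case: s => [//|y s] _; rewrite mem_head.
have key x y s1 s2 s3 : uniq (x :: s1 ++ y :: s2) -> 2 < size (x :: s1 ++ y :: s2) ->
    path adj x (rcons s1 y) -> path adj x (rcons s2 y) -> path adj x (rcons s3 y) -> 0 < size s3 ->
    (forall v, v \in s3 -> v \notin x :: s1 ++ y :: s2) -> exists v, x = vx K v.
  move=> uu ss q1 q2 q3 z3 o3.
  apply: (vx_of_degree (x := head y s1) (y := head y s2) (z := head y s3)); try exact: hd.
  rewrite /= !inE negb_or andbT.
  have o := o3 _ (hl s3 y z3); have n1 : head y s1 != head y s3.
    by apply: contraNneq o => <-; rewrite inE -cat_rcons mem_cat hin orbT.
  have n2 : head y s2 != head y s3.
    apply: contraNneq o => <-; case: (s2) => [|z s] /=; rewrite !inE mem_cat !inE ?eqxx ?orbT //.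
  rewrite n1 n2 !andbT; apply/eqP => h; move: uu ss h; case: (s1) (s2) => [|z s] [|z' s'] //=.
  - by move=> + _ h; rewrite -h !inE eqxx ?orbT ?andbF.
  - by move=> + _ h; rewrite h mem_cat [y \in [:: y]]inE eqxx orbT !andbF.
  - by move=> + _ h; rewrite h mem_cat !inE eqxx !orbT andbF.
have u' : uniq (flatten [:: [:: c]; p1; [:: c']; p2; l]).
  have -> : flatten [:: [:: c]; p1; [:: c']; p2; l] = (c :: p1 ++ c' :: p2) ++ l by rewrite /= cats0 -catA.
  by rewrite cat_uniq u ul andbT; apply/hasPn.
have [v ev] : exists v, c = vx K v.
  apply: (key c c' p1 (rev p2) l) => //; rewrite ?size_rev //.
  - by have := uniq_segs u' (kb := [:: (0, false); (1, false); (2, false); (3, true)]) isT isT; rewrite /= cats0.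
  - by move: sz; rewrite /= !size_cat /= size_rev.
  - by move=> w /lout; rewrite !inE !mem_cat !inE mem_rev.
have [v' ev'] : exists v, c' = vx K v.
  apply: (key c' c (rev p1) p2 (rev l)) => //; rewrite ?size_rev //.
  - by have := uniq_segs u' (kb := [:: (2, false); (1, true); (0, false); (3, false)]) isT isT; rewrite /= cats0.
  - by move: sz; rewrite /= !size_cat /= size_rev.
  - by move=> w; rewrite mem_rev => /lout; rewrite !inE !mem_cat !inE mem_rev; case: (w == c); case: (w == c'); rewrite ?orbT ?orbF.
have vv : v != v' by apply: contra cc' => /eqP vv; rewrite ev ev' vv.
have dist s : path adj c (rcons s c') -> (n.+1).*2 <= size s.
  move=> ps; have := vx_dist hN vv; rewrite -ev => /(_ _ ps).
  by rewrite last_rcons size_rcons -ev' => /(_ erefl) h; exact: (leq_trans nN h).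
apply: (three_arcs adjC no_theta (c := c) (c' := c') (l1 := p1) (l2 := rev p2) (l3 := l)) => //; try exact: dist.
by have := uniq_segs u' (kb := [:: (0, false); (2, false); (1, false); (3, true); (4, false)]) isT isT; rewrite /= cats0.
Qed.

(* an edge between two vertices of [C] belongs to [C], as one end of it has degree two *)
Lemma no_chord u t w : uniq (u :: t) -> path.cycle adj (u :: t) -> 1 < size t -> w \in t -> adj u w ->
  (exists t', t = w :: t') \/ (exists t', t = rcons t' w).
Proof.
move=> ut /= ct st wt auw; have [y [s [z et]]] := ends2 st; subst t.
move: ct; rewrite rcons_cons /= rcons_path last_rcons => /andP[uy /andP[ps zu]].
have yz : y != z by move: ut => /and3P[_ + _]; rewrite mem_rcons inE negb_or => /andP[].
have [[v ev]|[e [m [hm eu]]]] := mk_surj u; last first.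
  rewrite adjC in zu; move: yz uy zu auw; rewrite eu => yz /(adj_inner hm) uy /(adj_inner hm) zu /(adj_inner hm) uw.
  have : w = y \/ w = z.
    by move: yz; case: uw => ->; case: uy => ->; case: zu => ->; rewrite ?eqxx //; auto.
  by case=> ->; [left; exists (rcons s z)|right; exists (y :: s)].
have [[v' ev']|[e [m [hm ew]]]] := mk_surj w; first by move: auw; rewrite ev ev' (negbTE (vx_nadj K v v')).
move: wt; rewrite inE mem_rcons inE => /or3P[/eqP ->|/eqP ->|ws].
- by left; exists (rcons s z).
- by right; exists (y :: s).
case/splitPr: ws ut ps => s1 s2 ut ps; exfalso.
move: ps; rewrite rcons_cat rcons_cons cat_path /= => /and3P[_ a1 a2].
have {}a2 : adj w (head z s2) by case: (s2) a2 => [|x s'] /= /andP[].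
rewrite adjC in a1; rewrite adjC in auw.
have un : uniq [:: u; last y s1; head z s2].
  have h1 : last y s1 \in y :: s1 by exact: mem_last.
  have h2 : head z s2 \in rcons s2 z by case: (s2) => [|x s']; rewrite /= mem_head.
  move: ut; rewrite rcons_cat rcons_cons -cat_cons cons_uniq cat_uniq cons_uniq mem_cat inE.
  move=> /andP[/norP[n1 /norP[n2 n3]] /and3P[_ /norP[_ /hasPn n4] _]].
  rewrite /= !inE negb_or andbT; apply/andP; split; last by apply: contraTneq h1 => ->; exact: n4.
  by apply/andP; split; [apply: contraNneq n1 => ->|apply: contraNneq n3 => ->].
by have [v' ev'] := vx_of_degree un auw a1 a2; case: (nd_vx hm (etrans (esym ew) ev')).
Qed.
End CycleEars.

(** * Braids on graphs that contain T_0 or S_0 *)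

Section BraidsOfMarkedGraph.
Variables (G : graph) (K : marking G) (n : nat) (b0 : set (gpt G)).
Notation V := (mkV K).
Notation conf := (set (gpt G)).
Local Notation adj := (@madj G K).
Local Notation adjC := (@madjC G K).
Variables (X : finType) (Rl : rel X) (phi : (RR -> conf) -> seq (X * bool)).
Hypothesis phiE : forall f g, uloop n b0 f -> uloop n b0 g -> (uhomotopic n b0 f g <-> raag_eq Rl (phi f) (phi g)).
Hypothesis phi_onto : forall w, exists f, uloop n b0 f /\ raag_eq Rl (phi f) w.
Hypothesis phiM : forall f g, uloop n b0 f -> uloop n b0 g -> raag_eq Rl (phi (pconcat f g)) (phi f ++ phi g).
Hypothesis base : forall S : {set V}, #|S| = n -> exists p, ispath n b0 (CS S) p.
Hypothesis n5 : 4 < n.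
Local Notation M := (Mv Rl phi base).
Let P0 := perm_charts G n.

Definition strand_perm g : {perm 'I_n} := @holG _ _ b0 _ Rl phi phi_onto _ P0 g.
(** The ordering [kap], corrected by the holonomy of the fixed path to the base point, so that the
    permutation of a move is a difference of two such values. *)
Definition place_perm (x : 'I_n -> V) := (kap (@mpt G K \o x) * (bhol base P0 (im x))^-1)%g.

Lemma place_perm_comp x (s : {perm 'I_n}) : injective x -> place_perm (x \o s) = (s * place_perm x)%g.
Proof.
move=> ix; have e : im (x \o s) = im x.
  apply/setP => v; apply/imsetP/imsetP => [[i _ ->]|[i _ ->]]; first by exists (s i).
  by exists ((s^-1)%g i); rewrite //= permKV.
by rewrite /place_perm e -[_ \o (x \o s)]/((_ \o x) \o s) kap_perm ?mulgA //; exact: mpt_oconf.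
Qed.

Lemma strand_perm_move x i w : injective x -> adj (x i) w -> w \notin im x ->
  strand_perm (M (im x) (x i) w) = ((place_perm x)^-1 * place_perm (upd x i w))%g.
Proof.
move=> ix a wx; have h : mvok adj (im x) (x i) w by rewrite /mvok a mem_im.
have cS : #|im x| = n by rewrite (card_ord_im ix).
have c' : #|mvS (im x) (x i) w| = n by rewrite (card_mvS h).
have e' : im (upd x i w) = mvS (im x) (x i) w.
  have -> : upd x i w = mact [:: (x i, w)] \o x.
    by apply: funext => j; rewrite /upd /= /mva (inj_eq ix).
  have h1 : mok adj (im x) [:: (x i, w)] by rewrite /= h.
  exact: (im_mact h1).
rewrite /strand_perm (holG_cl phiE phi_onto base cS c' (mv_path cS h) (hol_move ix a wx)).
by rewrite /place_perm e' invgM invgK !mulgA.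
Qed.

Let Minv (S : {set V}) u w : #|S| = #|'I_n| -> mvok adj S u w -> M (mvS S u w) w u = (M S u w)^-1%g.
Proof. by rewrite card_ord => cS h; exact: (Mv_inv phiE phiM base cS h). Qed.

Let Msq (S : {set V}) u w u' w' : #|S| = #|'I_n| -> mvok adj S u w -> mvok adj S u' w' -> uniq [:: u; w; u'; w'] ->
  (M S u w * M (mvS S u w) u' w' = M S u' w' * M (mvS S u' w') u w)%g.
Proof. by rewrite card_ord => cS; exact: (Mv_square phiE phiM base cS). Qed.

Let rhoM g h : strand_perm (g * h)%g = (strand_perm g * strand_perm h)%g.
Proof. exact: (holGM phiE phi_onto phiM). Qed.

Let n5' : 4 < #|'I_n|. Proof. by rewrite card_ord. Qed.

Lemma no_tripod a b O O' P P' Q Q' v u w2 w3 Pa Qa Pb Qb B1 P1 Q1 :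
  htree adj 'I_n a b O O' P P' Q Q' (w2 ++ v :: w3) Pa Qa Pb Qb ->
  uniq (flatten (tsegs a b O O' P P' Q Q' v u w2 w3 Pa Qa Pb Qb B1 P1 Q1)) ->
  path adj v (B1 ++ u :: P1) -> path adj u Q1 -> [/\ n <= size B1, n <= size P1 & n <= size Q1] -> False.
Proof.
move=> H uT pB pQ s; apply: (tripod_contradiction adjC Msq rhoM place_perm_comp strand_perm_move n5' H uT pB pQ).
by rewrite card_ord.
Qed.

Lemma no_theta a b O O' P P' Q Q' wi Pa Qa Pb Qb : htree adj 'I_n a b O O' P P' Q Q' wi Pa Qa Pb Qb ->
  adj (last P Pa) (last P' Pb) -> adj (last Q Qa) (last Q' Qb) -> False.
Proof. by move=> H hP hQ; exact: (theta_contradiction adjC Minv Msq rhoM place_perm_comp strand_perm_move H hP hQ n5'). Qed.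

Variable N : nat.
Hypotheses (hN : forall e, N <= len K e) (nN : (n.+1).*2 < N).

Lemma ends3 (s : seq V) : 3 <= size s -> exists x y m z, s = x :: y :: rcons m z.
Proof. by case: s => [//|x [//|y s]]; case/lastP: s => [//|s z] _; exists x, y, s, z. Qed.

(** * A cycle with two pendant arms *)

Section HairyCycle.
Variables (a b : V) (L0 Lr A B : seq V).
Hypotheses (uABC : uniq ((a :: L0 ++ b :: Lr) ++ A ++ B)) (cC : path.cycle adj (a :: L0 ++ b :: Lr)).
Hypotheses (pA : path adj a A) (pB : path adj b B).
Hypotheses (s0 : 2 < size L0) (sr : 2 < size Lr) (sA : n < size A) (sB : n < size B).
Let C := a :: L0 ++ b :: Lr.

Let uC : uniq C. Proof. by move: uABC; rewrite cat_uniq => /andP[]. Qed.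
Let sC : 2 < size C. Proof. by rewrite /C /= size_cat /=; lia. Qed.
Let ne := cycle_no_ear no_theta hN nN uC cC sC.
Let aC : a \in C. Proof. exact: mem_head. Qed.
Let bC : b \in C. Proof. by rewrite /C -cat_cons mem_cat mem_head orbT. Qed.
Let LC v : v \in L0 -> v \in C. Proof. by rewrite /C inE mem_cat => ->; rewrite orbT. Qed.
Let LrC v : v \in Lr -> v \in C. Proof. by rewrite /C inE mem_cat inE => ->; rewrite !orbT. Qed.
Let aL : a \notin L0. Proof. by move: uC; rewrite /C /= mem_cat negb_or => /andP[/andP[]]. Qed.
Let bL : b \notin L0. Proof. by move: uC; rewrite /C /= cat_uniq => /and4P[_ _ /= /norP[]]. Qed.
Let ab : a != b. Proof. by apply/eqP => e; move: uC; rewrite /C e /= mem_cat mem_head orbT. Qed.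
Let Aout v : v \in A -> v \notin C.
Proof.
move=> vA; move: uABC; rewrite cat_uniq => /and3P[_ /hasPn h _]; apply: h; by rewrite mem_cat vA.
Qed.
Let Bout v : v \in B -> v \notin C.
Proof.
move=> vA; move: uABC; rewrite cat_uniq => /and3P[_ /hasPn h _]; apply: h; by rewrite mem_cat vA orbT.
Qed.
Let pU : path adj a (rcons L0 b).
Proof. by move: cC; rewrite /= rcons_cat /= -cat_rcons cat_path last_rcons => /andP[]. Qed.
Local Notation hang := (hang adj C).

Let hA : {subset A <= hang a}. Proof. by apply: hang_path => //; apply/allP. Qed.
Let hB : {subset B <= hang b}. Proof. by apply: hang_path => //; apply/allP. Qed.

Lemma hang_closed c : c \in C -> closed_to (hang c) [set c]%SET.
Proof.
move=> hc u w uh uw; rewrite finset.in_setU finset.in_set1; have [wC|wC] := boolP (w \in C).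
  by rewrite (hang_base ne hc uh uw wC) eqxx orbT.
by rewrite (hang_step uh uw wC).
Qed.

(** The cycle is rotated to begin with [u]; by [no_chord] a neighbour of [u] on it is then the
    second or the last vertex. *)
Lemma arc_nbrs u w : u \in L0 -> w \in C -> adj u w ->
  exists s1 s2, L0 = s1 ++ u :: s2 /\ (w = head b s2 \/ w = last a s1).
Proof.
move=> uL wC uw; have wu : w != u by apply: contraTneq uw => ->; apply/negP => /madj_neq; rewrite eqxx.
move: uL; case/path.splitPr e: {1}L0 / => [s1 s2]; exists s1, s2; split=> //.
have eC : rot (size (a :: s1)) C = u :: (s2 ++ b :: Lr ++ a :: s1).
  have -> : C = (a :: s1) ++ (u :: s2 ++ b :: Lr) by rewrite /C e /= -catA.
  by rewrite rot_size_cat /= -catA.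
have uu : uniq (u :: (s2 ++ b :: Lr ++ a :: s1)) by rewrite -eC rot_uniq.
have cc : path.cycle adj (u :: (s2 ++ b :: Lr ++ a :: s1)) by rewrite -eC rot_cycle.
have wt : w \in s2 ++ b :: Lr ++ a :: s1.
  by move: wC; rewrite -(mem_rot (size (a :: s1))) eC inE (negbTE wu).
have st : 1 < size (s2 ++ b :: Lr ++ a :: s1) by rewrite !size_cat /= size_cat; move: sr; clear; lia.
case: (no_chord uu cc st wt uw) => -[t' et]; last first.
  by right; have := congr1 (last w) et; rewrite last_rcons last_cat /= last_cat /= => ->.
by left; have := congr1 (head w) et; rewrite /= => <-; case: (s2).
Qed.

(** The inner vertices of one arc with all that hangs at them. Its only outer neighbours are [a] and
    [b], each of which is adjacent to a single vertex of [U], as [gates_opposite] demands. *)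
Let U := [set v | (v \in L0) || [exists c, (c \in L0) && (v \in hang c)]]%SET.

Let UP v : v \in U -> v \in L0 \/ exists2 c, c \in L0 & v \in hang c.
Proof. by rewrite finset.in_set => /orP[|/existsP[c /andP[]]]; [left|right; exists c]. Qed.
Let UL v : v \in L0 -> v \in U. Proof. by rewrite finset.in_set => ->. Qed.
Let Uh c v : c \in L0 -> v \in hang c -> v \in U.
Proof. by move=> hc hv; rewrite finset.in_set; apply/orP; right; apply/existsP; exists c; rewrite hc. Qed.

Lemma arc_closed : closed_to U [set a; b]%SET.
Proof.
move=> u w uU uw; rewrite finset.in_setU finset.in_set2; have [wC|wC] := boolP (w \in C).
  case: (UP uU) => [uL|[c cL uh]]; last by rewrite (hang_base ne (LC cL) uh uw wC) UL.
  have [s1 [s2 [e [->|->]]]] := arc_nbrs uL wC uw.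
    case: s2 e => [|x s2] e; first by rewrite eqxx !orbT.
    by rewrite UL // e mem_cat !inE eqxx !orbT.
  have := mem_last a s1; rewrite inE => /orP[/eqP ->|h]; first by rewrite eqxx orbT.
  by rewrite UL // e mem_cat h.
apply/orP; left; case: (UP uU) => [uL|[c cL uh]]; last by apply: (Uh cL); exact: hang_step uh uw wC.
by apply: (Uh uL); rewrite hangE wC connect1 //= uw.
Qed.

Lemma arc_first u Q s : L0 = Q :: s -> u \in U -> adj a u = (u == Q).
Proof.
move=> e uU; apply/idP/eqP => [|->]; last by move: cC; rewrite e /= => /andP[].
rewrite adjC => ua; case: (UP uU) => [uL|[c cL uh]]; last first.
  by move: aL; rewrite (hang_base ne (LC cL) uh ua aC) cL.
have [s1 [s2 [e' [h|h]]]] := arc_nbrs uL aC ua.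
  case: s2 e' h => [|x s2] e' h; first by case/negP: ab; apply/eqP.
  by move: aL; rewrite e' mem_cat /= h !inE eqxx !orbT.
case/lastP: s1 e' h => [|s1 x] e' h; first by move: e'; rewrite e => -[].
by move: aL; rewrite e' mem_cat mem_rcons h last_rcons mem_head.
Qed.

Lemma arc_last u Q s : L0 = rcons s Q -> u \in U -> adj b u = (u == Q).
Proof.
move=> e uU; apply/idP/eqP => [|->]; last first.
  by rewrite adjC; have := pU; rewrite e rcons_path last_rcons => /andP[].
rewrite adjC => ub; case: (UP uU) => [uL|[c cL uh]]; last first.
  by move: bL; rewrite (hang_base ne (LC cL) uh ub bC) cL.
have [s1 [s2 [e' [h|h]]]] := arc_nbrs uL bC ub.
  case: s2 e' h => [|x s2] e' h; first by have := congr1 (last a) e'; rewrite e last_rcons last_cat.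
  by move: bL; rewrite e' mem_cat /= h !inE eqxx !orbT.
have := mem_last a s1; rewrite -h inE eq_sym (negbTE ab) /= => hb.
by move: bL; rewrite e' mem_cat hb.
Qed.

Lemma hairy_cycle_contradiction : False.
Proof.
have [Q [Z [up [Q' e0]]]] := ends3 s0.
have [|O [Y [lw [ O' er]]]] := @ends3 (rev Lr); first by rewrite size_rev.
have [P [Pa eA]] : exists P Pa, A = P :: Pa by case: (A) sA => [//|P Pa]; exists P, Pa.
have [P' [Pb eB]] : exists P' Pb, B = P' :: Pb by case: (B) sB => [//|P' Pb]; exists P', Pb.
have p2 : path adj b (rcons Lr a).
  by move: cC; rewrite /= rcons_cat /= -cat_rcons cat_path last_rcons => /andP[].
have pL := rev_arc adjC p2; rewrite er in pL; have pU' := pU; rewrite e0 in pU'.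
have eLr : Lr = O' :: rev lw ++ [:: Y; O].
  by rewrite -[Lr]revK er !rev_cons rev_rcons -!cats1 /= -catA.
have ss : uniq (flatten [:: [:: a]; [:: Q]; [:: Z]; up; [:: Q']; [:: b]; [:: O']; rev lw; [:: Y]; [:: O];
    [:: P]; Pa; [:: P']; Pb]).
  by move: uABC; rewrite e0 eLr eA eB -!cats1 /= -!catA /= -!catA /= cats0.
have inL : Q \in L0 /\ Q' \in L0 by rewrite e0; split; rewrite !(inE, mem_rcons) eqxx ?orbT.
have inLr : [/\ O \in Lr, Y \in Lr & O' \in Lr] by rewrite eLr; split; rewrite !(inE, mem_cat) eqxx ?orbT.
have [QL Q'L] := inL; have [OL YL O'L] := inLr.
have hP' : P' \in hang b by apply: hB; rewrite eB mem_head.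
have hP : P \in hang a by apply: hA; rewrite eA mem_head.
have aO : adj a O by case/andP: pL.
have aQ : adj a Q by case/andP: pU'.
have aP : adj a P by move: pA; rewrite eA => /andP[].
have bP : adj b P' by move: pB; rewrite eB => /andP[].
have bO : adj b O' by move: p2; rewrite eLr => /andP[].
have eQ' : L0 = rcons [:: Q, Z & up] Q' by rewrite e0.
have bQ : adj b Q' by rewrite (arc_last eQ' (UL Q'L)).
have dOQ (x y : V) : x \in Lr -> y \in L0 -> x != y.
  move=> xr yL; apply: contraTneq uC => xy; rewrite /C /= cat_uniq; apply/negP => /and4P[_ _ /= /norP[_ /hasPn h] _].
  by have := h x xr; rewrite xy yL.
have nPC : P \notin C by apply: Aout; rewrite eA mem_head.
have nP'C : P' \notin C by apply: Bout; rewrite eB mem_head.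
have dC (x y : V) : x \in C -> y \notin C -> x != y by move=> xC; apply: contraNneq => <-.
have u3 (x y z : V) : x != y -> x != z -> y != z -> uniq [:: x; y; z].
  by move=> h1 h2 h3; rewrite /= !inE negb_or h1 h2 h3.
have [va ea] : exists v, a = vx K v.
  apply: (vx_of_degree (x := O) (y := Q) (z := P)) => //.
  exact: u3 (dOQ _ _ OL QL) (dC _ _ (LrC OL) nPC) (dC _ _ (LC QL) nPC).
have [vb eb] : exists v, b = vx K v.
  apply: (vx_of_degree (x := O') (y := Q') (z := P')) => //.
  exact: u3 (dOQ _ _ O'L Q'L) (dC _ _ (LrC O'L) nP'C) (dC _ _ (LC Q'L) nP'C).
have nab : ~~ adj a b by rewrite ea eb vx_nadj.
have ra : Q != a by apply: contraNneq aL => <-.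
have rb : Q' != b by apply: contraNneq bL => <-.
have hn := @hang_notin V adj C.
have cDa := hang_closed aC; have cDb := hang_closed bC.
have aU : a \notin U by apply/negP => /UP[h|[c _ h]]; [exact: (negP aL h)|exact: (negP (hn c _ aC) h)].
have bU : b \notin U by apply/negP => /UP[h|[c _ h]]; [exact: (negP bL h)|exact: (negP (hn c _ bC) h)].
have lam := gates_opposite phiE phi_onto ra cDa rb cDb arc_closed ab nab aU bU
  (fun u => arc_first e0) (fun u => arc_last eQ') (UL QL) (UL Q'L).
have ga := gateP phiE phi_onto phiM base ra (hn a _ (LC QL)) (hn a _ aC) cDa.
have gb := gateP phiE phi_onto phiM base rb (hn b _ (LC Q'L)) (hn b _ bC) cDb.
have uni := uniq_segs ss (kb := [:: (0, false); (5, false); (9, false); (6, false); (10, false); (12, false); (1, false);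
  (4, false); (8, false); (2, false); (7, true); (3, false); (11, false); (13, false)]) isT isT.
rewrite [map _ _]/= revK in uni.
apply: (cycle_contradiction adjC _ uni _ _ _ _ _ _ _ _ _ _ ga gb lam n5).
- by move=> S u w u' w' cS; apply: Msq; rewrite card_ord.
- by move: pL; rewrite !rcons_cons -!cats1 -!catA.
- by move: pU'; rewrite !rcons_cons -!cats1 -!catA.
- by rewrite -eA.
- by rewrite -eB.
- by move: sA; rewrite eA.
- by move: sB; rewrite eB.
- by rewrite -eA.
- by rewrite -eB.
- have hP'a : P' \notin hang a by apply: (hang_disj adjC ne bC aC) hP'; rewrite eq_sym.
  by rewrite /= (hn a _ aC) (hn a _ (LrC OL)) (hn a _ (LC QL)) (hn a _ (LrC YL)) (hn a _ (LrC O'L)) hP'a.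
rewrite all_cat /= (hn b _ bC) (hn b _ (LrC OL)) (hn b _ (LrC O'L)) (hn b _ (LC Q'L)) (hn b _ (LrC YL)).
rewrite (hang_disj adjC ne aC bC ab hP); apply/allP => z zP.
by apply: (hang_disj adjC ne aC bC ab); apply: hA; rewrite eA inE zP orbT.
Qed.
End HairyCycle.

Lemma carries_flat (H : graph) m f L (s : seq (gV H)) (t : seq (gE H)) : @carries V adj m H f L -> uniq s -> uniq t ->
  uniq (flatten (map (fun v => [:: f v]) s ++ map L t)).
Proof.
move=> c us ut; rewrite flatten_cat flatten_map1 cat_uniq (map_inj_uniq (car_inj c)) us /=.
apply/andP; split.
  by apply/hasPn => z /flattenP[_ /mapP[e _ ->] vL]; apply/negP => /mapP[v _ ev]; move: vL; rewrite ev (negbTE (car_out c _ _)).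
elim: t ut => //= e t IH /andP[et /IH ut]; rewrite cat_uniq (car_uniq c) ut andbT /=.
apply/hasPn => v /flattenP[_ /mapP[e' e't ->] vL]; apply/negP => vL'.
by rewrite (car_disj c vL' vL) e't in et.
Qed.
Lemma inord_uniq k m : k <= m.+1 -> uniq [seq (inord i : 'I_m.+1) | i <- iota 0 k].
Proof.
move=> km; rewrite map_inj_in_uniq ?iota_uniq // => i j; rewrite !mem_iota /= => hi hj e.
by rewrite -(@inordK m i) 1?(leq_trans hi) // e inordK // (leq_trans hj).
Qed.

Lemma T0_contradiction f L m : n < m -> @carries V adj m T0 f L -> False.
Proof.
move=> nm c; pose v i := f (inord i : 'I_10); pose l j := L (inord j : 'I_9).
have pth j : j < 9 -> path adj (v (nth 0 [:: 0; 0; 0; 1; 1; 2; 2; 3; 3] j)) (rcons (l j) (v j.+1)).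
  move=> hj; have := car_path c (inord j : 'I_9); rewrite /= inordK //.
  by do 9 (case: j hj => [|j] hj //).
have sz j : n < size (l j) by exact: leq_trans nm (car_size c _).
have uq : uniq (flatten [:: [:: v 0]; [:: v 1]; [:: v 2]; [:: v 3]; [:: v 4]; [:: v 5]; [:: v 6]; [:: v 7]; [:: v 8];
    [:: v 9]; l 0; l 1; l 2; l 3; l 4; l 5; l 6; l 7; l 8]).
  exact: (carries_flat c (inord_uniq (leqnn 10)) (inord_uniq (leqnn 9))).
have [ O [w2 e0]] : exists O w2, rev (l 0) = O :: w2.
  by have := sz 0; rewrite -size_rev; case: (rev _) => [//|O w2] _; exists O, w2.
have [w3 [ O' e1]] : exists w3 O', l 1 = rcons w3 O' by have := sz 1; case/lastP: (l 1) => [//|w3 O'] _; exists w3, O'.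
have split j : exists P Pa, l j = P :: Pa by have := sz j; case: (l j) => [//|P Pa] _; exists P, Pa.
have [[P [Pa e3]] [Q [Qa e4]]] := (split 3, split 4).
have [[P' [Pb e5]] [Q' [Qb e6]]] := (split 5, split 6).
have e0' : l 0 = rev w2 ++ [:: O] by rewrite -[l 0]revK e0 rev_cons cats1.
have e1' : l 1 = w3 ++ [:: O'] by rewrite e1 cats1.
have {}uq : uniq (flatten [:: [:: v 0]; [:: v 1]; [:: v 2]; [:: v 3]; [:: v 4]; [:: v 5]; [:: v 6]; [:: v 7]; [:: v 8];
    [:: v 9]; rev w2; [:: O]; w3; [:: O']; l 2; [:: P]; Pa; [:: Q]; Qa; [:: P']; Pb; [:: Q']; Qb; l 7; l 8]).
  by move: uq; rewrite /= e0' e1' e3 e4 e5 e6 /= -!catA.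
have p0 := rev_arc adjC (pth 0 isT); have p1 := pth 1 isT; have p2 := pth 2 isT.
have p3 := pth 3 isT; have p4 := pth 4 isT; have p5 := pth 5 isT; have p6 := pth 6 isT.
rewrite e0 in p0; rewrite e1 in p1; rewrite e3 in p3; rewrite e4 in p4; rewrite e5 in p5; rewrite e6 in p6.
have pw : path adj (v 1) (O :: rcons (w2 ++ v 0 :: w3) O') && adj O' (v 2).
  move: p1; rewrite rcons_path last_rcons => /andP[p1 ->]; rewrite andbT.
  have -> : O :: rcons (w2 ++ v 0 :: w3) O' = rcons (O :: w2) (v 0) ++ rcons w3 O' by rewrite rcons_cons rcons_cat /= cat_rcons.
  by rewrite cat_path last_rcons p0.
have [sw3 sPa] : n <= size w3 /\ n <= size Pa by have := sz 1; have := sz 3; rewrite e1 e3 size_rcons.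
have [sQa sPb] : n <= size Qa /\ n <= size Pb by have := sz 4; have := sz 5; rewrite e4 e5.
have sQb : n <= size Qb by have := sz 6; rewrite e6.
have hs := uniq_segs uq (kb := [:: (1, false); (2, false); (11, false); (13, false); (15, false); (19, false); (17, false);
  (21, false); (10, true); (0, false); (12, false); (16, false); (4, false); (18, false); (5, false); (20, false);
  (6, false); (22, false); (7, false)]) isT isT.
have ts := uniq_segs uq (kb := [:: (1, false); (2, false); (11, false); (13, false); (15, false); (19, false); (17, false);
  (21, false); (10, true); (0, false); (12, false); (16, false); (4, false); (18, false); (5, false); (20, false);
  (6, false); (22, false); (7, false); (14, false); (3, false); (23, false); (8, false); (24, false); (9, false)]) isT isT.
(* The H-tree joins two of the three neighbours of the centre [v 0] through it; the arm from [v 0]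
   leads to the third. *)
apply: (@no_tripod (v 1) (v 2) O O' P P' Q Q' (v 0) (v 3) w2 w3 (rcons Pa (v 4)) (rcons Qa (v 5)) (rcons Pb (v 6))
  (rcons Qb (v 7)) (l 2) (rcons (l 7) (v 8)) (rcons (l 8) (v 9))).
- split; rewrite ?card_ord ?size_rcons ?size_cat /=; try exact: leqW.
  + by move: hs; rewrite /hsegs /= revK -!cats1 -!catA.
  + exact: pw.
  + exact: p3.
  + exact: p4.
  + exact: p5.
  + exact: p6.
  by rewrite addnS; apply: leqW; apply: leq_trans sw3 (leq_addl _ _).
- by move: ts; rewrite /tsegs /= revK -!cats1 -!catA.
- by rewrite -cat_rcons cat_path last_rcons p2 (pth 7 isT).
- exact: (pth 8 isT).
by rewrite !size_rcons; split; do ?apply: leqW; apply: ltnW.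
Qed.

Lemma S0_contradiction f L m : n < m -> @carries V adj m S0 f L -> False.
Proof.
move=> nm c; pose v i := f (inord i : 'I_5); pose l j := L (inord j : 'I_5).
have pth j : j < 5 -> path adj (v (nth 0 [:: 0; 1; 2; 0; 1] j)) (rcons (l j) (v (nth 0 [:: 1; 2; 0; 3; 4] j))).
  by move=> hj; have := car_path c (inord j : 'I_5); rewrite /= inordK.
have sz j : n < size (l j) by exact: leq_trans nm (car_size c _).
have uq : uniq (flatten [:: [:: v 0]; [:: v 1]; [:: v 2]; [:: v 3]; [:: v 4]; l 0; l 1; l 2; l 3; l 4]).
  exact: (carries_flat c (inord_uniq (leqnn 5)) (inord_uniq (leqnn 5))).
have {}uq := uniq_segs uq (kb := [:: (0, false); (5, false); (1, false); (6, false); (2, false); (7, false); (8, false);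
  (3, false); (9, false); (4, false)]) isT isT.
(* The third vertex of the cycle becomes an inner vertex of one of the two arcs. *)
apply: (@hairy_cycle_contradiction (v 0) (v 1) (l 0) (l 1 ++ v 2 :: l 2) (rcons (l 3) (v 3)) (rcons (l 4) (v 4))).
- by move: uq; rewrite /= -!cats1 /= -!catA /= -!catA.
- have p0 := pth 0 isT; have p1 := pth 1 isT; have p2 := pth 2 isT; rewrite /= in p0 p1 p2.
  rewrite /= !(rcons_cat, rcons_cons) -cat_rcons cat_path p0 last_rcons /=.
  by rewrite -cat_rcons cat_path p1 last_rcons.
- exact: (pth 3).
- exact: (pth 4).
- by apply: leq_ltn_trans (sz 0); lia.
- by rewrite size_cat; have := sz 1; lia.
- by rewrite size_rcons; exact: leqW (sz 3).
- by rewrite size_rcons; exact: leqW (sz 4).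
Qed.
End BraidsOfMarkedGraph.

Theorem theoremB (G : graph) (n : nat) (b : set (gpt G)) :
  gconnected G -> (contains G T0 \/ contains G S0) -> (5 <= n)%N ->
  uconf n b -> ~ pi1_is_raag n b.
Proof.
move=> cG hc n5 [x [ox ->]] [X [Rl [phi [phiE [phi_onto phiM]]]]].
(* [N] meets two demands: the tokens of the base point have to round to distinct vertices, and an
   arc cut in two has to leave room for all tokens on both halves. *)
have [N0 hN0] := fine_exists ox; pose N := maxn N0 (n.+2).*2.
have N2 : 2 < N by rewrite /N leq_max; apply/orP; right; lia.
have nN : (n.+1).*2 < N by rewrite /N leq_max; apply/orP; right; lia.
have nN1 : n < N.-1 by lia.
have draw (H : graph) : contains G H -> exists (kG : gE G -> nat) f L, @carries _ (@madj G (fine_marking kG N2)) N.-1 H f L.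
  move=> [kG [kH sub]]; exists kG.
  have [f [L c]] := carries_sub (@madjC G (fine_marking kG N2)) sub (carries_fine kG N2).
  exact: carries_unsubdivide c.
have setup (kG : gE G -> nat) : (forall e, N <= len (fine_marking kG N2) e) /\
    (forall S : {set mkV (fine_marking kG N2)}, #|S| = n -> exists p, ispath n (range x) (CS S) p).
  have hN e : N <= len (fine_marking kG N2) e by rewrite fine_len mulSn leq_addr.
  split=> //; apply: (base_path ox _ (marking_conn cG)); apply: hN0 => e.
  by apply: leq_trans (hN e); rewrite leq_maxl.
case: hc => /draw[kG [f [L c]]]; have [hN base] := setup kG.
  exact: (T0_contradiction phiE phi_onto phiM base n5 nN1 c).
exact: (S0_contradiction phiE phi_onto phiM base n5 hN nN nN1 c).
Qed.
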